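(* Let $F:\mathcal{S}_n\to\mathbb{R}$ be continuous, uniformly elliptic and quasiconcave, and let $u\in C^{1,1}(B_1)$ satisfy $F(D^2u)=0$ in $B_1\subset\mathbb{R}^n$ in the viscosity sense. Then $u\in C^{2,\alpha}(B_{1/2})$ and \[ \|u\|_{C^{2,\alpha}(B_{1/2})}\leq C, \] where $\alpha\in(0,1)$ depends only on $n,\lambda,\Lambda$ and $C$ depends on $n,\lambda,\Lambda$ and $\|u\|_{C^{1,1}(B_{3/4})}$.
   Context: $\mathcal{S}_n$ is the space of real symmetric $n\times n$ matrices. $F$ is uniformly elliptic with constants $0<\lambda\le\Lambda$ if $\lambda\|N\|\leq F(M+N)-F(M)\leq\Lambda\|N\|$ for all $M,N\in\mathcal{S}_n$ with $N\geq0$, where $\|N\|=\sup_{|x|=1}|Nx|$. $F$ is quasiconcave if $F(\theta M_1+(1-\theta)M_2)\geq\min\{F(M_1),F(M_2)\}$ for all $M_1,M_2\in\mathcal{S}_n$, $\theta\in[0,1]$. Viscosity solutions are defined via $C^2$ test functions touching from above/below. *)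

(* Defs.v *)
From HB Require Import structures.
From mathcomp Require Import all_boot all_order all_algebra.
From mathcomp Require Import all_classical all_reals all_analysis.
Set Implicit Arguments. Unset Strict Implicit. Unset Printing Implicit Defensive.
Import Order.TTheory GRing.Theory Num.Theory.
Import numFieldNormedType.Exports.
Local Open Scope classical_set_scope.
Local Open Scope ring_scope.

Section Defs.
Variables (R : realType) (n : nat).
Local Notation vec := 'rV[R]_n.
Local Notation mat := 'M[R]_n.

Definition enorm (x : vec) : R := Num.sqrt (\sum_(i < n) x 0 i ^+ 2).

Definition eball (c : vec) (r : R) : set vec := [set x | enorm (x - c) < r].

Definition symmx (M : mat) : Prop := M^T = M.

Definition psdmx (N : mat) : Prop := forall v : vec, 0 <= (v *m N *m v^T) 0 0.

(* operator norm ||N|| = sup_{|x|=1} |N x|  (N x computed as (x N^T)^T) *)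
Definition opnorm (N : mat) : R :=
  sup [set enorm (v *m N^T) | v in [set v : vec | enorm v = 1]].

Definition unif_elliptic (F : mat -> R) (lam Lam : R) : Prop :=
  forall M N : mat, symmx M -> symmx N -> psdmx N ->
    lam * opnorm N <= F (M + N) - F M /\ F (M + N) - F M <= Lam * opnorm N.

Definition quasiconcave (F : mat -> R) : Prop :=
  forall (M1 M2 : mat) (t : R), symmx M1 -> symmx M2 -> 0 <= t <= 1 ->
    Num.min (F M1) (F M2) <= F (t *: M1 + (1 - t) *: M2).

Definition cont_on_Sn (F : mat -> R) : Prop :=
  {within [set M : mat | symmx M], continuous F}.

Definition partial (i : 'I_n) (f : vec -> R) : vec -> R :=
  fun x => 'D_(delta_mx 0 i) f x.

Definition hessian (f : vec -> R) (x : vec) : mat :=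
  \matrix_(i, j) partial j (partial i f) x.

Definition C2_on (U : set vec) (f : vec -> R) : Prop :=
  (forall x, U x -> differentiable f x) /\
  (forall i x, U x -> differentiable (partial i f) x) /\
  (forall i j, {within U, continuous (partial j (partial i f))}).

Definition visc_sub (F : mat -> R) (U : set vec) (u : vec -> R) : Prop :=
  forall (x0 : vec) (phi : vec -> R), U x0 ->
    (exists2 r : R, 0 < r & C2_on (eball x0 r) phi) ->
    phi x0 = u x0 -> (\forall x \near x0, u x <= phi x) ->
    0 <= F (hessian phi x0).

Definition visc_super (F : mat -> R) (U : set vec) (u : vec -> R) : Prop :=
  forall (x0 : vec) (phi : vec -> R), U x0 ->
    (exists2 r : R, 0 < r & C2_on (eball x0 r) phi) ->
    phi x0 = u x0 -> (\forall x \near x0, phi x <= u x) ->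
    F (hessian phi x0) <= 0.

Definition visc_sol (F : mat -> R) (U : set vec) (u : vec -> R) : Prop :=
  visc_sub F U u /\ visc_super F U u.

Local Open Scope ereal_scope.

Definition supnorm (U : set vec) (g : vec -> R) : \bar R :=
  ereal_sup [set `|g x|%:E | x in U].

Definition lipsemi (U : set vec) (g : vec -> R) : \bar R :=
  ereal_sup [set r | exists x y, [/\ U x, U y, x != y &
     r = (`|g x - g y| / enorm (x - y))%:E]].

Definition holdsemi (U : set vec) (a : R) (g : vec -> R) : \bar R :=
  ereal_sup [set r | exists x y, [/\ U x, U y, x != y &
     r = (`|g x - g y| / (enorm (x - y) `^ a))%:E]].

Definition C11norm (U : set vec) (u : vec -> R) : \bar R :=
  supnorm U u + (\sum_(i < n) supnorm U (partial i u))
  + \sum_(i < n) lipsemi U (partial i u).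

Definition C11_on (U : set vec) (u : vec -> R) : Prop :=
  (forall x, U x -> differentiable u x) /\ C11norm U u < +oo.

Definition C2a_norm (U : set vec) (a : R) (u : vec -> R) : \bar R :=
  supnorm U u + (\sum_(i < n) supnorm U (partial i u))
  + (\sum_(i < n) \sum_(j < n) supnorm U (partial j (partial i u)))
  + \sum_(i < n) \sum_(j < n) holdsemi U a (partial j (partial i u)).

Definition C2a_on (U : set vec) (a : R) (u : vec -> R) : Prop :=
  C2_on U u /\ C2a_norm U a u < +oo.

End Defs.

(* Main.v *)
(* Since {F >= 0} is convex, every translation-invariant average v of u satisfies
   F(D^2 v) >= 0: the linear inequalities that cut out {F >= 0} pass to averages, as a
   viscosity subsolution of a linear inequality lies below its random-walk means.
   Comparing u with averaged translates of u, second differences of u therefore obey a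
   maximum principle with an explicit barrier.

   For D^2 u bounded by 1 on the unit ball, a chain of points along which a second
   difference increases by a fixed amount must stop, and where it stops the barrier
   makes the second differences along e_i and e_i + e_j nearly constant on one ball of
   controlled size: there the gradient is almost affine, with matrix H. Bernstein's
   method turns this into D^2 u <= H + small on that ball, with F(H) nearly nonpositive.
   If in one of finitely many directions e the upper bound known for D^2 u exceeds H e .
   e by a fixed amount, the barrier lowers it by a fixed amount on a concentric smaller
   ball. Otherwise D^2 u <= H + small on a large ball, ellipticity gives D^2 u >= H -
   1/2, and the oscillation of D^2 u has halved. As only boundedly many drops are
   possible, the oscillation decays geometrically in the radius. *)
Require Import Defs.
From HB Require Import structures.
From mathcomp Require Import all_boot all_order all_algebra.
From mathcomp Require Import all_classical all_reals all_analysis.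
From mathcomp Require Import ring lra.
Set Implicit Arguments. Unset Strict Implicit. Unset Printing Implicit Defensive.
Import Order.TTheory GRing.Theory Num.Theory.
Import numFieldNormedType.Exports.
Local Open Scope classical_set_scope.
Local Open Scope ring_scope.

(** * Euclidean geometry of row vectors, quadratic forms and rank-one matrices *)

Section Euclid.
Variables (R : realType) (n : nat).
Local Notation vec := 'rV[R]_n.
Local Notation mat := 'M[R]_n.

Implicit Types (x y z : vec) (X Y : mat) (a : R).

(** A viscosity inequality tests [u] at one point, while a second difference involves three.
    Averaging gives the two translates classical Hessians, so only [-2u] stays rough, and a maximum
    point supplies a test function for it from below. The resulting maximum principle is one-sided:
    upper bounds of second differences improve, while lower bounds come from the equation once an
    upper bound is sharp.

    The other obstacle is the gap between scales. The chain argument controls differences with one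
    fixed step [s], on a ball of many multiples of [s], and is silent about shorter steps. What it
    does give is a gradient that is affine up to an error small relative to the radius, and from
    this alone Bernstein's estimate bounds second differences of all shorter steps from above.

    Regularity is phrased through differences and Taylor remainders because these pass to averages.
    Uncontrolled constants, such as the [K] of [Reg], never reach the final bounds: they multiply
    errors that vanish in a limit. *)

Definition dot (x y : vec) : R := \sum_i x 0 i * y 0 i.

Lemma dotC x y : dot x y = dot y x.
Proof. by apply: eq_bigr => i _; rewrite mulrC. Qed.

Lemma dotDl x y z : dot (x + y) z = dot x z + dot y z.
Proof. by rewrite -big_split; apply: eq_bigr => i _; rewrite mxE mulrDl. Qed.

Lemma dotZl a x z : dot (a *: x) z = a * dot x z.
Proof. by rewrite mulr_sumr; apply: eq_bigr => i _; rewrite mxE mulrA. Qed.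

Lemma dotNl x z : dot (- x) z = - dot x z.
Proof. by rewrite -scaleN1r dotZl mulN1r. Qed.

Lemma dotBl x y z : dot (x - y) z = dot x z - dot y z.
Proof. by rewrite dotDl dotNl. Qed.

Lemma dotDr x y z : dot z (x + y) = dot z x + dot z y.
Proof. by rewrite !(dotC z) dotDl. Qed.

Lemma dotZr a x z : dot z (a *: x) = a * dot z x.
Proof. by rewrite !(dotC z) dotZl. Qed.

Lemma dotNr x z : dot z (- x) = - dot z x.
Proof. by rewrite !(dotC z) dotNl. Qed.

Lemma dotBr x y z : dot z (x - y) = dot z x - dot z y.
Proof. by rewrite !(dotC z) dotBl. Qed.

Lemma dot0l x : dot 0 x = 0.
Proof. by rewrite -(scale0r 0) dotZl mul0r. Qed.

Lemma dot0r x : dot x 0 = 0.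
Proof. by rewrite dotC dot0l. Qed.

Lemma dot_deltal i x : dot (delta_mx 0 i) x = x 0 i.
Proof.
rewrite /dot (bigD1 i) //= mxE !eqxx mul1r big1 ?addr0 // => j ji.
by rewrite mxE (negbTE ji) andbF mul0r.
Qed.

Lemma dot_deltar i x : dot x (delta_mx 0 i) = x 0 i.
Proof. by rewrite dotC dot_deltal. Qed.

Lemma dot_sumr (I : Type) (s : seq I) (P : pred I) x (F : I -> vec) :
  dot x (\sum_(i <- s | P i) F i) = \sum_(i <- s | P i) dot x (F i).
Proof. by elim/big_rec2: _ => [|i a b _ <-]; rewrite ?dot0r ?dotDr. Qed.

Lemma dot_suml (I : Type) (s : seq I) (P : pred I) x (F : I -> vec) :
  dot (\sum_(i <- s | P i) F i) x = \sum_(i <- s | P i) dot (F i) x.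
Proof. by rewrite dotC dot_sumr; apply: eq_bigr => i _; rewrite dotC. Qed.

Lemma dot_mulmx (x y : vec) (X : mat) : dot (x *m X) y = dot x (y *m X^T).
Proof.
have E (a b : vec) : dot a b = (a *m b^T) 0 0.
  by rewrite mxE; apply: eq_bigr => i _; rewrite mxE.
by rewrite !E trmx_mul trmxK mulmxA.
Qed.

Lemma dot_ge0 x : 0 <= dot x x.
Proof. by apply: sumr_ge0 => i _; rewrite -expr2 sqr_ge0. Qed.

Lemma enormE x : enorm x = Num.sqrt (dot x x).
Proof. by congr Num.sqrt; apply: eq_bigr => i _; rewrite expr2. Qed.

Lemma enorm_ge0 x : 0 <= enorm x. Proof. exact: sqrtr_ge0. Qed.
Local Hint Resolve enorm_ge0 : core.

Lemma enorm2 x : enorm x ^+ 2 = dot x x.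
Proof. by rewrite enormE sqr_sqrtr ?dot_ge0. Qed.

Lemma enorm2M x : enorm x * enorm x = dot x x.
Proof. by rewrite -expr2 enorm2. Qed.

Lemma enormN x : enorm (- x) = enorm x.
Proof. by rewrite !enormE dotNl dotNr opprK. Qed.

Lemma enormZ a x : enorm (a *: x) = `|a| * enorm x.
Proof. by rewrite !enormE dotZl dotZr mulrA -expr2 sqrtrM ?sqr_ge0 // sqrtr_sqr. Qed.

Lemma enorm0 : enorm (0 : vec) = 0.
Proof. by rewrite enormE dot0l sqrtr0. Qed.

Lemma enormB x y : enorm (x - y) = enorm (y - x).
Proof. by rewrite -enormN opprB. Qed.

Lemma cauchy_schwarz x y : `|dot x y| <= enorm x * enorm y.
Proof.
rewrite !enormE -sqrtrM ?dot_ge0 // -sqrtr_sqr ler_wsqrtr //.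
have := dot_ge0 (dot y y *: x - dot x y *: y).
rewrite !(dotBl, dotBr, dotZl, dotZr) (dotC y x).
have [y0|y0] := eqVneq (dot y y) 0.
  have y00 i : y 0 i = 0.
    move/eqP: y0; rewrite psumr_eq0 => [/allP /(_ i (mem_index_enum _))/=|j _].
      by rewrite mulf_eq0 orbb => /eqP.
    by rewrite -expr2 sqr_ge0.
  move=> _; rewrite y0 mulr0 [dot x y]big1 ?expr0n // => i _; by rewrite y00 mulr0.
have yp : 0 < dot y y by rewrite lt_def y0 dot_ge0.
move: yp; set a := dot x x; set b := dot y y; set c := dot x y => yp h.
have : 0 <= b * (a * b - c ^+ 2) by apply: le_trans h _; rewrite le_eqVlt; apply/orP; left; apply/eqP; ring.
by rewrite pmulr_rge0 // subr_ge0.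
Qed.

Lemma dot_le x y : dot x y <= enorm x * enorm y.
Proof. exact: le_trans (ler_norm _) (cauchy_schwarz _ _). Qed.

Lemma enormD x y : enorm (x + y) <= enorm x + enorm y.
Proof.
rewrite -(ler_pXn2r (n := 2)) ?nnegrE ?addr_ge0 // enorm2 sqrrD !enorm2.
rewrite !(dotDl, dotDr) (dotC y x).
have := dot_le x y; lra.
Qed.

Lemma enormDB x y : enorm (x - y) <= enorm x + enorm y.
Proof. by rewrite -(enormN y) enormD. Qed.

Lemma enorm_tri x y z : enorm (x - z) <= enorm (x - y) + enorm (y - z).
Proof. by apply: le_trans (enormD _ _); rewrite addrA subrK. Qed.

Lemma enorm_eq0 x : (enorm x == 0) = (x == 0).
Proof.
apply/eqP/eqP => [h|->]; last exact: enorm0.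
have : dot x x = 0 by rewrite -enorm2 h expr0n.
move/eqP; rewrite psumr_eq0 => [/allP h0|j _]; last by rewrite -expr2 sqr_ge0.
apply/rowP => i; have /(_ i (mem_index_enum _)) := h0.
by rewrite /= mulf_eq0 orbb mxE => /eqP.
Qed.

Lemma enorm_gt0 x : (0 < enorm x) = (x != 0).
Proof. by rewrite lt_def enorm_eq0 enorm_ge0 andbT. Qed.

Lemma enorm_delta i : enorm (delta_mx 0 i : vec) = 1.
Proof. by rewrite enormE dot_deltal mxE !eqxx sqrtr1. Qed.

Lemma coord_le_enorm x i : `|x 0 i| <= enorm x.
Proof. by have := cauchy_schwarz x (delta_mx 0 i); rewrite dot_deltar enorm_delta mulr1. Qed.

Lemma vec_sum_delta x : x = \sum_i x 0 i *: delta_mx 0 i.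
Proof.
apply/rowP => j; rewrite summxE (bigD1 j) //= !mxE !eqxx mulr1 big1 ?addr0 //.
by move=> i ij; rewrite !mxE eq_sym (negbTE ij) andbF mulr0.
Qed.

Lemma enorm_le_sum x : enorm x <= \sum_i `|x 0 i|.
Proof.
rewrite {1}[x]vec_sum_delta; elim/big_rec2: _ => [|i a b _ h]; first by rewrite enorm0.
by apply: le_trans (enormD _ _) _; rewrite lerD // enormZ enorm_delta mulr1.
Qed.

Definition qf (X : mat) (z : vec) : R := dot (z *m X) z.

Lemma qfD X Y z : qf (X + Y) z = qf X z + qf Y z.
Proof. by rewrite /qf mulmxDr dotDl. Qed.

Lemma qfZ a X z : qf (a *: X) z = a * qf X z.
Proof. by rewrite /qf -scalemxAr dotZl. Qed.

Lemma qfN X z : qf (- X) z = - qf X z.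
Proof. by rewrite /qf mulmxN dotNl. Qed.

Lemma qfB X Y z : qf (X - Y) z = qf X z - qf Y z.
Proof. by rewrite qfD qfN. Qed.

Lemma qf0 z : qf 0 z = 0.
Proof. by rewrite /qf mulmx0 dot0l. Qed.

Lemma qfM a z : qf (a%:M) z = a * dot z z.
Proof. by rewrite /qf mul_mx_scalar dotZl. Qed.

Lemma qf_scale X a z : qf X (a *: z) = a ^+ 2 * qf X z.
Proof. by rewrite /qf -scalemxAl dotZl dotZr mulrA expr2. Qed.

Lemma qf_opp X z : qf X (- z) = qf X z.
Proof. by rewrite -scaleN1r qf_scale sqrrN expr1n mul1r. Qed.

Lemma qf_tr X z : qf X^T z = qf X z.
Proof. by rewrite /qf dot_mulmx trmxK dotC. Qed.

Lemma qf_sumX (I : Type) (s : seq I) (P : pred I) (F : I -> mat) z :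
  qf (\sum_(i <- s | P i) F i) z = \sum_(i <- s | P i) qf (F i) z.
Proof. by elim/big_rec2: _ => [|i a b _ <-]; rewrite ?qf0 ?qfD. Qed.

Lemma qfE X z : qf X z = \sum_i \sum_j X i j * (z 0 i * z 0 j).
Proof.
rewrite /qf /dot exchange_big; apply: eq_bigr => j _ /=.
rewrite mxE mulr_suml; apply: eq_bigr => i _; ring.
Qed.

Lemma qf_psd X z : (z *m X *m z^T) 0 0 = qf X z.
Proof. by rewrite mxE; apply: eq_bigr => i _; rewrite [z^T _ _]mxE. Qed.

Lemma qf_add X y z : symmx X -> qf X (y + z) = qf X y + qf X z + 2 * dot (y *m X) z.
Proof.
move=> sX; rewrite /qf mulmxDl !dotDl !dotDr.
have -> : dot (z *m X) y = dot (y *m X) z by rewrite dot_mulmx sX dotC.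
ring.
Qed.

Definition outer (x y : vec) : mat := x^T *m y.

Lemma dot_outer (a b : vec) x y : dot (a *m outer x y) b = dot a x * dot y b.
Proof.
rewrite /outer mulmxA.
have -> : a *m x^T = (dot a x)%:M.
  apply/matrixP => i j; rewrite !ord1 !mxE eqxx mulr1n.
  by apply: eq_bigr => k _; rewrite mxE.
by rewrite mul_scalar_mx dotZl.
Qed.

Lemma qf_outer x y z : qf (outer x y) z = dot x z * dot y z.
Proof. by rewrite /qf dot_outer dotC. Qed.

Lemma outer_tr x y : (outer x y)^T = outer y x.
Proof. by rewrite /outer trmx_mul trmxK. Qed.

Definition mabs (X : mat) : R := \sum_i \sum_j `|X i j|.

Lemma mabs_ge0 X : 0 <= mabs X.
Proof. by apply: sumr_ge0 => i _; apply: sumr_ge0. Qed.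

Lemma bf_le X y z : `|dot (y *m X) z| <= mabs X * (enorm y * enorm z).
Proof.
have -> : dot (y *m X) z = \sum_i \sum_j X i j * (y 0 i * z 0 j).
  rewrite /dot exchange_big; apply: eq_bigr => j _ /=.
  by rewrite mxE mulr_suml; apply: eq_bigr => i _; ring.
rewrite mulr_suml; apply: le_trans (ler_norm_sum _ _ _) _; apply: ler_sum => i _.
rewrite mulr_suml; apply: le_trans (ler_norm_sum _ _ _) _; apply: ler_sum => j _.
by rewrite !normrM ler_wpM2l // ler_pM // coord_le_enorm.
Qed.

Lemma qf_le X z : `|qf X z| <= mabs X * dot z z.
Proof. by rewrite -enorm2M; exact: bf_le. Qed.

Lemma symmxD X Y : symmx X -> symmx Y -> symmx (X + Y).
Proof. by move=> hX hY; rewrite /symmx raddfD /= hX hY. Qed.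

Lemma symmxZ a X : symmx X -> symmx (a *: X).
Proof. by move=> hX; rewrite /symmx linearZ /= hX. Qed.

Lemma symmxN X : symmx X -> symmx (- X).
Proof. by move=> hX; rewrite /symmx raddfN /= hX. Qed.

Lemma symmxM a : symmx (a%:M : mat).
Proof. exact: tr_scalar_mx. Qed.

Lemma symmx_outer x : symmx (outer x x).
Proof. exact: outer_tr. Qed.

Lemma symmx_outer2 x y : symmx (outer x y + outer y x).
Proof. by rewrite /symmx raddfD /= !outer_tr addrC. Qed.

Lemma symmx_sum (I : Type) (s : seq I) (P : pred I) (F : I -> mat) :
  (forall i, P i -> symmx (F i)) -> symmx (\sum_(i <- s | P i) F i).
Proof.
by move=> h; elim/big_ind: _ => [|A B|i /h//]; [exact: trmx0|exact: symmxD].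
Qed.

End Euclid.
#[export] Hint Extern 0 (is_true (Order.le _ (enorm _))) => (apply: enorm_ge0) : core.
#[export] Hint Extern 0 (is_true (Order.le _ (dot _ _))) => (apply: dot_ge0) : core.

(** * Extrema on compact sets, in terms of the Euclidean norm *)

Section EVT.
Variables (R : realType) (n : nat).
Local Notation vec := 'rV[R]_n.
Implicit Types x y z : vec.

Lemma coord_le_normr x i : `|x 0 i| <= `|x|.
Proof. by have -> : `|x| = mx_norm x by []; rewrite mx_normrE; apply: (le_trans _ (le_bigmax _ _ (0, i))). Qed.

Lemma normr_le_enorm x : `|x| <= enorm x.
Proof.
have -> : `|x| = mx_norm x by [].
rewrite mx_normrE; apply/bigmax_leP; split => [|-[i j] _ /=]; first exact: enorm_ge0.
by rewrite (ord1 i) coord_le_enorm.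
Qed.

Lemma near_enorm x (e : R) : 0 < e -> \forall y \near x, enorm (y - x) < e.
Proof.
move=> e0; have e1 : 0 < e / n.+1%:R by rewrite divr_gt0 // ltr0n.
near=> y; have yx : `|x - y| < e / n.+1%:R.
  by near: y; apply: cvgr_dist_lt.
rewrite -(enormN (y - x)) opprB.
apply: le_lt_trans (enorm_le_sum _) _.
apply: (@le_lt_trans _ _ (\sum_(i < n) (e / n.+1%:R))).
  apply: ler_sum => i _; apply: le_trans (ltW yx).
  exact: coord_le_normr.
rewrite sumr_const card_ord -[_ *+ n]mulr_natr mulrAC ltr_pdivrMr ?ltr0n//.
by rewrite ltr_pM2l // ltr_nat.
Unshelve. all: by end_near. Qed.

Lemma enorm_near x (P : vec -> Prop) : (\forall y \near x, P y) ->
  exists2 e : R, 0 < e & forall y, enorm (y - x) < e -> P y.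
Proof.
move=> /nbhs_ballP[e /= e0 h]; exists e => // y yx; apply: h.
by rewrite -ball_normE /= distrC; apply: le_lt_trans yx; exact: normr_le_enorm.
Qed.

(** The topology of matrices comes from the max norm; closedness and continuity are stated with
    [enorm] because that is what the estimates produce, and [near_enorm] translates. *)
Lemma compact_min (A : set vec) (f : vec -> R) (M : R) :
  A !=set0 -> (forall x, A x -> enorm x <= M) ->
  (forall x, (forall e : R, 0 < e -> exists2 y, A y & enorm (y - x) < e) -> A x) ->
  (forall x (e : R), A x -> 0 < e -> exists2 d : R, 0 < d &
     forall y, A y -> enorm (y - x) < d -> `|f x - f y| < e) ->
  exists2 x, A x & forall y, A y -> f x <= f y.
Proof.
move=> A0 bA clA cf.
have cA : compact A.
  apply: bounded_closed_compact.
    exists M; split; first exact: num_real.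
    move=> N MN x Ax; apply: (le_trans _ (ltW MN)); apply: le_trans (bA _ Ax).
    exact: normr_le_enorm.
  move=> x clx; apply: clA => e e0.
  by have [y [Ay ?]] := clx _ (near_enorm x e0); exists y.
have [c cA' hc] : exists2 c, c \in A & forall t, t \in A -> f c <= f t.
  apply: compact_EVT_min => //; apply/subspace_continuousP => x Ax.
  apply/cvgrPdist_lt => e e0; have [d d0 hd] := cf _ _ Ax e0.
  rewrite /within /= near_withinE; near=> y => Ay; apply: hd => //.
  by near: y; exact: near_enorm.
exists c; first by rewrite inE in cA'.
by move=> y Ay; apply: hc; rewrite inE.
Unshelve. all: by end_near. Qed.

Lemma cball_max (f : vec -> R) c (r L : R) : 0 <= r ->
  (forall x y, enorm (x - c) <= r -> enorm (y - c) <= r ->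
    `|f x - f y| <= L * enorm (x - y)) ->
  exists2 x, enorm (x - c) <= r & forall y, enorm (y - c) <= r -> f y <= f x.
Proof.
move=> r0 lf.
pose A : set vec := [set x | enorm (x - c) <= r].
have [||||x Ax hx] := @compact_min A (fun x => - f x) (r + enorm c).
- by exists c; rewrite /A /= subrr enorm0.
- by move=> x Ax; rewrite -[x](subrK c); apply: le_trans (enormD _ _) _; rewrite lerD2r.
- move=> x h; apply/ler_addgt0Pr => e e0; have [y Ay yx] := h e e0.
  apply: le_trans (enorm_tri _ y _) _; rewrite enormB addrC; apply: lerD => //; exact: ltW.
- move=> x e Ax e0; exists (e / (`|L| + 1)); first by rewrite divr_gt0 // ltr_wpDl.
  move=> y Ay yx; rewrite -opprD normrN; apply: le_lt_trans (lf _ _ Ax Ay) _.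
  rewrite enormB; rewrite ltr_pdivlMr ?ltr_wpDl // in yx.
  apply: le_lt_trans yx; rewrite [leLHS]mulrC; apply: ler_wpM2l; first exact: enorm_ge0.
  by have := ler_norm L; lra.
by exists x => // y Ay; have := hx _ Ay; rewrite lerN2.
Qed.

End EVT.

(** * One-dimensional averages over the unit interval *)

Section Average.
Variable R : realType.
Implicit Types (f g F : R -> R) (t s c : R).

Lemma antiderivative_ex f (T : R) : continuous f ->
  exists F : R -> R, forall t, - T < t < T -> is_derive t 1 F (f t).
Proof.
move=> cf; exists (fun x => \int[lebesgue_measure]_(t in `[- T, x]) f t) => t /andP[tl tu].
have hi : lebesgue_measure.-integrable `[- T, T] (EFin \o f).
  apply: continuous_compact_integrable; first exact: segment_compact.
  by apply: continuous_subspaceT => x; exact: cf.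
have [d e] := continuous_FTC1_closed tu hi tl (cf t).
by apply: DeriveDef; [exact: d|rewrite -derive1E; exact: e].
Qed.

Lemma derive_bound F f (a b m : R) : a <= b ->
  (forall t, a <= t <= b -> is_derive t 1 F (f t)) ->
  (forall t, a <= t <= b -> f t <= m) -> F b - F a <= m * (b - a).
Proof.
move=> ab dF fm.
have [||c cab ->] := @MVT_segment _ F f a b ab.
- by move=> x; rewrite in_itv /= => /andP[/ltW? /ltW?]; apply: dF; apply/andP.
- apply: derivable_within_continuous => x xab.
  by have [] : is_derive x 1 F (f x) by apply: dF; move: xab; rewrite in_itv.
- by rewrite ler_wpM2r ?subr_ge0 // fm //; move: cab; rewrite in_itv.
Qed.

(** The integral of [f] over [[0,1]], as the increment of a chosen primitive. The primitive lives on
    [(-2,2)] so that two-sided derivatives make sense at both endpoints; if [f] has none, the zero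
    function is chosen and the average is 0. *)
Definition avg f : R :=
  let F := xget (fun=> 0) [set F : R -> R | forall t, - 2 < t < 2 -> is_derive t 1 F (f t)] in
  F 1 - F 0.

Lemma avgE f F : continuous f -> (forall t, 0 <= t <= 1 -> is_derive t 1 F (f t)) ->
  avg f = F 1 - F 0.
Proof.
move=> cf dF; rewrite /avg; case: xgetP => [G _ /= dG|]; last first.
  by have [F' hF'] := antiderivative_ex 2 cf; move=> /(_ F').
have dG' t : 0 <= t <= 1 -> is_derive t 1 G (f t).
  by move=> /andP[t0 t1]; apply: dG; apply/andP; split; lra.
have h : forall F1 F2 : R -> R, (forall t, 0 <= t <= 1 -> is_derive t 1 F1 (f t)) ->
   (forall t, 0 <= t <= 1 -> is_derive t 1 F2 (f t)) -> F1 1 - F1 0 <= F2 1 - F2 0.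
  move=> F1 F2 d1 d2.
  have := @derive_bound (F1 - F2) (fun t => f t - f t) 0 1 0 ler01.
  rewrite !fctE => hh; suff : F1 1 - F2 1 - (F1 0 - F2 0) <= 0 * (1 - 0) by lra.
  apply: hh => t ht; last by rewrite subrr.
  by apply: is_deriveB; [exact: d1|exact: d2].
by apply/eqP; rewrite eq_le !h.
Qed.

Lemma avgD f g : continuous f -> continuous g -> avg (fun s => f s + g s) = avg f + avg g.
Proof.
move=> cf cg; have [F hF] := antiderivative_ex 2 cf; have [G hG] := antiderivative_ex 2 cg.
have i t : 0 <= t <= 1 -> - 2 < t < (2 : R) by move=> /andP[? ?]; apply/andP; split; lra.
have -> : avg f = F 1 - F 0 by apply: avgE => // t /i/hF.
have -> : avg g = G 1 - G 0 by apply: avgE => // t /i/hG.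
rewrite (_ : avg _ = (F + G) 1 - (F + G) 0); first by rewrite !fctE; ring.
apply: (@avgE _ (F + G)).
- by move=> x; apply: cvgD; [exact: cf|exact: cg].
- by move=> t /i h; apply: is_deriveD; [exact: hF|exact: hG].
Qed.

Lemma avgZ c f : continuous f -> avg (fun s => c * f s) = c * avg f.
Proof.
move=> cf; have [F hF] := antiderivative_ex 2 cf.
have i t : 0 <= t <= 1 -> - 2 < t < (2 : R) by move=> /andP[? ?]; apply/andP; split; lra.
have -> : avg f = F 1 - F 0 by apply: avgE => // t /i/hF.
rewrite (_ : avg _ = (c *: F) 1 - (c *: F) 0); first by rewrite !fctE /GRing.scale /=; ring.
apply: (@avgE _ (c *: F)).
- by move=> x; apply: cvgM; [exact: cvg_cst|exact: cf].
- by move=> t /i h; apply: is_deriveZ; exact: hF.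
Qed.

Lemma avg_cst c : avg (fun=> c) = c.
Proof.
rewrite (_ : avg _ = (c *: id) 1 - (c *: id) 0); first by rewrite !fctE /GRing.scale /=; ring.
apply: (@avgE _ (c *: id)).
- by move=> x; exact: cvg_cst.
- move=> t _; rewrite -[X in is_derive _ _ _ X]mulr1; apply: is_deriveZ.
Qed.

Lemma avg_le f g : continuous f -> continuous g ->
  (forall s, 0 <= s <= 1 -> f s <= g s) -> avg f <= avg g.
Proof.
move=> cf cg fg; rewrite -subr_ge0 -oppr_le0 opprB.
have -> : avg f - avg g = avg (fun s => f s + -1 * g s).
  rewrite avgD // ?avgZ ?mulN1r // => x; apply: cvgM; [exact: cvg_cst|exact: cg].
have ch : continuous (fun s => f s + -1 * g s).
  by move=> x; apply: cvgD; [exact: cf|apply: cvgM; [exact: cvg_cst|exact: cg]].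
have [F hF] := antiderivative_ex 2 ch.
have i t : 0 <= t <= 1 -> - 2 < t < (2 : R) by move=> /andP[? ?]; apply/andP; split; lra.
have -> : avg (fun s => f s + -1 * g s) = F 1 - F 0 by apply: avgE => // t /i/hF.
have := @derive_bound F (fun s => f s + -1 * g s) 0 1 0 ler01.
rewrite mul0r; apply => [t /i/hF//|t /fg]; lra.
Qed.

(** For a primitive [F] of [f] the left side is the increment from 0 to [t] of
    [D s = F (s + 1) - F s - c * s], whose derivative is at most [B * |s|]. This is what gives
    averages along segments one more derivative. *)
Lemma avg_shift_le f t c (B : R) : continuous f -> 0 <= B ->
  (forall s, `|s| <= `|t| -> `|f (s + 1) - f s - c| <= B * `|s|) ->
  `|avg (fun s => f (s + t)) - avg f - t * c| <= B * t ^+ 2.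
Proof.
move=> cf B0 hB; pose T := `|t| + 3.
have [F hF] := antiderivative_ex T cf.
have dF s : `|s| < T -> is_derive s 1 F (f s).
  by move=> h; apply: hF; rewrite -ltr_norml.
have tT : `|t| + 2 < T by rewrite /T; lra.
have t0 := normr_ge0 t.
have shift d s : is_derive (s + d) 1 F (f (s + d)) -> is_derive s 1 (fun s => F (s + d)) (f (s + d)).
  move=> h.
  have h1 : is_derive s 1 (fun s : R => s + d) 1.
    by rewrite -[X in is_derive _ _ _ X]addr0; apply: is_deriveD.
  have := @is_derive1_comp _ F (fun s : R => s + d) s _ _ h h1.
  by rewrite mulr1.
have cs d : continuous (fun s => f (s + d)).
  by move=> x; apply: (@continuous_comp _ _ _ (fun s : R => s + d) f);
     [apply: cvgD; [exact: cvg_id|exact: cvg_cst]|exact: cf].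
have -> : avg (fun s => f (s + t)) = F (1 + t) - F (0 + t).
  apply: (@avgE _ (fun s => F (s + t))) => // s /andP[s0 s1]; apply: shift; apply: dF.
  by apply: le_lt_trans tT; apply: le_trans (ler_normD _ _) _; rewrite ger0_norm //; lra.
have -> : avg f = F 1 - F 0.
  by apply: avgE => // s /andP[s0 s1]; apply: dF; rewrite ger0_norm //; lra.
pose D s := F (s + 1) - F s - c * s.
have dD s : `|s| <= `|t| -> is_derive s 1 D (f (s + 1) - f s - c).
  move=> st; rewrite /D; apply: is_deriveB.
    apply: is_deriveB; last by apply: dF; lra.
    apply: shift; apply: dF; apply: le_lt_trans (ler_normD _ _) _.
    by rewrite normr1; lra.
  have := @is_deriveZ _ _ _ (id : R -> R) c s 1 1 (is_derive_id _ _).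
  by rewrite /GRing.scale /= mulr1.
have dDN s : `|s| <= `|t| -> is_derive s 1 (- D) (- (f (s + 1) - f s - c)).
  by move=> /dD h; apply: is_deriveN.
have -> : F (1 + t) - F (0 + t) - (F 1 - F 0) - t * c = D t - D 0.
  by rewrite /D !add0r addrC; rewrite (addrC 1 t); ring.
have main (G g : R -> R) : (forall s, `|s| <= `|t| -> is_derive s 1 G (g s)) ->
    (forall s, `|s| <= `|t| -> `|g s| <= B * `|s|) -> G t - G 0 <= B * t ^+ 2.
  move=> dG gB.
  have gB' s : `|s| <= `|t| -> `|g s| <= B * `|t|.
    by move=> st; apply: le_trans (gB _ st) _; rewrite ler_wpM2l.
  have [tp|tn] := leP 0 t.
    have -> : B * t ^+ 2 = (B * `|t|) * (t - 0) by rewrite ger0_norm //; ring.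
    apply: (@derive_bound G g) => // s /andP[s0 s1].
      by apply: dG; rewrite !ger0_norm.
    by apply: le_trans (ler_norm _) _; apply: gB'; rewrite !ger0_norm.
  have st s : t <= s <= 0 -> `|s| <= `|t|.
    by move=> /andP[? ?]; rewrite !ler0_norm ?lerN2 //; lra.
  have := @derive_bound (- G) (fun s => - g s) t 0 (B * `|t|) (ltW tn).
  rewrite !fctE ltr0_norm // => hh; suff : - G 0 - - G t <= B * - t * (0 - t) by lra.
  apply: hh => s /st h; first by apply: is_deriveN; exact: dG.
  by apply: le_trans (ler_norm _) _; rewrite normrN -ltr0_norm // gB'.
have h1 : D t - D 0 <= B * t ^+ 2 by apply: main dD _.
have h2 : (- D) t - (- D) 0 <= B * t ^+ 2.
  by apply: main dDN _ => s st; rewrite normrN; exact: hB.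
by rewrite ler_norml; apply/andP; split; rewrite ?fctE in h2; lra.
Qed.

End Average.

(** * Averaging operators on functions with bounded second differences *)

Section Smoothing.
Variables (R : realType) (n : nat).
Local Notation vec := 'rV[R]_n.
Local Notation mat := 'M[R]_n.
Implicit Types (x y z a b w : vec) (f g : vec -> R) (K L r t c : R).

Definition mixd f x a b : R := f (x + a + b) - f (x + a) - f (x + b) + f x.

Definition C11 K f : Prop := forall x a b, `|mixd f x a b| <= K * (enorm a * enorm b).

(** The growth of a function whose gradient is [K]-Lipschitz and bounded by [L] at the origin. It
    secures continuity along lines, and its form survives translations and averages. *)
Definition lip_loc K L f : Prop :=
  forall x z, `|f (x + z) - f x| <= (L + K * enorm x + K * enorm z) * enorm z.

Definition Reg K f : Prop := [/\ 0 <= K, C11 K f & exists2 L, 0 <= L & lip_loc K L f].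

Lemma Reg_ge0 K f : Reg K f -> 0 <= K. Proof. by case. Qed.

Lemma RegW K K' f : K <= K' -> Reg K f -> Reg K' f.
Proof.
move=> KK [K0 c [L L0 l]]; split; [lra| |exists L => //].
- move=> x a b; apply: le_trans (c x a b) _; by rewrite ler_wpM2r // mulr_ge0.
- move=> x z; apply: le_trans (l x z) _; rewrite ler_wpM2r //.
  by rewrite lerD ?ler_wpM2r // lerD ?ler_wpM2r.
Qed.

Lemma Reg_cst c : Reg 0 (fun=> c).
Proof.
split => // [x a b|].
  have -> : mixd (fun=> c) x a b = 0 by rewrite /mixd; ring.
  by rewrite normr0 mul0r.
by exists 0 => // x z; rewrite subrr normr0 !mul0r !addr0 mul0r.
Qed.

Lemma RegD K K' f g : Reg K f -> Reg K' g -> Reg (K + K') (fun x => f x + g x).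
Proof.
move=> [K0 cf [L L0 lf]] [K0' cg [L' L0' lg]]; split; first lra.
- move=> x a b; rewrite mulrDl; apply: le_trans (lerD (cf x a b) (cg x a b)).
  by apply: le_trans (ler_normD _ _); rewrite /mixd le_eqVlt; apply/orP; left; apply/eqP; congr `|_|; ring.
exists (L + L'); first lra.
move=> x z; have := lerD (lf x z) (lg x z).
rewrite -mulrDl => h; apply: le_trans (le_trans _ h) _.
  by apply: le_trans (ler_normD _ _); rewrite le_eqVlt; apply/orP; left; apply/eqP; congr `|_|; ring.
by rewrite le_eqVlt; apply/orP; left; apply/eqP; ring.
Qed.

Lemma RegZ K c f : Reg K f -> Reg (`|c| * K) (fun x => c * f x).
Proof.
move=> [K0 cf [L L0 lf]]; split; first exact: mulr_ge0.
- move=> x a b; rewrite -mulrA; apply: le_trans (ler_wpM2l (normr_ge0 c) (cf x a b)).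
  by rewrite -normrM /mixd le_eqVlt; apply/orP; left; apply/eqP; congr `|_|; ring.
exists (`|c| * L); first exact: mulr_ge0.
move=> x z; rewrite -mulrBr normrM.
apply: le_trans (ler_wpM2l (normr_ge0 c) (lf x z)) _.
by rewrite le_eqVlt; apply/orP; left; apply/eqP; ring.
Qed.

Lemma RegN K f : Reg K f -> Reg K (fun x => - f x).
Proof.
move=> /(RegZ (-1)); rewrite normrN1 mul1r.
by have -> : (fun x => -1 * f x) = (fun x => - f x) by apply/funext => x; rewrite mulN1r.
Qed.

Lemma RegB K K' f g : Reg K f -> Reg K' g -> Reg (K + K') (fun x => f x - g x).
Proof. by move=> rf /RegN rg; exact: RegD. Qed.

Lemma RegT K f a : Reg K f -> Reg K (fun x => f (x + a)).
Proof.
move=> [K0 cf [L L0 lf]]; split => //.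
- move=> x b c; have := cf (x + a) b c; rewrite /mixd.
  by rewrite (addrAC _ b a) (addrAC _ c a) (addrAC _ c a) (addrAC _ b a).
exists (L + K * enorm a); first by rewrite addr_ge0 // mulr_ge0.
move=> x z; rewrite (addrAC x); apply: le_trans (lf (x + a) z) _.
rewrite ler_wpM2r // lerD2r -addrA lerD2l -mulrDr ler_wpM2l //.
by rewrite addrC enormD.
Qed.

Lemma Reg_line_cont K f x z : Reg K f -> continuous (fun s : R => f (x + s *: z)).
Proof.
move=> [K0 _ [L L0 l]] t.
pose B := (L + K * enorm (x + t *: z) + K * enorm z) * enorm z.
have B0 : 0 <= B by rewrite /B !(mulr_ge0, addr_ge0).
apply/cvgrPdist_lt => e e0.
have e1 : 0 < e / (B + 1) by rewrite divr_gt0 // ltr_wpDl.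
near=> s.
have st1 : `|t - s| < 1 by near: s; apply: cvgr_dist_lt.
have st2 : `|t - s| < e / (B + 1).
  by near: s; apply: cvgr_dist_lt.
have := l (x + t *: z) ((s - t) *: z).
have -> : x + t *: z + (s - t) *: z = x + s *: z.
  by rewrite -addrA -scalerDl; congr (_ + _ *: _); ring.
rewrite distrC enormZ [`|s - t|]distrC => h.
apply: (le_lt_trans (y := B * `|t - s|)).
  apply: le_trans h _; rewrite /B -mulrA [enorm z * `|_|]mulrC.
  rewrite ler_wpM2r ?mulr_ge0 // lerD2l ler_wpM2l //.
  by rewrite ler_piMl // ltW.
apply: (le_lt_trans (y := (B + 1) * `|t - s|)); first by rewrite ler_wpM2r // lerDl.
by rewrite mulrC -ltr_pdivlMr // ltr_wpDl.
Unshelve. all: by end_near. Qed.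

(* An abstract translation-invariant average over a ball of radius [r]: all that
   is ever used of convolution with a probability kernel. *)
Record avop (A : (vec -> R) -> vec -> R) (r : R) : Prop := Avop {
  av_r0 : 0 <= r;
  avD : forall K K' f g x, Reg K f -> Reg K' g ->
    A (fun y => f y + g y) x = A f x + A g x;
  avZ : forall K c f x, Reg K f -> A (fun y => c * f y) x = c * A f x;
  avT : forall f a x, A (fun y => f (y + a)) x = A f (x + a);
  avC : forall c x, A (fun=> c) x = c;
  avle : forall K K' f g x, Reg K f -> Reg K' g ->
    (forall y, enorm (y - x) <= r -> f y <= g y) -> A f x <= A g x }.

Section AvopTheory.
Variables (A : (vec -> R) -> vec -> R) (r : R).
Hypothesis hA : avop A r.

Lemma avN K f x : Reg K f -> A (fun y => - f y) x = - A f x.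
Proof.
move=> rf; rewrite -mulN1r -(avZ hA _ _ rf); congr A.
by apply/funext => y; rewrite mulN1r.
Qed.

Lemma avB K K' f g x : Reg K f -> Reg K' g ->
  A (fun y => f y - g y) x = A f x - A g x.
Proof. by move=> rf rg; rewrite (avD hA _ rf (RegN rg)) (avN _ rg). Qed.

Lemma av_bound K f x c : Reg K f -> (forall y, enorm (y - x) <= r -> `|f y| <= c) ->
  `|A f x| <= c.
Proof.
move=> rf h; rewrite ler_norml; apply/andP; split.
  rewrite -[X in X <= _](avC hA _ x); apply: (avle hA (Reg_cst _) rf) => y /h.
  by rewrite ler_norml => /andP[].
rewrite -[X in _ <= X](avC hA _ x); apply: (avle hA rf (Reg_cst _)) => y /h.
by rewrite ler_norml => /andP[].
Qed.

Lemma av_mixd K f x a b : Reg K f -> mixd (A f) x a b = A (fun y => mixd f y a b) x.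
Proof.
move=> rf; rewrite /mixd.
have r1 := RegT (a + b) rf; have r2 := RegT a rf; have r3 := RegT b rf.
have -> : (fun y => f (y + a + b) - f (y + a) - f (y + b) + f y) =
  (fun y => (f (y + (a + b)) - f (y + a)) - f (y + b) + f y).
  by apply/funext => y; rewrite addrA.
rewrite (avD hA _ (RegB (RegB r1 r2) r3) rf) (avB _ (RegB r1 r2) r3) (avB _ r1 r2).
by rewrite !(avT hA) addrA.
Qed.

Lemma av_reg K f : Reg K f -> Reg K (A f).
Proof.
move=> rf; have [K0 cf [L L0 lf]] := rf; split => //.
- move=> x a b; rewrite (av_mixd _ _ _ rf).
  have r1 := RegT (a + b) rf; have r2 := RegT a rf; have r3 := RegT b rf.
  apply: (@av_bound (K + K + K + K)); last by move=> y _; exact: cf.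
  have -> : (fun y => mixd f y a b) =
     (fun y => (f (y + (a + b)) - f (y + a)) - f (y + b) + f y).
    by apply/funext => y; rewrite /mixd addrA.
  by apply: RegD rf; apply: RegB r3; exact: RegB.
exists (L + K * r); first by rewrite addr_ge0 // mulr_ge0 ?(av_r0 hA).
move=> x z; rewrite -(avT hA) -(avB _ (RegT z rf) rf).
apply: (av_bound (RegB (RegT z rf) rf)) => y yx.
apply: le_trans (lf y z) _; rewrite ler_wpM2r // lerD2r -addrA lerD2l -mulrDr ler_wpM2l //.
by rewrite -[y](subrK x); apply: le_trans (enormD _ _) _; rewrite lerD2r.
Qed.

End AvopTheory.

Lemma avop_id : avop (fun f => f) 0.
Proof. by split => // K K' f g x _ _ h; apply: h; rewrite subrr enorm0. Qed.

Lemma avop_comp A B r r' : avop A r -> avop B r' -> avop (fun f => A (B f)) (r + r').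
Proof.
move=> hA hB; split.
- by rewrite addr_ge0 ?(av_r0 hA) ?(av_r0 hB).
- move=> K K' f g x rf rg; rewrite -(avD hA _ (av_reg hB rf) (av_reg hB rg)).
  by congr A; apply/funext => y; exact: (avD hB _ rf rg).
- move=> K c f x rf; rewrite -(avZ hA _ _ (av_reg hB rf)).
  by congr A; apply/funext => y; exact: (avZ hB _ _ rf).
- move=> f a x; rewrite -(avT hA); congr A; by apply/funext => y; exact: (avT hB).
- move=> c x; rewrite -{2}(avC hA c x); congr A; by apply/funext => y; exact: (avC hB).
- move=> K K' f g x rf rg h; apply: (avle hA (av_reg hB rf) (av_reg hB rg)) => y yx.
  apply: (avle hB rf rg) => y' y'y; apply: h.
  by apply: le_trans (enorm_tri _ y _) _; rewrite addrC lerD.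
Qed.

Lemma avopW A r r' : r <= r' -> avop A r -> avop A r'.
Proof.
move=> rr h; split.
- exact: le_trans (av_r0 h) rr.
- exact: (avD h).
- exact: (avZ h).
- exact: (avT h).
- exact: (avC h).
- move=> K K' f g x rf rg hl; apply: (avle h rf rg) => y yx; apply: hl; exact: le_trans rr.
Qed.

Lemma avop_half A B r : avop A r -> avop B r ->
  avop (fun f x => 2^-1 * (A f x + B f x)) r.
Proof.
move=> hA hB; split.
- exact: av_r0 hA.
- by move=> K K' f g x rf rg; rewrite (avD hA _ rf rg) (avD hB _ rf rg); ring.
- by move=> K c f x rf; rewrite (avZ hA _ _ rf) (avZ hB _ _ rf); ring.
- by move=> f a x; rewrite (avT hA) (avT hB).
- by move=> c x; rewrite (avC hA) (avC hB); field.
- move=> K K' f g x rf rg h; rewrite ler_wpM2l ?invr_ge0 //.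
  by rewrite lerD // ?(avle hA rf rg) // (avle hB rf rg).
Qed.

Definition lineavg z f x : R := avg (fun s : R => f (x + s *: z)).

Lemma avop_lineavg z : avop (lineavg z) (enorm z).
Proof.
split => //.
- by move=> K K' f g x rf rg; apply: avgD; [exact: (Reg_line_cont rf)|exact: (Reg_line_cont rg)].
- by move=> K c f x rf; apply: avgZ; exact: (Reg_line_cont rf).
- by move=> f a x; congr avg; apply/funext => s; rewrite addrAC.
- by move=> c x; exact: avg_cst.
- move=> K K' f g x rf rg h; apply: avg_le; [exact: (Reg_line_cont rf)|exact: (Reg_line_cont rg)|].
  move=> s /andP[s0 s1]; apply: h; rewrite addrC addKr enormZ ger0_norm //.
  by rewrite ler_piMl.
Qed.

(** Fundamental theorem of calculus: the average over the segment from [x] to [x + z] has, along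
    [z], the plain increment [f (x + z) - f x] as derivative. *)
Lemma lineavg_derive K z f x t : Reg K f ->
  `|lineavg z f (x + t *: z) - lineavg z f x - t * (f (x + z) - f x)|
    <= K * enorm z ^+ 2 * t ^+ 2.
Proof.
move=> rf; have [K0 cf _] := rf; rewrite /lineavg.
have -> : (fun s : R => f (x + t *: z + s *: z)) = (fun s => f (x + (s + t) *: z)).
  by apply/funext => s; rewrite scalerDl -addrA (addrC (t *: z)).
apply: (avg_shift_le (f := fun s : R => f (x + s *: z))); first exact: (Reg_line_cont rf).
  by rewrite mulr_ge0 // exprn_ge0.
move=> s _; have := cf x (s *: z) z; rewrite /mixd enormZ scalerDl scale1r addrA.
rewrite (_ : _ * (_ * _) = K * enorm z ^+ 2 * `|s|); last by ring.
by congr (`|_| <= _); ring.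
Qed.

(** The average over the segment of direction [z] centred at [x]. The symmetry cancels the
    first-order term, so the distance to [f] is quadratic in [z]. *)
Definition clineavg z f x : R :=
  2^-1 * (lineavg (2^-1 *: z) f x + lineavg (- (2^-1 *: z)) f x).

Lemma avop_clineavg z : avop (clineavg z) (enorm z).
Proof.
apply: (@avopW _ (enorm (2^-1 *: z))).
  by rewrite enormZ ger0_norm ?invr_ge0 // ler_piMl // invf_le1 // ler1n.
apply: avop_half; first exact: avop_lineavg.
by rewrite -(enormN (2^-1 *: z)); exact: avop_lineavg.
Qed.

Lemma clineavg_derive K z f x t : Reg K f ->
  `|clineavg z f (x + t *: z) - clineavg z f x
     - t * (f (x + 2^-1 *: z) - f (x - 2^-1 *: z))| <= K * enorm z ^+ 2 * t ^+ 2.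
Proof.
move=> rf; have := lineavg_derive (2^-1 *: z) x (2 * t) rf.
have := lineavg_derive (- (2^-1 *: z)) x (- (2 * t)) rf.
rewrite enormN enormZ !scalerN scaleNr opprK !scalerA.
rewrite mulrAC divff ?pnatr_eq0 // mul1r [`|2^-1|]ger0_norm ?invr_ge0 //.
rewrite (_ : K * (2^-1 * enorm z) ^+ 2 * (- (2 * t)) ^+ 2 = K * enorm z ^+ 2 * t ^+ 2); last by field.
rewrite (_ : K * (2^-1 * enorm z) ^+ 2 * (2 * t) ^+ 2 = K * enorm z ^+ 2 * t ^+ 2); last by field.
rewrite /clineavg; move: (K * enorm z ^+ 2 * t ^+ 2) => B.
set p := lineavg _ _ _; set p' := lineavg _ _ _; set q := lineavg _ _ _; set q' := lineavg _ _ _.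
rewrite !ler_norml => /andP[h1 h2] /andP[h3 h4]; apply/andP; split; lra.
Qed.

Lemma clineavg_near K z f x : Reg K f -> `|clineavg z f x - f x| <= K * enorm z ^+ 2.
Proof.
move=> rf; have [K0 cf _] := rf; rewrite /clineavg.
set w := 2^-1 *: z.
have c1 := Reg_line_cont (x := x) (z := w) rf; have c2 := Reg_line_cont (x := x) (z := - w) rf.
have -> : 2^-1 * (lineavg w f x + lineavg (- w) f x) =
  avg (fun s => 2^-1 * (f (x + s *: w) + f (x + s *: - w))).
  rewrite avgZ; last by move=> s; apply: cvgD; [exact: c1|exact: c2].
  by rewrite avgD.
have cc : continuous (fun s : R => 2^-1 * (f (x + s *: w) + f (x + s *: - w))).
  by move=> s; apply: cvgM; [exact: cvg_cst|apply: cvgD; [exact: c1|exact: c2]].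
have key (s : R) : 0 <= s <= 1 ->
   `|2^-1 * (f (x + s *: w) + f (x + s *: - w)) - f x| <= K * enorm z ^+ 2.
  move=> /andP[s0 s1]; have := cf (x - s *: w) (s *: w) (s *: w).
  rewrite /mixd subrK enormZ [`|s|]ger0_norm // scalerN /w enormZ [`|2^-1|]ger0_norm ?invr_ge0 //.
  have B0 : 0 <= K * enorm z ^+ 2 by rewrite mulr_ge0 // exprn_ge0.
  have -> : K * (s * (2^-1 * enorm z) * (s * (2^-1 * enorm z))) = (K * enorm z ^+ 2) * (s ^+ 2 / 4) by field.
  have s2 : s ^+ 2 <= 1 by rewrite exprn_ile1.
  move: B0; set B := K * enorm z ^+ 2 => B0.
  have : B * (s ^+ 2 / 4) <= B * 1 by rewrite ler_wpM2l //; lra.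
  rewrite mulr1 !ler_norml => h1 /andP[h2 h3]; apply/andP; split; lra.
have cst0 (c : R) : continuous (fun _ : R => c) by move=> s; exact: cvg_cst.
have := avg_le (cst0 (f x - K * enorm z ^+ 2)) cc.
have := avg_le cc (cst0 (f x + K * enorm z ^+ 2)).
rewrite !avg_cst => h1 h2; rewrite ler_norml; apply/andP; split.
  rewrite lerBrDr addrC; apply: h2 => s /key; rewrite ler_norml => /andP[]; lra.
rewrite lerBlDl; apply: h1 => s /key; rewrite ler_norml => /andP[]; lra.
Qed.

End Smoothing.

Lemma le_of_eq_norm (R : realType) (a b c : R) : a = b -> `|b| <= c -> `|a| <= c.
Proof. by move=> ->. Qed.

Lemma le_add_inv_nat (R : realType) (a b c : R) :
  (forall m : nat, a <= b + c / m.+1%:R) -> a <= b.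
Proof.
move=> h; apply/ler_addgt0Pr => e e0.
have [m hm] : exists m : nat, `|c| / e < m.+1%:R.
  exists (Num.truncn (`|c| / e)); exact: truncnS_gt.
apply: le_trans (h m) _; rewrite lerD2l ler_pdivrMr ?ltr0n //.
rewrite mulrC -ler_pdivrMr //; apply: le_trans (ltW hm).
by rewrite ler_pM2r ?invr_gt0 // ler_norm.
Qed.

(** * Second-order Taylor expansions and a mollifier with explicit derivatives *)

Section Jets.
Variables (R : realType) (n : nat).
Local Notation vec := 'rV[R]_n.
Local Notation mat := 'M[R]_n.
Local Notation e_ i := (delta_mx 0 i : vec).
Implicit Types (x y z a b w : vec) (f g : vec -> R) (K L r t c C : R).

Lemma sum_abs_le_enorm z : \sum_i `|z 0 i| <= n%:R * enorm z.
Proof.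
apply: (@le_trans _ _ (\sum_(i < n) enorm z)).
  by apply: ler_sum => i _; exact: coord_le_enorm.
by rewrite sumr_const card_ord mulr_natl.
Qed.

(** The increment along [z] is built one coordinate at a time; moving the base point of a coordinate
    step costs a mixed second difference, which [C11] bounds. *)
Lemma grad_of_coords K g (h : vec) x z : 0 <= K -> C11 K g ->
  (forall i t, `|g (x + t *: e_ i) - g x - t * h 0 i| <= K * t ^+ 2) ->
  `|g (x + z) - g x - dot h z| <= K * n%:R ^+ 2 * enorm z ^+ 2.
Proof.
move=> K0 cg hc.
suff main (l : seq 'I_n) :
    `|g (x + \sum_(i <- l) z 0 i *: e_ i) - g x - \sum_(i <- l) z 0 i * h 0 i|
    <= K * (\sum_(i <- l) `|z 0 i|) ^+ 2.
  have := main (index_enum _); rewrite -vec_sum_delta.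
  have -> : dot h z = \sum_i z 0 i * h 0 i by rewrite dotC.
  move=> /le_trans; apply; rewrite -mulrA ler_wpM2l // -exprMn.
  rewrite ler_pXn2r // ?nnegrE ?sumr_ge0 // ?mulr_ge0 //; exact: sum_abs_le_enorm.
elim: l => [|i l IH]; first by rewrite !big_nil addr0 !subrr normr0 expr0n mulr0.
rewrite !big_cons; set S := \sum_(_ <- l) _ in IH *; set T := \sum_(_ <- l) _ in IH *.
set Q := \sum_(_ <- l) _ in IH *.
have SQ : enorm S <= Q.
  rewrite /S /Q; elim/big_rec2: _ => [|j u v _ huv]; first by rewrite enorm0.
  by apply: le_trans (enormD _ _) _; rewrite lerD // enormZ enorm_delta mulr1.
have := cg x S (z 0 i *: e_ i); rewrite /mixd enormZ enorm_delta mulr1 => h1.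
have h2 := hc i (z 0 i).
have -> : x + (z 0 i *: e_ i + S) = x + S + z 0 i *: e_ i by rewrite [_ + S]addrC addrA.
have h3 : K * (enorm S * `|z 0 i|) <= K * (Q * `|z 0 i|) by rewrite ler_wpM2l // ler_wpM2r.
have h5 : `|z 0 i| ^+ 2 = z 0 i ^+ 2 by rewrite real_normK ?num_real.
have Q0 : 0 <= Q by apply: le_trans SQ.
have h6 : 0 <= K * (Q * `|z 0 i|) by rewrite !mulr_ge0.
have -> : K * (`|z 0 i| + Q) ^+ 2 = K * z 0 i ^+ 2 + 2 * (K * (Q * `|z 0 i|)) + K * Q ^+ 2.
  by rewrite -h5; ring.
move: IH h1 h2; rewrite !ler_norml => /andP[a1 a2] /andP[b1 b2] /andP[c1 c2].
by apply/andP; split; lra.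
Qed.

(** The segment is cut into [m + 1] equal steps and the first-order expansions are summed. Their
    quadratic errors total [C1 |z|^2 / (m + 1)] and vanish in the limit, while the increments of the
    gradient add up to the quadratic term. *)
Lemma jet_integrate C1 C2 g (p : vec -> vec) (X : mat) x z : 0 <= C1 -> 0 <= C2 ->
  (forall y w, `|g (y + w) - g y - dot (p y) w| <= C1 * enorm w ^+ 2) ->
  (forall t w, `|dot (p (x + t *: w)) w - dot (p x) w - t * qf X w|
       <= C2 * enorm (t *: w) ^+ 2 * enorm w) ->
  `|g (x + z) - g x - dot (p x) z - 2^-1 * qf X z| <= C2 * enorm z ^+ 3.
Proof.
move=> C10 C20 h1 h2.
apply: (@le_add_inv_nat _ _ _ (C1 * enorm z ^+ 2 + `|2^-1 * qf X z|)) => m.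
pose M : R := m.+1%:R; have M0 : 0 < M by rewrite ltr0n.
have Mn0 : M != 0 by rewrite gt_eqF.
pose w := M^-1 *: z.
have ew : enorm w = enorm z / M by rewrite enormZ ger0_norm ?invr_ge0 ?ltW // mulrC.
have step (k : nat) : `|g (x + k%:R *: w) - g x - k%:R * dot (p x) w
     - (k%:R * (k%:R - 1) / 2) * qf X w|
     <= k%:R * (C1 * enorm w ^+ 2) + C2 * (k%:R * enorm w) ^+ 3.
  elim: k => [|k IH].
    rewrite scale0r addr0 subrr !mul0r !subr0 normr0 add0r expr0n /= mulr0.
    by rewrite lexx.
  have a1 := h1 (x + k%:R *: w) w.
  have a2 := h2 k%:R w.
  have -> : x + k.+1%:R *: w = x + k%:R *: w + w.
    by rewrite -natr1 scalerDl scale1r addrA.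
  rewrite enormZ (ger0_norm (ler0n R k)) in a2.
  have a3 : C2 * (k%:R * enorm w) ^+ 2 * enorm w + C2 * (k%:R * enorm w) ^+ 3
     <= C2 * (k.+1%:R * enorm w) ^+ 3.
    rewrite -mulrA -mulrDr ler_wpM2l // -(natr1 k).
    have k0 : 0 <= k%:R :> R by [].
    have e0 : 0 <= enorm w ^+ 3 by rewrite exprn_ge0.
    rewrite -subr_ge0.
    have -> : ((k%:R + 1) * enorm w) ^+ 3 - ((k%:R * enorm w) ^+ 2 * enorm w + (k%:R * enorm w) ^+ 3)
      = (2 * k%:R ^+ 2 + 3 * k%:R + 1) * enorm w ^+ 3 by ring.
    by rewrite mulr_ge0 // !addr_ge0 // mulr_ge0 // sqr_ge0.
  move: IH a1 a2; rewrite -(natr1 k) in a3 *; rewrite !ler_norml => /andP[i1 i2] /andP[b1 b2] /andP[c1 c2].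
  by apply/andP; split; lra.
have := step m.+1; rewrite -/M /w scalerA divff // scale1r dotZr qf_scale mulrA divff // mul1r.
rewrite -/w ew [M * (_ / _)]mulrC divfK // (_ : M * (C1 * (enorm z / M) ^+ 2) = C1 * enorm z ^+ 2 / M);
  last by field.
rewrite (_ : M * (M - 1) / 2 * ((M^-1) ^+ 2 * qf X z) = 2^-1 * qf X z - 2^-1 * qf X z / M); last by field.
move=> h; rewrite -/M mulrDl.
have q1 := ler_norm (2^-1 * qf X z); have q2 := ler_norm (- (2^-1 * qf X z)); rewrite normrN in q2.
have Mi0 : 0 <= M^-1 by rewrite invr_ge0 ltW.
have q3 := ler_wpM2r Mi0 q1; have q4 := ler_wpM2r Mi0 q2; rewrite mulNr in q4.
move: h; clearbody M; rewrite !ler_norml => /andP[k1 k2]; apply/andP; split; lra.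
Qed.

(** [C] stands for bounds on third derivatives in [sm_jet] and [sm_lip], and on fourth ones in
    [sm_d2]. The latter makes the average of the Hessian over a symmetric step differ from its
    central value by the square of the step. *)
Record smooth C g (p : vec -> vec) (X : vec -> mat) : Prop := Smooth {
  sm_C0 : 0 <= C;
  sm_sym : forall x, symmx (X x);
  sm_jet : forall x z,
    `|g (x + z) - g x - dot (p x) z - 2^-1 * qf (X x) z| <= C * enorm z ^+ 3;
  sm_lip : forall x z w,
    `|qf (X (x + z)) w - qf (X x) w| <= C * enorm z * enorm w ^+ 2;
  sm_d2 : forall x z w,
    `|qf (X (x + z)) w + qf (X (x - z)) w - 2 * qf (X x) w|
      <= C * enorm z ^+ 2 * enorm w ^+ 2 }.

Section Mollifier.
Variable s : R.
Hypothesis s0 : 0 < s.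

(** Convolution with a box kernel, one coordinate direction at a time. *)
Definition Ns (l : seq 'I_n) f : vec -> R := foldr (fun i g => clineavg (s *: e_ i) g) f l.

Definition dq i f x : R :=
  (f (x + 2^-1 *: (s *: e_ i)) - f (x - 2^-1 *: (s *: e_ i))) / s.

(** The [i]-th partial derivative of [Ns l f]: at the first occurrence of [i] the average becomes a
    difference quotient. The value 0 for an index absent from [l] is a default. *)
Fixpoint dN i (l : seq 'I_n) f : vec -> R :=
  if l is j :: l' then
    (if j == i then dq i (Ns l' f) else clineavg (s *: e_ j) (dN i l' f))
  else fun=> 0.

Lemma enorm_se i : enorm (s *: e_ i) = s.
Proof. by rewrite enormZ enorm_delta mulr1 gtr0_norm. Qed.

Lemma avop_Ns l : avop (Ns l) ((size l)%:R * s).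
Proof.
elim: l => [|i l IH]; first by rewrite mul0r; exact: avop_id.
have -> : (size (i :: l))%:R * s = enorm (s *: e_ i) + (size l)%:R * s.
  by rewrite enorm_se -natr1; ring.
exact: avop_comp (avop_clineavg _) IH.
Qed.

Lemma Ns_reg l K f : Reg K f -> Reg K (Ns l f).
Proof. exact: (av_reg (avop_Ns l)). Qed.

Lemma Ns_near l K f x : Reg K f -> `|Ns l f x - f x| <= (size l)%:R * K * s ^+ 2.
Proof.
move=> rf; elim: l => [|i l IH] /=; first by rewrite subrr normr0 !mul0r.
have := clineavg_near (s *: e_ i) x (Ns_reg l rf); rewrite enorm_se => h.
have -> : (size l).+1%:R * K * s ^+ 2 = K * s ^+ 2 + (size l)%:R * K * s ^+ 2 by rewrite -natr1; ring.
by apply: le_trans (lerD h IH); apply: le_trans (ler_normD _ _); rewrite addrA subrK.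
Qed.

Lemma dq_reg K i f : Reg K f -> Reg (2 * K / s) (dq i f).
Proof.
move=> rf; have := RegZ (s^-1) (RegB (RegT (2^-1 *: (s *: e_ i)) rf) (RegT (- (2^-1 *: (s *: e_ i))) rf)).
rewrite ger0_norm ?invr_ge0 ?ltW // (_ : s^-1 * (K + K) = 2 * K / s); last by ring.
by congr Reg; apply/funext => x; rewrite /dq mulrC.
Qed.

Lemma dN_reg K i l f : Reg K f -> Reg (2 * K / s) (dN i l f).
Proof.
move=> rf; have K0 := Reg_ge0 rf; elim: l => [|j l IH] /=.
  by apply: (RegW _ (Reg_cst n (0 : R))); rewrite divr_ge0 ?mulr_ge0 // ltW.
case: eqP => _; first exact/dq_reg/Ns_reg.
exact: (av_reg (avop_clineavg _) IH).
Qed.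

Lemma dN_lip K i l f x b : Reg K f -> `|dN i l f (x + b) - dN i l f x| <= K * enorm b.
Proof.
move=> rf; have K0 := Reg_ge0 rf; elim: l x => [|j l IH] x /=.
  by rewrite subrr normr0 mulr_ge0.
case: eqP => _.
  have [_ c _] := Ns_reg l rf.
  have := c (x - 2^-1 *: (s *: e_ i)) (s *: e_ i) b.
  rewrite enorm_se /mixd /dq -mulrBl normrM [`|s^-1|]ger0_norm ?invr_ge0 ?(ltW s0) //.
  have -> : x - 2^-1 *: (s *: e_ i) + s *: e_ i = x + 2^-1 *: (s *: e_ i).
    by rewrite -addrA -scaleNr -[X in _ + (_ + X)]scale1r -scalerDl; congr (_ + _ *: _); field.
  move=> h; rewrite ler_pdivrMr // -mulrA [_ * s]mulrC; apply: le_of_eq_norm h.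
  by rewrite !(addrAC x b); ring.
have rg := dN_reg i l rf.
rewrite -(avT (avop_clineavg _)) -(avB (avop_clineavg _) _ (RegT b rg) rg).
by apply: (av_bound (avop_clineavg _) (RegB (RegT b rg) rg)) => y _; exact: IH.
Qed.

Lemma Ns_derive K i l f x t : Reg K f -> i \in l ->
  `|Ns l f (x + t *: e_ i) - Ns l f x - t * dN i l f x| <= K * t ^+ 2.
Proof.
move=> rf; elim: l x => // j l IH x; rewrite inE /=.
case: (eqVneq j i) => [-> _|ji].
  have := clineavg_derive (s *: e_ i) x (t / s) (Ns_reg l rf).
  rewrite enorm_se scalerA divfK ?gt_eqF // (_ : K * s ^+ 2 * (t / s) ^+ 2 = K * t ^+ 2); last first.
    by field; rewrite gt_eqF.
  by apply: le_of_eq_norm; rewrite /dq; ring.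
move=> /= il.
have r1 := Ns_reg l rf; have r2 := dN_reg i l rf.
have hA := avop_clineavg (s *: e_ j).
rewrite -(avT hA) -(avB hA _ (RegT _ r1) r1) -(avZ hA _ _ r2).
rewrite -(avB hA _ (RegB (RegT _ r1) r1) (RegZ t r2)).
by apply: (av_bound hA (RegB (RegB (RegT _ r1) r1) (RegZ t r2))) => y _; exact: IH.
Qed.

Let E := index_enum 'I_n.

(** Two box convolutions in every direction make both derivatives explicit difference quotients, so
    the Hessian inherits bounds on its own second differences from those of [f]. *)
Definition moll f : vec -> R := Ns E (Ns E f).

Lemma size_E : size E = n.
Proof. by rewrite /E /index_enum -enumT size_enum_ord. Qed.

Lemma avop_moll : avop moll (2 * n%:R * s).
Proof.
have -> : 2 * n%:R * s = (size E)%:R * s + (size E)%:R * s by rewrite size_E; ring.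
exact: avop_comp (avop_Ns E) (avop_Ns E).
Qed.

Lemma moll_near K f x : Reg K f -> `|moll f x - f x| <= 2 * n%:R * K * s ^+ 2.
Proof.
move=> rf; have := Ns_near E x (Ns_reg E rf); have := Ns_near E x rf.
rewrite size_E => h1 h2; rewrite (_ : _ * s ^+ 2 = n%:R * K * s ^+ 2 + n%:R * K * s ^+ 2); last by ring.
by apply: le_trans (lerD h2 h1); apply: le_trans (ler_normD _ _); rewrite addrA subrK.
Qed.

Let H i j f := dN j E (dN i E f).

Definition moll_grad f x : vec := \row_i Ns E (dN i E f) x.
(** Symmetrised so that symmetry holds without exchanging the two differentiations; the quadratic
    form is unaffected. *)
Definition moll_hess f x : mat := \matrix_(i, j) (2^-1 * (H i j f x + H j i f x)).

Lemma qf_moll_hess f x w :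
  qf (moll_hess f x) w = \sum_i \sum_j H i j f x * (w 0 i * w 0 j).
Proof.
pose S := \sum_i \sum_j H i j f x * (w 0 i * w 0 j).
have S2 : \sum_i \sum_j H j i f x * (w 0 i * w 0 j) = S.
  by rewrite exchange_big; apply: eq_bigr => i _; apply: eq_bigr => j _; rewrite [w 0 j * _]mulrC.
rewrite qfE -/S; transitivity (2^-1 * (S + S)); last by field.
rewrite -{2}S2 /S -big_split mulr_sumr; apply: eq_bigr => i _ /=.
rewrite -big_split mulr_sumr; apply: eq_bigr => j _ /=.
by rewrite mxE; ring.
Qed.

Lemma quad_sum_le (h : 'I_n -> 'I_n -> R) w B : (forall i j, `|h i j| <= B) ->
  `|\sum_i \sum_j h i j * (w 0 i * w 0 j)| <= B * n%:R ^+ 2 * enorm w ^+ 2.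
Proof.
move=> hB; apply: le_trans (ler_norm_sum _ _ _) _.
apply: (@le_trans _ _ (\sum_(i < n) \sum_(j < n) B * enorm w ^+ 2)).
  apply: ler_sum => i _; apply: le_trans (ler_norm_sum _ _ _) _; apply: ler_sum => j _.
  by rewrite !normrM expr2 ler_pM ?mulr_ge0 // ler_pM // coord_le_enorm.
rewrite !sumr_const !card_ord -mulrnA -[X in X <= _]mulr_natr natrM.
by rewrite le_eqVlt; apply/orP; left; apply/eqP; ring.
Qed.

Lemma moll_smooth K f : Reg K f ->
  exists C, smooth C (moll f) (moll_grad f) (moll_hess f).
Proof.
move=> rf; have K0 := Reg_ge0 rf.
have iE i : i \in E by rewrite /E mem_index_enum.
(* Each difference quotient multiplies the second-difference constant by [2 / s]. *)
have [K1 K1E] : exists K1, K1 = 2 * K / s by eexists.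
have K10 : 0 <= K1 by rewrite K1E; apply: divr_ge0 (ltW s0); exact: mulr_ge0.
have [K2 K2E] : exists K2, K2 = 2 * K1 / s by eexists.
have K20 : 0 <= K2 by rewrite K2E; apply: divr_ge0 (ltW s0); exact: mulr_ge0.
have r1 i : Reg K1 (dN i E f) by rewrite K1E; exact: dN_reg.
have r2 i j : Reg K2 (H i j f) by rewrite K2E; exact: dN_reg.
have n0 : 0 <= n%:R :> R by [].
pose C1 := K * n%:R ^+ 2; pose C2 := K1 * n%:R ^+ 2 * n%:R.
have C20 : 0 <= C2 by rewrite /C2 !mulr_ge0 // ?exprn_ge0.
have g1 y w : `|moll f (y + w) - moll f y - dot (moll_grad f y) w| <= C1 * enorm w ^+ 2.
  apply: grad_of_coords => //; first by have [] := Ns_reg E (Ns_reg E rf).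
  move=> i t; rewrite mxE /moll.
  have hA := avop_Ns E; have q1 := Ns_reg E rf.
  rewrite -(avT hA) -(avB hA _ (RegT _ q1) q1) -(avZ hA _ _ (r1 i)).
  rewrite -(avB hA _ (RegB (RegT _ q1) q1) (RegZ t (r1 i))).
  apply: (av_bound hA (RegB (RegB (RegT _ q1) q1) (RegZ t (r1 i)))) => z _.
  exact: Ns_derive.
have g2 x t w : `|dot (moll_grad f (x + t *: w)) w - dot (moll_grad f x) w - t * qf (moll_hess f x) w|
    <= C2 * enorm (t *: w) ^+ 2 * enorm w.
  rewrite qf_moll_hess /dot -sumrB mulr_sumr -sumrB.
  apply: le_trans (ler_norm_sum _ _ _) _.
  apply: (@le_trans _ _ (\sum_i `|w 0 i| * (K1 * n%:R ^+ 2 * enorm (t *: w) ^+ 2))).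
    apply: ler_sum => i _; rewrite !mxE.
    have [_ c _] := Ns_reg E (r1 i).
    have := @grad_of_coords K1 (Ns E (dN i E f)) (\row_j H i j f x) x (t *: w) K10 c.
    move=> /(_ _) /(ler_wpM2l (normr_ge0 (w 0 i))) h.
    apply: le_trans (h _); last by move=> j u; rewrite mxE; exact: Ns_derive.
    rewrite -normrM le_eqVlt; apply/orP; left; apply/eqP; congr `|_|.
    rewrite mulrBr mulr_sumr /dot; congr (_ - _); first by ring.
    rewrite mulr_sumr; apply: eq_bigr => j _; rewrite !mxE; ring.
  rewrite -mulr_suml; apply: le_trans (ler_wpM2r _ (sum_abs_le_enorm w)) _.
    by rewrite !mulr_ge0 // ?exprn_ge0.
  by rewrite /C2 le_eqVlt; apply/orP; left; apply/eqP; ring.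
pose C := C2 + K1 * n%:R ^+ 2 + K2 * n%:R ^+ 2.
have a1 : 0 <= K1 * n%:R ^+ 2 by rewrite mulr_ge0 // ?exprn_ge0.
have a2 : 0 <= K2 * n%:R ^+ 2 by rewrite mulr_ge0 // ?exprn_ge0.
exists C; split.
- by rewrite !addr_ge0.
- by move=> x; apply/matrixP => i j; rewrite !mxE addrC.
- move=> x z; have := jet_integrate z _ C20 g1 (g2 x).
  move=> /(_ _)/le_trans; apply; first by rewrite mulr_ge0 // ?exprn_ge0.
  by rewrite ler_wpM2r ?exprn_ge0 // /C; lra.
- move=> x z w; rewrite !qf_moll_hess -sumrB.
  under eq_bigr do rewrite -sumrB.
  under eq_bigr do under eq_bigr do rewrite -mulrBl.
  have := @quad_sum_le (fun i j => H i j f (x + z) - H i j f x) w (K1 * enorm z).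
  move=> /(_ _)/le_trans; apply; first by move=> i j; exact: dN_lip.
  rewrite ler_wpM2r ?exprn_ge0 // mulrAC ler_wpM2r // /C; lra.
- move=> x z w; rewrite !qf_moll_hess.
  rewrite (_ : _ - _ = \sum_i \sum_j (H i j f (x + z) + H i j f (x - z) - 2 * H i j f x) * (w 0 i * w 0 j));
    last first.
    rewrite mulr_sumr -big_split -sumrB; apply: eq_bigr => i _ /=.
    by rewrite mulr_sumr -big_split -sumrB; apply: eq_bigr => j _ /=; ring.
  have := @quad_sum_le (fun i j => H i j f (x + z) + H i j f (x - z) - 2 * H i j f x) w (K2 * enorm z ^+ 2).
  move=> /(_ _)/le_trans; apply.
    move=> i j; have [_ c _] := r2 i j; have := c (x - z) z z.
    rewrite /mixd subrK -expr2; apply: le_of_eq_norm; ring.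
  rewrite ler_wpM2r ?exprn_ge0 // mulrAC ler_wpM2r ?exprn_ge0 // /C; lra.
Qed.

End Mollifier.
End Jets.

Lemma dot_sqD (R : realType) m (b w : 'rV[R]_m) (s : R) :
  dot (b + s *: w) (b + s *: w) = dot b b + 2 * s * dot b w + s ^+ 2 * dot w w.
Proof. by rewrite !(dotDl, dotDr, dotZl, dotZr) (dotC w b); ring. Qed.

(** * Positive semidefinite matrices, ellipticity, and the half-spaces that cut out [F >= 0] *)

Section Elliptic.
Variables (R : realType) (n : nat).
Local Notation vec := 'rV[R]_n.
Local Notation mat := 'M[R]_n.
Local Notation e_ i := (delta_mx 0 i : vec).
Implicit Types (x y z a b w v : vec) (X Y M N A : mat) (t c : R).

(** Cholesky elimination over the list of indices whose rows may be nonzero: a positive pivot is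
    removed by a rank-one term, and a zero pivot forces its whole row to vanish. *)
Lemma psd_decomp A : symmx A -> (forall z, 0 <= qf A z) ->
  exists l : seq vec, A = \sum_(a <- l) outer a a.
Proof.
move=> sA pA.
suff main (s : seq 'I_n) : forall A, symmx A -> (forall z, 0 <= qf A z) ->
    (forall i, i \notin s -> forall j, A i j = 0) -> exists l : seq vec, A = \sum_(a <- l) outer a a.
  by apply: (main (enum 'I_n)) => // i; rewrite mem_enum.
elim: s => [|i s IH] {sA pA}A sA pA hA.
  by exists [::]; rewrite big_nil; apply/matrixP => i j; rewrite hA // mxE.
have Aij j k : A j k = A k j by rewrite -{1}sA mxE.
have dotA j z : dot (e_ j *m A) z = \sum_k A j k * z 0 k.
  by apply: eq_bigr => k _; rewrite -rowE mxE.
have qd j : qf A (e_ j) = A j j by rewrite /qf dot_deltar -rowE mxE.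
have Aii0 : 0 <= A i i by rewrite -qd.
have [A0|A0] := eqVneq (A i i) 0.
  apply: IH => // k ks j.
  have [->|ki] := eqVneq k i; last by apply: hA; rewrite inE negb_or ki.
  apply/eqP; apply: contraT => Aij0.
  (* If the pivot is 0 and [A i j] is not, the form takes the value -1 at this vector. *)
  have := pA (e_ j + (- (A j j + 1) / (2 * A i j)) *: e_ i).
  rewrite qf_add // qf_scale !qd A0 mulr0 addr0 dotZr dot_deltar -rowE mxE (Aij j i).
  set q := A i j in Aij0 *.
  have -> : A j j + 2 * (- (A j j + 1) / (2 * q) * q) = -1 by field.
  by rewrite lerNr oppr0 ler10.
have Ap : 0 < A i i by rewrite lt_def A0.
pose a := (Num.sqrt (A i i))^-1 *: (e_ i *m A).
have aE z : dot a z ^+ 2 = dot (e_ i *m A) z ^+ 2 / A i i.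
  by rewrite dotZl exprMn exprVn sqr_sqrtr // mulrC.
have ac k : a 0 k = (Num.sqrt (A i i))^-1 * A i k by rewrite /a -rowE !mxE.
have sq : Num.sqrt (A i i) * Num.sqrt (A i i) = A i i by rewrite -expr2 sqr_sqrtr.
have sq0 : Num.sqrt (A i i) != 0 by rewrite gt_eqF // sqrtr_gt0.
have oE k j : outer a a k j = A i k * A i j / A i i.
  rewrite mxE big_ord1 mxE !ac -{3}sq; field; exact: sq0.
have [|||l lE] := IH (A - outer a a).
- by apply: symmxD => //; apply: symmxN; exact: symmx_outer.
- move=> z; rewrite qfB qf_outer -expr2 aE.
  set b := dot (e_ i *m A) z.
  have := pA (z + (- (b / A i i)) *: e_ i); rewrite qf_add // qf_scale qd dotZr.
  have -> : dot (z *m A) (e_ i) = b by rewrite /b dot_mulmx sA dotC.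
  by congr (0 <= _); field.
- move=> k ks j; rewrite mxE [X in _ + X]mxE oE.
  have [->|ki] := eqVneq k i; first by field.
  by rewrite (Aij i k) !(hA k) ?inE ?negb_or ?ki // !mul0r subr0.
by exists (a :: l); rewrite big_cons -lE addrC subrK.
Qed.

(** The operator norm is reduced to two consequences: the lower bound along one unit vector at a
    time, and the upper bound for multiples of the identity. *)
Record ell (F : mat -> R) (lam Lam : R) : Prop := Ell {
  el_n : (0 < n)%N;
  el_lam : 0 < lam;
  el_Lam : lam <= Lam;
  el_low : forall M N v, symmx M -> symmx N -> (forall z, 0 <= qf N z) ->
    enorm v = 1 -> F M + lam * qf N v <= F (M + N);
  el_up : forall M t, symmx M -> 0 <= t -> F (M + t%:M) <= F M + Lam * t;
  el_qc : quasiconcave F }.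

Section EllTheory.
Variables (F : mat -> R) (lam Lam : R).
Hypothesis hF : ell F lam Lam.

Lemma el_Lam0 : 0 < Lam. Proof. exact: lt_le_trans (el_lam hF) (el_Lam hF). Qed.

Lemma unit_vec_ex : exists v : vec, enorm v = 1.
Proof. by exists (e_ (Ordinal (el_n hF))); exact: enorm_delta. Qed.

Lemma el_mono M N : symmx M -> symmx N -> (forall z, 0 <= qf N z) -> F M <= F (M + N).
Proof.
move=> sM sN pN; have [v v1] := unit_vec_ex.
apply: le_trans (el_low hF sM sN pN v1).
by rewrite lerDl mulr_ge0 ?(ltW (el_lam hF)).
Qed.

Lemma el_down M t : symmx M -> 0 <= t -> F M - Lam * t <= F (M - t%:M).
Proof.
move=> sM t0; have sMt : symmx (M - t%:M) by apply: symmxD => //; apply: symmxN; exact: symmxM.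
by have := el_up hF sMt t0; rewrite subrK lerBlDr.
Qed.

Lemma el_upI M t : symmx M -> 0 <= t -> F M + lam * t <= F (M + t%:M).
Proof.
move=> sM t0; have [v v1] := unit_vec_ex.
have := el_low hF sM (symmxM n t) _ v1.
rewrite qfM -enorm2 v1 expr1n mulr1; apply => z.
by rewrite qfM mulr_ge0.
Qed.

Lemma qf_mabs X z : qf X z <= mabs X * dot z z.
Proof. exact: le_trans (ler_norm _) (qf_le _ _). Qed.

Lemma el_lip M N : symmx M -> symmx N -> F M - Lam * mabs (M - N) <= F N.
Proof.
move=> sM sN; have sD : symmx (M - N) by apply: symmxD => //; exact: symmxN.
have h : F M <= F (N + (mabs (M - N))%:M).
  have -> : N + (mabs (M - N))%:M = M + ((mabs (M - N))%:M - (M - N)).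
    by rewrite opprB [RHS]addrCA [M + (N - M)]addrC subrK addrC.
  apply: el_mono => //; first by apply: symmxD; [exact: symmxM|exact: symmxN].
  by move=> z; rewrite qfB qfM subr_ge0 qf_mabs.
rewrite lerBlDr; apply: le_trans h _; exact: (el_up hF sN (mabs_ge0 _)).
Qed.

Lemma el_conv X Y s t : symmx X -> symmx Y -> 0 <= F X -> 0 <= F Y ->
  0 <= s -> 0 <= t -> s + t = 1 -> 0 <= F (s *: X + t *: Y).
Proof.
move=> sX sY FX FY s0 t0 st.
have -> : t = 1 - s by lra.
apply: le_trans (el_qc hF sX sY _); first by rewrite le_min FX.
by rewrite s0 /=; lra.
Qed.

Lemma dot_mxvec A X : dot (mxvec A) (mxvec X) = \sum_i \sum_j A i j * X i j.
Proof.
rewrite /dot (reindex _ (curry_mxvec_bij n n)) /=.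
rewrite pair_bigA /=; apply: eq_bigr => -[i j] _ /=; by rewrite !mxvecE.
Qed.

Lemma dot_mxvec_outer a X : dot (mxvec (outer a a)) (mxvec X) = qf X a.
Proof.
rewrite dot_mxvec qfE; apply: eq_bigr => i _; apply: eq_bigr => j _.
by rewrite mxE big_ord1 mxE mulrC.
Qed.

(* The separating functional is the vector from [X0] to its nearest point in the
   convex set [F >= 0]; monotonicity of [F] makes it positive semidefinite. *)
Lemma separation X0 : symmx X0 -> F X0 < 0 ->
  exists (l : seq vec) (c : R), \sum_(a <- l) qf X0 a < c /\
    forall X, symmx X -> 0 <= F X -> c <= \sum_(a <- l) qf X a.
Proof.
move=> sX0 F0.
pose x0 := mxvec X0.
(* [X0 + t0 I] lies in [F >= 0] by the lower ellipticity bound; it confines the search for the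
   nearest point to a bounded set. *)
pose t0 := - F X0 / lam.
have t00 : 0 <= t0 by rewrite /t0 divr_ge0 ?(ltW (el_lam hF)) // oppr_ge0 ltW.
have Y0 : 0 <= F (X0 + t0%:M).
  apply: le_trans (el_upI sX0 t00); rewrite /t0 [lam * _]mulrC divfK ?subrr //.
  by rewrite gt_eqF // (el_lam hF).
pose y0 := mxvec (X0 + t0%:M); pose D := enorm (y0 - x0).
pose A : set 'rV[R]_(n * n) := [set v | [/\ symmx (vec_mx v), 0 <= F (vec_mx v) & enorm (v - x0) <= D]].
have ec (v : 'rV[R]_(n * n)) i j : `|vec_mx v i j| <= enorm v.
  by rewrite mxE; exact: coord_le_enorm.
have emabs (v : 'rV[R]_(n * n)) : mabs (vec_mx v) <= (n * n)%:R * enorm v.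
  apply: (@le_trans _ _ (\sum_(i < n) \sum_(j < n) enorm v)).
    by apply: ler_sum => i _; apply: ler_sum => j _; exact: ec.
  by rewrite !sumr_const !card_ord -mulrnA -[X in X <= _]mulr_natl.
have [||||vs [sv Fv Dv] hv] := @compact_min R (n * n) A (fun v : 'rV[R]_(n * n) => enorm (v - x0)) (D + enorm x0).
- exists y0; rewrite /A /= /y0 mxvecK; split => //.
  by apply: symmxD => //; exact: symmxM.
- by move=> x [_ _ h]; rewrite -[x](subrK x0); apply: le_trans (enormD _ _) _; rewrite lerD2r.
- move=> x hx.
  have sx : symmx (vec_mx x).
    apply/matrixP => i j; rewrite mxE; apply/eqP; rewrite -subr_eq0 -normr_le0.
    apply/ler_addgt0Pr => e e0; rewrite add0r.
    have [y [sy _ _] yx] := hx (e / 2) (divr_gt0 e0 (ltr0n _ 2)).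
    have h1 := ec (y - x) j i; have h2 := ec (y - x) i j.
    rewrite linearB /= !mxE in h1 h2.
    have h3 : vec_mx y i j = vec_mx y j i by rewrite -{1}sy mxE.
    move: h1 h2 yx; rewrite !mxE in h3 *; move: (enorm _) => E.
    rewrite !ler_norml => /andP[? ?] /andP[? ?] ?; apply/andP; split; lra.
  split => //.
    apply/ler_addgt0Pr => e e0.
    pose e' := e / (Lam * (n * n)%:R + 1).
    have p0 : 0 < Lam * (n * n)%:R + 1 by rewrite ltr_wpDl // mulr_ge0 // ltW // el_Lam0.
    have [y [sy Fy _] yx] := hx e' (divr_gt0 e0 p0).
    have := el_lip sy sx; rewrite -linearB /= => h.
    have h2 : Lam * mabs (vec_mx (y - x)) <= e.
      apply: (@le_trans _ _ (Lam * ((n * n)%:R * e'))).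
        rewrite ler_wpM2l ?(ltW el_Lam0) //; apply: le_trans (emabs _) _.
        by rewrite ler_wpM2l // ltW.
      rewrite mulrA /e' mulrA ler_pdivrMr // mulrC ler_pM2l //; lra.
    lra.
  apply/ler_addgt0Pr => e e0; have [y [_ _ yD] yx] := hx e e0.
  by apply: le_trans (enorm_tri _ y _) _; rewrite enormB addrC lerD // ltW.
- move=> x e Ax e0; exists e => // y Ay yx; apply: le_lt_trans yx.
  rewrite ler_norml; have := enorm_tri x y x0; have := enorm_tri y x x0; rewrite (enormB x y).
  by move=> ? ?; apply/andP; split; lra.
have hmin X : symmx X -> 0 <= F X -> enorm (vs - x0) <= enorm (mxvec X - x0).
  move=> sX FX; have [le|gt] := leP (enorm (mxvec X - x0)) D.
    by apply: hv; split; rewrite ?mxvecK.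
  by apply: le_trans Dv (ltW gt).
pose B := vs - x0.
(* Variational inequality of the nearest point: move from it towards [X] by the fraction
   [1 / (m + 1)] and let [m] grow. *)
have var X : symmx X -> 0 <= F X -> 0 <= dot B (mxvec X - vs).
  move=> sX FX; set W := mxvec X - vs.
  suff : 0 <= 2 * dot B W by rewrite pmulr_rge0.
  apply: (@le_add_inv_nat _ _ _ (dot W W)) => m.
  pose s : R := m.+1%:R^-1; have s0 : 0 < s by rewrite invr_gt0 ltr0n.
  have s1 : s <= 1 by rewrite invf_le1 ?ltr0n // ler1n.
  have sZ : symmx (s *: X + (1 - s) *: vec_mx vs) by apply: symmxD; exact: symmxZ.
  have := hmin _ sZ (el_conv sX sv FX Fv (ltW s0) _ _).
  rewrite subr_ge0 addrC subrK => /(_ s1 erefl).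
  have -> : mxvec (s *: X + (1 - s) *: vec_mx vs) - x0 = B + s *: W.
    rewrite linearD !linearZ /= vec_mxK /B /W scalerBr scalerBl scale1r.
    by move: (x0) (mxvec X) => q mX; apply/rowP => k; rewrite !mxE; ring.
  rewrite -(ler_pXn2r (n := 2)) ?nnegrE // !enorm2.
  rewrite dot_sqD -/B => h.
  have : 0 <= s * (2 * dot B W + dot W W * s) by lra.
  by rewrite pmulr_rge0.
have sB : symmx (vec_mx B).
  by rewrite /B linearB /=; apply: symmxD => //; apply: symmxN; rewrite mxvecK.
have pB z : 0 <= qf (vec_mx B) z.
  have sN := symmx_outer z.
  have := var (vec_mx vs + outer z z) (symmxD sv sN) _.
  rewrite linearD /= vec_mxK (addrC vs) addrK -[X in dot X _](vec_mxK B) dotC dot_mxvec_outer.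
  apply; apply: le_trans Fv (el_mono sv sN _) => w.
  by rewrite qf_outer -expr2 sqr_ge0.
have [l lE] := psd_decomp sB pB.
have lin X : \sum_(a <- l) qf X a = dot B (mxvec X).
  rewrite -[B]vec_mxK lE linear_sum dot_suml; apply: eq_bigr => a _.
  by rewrite dot_mxvec_outer.
exists l, (dot B vs); split.
  rewrite lin -/x0 -subr_gt0 -dotBr -/B.
  rewrite lt_def dot_ge0 andbT; apply/eqP => B0.
  have : vs = x0.
    apply/eqP; rewrite -subr_eq0 -enorm_eq0 -/B; apply/eqP.
    by apply/eqP; rewrite -sqrf_eq0 enorm2 B0.
  by move=> vx; move: Fv; rewrite vx mxvecK leNgt F0.
by move=> X sX FX; rewrite lin -subr_ge0 -dotBr; exact: var.
Qed.

End EllTheory.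
End Elliptic.

(** * Viscosity solutions, and random walks along finitely many directions *)

Section Viscosity.
Variables (R : realType) (n : nat).
Local Notation vec := 'rV[R]_n.
Local Notation mat := 'M[R]_n.
Implicit Types (x y z a b w v : vec) (f g u : vec -> R) (K t c C M d : R).

(* Test functions have a cubic error term instead of [o(|z|^2)]: all those that
   occur below are of this form, and they are C^2 perturbations of quadratics. *)
Definition touch_above u x0 (X : mat) : Prop :=
  exists p C d, 0 < d /\ forall z, enorm z < d ->
    u (x0 + z) <= u x0 + dot p z + 2^-1 * qf X z + C * enorm z ^+ 3.

Definition touch_below u x0 (X : mat) : Prop :=
  exists p C d, 0 < d /\ forall z, enorm z < d ->
    u x0 + dot p z + 2^-1 * qf X z - C * enorm z ^+ 3 <= u (x0 + z).

Definition subsol (F : mat -> R) (U : set vec) u : Prop :=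
  forall x0 X, U x0 -> symmx X -> touch_above u x0 X -> 0 <= F X.

Definition supersol (F : mat -> R) (U : set vec) u : Prop :=
  forall x0 X, U x0 -> symmx X -> touch_below u x0 X -> F X <= 0.

Section Walk.
Variables (l : seq vec) (r : R).
Hypothesis r0 : 0 <= r.
Let m : R := (size l)%:R.
Hypothesis l0 : (0 < size l)%N.

Let m0 : 0 < m. Proof. by rewrite ltr0n. Qed.
Let m1 : 1 <= m. Proof. by rewrite ler1n. Qed.

Definition walk f x : R := (2 * m)^-1 * \sum_(a <- l) (f (x + r *: a) + f (x - r *: a)).

(** The generator of the walk: a step of size [r] changes a smooth function by [r^2] times [ellf] of
    its Hessian, to leading order. For [l] from [separation] it is, up to the factor, the functional
    that defines a half-space containing [F >= 0]. *)
Definition ellf (X : mat) : R := (2 * m)^-1 * \sum_(a <- l) qf X a.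

Let B1 : R := \sum_(a <- l) enorm a.
Let B2 : R := \sum_(a <- l) enorm a ^+ 2.
Let B3 : R := \sum_(a <- l) enorm a ^+ 3.

Lemma walk_le f g x : (forall y, f y <= g y) -> walk f x <= walk g x.
Proof.
move=> h; rewrite ler_wpM2l ?invr_ge0 ?mulr_ge0 ?(ltW m0) //.
by apply: ler_sum => a _; rewrite lerD.
Qed.

Lemma walkD f g x : walk (fun y => f y + g y) x = walk f x + walk g x.
Proof.
rewrite /walk -mulrDr -big_split; congr (_ * _); apply: eq_bigr => a _ /=; ring.
Qed.

Lemma walkZ c f x : walk (fun y => c * f y) x = c * walk f x.
Proof.
rewrite /walk [RHS]mulrCA; congr (_ * _); rewrite mulr_sumr; apply: eq_bigr => a _; ring.
Qed.

Lemma walkC c x : walk (fun=> c) x = c.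
Proof.
rewrite /walk big_const_seq count_predT iter_addr addr0 -[_ *+ size l]mulr_natr -/m.
by field; rewrite gt_eqF.
Qed.

Lemma walkE f x : walk f x = f x + (2 * m)^-1 * \sum_(a <- l) (f (x + r *: a) + f (x - r *: a) - 2 * f x).
Proof.
rewrite sumrB.
have -> : \sum_(a <- l) 2 * f x = 2 * m * f x.
  by rewrite big_const_seq count_predT iter_addr addr0 -[_ *+ size l]mulr_natr -/m; ring.
rewrite mulrBr -/(walk f x); have -> : (2 * m)^-1 * (2 * m * f x) = f x by field; rewrite gt_eqF.
ring.
Qed.

Lemma avop_walk : avop walk (r * B1).
Proof.
have B1le a : a \in l -> enorm (r *: a) <= r * B1.
  move=> al; rewrite enormZ (ger0_norm r0) ler_wpM2l // /B1.
  by rewrite (big_rem a) //= lerDl sumr_ge0.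
split.
- by rewrite mulr_ge0 // sumr_ge0.
- by move=> K K' f g x _ _; exact: walkD.
- by move=> K c f x _; exact: walkZ.
- move=> f a x; rewrite /walk; congr (_ * _); apply: eq_bigr => b _.
  by rewrite !(addrAC _ a).
- exact: walkC.
- move=> K K' f g x _ _ h; rewrite ler_wpM2l ?invr_ge0 ?mulr_ge0 ?(ltW m0) //.
  rewrite !big_seq; apply: ler_sum => a al.
  rewrite lerD // h // addrAC subrr add0r ?enormN; exact: B1le.
Qed.

Lemma walk_avop_comm A ro K f x : avop A ro -> Reg K f -> A (walk f) x = walk (A f) x.
Proof.
move=> hA rf; rewrite /walk.
have rs (s : seq vec) : exists K', Reg K' (fun y => \sum_(a <- s) (f (y + r *: a) + f (y - r *: a)))
    /\ A (fun y => \sum_(a <- s) (f (y + r *: a) + f (y - r *: a))) x =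
       \sum_(a <- s) (A f (x + r *: a) + A f (x - r *: a)).
  elim: s => [|a s [K' [r' e']]].
    exists 0; rewrite big_nil.
    have -> : (fun y => \sum_(a <- [::]) (f (y + r *: a) + f (y - r *: a))) = (fun=> 0).
      by apply/funext => y; rewrite big_nil.
    by split; [exact: Reg_cst|exact: avC hA _ _].
  have r1 := RegT (r *: a) rf; have r2 := RegT (- (r *: a)) rf.
  have -> : (fun y => \sum_(b <- a :: s) (f (y + r *: b) + f (y - r *: b))) =
    (fun y => (f (y + r *: a) + f (y - r *: a)) + \sum_(b <- s) (f (y + r *: b) + f (y - r *: b))).
    by apply/funext => y; rewrite big_cons.
  exists (K + K + K'); split; first exact: RegD (RegD r1 r2) r'.
  by rewrite big_cons -e' (avD hA _ (RegD r1 r2) r') (avD hA _ r1 r2) !(avT hA).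
have [K' [r' e']] := rs l; by rewrite (avZ hA _ _ r') e'.
Qed.

Lemma walk_reg K f : Reg K f -> Reg K (walk f).
Proof. exact: (av_reg avop_walk). Qed.

Lemma iter_walk_reg K f k : Reg K f -> Reg K (iter k walk f).
Proof. by move=> rf; elim: k => //= k; exact: walk_reg. Qed.

Lemma iter_walk_comm A ro K f k x : avop A ro -> Reg K f ->
  A (iter k walk f) x = iter k walk (A f) x.
Proof.
move=> hA rf; elim: k x => //= k IH x.
rewrite (walk_avop_comm _ hA (iter_walk_reg k rf)); congr walk; exact/funext.
Qed.

Lemma iter_walk_le k f g x : (forall y, f y <= g y) -> iter k walk f x <= iter k walk g x.
Proof. by move=> h; elim: k x => //= k IH x; exact: walk_le. Qed.

Lemma iter_walk_addC k f c x : iter k walk (fun y => f y + c) x = iter k walk f x + c.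
Proof.
elim: k x => //= k IH x; rewrite -[in RHS](walkC c x) -walkD; congr walk.
exact/funext.
Qed.

Let B20 : 0 <= B2. Proof. by apply: sumr_ge0 => a _; rewrite exprn_ge0. Qed.
Let B30 : 0 <= B3. Proof. by apply: sumr_ge0 => a _; rewrite exprn_ge0. Qed.
Let B10 : 0 <= B1. Proof. by apply: sumr_ge0 => a _. Qed.

Lemma walk_sum_le (h k : vec -> R) : (forall a, a \in l -> `|h a| <= k a) ->
  `|(2 * m)^-1 * \sum_(a <- l) h a| <= \sum_(a <- l) k a.
Proof.
move=> hk; rewrite normrM ger0_norm ?invr_ge0 ?mulr_ge0 ?(ltW m0) //.
have S : `|\sum_(a <- l) h a| <= \sum_(a <- l) k a.
  apply: le_trans (ler_norm_sum _ _ _) _; rewrite !big_seq; exact: ler_sum.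
apply: le_trans S; rewrite ler_piMl // invf_le1 ?mulr_gt0 ?m0 //.
have := m1; lra.
Qed.

Lemma walk_near K f x : Reg K f -> `|walk f x - f x| <= K * r ^+ 2 * B2.
Proof.
move=> [K0 cf _]; rewrite walkE addrC addKr /B2 mulr_sumr; apply: walk_sum_le => a _.
have := cf (x - r *: a) (r *: a) (r *: a); rewrite /mixd subrK enormZ (ger0_norm r0).
rewrite (_ : K * _ = K * r ^+ 2 * enorm a ^+ 2); last by ring.
by apply: le_of_eq_norm; ring.
Qed.

Lemma iter_walk_near K f k x : Reg K f -> `|iter k walk f x - f x| <= k%:R * (K * r ^+ 2 * B2).
Proof.
move=> rf; elim: k => [|k IH] /=; first by rewrite subrr normr0 mul0r.
have := walk_near x (iter_walk_reg k rf); move: IH; rewrite -(natr1 k).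
by rewrite !ler_norml => /andP[? ?] /andP[? ?]; apply/andP; split; lra.
Qed.

Lemma walk_smooth_near C g p X x : smooth C g p X ->
  `|walk g x - g x - r ^+ 2 * ellf (X x)| <= 2 * C * r ^+ 3 * B3.
Proof.
move=> sg; rewrite walkE /ellf mulrCA.
have -> : forall q, g x + (2 * m)^-1 * q - g x = (2 * m)^-1 * q by move=> q; ring.
rewrite -mulrBr mulr_sumr -sumrB /B3 mulr_sumr; apply: walk_sum_le => a _.
have := sm_jet sg x (r *: a); have := sm_jet sg x (- (r *: a)).
rewrite enormN dotNr qf_opp qf_scale enormZ (ger0_norm r0) exprMn.
rewrite !ler_norml => /andP[? ?] /andP[? ?]; apply/andP; split; lra.
Qed.

(** A walk step averages jets, so [C] does not grow and any number of steps can be taken; only the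
    value of [ellf] moves, by a multiple of [r]. *)
Lemma walk_smooth C g p X : smooth C g p X ->
  exists p' X', smooth C (walk g) p' X' /\
    (forall x, `|ellf (X' x) - ellf (X x)| <= C * r * B1 * B2).
Proof.
move=> sg; have C0 := sm_C0 sg.
pose p' x := (2 * m)^-1 *: \sum_(a <- l) (p (x + r *: a) + p (x - r *: a)).
pose X' x := (2 * m)^-1 *: \sum_(a <- l) (X (x + r *: a) + X (x - r *: a)).
have dp x z : dot (p' x) z = walk (fun y => dot (p y) z) x.
  by rewrite dotZl dot_suml; congr (_ * _); apply: eq_bigr => a _; rewrite dotDl.
have qX x z : qf (X' x) z = walk (fun y => qf (X y) z) x.
  by rewrite qfZ qf_sumX; congr (_ * _); apply: eq_bigr => a _; rewrite qfD.
have wle (h : vec -> R) x c : (forall y, `|h y| <= c) -> `|walk h x| <= c.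
  move=> hc; rewrite ler_norml -{1}(walkC (- c) x) -{2}(walkC c x).
  by rewrite !walk_le // => y; have := hc y; rewrite ler_norml => /andP[].
have wT h x z : walk h (x + z) = walk (fun y => h (y + z)) x.
  by rewrite (avT avop_walk).
have wN h x : - walk h x = walk (fun y => - h y) x.
  by rewrite -mulN1r -walkZ; congr walk; apply/funext => y; rewrite mulN1r.
exists p', X'; split.
  split => //.
  - move=> x; apply: symmxZ; apply: symmx_sum => a _.
    by apply: symmxD; exact: (sm_sym sg).
  - move=> x z; rewrite dp qX wT -walkZ !wN -!walkD; apply: wle => y.
    exact: (sm_jet sg).
  - move=> x z w; rewrite !qX wT wN -walkD; apply: wle => y; exact: (sm_lip sg).
  - move=> x z w; rewrite !qX !wT -walkZ wN -!walkD; apply: wle => y; exact: (sm_d2 sg).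
move=> x; rewrite /ellf -mulrBr -sumrB /B2 mulr_sumr; apply: walk_sum_le => a al.
rewrite qX -[qf (X x) a](walkC _ x) wN -walkD /walk -[X in _ <= X]mul1r.
rewrite normrM ger0_norm ?invr_ge0 ?mulr_ge0 ?(ltW m0) //.
apply: (@le_trans _ _ ((2 * m)^-1 * \sum_(b <- l) (2 * (C * r * B1 * enorm a ^+ 2)))).
  rewrite ler_wpM2l ?invr_ge0 ?mulr_ge0 ?(ltW m0) //.
  apply: le_trans (ler_norm_sum _ _ _) _; rewrite !big_seq; apply: ler_sum => b bl.
  have := sm_lip sg x (r *: b) a; have := sm_lip sg x (- (r *: b)) a.
  rewrite enormN enormZ (ger0_norm r0).
  have bB : enorm b <= B1 by rewrite /B1 (big_rem b) //= lerDl sumr_ge0.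
  have h : C * (r * enorm b) * enorm a ^+ 2 <= C * r * B1 * enorm a ^+ 2.
    by rewrite ler_wpM2r ?exprn_ge0 // mulrA ler_wpM2l // mulr_ge0.
  by rewrite !ler_norml => /andP[? ?] /andP[? ?]; apply/andP; split; lra.
rewrite big_const_seq count_predT iter_addr addr0 -[_ *+ size l]mulr_natr -/m.
by rewrite le_eqVlt; apply/orP; left; apply/eqP; field; rewrite gt_eqF.
Qed.

Lemma iter_walk_smooth C g p X k : smooth C g p X ->
  exists p' X', smooth C (iter k walk g) p' X'.
Proof.
move=> sg; elim: k => [|k [p' [X' s']]] /=; first by exists p, X.
by have [p2 [X2 [s2 _]]] := walk_smooth s'; exists p2, X2.
Qed.

(** Discrete heat flow over the time [k r^2]. Each step adds [r^2] times an [ellf] already averaged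
    by the other steps; by [sm_d2] every averaging costs a multiple of [r^2], whence the term in
    [k^2 r^4]. *)
Lemma iter_walk_smooth_le C g p X k x : smooth C g p X ->
  iter k walk g x <= g x + k%:R * (r ^+ 2 * ellf (X x) + 2 * C * r ^+ 3 * B3)
    + k%:R ^+ 2 * (C * r ^+ 4 * B2 * B2).
Proof.
move=> sg; have C0 := sm_C0 sg; elim: k x => [|k IH] x /=.
  by rewrite mul0r expr0n /= mul0r !addr0.
pose c1 := 2 * C * r ^+ 3 * B3; pose c2 := C * r ^+ 4 * B2 * B2.
have c20 : 0 <= c2 by rewrite /c2 !mulr_ge0 // exprn_ge0.
apply: (@le_trans _ _ (walk (fun y => g y + (k%:R * r ^+ 2) * ellf (X y) + (k%:R * c1 + k%:R ^+ 2 * c2)) x)).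
  by apply: walk_le => y; apply: le_trans (IH y) _; rewrite -/c1 -/c2; lra.
rewrite walkD walkC walkD walkZ.
have h1 : walk g x <= g x + r ^+ 2 * ellf (X x) + c1.
  by have := walk_smooth_near x sg; rewrite -/c1 ler_norml => /andP[]; lra.
have h2 : walk (fun y => ellf (X y)) x <= ellf (X x) + C * r ^+ 2 * B2 * B2.
  have := walkE (fun y => ellf (X y)) x => ->; rewrite lerD2l.
  apply: le_trans (ler_norm _) _.
  have -> : C * r ^+ 2 * B2 * B2 = \sum_(a <- l) C * r ^+ 2 * B2 * enorm a ^+ 2.
    by rewrite -mulr_sumr.
  apply: walk_sum_le => a _.
  have -> : C * r ^+ 2 * B2 * enorm a ^+ 2 = \sum_(b <- l) C * r ^+ 2 * enorm a ^+ 2 * enorm b ^+ 2.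
    by rewrite -mulr_sumr -/B2; ring.
  have -> : ellf (X (x + r *: a)) + ellf (X (x - r *: a)) - 2 * ellf (X x) =
     (2 * m)^-1 * \sum_(b <- l) (qf (X (x + r *: a)) b + qf (X (x - r *: a)) b - 2 * qf (X x) b).
    by rewrite /ellf sumrB big_split -mulr_sumr /=; ring.
  apply: walk_sum_le => b _.
  have := sm_d2 sg x (r *: a) b; rewrite enormZ (ger0_norm r0) exprMn.
  by rewrite [C * (_ ^+ 2 * _)]mulrA.
have kr : 0 <= k%:R * r ^+ 2 :> R by rewrite mulr_ge0 // exprn_ge0.
have h3 := ler_wpM2l kr h2.
have -> : k.+1%:R ^+ 2 = k%:R ^+ 2 + 2 * k%:R + 1 :> R by rewrite -(natr1 k); ring.
rewrite -(natr1 k) -/c1 -/c2.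
have e2 : k%:R * r ^+ 2 * (ellf (X x) + C * r ^+ 2 * B2 * B2) = k%:R * r ^+ 2 * ellf (X x) + k%:R * c2.
  by rewrite /c2; ring.
have k0 : 0 <= k%:R * c2 by rewrite mulr_ge0.
rewrite e2 in h3; lra.
Qed.

End Walk.
End Viscosity.

(** * From viscosity inequalities to classical ones for averages *)

Section Mollification.
Variables (R : realType) (n : nat).
Local Notation vec := 'rV[R]_n.
Local Notation mat := 'M[R]_n.
Implicit Types (x y z a b w v : vec) (f g u : vec -> R) (K t c C M d r : R).

Lemma Reg_lip_ball K f (c : vec) r : Reg K f -> 0 <= r ->
  exists2 L : R, 0 <= L & forall x y, enorm (x - c) <= r -> enorm (y - c) <= r ->
    `|f x - f y| <= L * enorm (x - y).
Proof.
move=> [K0 _ [L L0 lf]] r0; exists (L + K * (enorm c + r) + K * (2 * r)).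
  by rewrite !(addr_ge0, mulr_ge0).
move=> x y xc yc; have := lf y (x - y); rewrite subrKC => /le_trans; apply.
rewrite ler_wpM2r // lerD ?ler_wpM2l // ?lerD2l ?ler_wpM2l //.
  by rewrite -[y](subrK c) addrC; apply: le_trans (enormD _ _) _; rewrite lerD2l.
by apply: le_trans (enorm_tri _ c _) _; rewrite (enormB c); lra.
Qed.

Lemma Reg_max K f (c : vec) r : Reg K f -> 0 <= r ->
  exists2 x, enorm (x - c) <= r & forall y, enorm (y - c) <= r -> f y <= f x.
Proof.
move=> rf r0; have [L _ h] := Reg_lip_ball c rf r0; exact: cball_max h.
Qed.

Lemma Reg_qf (X : mat) : symmx X -> Reg (2 * mabs X) (qf X).
Proof.
move=> sX; have X0 := mabs_ge0 X; split; first by rewrite mulr_ge0.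
- move=> x a b; have -> : mixd (qf X) x a b = 2 * dot (a *m X) b.
    rewrite /mixd !qf_add // mulmxDl dotDl; ring.
  by rewrite normrM ger0_norm // -mulrA ler_wpM2l // bf_le.
exists 0 => // x z; rewrite qf_add // add0r -mulrDr -!mulrA.
have -> : qf X x + qf X z + 2 * dot (x *m X) z - qf X x = qf X z + 2 * dot (x *m X) z by ring.
apply: le_trans (ler_normD _ _) _.
have h1 := qf_le X z; have h2 := bf_le X x z.
rewrite normrM ger0_norm //; rewrite -enorm2M in h1.
have h3 : 0 <= mabs X * (enorm z * enorm z) by rewrite !mulr_ge0.
lra.
Qed.

Lemma Reg_dot p : Reg 0 (fun x => dot p x).
Proof.
split => // [x a b|].
  have -> : mixd (dot p) x a b = 0 by rewrite /mixd !dotDr; ring.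
  by rewrite normr0 mul0r.
exists (enorm p) => // x z; rewrite dotDr !mul0r !addr0 [dot p x + _]addrC addrK.
exact: cauchy_schwarz.
Qed.

Section MeanValue.
Variables (K : R) (u : vec -> R) (l : seq vec) (c : R) (U : set vec).
Hypothesis ru : Reg K u.
Hypothesis l0 : (0 < size l)%N.
Hypothesis hsub : forall x0 X, U x0 -> symmx X -> touch_above u x0 X ->
  c <= \sum_(a <- l) qf X a.
Let m : R := (size l)%:R.
Let c' := (2 * m)^-1 * c.
Let B1 : R := \sum_(a <- l) enorm a.
Let B2 : R := \sum_(a <- l) enorm a ^+ 2.
Let B3 : R := \sum_(a <- l) enorm a ^+ 3.

(* The random walk along [l] is run for [k] steps of size [r].  The error
   [u - T^j (moll u)] is compared with the parabola [M |x - x1|^2] by induction on [j]: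
   an interior maximum would be a touching point from above. *)
Lemma walk_mean eps tau d sig : 0 < eps -> 0 < tau -> 0 < d -> 0 < sig ->
  tau * (K * B2 + `|c'|) / d ^+ 2 * B2 <= eps / 2 ->
  exists k r, [/\ 0 <= r, r <= eps, k%:R * r ^+ 2 = tau &
   forall x1, (forall y, enorm (y - x1) <= d -> U y) ->
     u x1 <= iter k (walk l r) u x1 + 4 * n%:R * K * sig ^+ 2 - (c' - eps) * tau].
Proof.
move=> eps0 tau0 d0 sig0 hM.
have K0 := Reg_ge0 ru.
have m0 : 0 < m by rewrite ltr0n.
have m1 : 1 <= m by rewrite ler1n.
have B10 : 0 <= B1 by apply: sumr_ge0.
have B20 : 0 <= B2 by apply: sumr_ge0 => a _; rewrite exprn_ge0.
have B30 : 0 <= B3 by apply: sumr_ge0 => a _; rewrite exprn_ge0.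
have [C sm] := moll_smooth sig0 ru; have C0 := sm_C0 sm.
pose r1 := Num.min eps (eps / (2 * (C * (B1 * B2 + 2 * B3) + 1))).
have q0 : 0 < C * (B1 * B2 + 2 * B3) + 1 by rewrite ltr_wpDl // !(mulr_ge0, addr_ge0).
have r10 : 0 < r1 by rewrite /r1 lt_min eps0 /= divr_gt0 // mulr_gt0.
(* Enough steps for [r] to fall below [r1]; [r] is then set so that the total time [k r^2] is
   exactly [tau]. *)
have [k kE] : exists k, k = (Num.truncn (tau / r1 ^+ 2)).+1 by eexists.
have k0 : 0 < k%:R :> R by rewrite kE ltr0n.
pose r := Num.sqrt (tau / k%:R).
have r2 : r ^+ 2 = tau / k%:R by rewrite /r sqr_sqrtr // divr_ge0 // ltW.
have r0 : 0 <= r by exact: sqrtr_ge0.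
have rr1 : r <= r1.
  rewrite -(ler_pXn2r (n := 2)) ?nnegrE // ?(ltW r10) // r2 ler_pdivrMr // mulrC.
  by rewrite -ler_pdivrMr ?exprn_gt0 // ltW // kE truncnS_gt.
have kr2 : k%:R * r ^+ 2 = tau by rewrite r2 mulrC divfK // gt_eqF.
have re : r <= eps by apply: le_trans rr1 _; rewrite /r1 ge_min lexx.
have rC : C * r * B1 * B2 + 2 * C * r * B3 <= eps / 2.
  have h : r <= eps / (2 * (C * (B1 * B2 + 2 * B3) + 1)).
    by apply: le_trans rr1 _; rewrite /r1 ge_min lexx orbT.
  by rewrite ler_pdivlMr ?mulr_gt0 // in h; move: h r0; clear -ru l0 hsub c' B1 B2 B3; lra.
exists k, r; split => // x1 hU.
(* At distance [d] the parabola outweighs all that the walk and the drift can contribute in time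
   [tau], so a maximum on the boundary already satisfies the bound. The hypothesis on [tau] keeps
   the parabola's own effect [M * B2] below [eps / 2]. *)
pose M := tau * (K * B2 + `|c'|) / d ^+ 2.
have M0 : 0 <= M by rewrite /M divr_ge0 ?exprn_ge0 ?(ltW d0) // mulr_ge0 ?(ltW tau0) // addr_ge0 // mulr_ge0.
have Md : M * d ^+ 2 = tau * (K * B2 + `|c'|).
  by rewrite /M divfK // sqrf_eq0 gt_eqF.
pose v0 x := moll sig u x + 2 * n%:R * K * sig ^+ 2.
pose w0 := moll sig u; pose cs := 2 * n%:R * K * sig ^+ 2.
pose v j := iter j (walk l r) w0.
have rv j : Reg K (v j).
  apply: iter_walk_reg => //; exact: (av_reg (avop_moll n sig0) ru).
have sI : symmx (1%:M : mat) by exact: symmxM.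
have claim j : (j <= k)%N -> forall x, enorm (x - x1) <= d ->
    u x - (v j x + cs) - M * enorm (x - x1) ^+ 2 + (c' - eps) * r ^+ 2 * j%:R <= 0.
  elim: j => [|j IH] jk x xd.
    have := moll_near sig0 x ru; rewrite ler_norml => /andP[h _].
    have : 0 <= M * enorm (x - x1) ^+ 2 by rewrite mulr_ge0 // exprn_ge0.
    by rewrite mulr0 addr0 /v /= -/w0 -/cs in h *; move: h; clear -ru l0 hsub c' B1 B2 B3; lra.
  pose T x := u x - v j.+1 x - M * qf 1%:M (x - x1).
  have rT : Reg (K + K + `|M| * (2 * mabs (1%:M : mat))) T.
    by apply: RegB (RegB ru (rv _)) (RegZ M (RegT (- x1) (Reg_qf sI))).
  have TE y : T y = u y - v j.+1 y - M * enorm (y - x1) ^+ 2.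
    by rewrite /T qfM mul1r enorm2.
  have [x0 x0d hx0] := Reg_max x1 rT (ltW d0).
  suff : T x0 - cs + (c' - eps) * r ^+ 2 * j.+1%:R <= 0.
    by have := hx0 x xd; rewrite !TE; clear -ru l0 hsub c' B1 B2 B3; lra.
  have jtau : j.+1%:R * r ^+ 2 <= tau.
    by rewrite -kr2 ler_wpM2r ?exprn_ge0 // ler_nat.
  have [x0lt|x0ge] := ltP (enorm (x0 - x1)) d; last first.
    rewrite TE (_ : enorm (x0 - x1) = d); last by apply/eqP; rewrite eq_le x0d.
    rewrite Md.
    have := iter_walk_near r0 l0 j.+1 x0 (av_reg (avop_moll n sig0) ru).
    rewrite -/w0 -/(v _) -/B2 ler_norml => /andP[h1 _].
    have := moll_near sig0 x0 ru; rewrite -/w0 -/cs ler_norml => /andP[h2 _].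
    have h3 : j.+1%:R * (K * r ^+ 2 * B2) <= tau * (K * B2).
      rewrite (_ : j.+1%:R * _ = j.+1%:R * r ^+ 2 * (K * B2)); last by ring.
      by rewrite ler_wpM2r // mulr_ge0.
    have h4 : (c' - eps) * r ^+ 2 * j.+1%:R <= tau * `|c'|.
      rewrite (_ : _ * _ = j.+1%:R * r ^+ 2 * (c' - eps)); last by ring.
      apply: (@le_trans _ _ (j.+1%:R * r ^+ 2 * `|c'|)).
        rewrite ler_wpM2l ?mulr_ge0 ?exprn_ge0 //.
        by have := ler_norm c'; move: eps0; clear -ru l0 hsub c' B1 B2 B3; lra.
      by rewrite ler_wpM2r.
    by move: h1 h2 h3 h4; clear -ru l0 hsub c' B1 B2 B3; lra.
  have [pj [Xj sj]] := iter_walk_smooth r0 l0 j sm.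
  have [p2 [X2 [s2 hX]]] := walk_smooth r0 l0 sj.
  have touch : touch_above u x0 (X2 x0 + (2 * M) *: 1%:M).
    exists (p2 x0 + (2 * M) *: (x0 - x1)), C, (d - enorm (x0 - x1)).
    split; first by rewrite subr_gt0.
    move=> z zd.
    have zx : enorm (x0 + z - x1) <= d.
      by rewrite addrAC; apply: le_trans (enormD _ _) _; move: zd; clear -ru l0 hsub c' B1 B2 B3; lra.
    have := hx0 _ zx; have := sm_jet s2 x0 z.
    rewrite /T -/(v j.+1) qfD qfZ [x0 + z - x1]addrAC (qf_add (x0 - x1) z) // mulmx1 dotDl dotZl.
    rewrite ler_norml => /andP[h1 h2] h3.
    have e1 : v j.+1 = walk l r (iter j (walk l r) (moll sig u)) by [].
    by rewrite e1 in h3; move: h2 h3; clear -ru l0 hsub c' B1 B2 B3; lra.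
  have sX2 : symmx (X2 x0 + (2 * M) *: 1%:M).
    by apply: symmxD; [exact: (sm_sym s2)|exact: symmxZ].
  have := hsub (hU _ x0d) sX2 touch.
  have -> : \sum_(a <- l) qf (X2 x0 + (2 * M) *: 1%:M) a = \sum_(a <- l) qf (X2 x0) a + 2 * M * B2.
    rewrite /B2 mulr_sumr -big_split; apply: eq_bigr => a _ /=.
    by rewrite qfD qfZ qfM mul1r enorm2.
  move=> hc.
  have im0 : 0 < (2 * m)^-1 by rewrite invr_gt0 mulr_gt0.
  have := ler_wpM2l (ltW im0) hc; rewrite -/c' mulrDr -/m -/(ellf l (X2 x0)).
  have im : (2 * m)^-1 * (2 * M * B2) <= M * B2.
    rewrite (_ : (2 * m)^-1 * (2 * M * B2) = M * B2 / m); last by field; rewrite gt_eqF.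
    by apply: ler_piMr; [exact: mulr_ge0|rewrite invf_le1].
  move=> hc2.
  have hs := walk_smooth_near r0 l0 x0 sj; have hx := hX x0.
  rewrite -/(v j) -/B3 in hs; rewrite -/B1 -/B2 in hx.
  have vj1 : walk l r (v j) x0 = v j.+1 x0 by [].
  rewrite vj1 in hs.
  have := IH (ltnW jk) x0 x0d; rewrite TE => IH0.
  have hM' : M * B2 <= eps / 2 by [].
  have ell1 : c' - eps <= ellf l (Xj x0) - 2 * C * r * B3.
    by move: hx; rewrite ler_norml => /andP[]; move: hc2 im hM' rC; clear -ru l0 hsub c' B1 B2 B3; lra.
  have r20 : 0 <= r ^+ 2 by rewrite exprn_ge0.
  have := ler_wpM2l r20 ell1.
  move: hs; rewrite ler_norml -(natr1 j) => /andP[].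
  by move: IH0; clear -ru l0 hsub c' B1 B2 B3; lra.
have := claim k (leqnn k) x1; rewrite subrr enorm0 expr0n /= mulr0 subr0 => /(_ (ltW d0)).
rewrite -mulrA [r ^+ 2 * _]mulrC kr2.
have : v k x1 <= iter k (walk l r) u x1 + cs.
  rewrite -iter_walk_addC //; apply: iter_walk_le => // y.
  by have := moll_near sig0 y ru; rewrite -/w0 -/cs ler_norml => /andP[]; clear -ru l0 hsub c' B1 B2 B3; lra.
by rewrite /cs; clear -ru l0 hsub c' B1 B2 B3; lra.
Qed.

(** Averages commute with the walk, so the mean-value inequality for [u] passes to [A u]. There the
    walk can be expanded at a smooth jet, and division by the time [tau] leaves [ellf (X x) >= c']
    up to small errors. *)
Lemma mollified_linear A ro C p X x d : avop A ro -> smooth C (A u) p X -> 0 < d ->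
  (forall y, enorm (y - x) <= ro + d -> U y) -> c <= \sum_(a <- l) qf (X x) a.
Proof.
move=> hA sm d0 hU.
have K0 := Reg_ge0 ru; have C0 := sm_C0 sm.
have m0 : 0 < m by rewrite ltr0n.
have B20 : 0 <= B2 by apply: sumr_ge0 => a _; rewrite exprn_ge0.
have B30 : 0 <= B3 by apply: sumr_ge0 => a _; rewrite exprn_ge0.
rewrite leNgt; apply/negP => lt.
pose L := ellf l (X x).
have im0 : 0 < (2 * m)^-1 by rewrite invr_gt0 mulr_gt0.
have Lc : L < c' by rewrite /L /c' /ellf ltr_pM2l.
pose eta := (c' - L) / 4; have eta0 : 0 < eta by rewrite /eta; lra.
pose q1 := 1 + 2 * C * B3; have q10 : 0 < q1 by rewrite /q1 ltr_wpDr // !mulr_ge0.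
pose eps := eta / q1; have eps0 : 0 < eps by rewrite divr_gt0.
pose q2 := (K * B2 + `|c'|) / d ^+ 2 * B2 + 1.
have q20 : 0 < q2.
  rewrite /q2; apply: ltr_wpDl => //; apply: mulr_ge0 => //; apply: divr_ge0; last exact/exprn_ge0/ltW.
  by apply: addr_ge0 => //; exact: mulr_ge0.
pose q3 := C * B2 * B2 + 1; have q30 : 0 < q3 by rewrite /q3 ltr_wpDl // !mulr_ge0.
pose tau := Num.min (eps / (2 * q2)) (eta / q3).
have tau0 : 0 < tau.
  have q22 : 0 < 2 * q2 by rewrite pmulr_rgt0.
  by rewrite /tau lt_min; apply/andP; split; [exact: divr_gt0 eps0 q22|exact: divr_gt0 eta0 q30].
pose q4 := 4 * n%:R * K + 1; have q40 : 0 < q4 by rewrite /q4 ltr_wpDl // !mulr_ge0.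
(* [sig] is chosen after [tau], so that the mollification error of [walk_mean] is at most
   [eta * tau] and survives the division by [tau]. *)
pose sig := Num.sqrt (eta * tau / q4).
have sig2 : sig ^+ 2 = eta * tau / q4 by apply: sqr_sqrtr; apply: divr_ge0 (ltW q40); apply: mulr_ge0; exact: ltW.
have sig0 : 0 < sig by rewrite sqrtr_gt0; apply: divr_gt0 => //; exact: mulr_gt0.
have hM : tau * (K * B2 + `|c'|) / d ^+ 2 * B2 <= eps / 2.
  have h : tau <= eps / (2 * q2) by rewrite /tau ge_min lexx.
  rewrite ler_pdivlMr ?mulr_gt0 // in h.
  have -> : tau * (K * B2 + `|c'|) / d ^+ 2 * B2 = tau * (q2 - 1) by rewrite /q2; ring.
  by have := tau0; move: h; clear -ru l0 hsub c' B1 B2 B3; lra.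
have [k [r [r0 re kr hk]]] := walk_mean eps0 tau0 d0 sig0 hM.
have g1 : A u x <= iter k (walk l r) (A u) x + (4 * n%:R * K * sig ^+ 2 - (c' - eps) * tau).
  rewrite -(iter_walk_comm r0 l0 _ _ hA ru).
  set cc := 4 * n%:R * K * sig ^+ 2 - (c' - eps) * tau.
  rewrite -[X in _ + X](avC hA cc x) -(avD hA _ (iter_walk_reg r0 l0 k ru) (Reg_cst n cc)).
  apply: (avle hA ru (RegD (iter_walk_reg r0 l0 k ru) (Reg_cst n cc))) => y yx.
  rewrite /cc addrA; apply: hk => y' y'y; apply: hU.
  by apply: le_trans (enorm_tri _ y _) _; rewrite addrC lerD.
have g2 := iter_walk_smooth_le r0 l0 k x sm.
rewrite -/B2 -/B3 -/L in g2.
have e1 : k%:R * (r ^+ 2 * L + 2 * C * r ^+ 3 * B3) = tau * L + tau * (r * (2 * C * B3)).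
  by rewrite -kr; ring.
have e2 : k%:R ^+ 2 * (C * r ^+ 4 * B2 * B2) = tau * (tau * (C * B2 * B2)).
  by rewrite -kr; ring.
rewrite e1 e2 in g2.
have t1 : r * (2 * C * B3) <= eps * (2 * C * B3) by rewrite ler_wpM2r // !mulr_ge0.
have t2 : tau * (C * B2 * B2) <= eta.
  have h : tau <= eta / q3 by rewrite /tau ge_min lexx orbT.
  by rewrite ler_pdivlMr // /q3 in h; have := tau0; move: h; clear -ru l0 hsub c' B1 B2 B3; lra.
have t3 : 4 * n%:R * K * sig ^+ 2 <= eta * tau.
  rewrite sig2 mulrA ler_pdivrMr // mulrC ler_wpM2l ?(ltW (mulr_gt0 _ _)) //.
  by rewrite /q4; clear -ru l0 hsub c' B1 B2 B3; lra.
have t4 : eps + eps * (2 * C * B3) = eta.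
  by rewrite /eps /q1; field; rewrite gt_eqF.
have s1 : tau * (r * (2 * C * B3)) <= tau * (eps * (2 * C * B3)) by rewrite ler_pM2l.
have s2 : tau * (tau * (C * B2 * B2)) <= tau * eta by rewrite ler_pM2l.
have fin : tau * (c' - L) <= tau * (3 * eta).
  have : tau * (3 * eta) = tau * (eps + eps * (2 * C * B3)) + tau * eta + tau * eta by rewrite t4; ring.
  by move=> ->; move: g1 g2 s1 s2 t3; clear -ru l0 hsub c' B1 B2 B3; lra.
by rewrite ler_pM2l // in fin; move: fin eta0; rewrite /eta; clear -ru l0 hsub c' B1 B2 B3; lra.
Qed.

End MeanValue.

(** Otherwise a half-space separates [X x] from [F >= 0]; its linear inequality holds for [u] in the
    viscosity sense and survives averaging, so it holds at [X x] after all. *)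
Lemma mollified_subsol (F : mat -> R) lam Lam K u (U : set vec) A ro C p X x d :
  ell F lam Lam -> Reg K u -> subsol F U u -> avop A ro -> smooth C (A u) p X ->
  0 < d -> (forall y, enorm (y - x) <= ro + d -> U y) -> 0 <= F (X x).
Proof.
move=> hF ru sub hA sm d0 hU; rewrite leNgt; apply/negP => lt.
have sX := sm_sym sm x.
have [l [c [h1 h2]]] := separation hF sX lt.
(* An empty list makes the functional zero; a point of [F >= 0] then gives [0 < c <= 0]. *)
case: (posnP (size l)) => [/size0nil l0|l0].
  pose t := - F (X x) / lam.
  have t0 : 0 <= t by rewrite divr_ge0 ?(ltW (el_lam hF)) // oppr_ge0 ltW.
  have := el_upI hF sX t0; rewrite /t [lam * _]mulrC divfK ?gt_eqF ?(el_lam hF) // subrr => h3.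
  have := h2 _ (symmxD sX (symmxM _ _)) h3.
  by move: h1; rewrite l0 !big_nil => /lt_le_trans h /h; rewrite ltxx.
have hl x0 Y : U x0 -> symmx Y -> touch_above u x0 Y -> c <= \sum_(a <- l) qf Y a.
  by move=> Ux0 sY hY; apply: h2 => //; exact: sub hY.
by have := mollified_linear ru l0 hl hA sm d0 hU; rewrite leNgt h1.
Qed.

End Mollification.

(** * Pointwise calculus of second-order jets with cubic remainder *)

Section Jet2.
Variables (R : realType) (n : nat).
Local Notation vec := 'rV[R]_n.
Local Notation mat := 'M[R]_n.
Implicit Types (x y z h p q : vec) (f g u : vec -> R) (a b c : R) (X Y : mat).

Definition jet2 f x a p X : Prop := exists C d, [/\ 0 <= C, 0 < d &
  forall h, enorm h < d -> `|f (x + h) - (a + dot p h + 2^-1 * qf X h)| <= C * enorm h ^+ 3].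

Lemma jet2D f g x a p X b q Y : jet2 f x a p X -> jet2 g x b q Y ->
  jet2 (fun y => f y + g y) x (a + b) (p + q) (X + Y).
Proof.
move=> [C [d [C0 d0 hf]]] [C' [d' [C0' d0' hg]]].
exists (C + C'), (Num.min d d'); split; [lra|by rewrite lt_min d0|].
move=> h; rewrite lt_min => /andP[/hf h1 /hg h2].
rewrite mulrDl; apply: le_trans (lerD h1 h2); apply: le_trans (ler_normD _ _).
by rewrite dotDl qfD le_eqVlt; apply/orP; left; apply/eqP; congr `|_|; ring.
Qed.

Lemma jet2Z c f x a p X : jet2 f x a p X -> jet2 (fun y => c * f y) x (c * a) (c *: p) (c *: X).
Proof.
move=> [C [d [C0 d0 hf]]]; exists (`|c| * C), d; split => //; first exact: mulr_ge0.
move=> h /hf h1; rewrite -mulrA; apply: le_trans (ler_wpM2l (normr_ge0 c) h1).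
by rewrite -normrM dotZl qfZ le_eqVlt; apply/orP; left; apply/eqP; congr `|_|; ring.
Qed.

Lemma jet2_cst c x : jet2 (fun=> c) x c 0 0.
Proof.
exists 0, 1; split => // h _; rewrite dot0l qf0 mulr0 !addr0 subrr normr0 mul0r //.
Qed.

Lemma jet2M f g x a p X b q Y : jet2 f x a p X -> jet2 g x b q Y ->
  jet2 (fun y => f y * g y) x (a * b) (b *: p + a *: q)
    (b *: X + a *: Y + (outer p q + outer q p)).
Proof.
move=> [C [d [C0 d0 hf]]] [C' [d' [C0' d0' hg]]].
have [P1 P1E] : exists P1, P1 = enorm p by eexists.
have [P2 P2E] : exists P2, P2 = enorm q by eexists.
have [Q1 Q1E] : exists Q1, Q1 = 2^-1 * mabs X by eexists.
have [Q2 Q2E] : exists Q2, Q2 = 2^-1 * mabs Y by eexists.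
have Q10 : 0 <= Q1 by rewrite Q1E mulr_ge0 ?invr_ge0 ?mabs_ge0.
have Q20 : 0 <= Q2 by rewrite Q2E mulr_ge0 ?invr_ge0 ?mabs_ge0.
have P10 : 0 <= P1 by rewrite P1E.
have P20 : 0 <= P2 by rewrite P2E.
exists (C * (`|b| + P2 + Q2 + C') + (`|a| + P1 + Q1) * C' + (P1 * Q2 + Q1 * P2 + Q1 * Q2)).
exists (Num.min (Num.min d d') 1); split.
- by rewrite !(addr_ge0, mulr_ge0) // ?enorm_ge0.
- by rewrite !lt_min d0 d0' ltr01.
move=> h; rewrite !lt_min => /andP[/andP[/hf h1 /hg h2] ht].
set t := enorm h in h1 h2 ht *; have t0 : 0 <= t by exact: enorm_ge0.
have t1 := ltW ht.
have t21 : t ^+ 2 <= 1 by rewrite exprn_ile1.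
have t31 : t ^+ 3 <= 1 by rewrite exprn_ile1.
have t2t : t ^+ 2 <= t by rewrite expr2 ler_piMl.
have t3t : t ^+ 4 <= t ^+ 3 by rewrite exprSr ler_piMr // exprn_ge0.
have t30 : 0 <= t ^+ 3 by rewrite exprn_ge0.
have dp : `|dot p h| <= P1 * t by rewrite P1E; exact: cauchy_schwarz.
have dqq : `|dot q h| <= P2 * t by rewrite P2E; exact: cauchy_schwarz.
have qX : `|2^-1 * qf X h| <= Q1 * t ^+ 2.
  by rewrite Q1E normrM ger0_norm ?invr_ge0 // -mulrA ler_wpM2l ?invr_ge0 // enorm2 qf_le.
have qY : `|2^-1 * qf Y h| <= Q2 * t ^+ 2.
  by rewrite Q2E normrM ger0_norm ?invr_ge0 // -mulrA ler_wpM2l ?invr_ge0 // enorm2 qf_le.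
rewrite !qfD !qfZ !qf_outer dotDl !dotZl.
set fv := f (x + h) in h1 *; set gv := g (x + h) in h2 *.
set P := dot p h in h1 dp *; set P' := dot q h in h2 dqq *.
set Qx := 2^-1 * qf X h in h1 qX; set Qy := 2^-1 * qf Y h in h2 qY.
pose E1 := fv - (a + P + Qx); pose E2 := gv - (b + P' + Qy).
have -> : fv * gv - (a * b + (b * P + a * P') + 2^-1 * (b * qf X h + a * qf Y h + (P * P' + P' * P)))
   = E1 * (b + P' + Qy + E2) + (a + P + Qx) * E2 + (P * Qy + Qx * P' + Qx * Qy).
  by rewrite /E1 /E2 /Qx /Qy; field.
have E1b : `|E1| <= C * t ^+ 3 by exact: h1.
have E2b : `|E2| <= C' * t ^+ 3 by exact: h2.
have mono (A B A' B' : R) : `|A| <= A' -> `|B| <= B' -> `|A * B| <= A' * B'.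
  by move=> hA hB; rewrite normrM ler_pM.
have gb : `|b + P' + Qy + E2| <= `|b| + P2 + Q2 + C'.
  apply: le_trans (ler_normD _ _) _; apply: lerD; last first.
    by apply: le_trans E2b _; rewrite ler_piMr.
  apply: le_trans (ler_normD _ _) _; apply: lerD; last first.
    by apply: le_trans qY _; rewrite ler_piMr.
  apply: le_trans (ler_normD _ _) _; rewrite lerD2l.
  by apply: le_trans dqq _; rewrite ler_piMr.
have fb : `|a + P + Qx| <= `|a| + P1 + Q1.
  apply: le_trans (ler_normD _ _) _; apply: lerD; last first.
    by apply: le_trans qX _; rewrite ler_piMr.
  apply: le_trans (ler_normD _ _) _; rewrite lerD2l.
  by apply: le_trans dp _; rewrite ler_piMr.
rewrite [leRHS]mulrDl [X in _ <= X + _]mulrDl.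
apply: le_trans (ler_normD _ _) _; apply: lerD.
  apply: le_trans (ler_normD _ _) _; apply: lerD.
    by rewrite mulrAC; exact: mono.
  by rewrite -mulrA; exact: mono.
rewrite !mulrDl; apply: le_trans (ler_normD _ _) _; apply: lerD.
  apply: le_trans (ler_normD _ _) _; apply: lerD.
    by rewrite (_ : P1 * Q2 * t ^+ 3 = P1 * t * (Q2 * t ^+ 2)); [exact: mono|ring].
  by rewrite (_ : Q1 * P2 * t ^+ 3 = Q1 * t ^+ 2 * (P2 * t)); [exact: mono|ring].
apply: (@le_trans _ _ (Q1 * t ^+ 2 * (Q2 * t ^+ 2))); first exact: mono.
rewrite (_ : Q1 * t ^+ 2 * (Q2 * t ^+ 2) = Q1 * Q2 * t ^+ 4); last by ring.
by rewrite ler_wpM2l // mulr_ge0.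
Qed.

Lemma jet2_smooth C g (p : vec -> vec) (X : vec -> mat) x : smooth C g p X -> jet2 g x (g x) (p x) (X x).
Proof.
move=> sg; exists C, 1; split => //; first exact: sm_C0 sg.
by move=> h _; have := sm_jet sg x h; apply: le_of_eq_norm; ring.
Qed.

Lemma jet2T f x y a p X : jet2 f (x + y) a p X -> jet2 (fun w => f (w + y)) x a p X.
Proof.
move=> [C [d [C0 d0 hf]]]; exists C, d; split => // h hd.
by rewrite addrAC; exact: hf.
Qed.

Lemma jet2_eq f g x a b p q X Y : jet2 f x a p X -> f =1 g -> a = b -> p = q -> X = Y ->
  jet2 g x b q Y.
Proof. by move=> h /funext <- <- <- <-. Qed.

Lemma jet2X f x a p X k : jet2 f x a p X ->
  jet2 (fun y => f y ^+ k.+2) x (a ^+ k.+2) ((k.+2%:R * a ^+ k.+1) *: p)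
   ((k.+2%:R * a ^+ k.+1) *: X + (k.+2%:R * k.+1%:R * a ^+ k) *: outer p p).
Proof.
move=> hf; elim: k => [|k IH].
  apply: (jet2_eq (jet2M hf hf)).
  - by move=> y; rewrite expr2.
  - by rewrite expr2.
  - by rewrite -scalerDl; congr (_ *: _); ring.
  - rewrite -scalerDl -[outer p p]scale1r -scalerDl scalerA.
    by congr (_ *: _ + _ *: _); ring.
apply: (jet2_eq (jet2M hf IH)).
- by move=> y; rewrite -exprS.
- by rewrite -exprS.
- rewrite scalerA -scalerDl; congr (_ *: _).
  by rewrite -[k.+3%:R]natr1 [a ^+ k.+2]exprS; ring.
- rewrite scalerDr !scalerA.
  have oZ c : outer p (c *: p) + outer (c *: p) p = (2 * c) *: outer p p.
    rewrite /outer -scalemxAr [(c *: p)^T]linearZ /= -scalemxAl -scalerDl; congr (_ *: _); ring.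
  rewrite oZ addrA -scalerDl -addrA -scalerDl; congr (_ *: _ + _ *: _).
    by rewrite -[k.+3%:R]natr1 [a ^+ k.+2]exprS; ring.
  by rewrite -[k.+3%:R]natr1 -[k.+2%:R]natr1 [a ^+ k.+1]exprS; ring.
Qed.

Lemma jet2_dist y x : jet2 (fun w => enorm (w - y) ^+ 2) x (enorm (x - y) ^+ 2)
  (2 *: (x - y)) (2 *: 1%:M).
Proof.
exists 0, 1; split => // h _; rewrite mul0r addrAC !enorm2 qfZ qfM dotZl.
move: (x - y) => w; rewrite !(dotDl, dotDr) (dotC h w).
by rewrite normr_le0; apply/eqP; field.
Qed.

Lemma outerZ a b p q : outer (a *: p) (b *: q) = (a * b) *: outer p q.
Proof. by rewrite /outer -scalemxAr [(a *: p)^T]linearZ /= -scalemxAl scalerA mulrC. Qed.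

Lemma jet2_touch_below u f x p X : jet2 f x (u x) p X ->
  (exists2 d : R, 0 < d & forall h, enorm h < d -> f (x + h) <= u (x + h)) ->
  touch_below u x X.
Proof.
move=> [C [d [C0 d0 hf]]] [d' d0' hu]; exists p, C, (Num.min d d').
split; first by rewrite lt_min d0.
move=> h; rewrite lt_min => /andP[/hf h1 /hu h2]; apply: le_trans h2.
by move: h1; rewrite ler_norml => /andP[]; lra.
Qed.

End Jet2.

(** * The maximum principle for second differences and its barrier *)

Section Barrier.
Variables (R : realType) (n : nat) (lam Lam : R).
Local Notation vec := 'rV[R]_n.
Local Notation mat := 'M[R]_n.
Implicit Types (x y z e : vec) (u : vec -> R) (c m K s : R).

Definition dd u e x : R := u (x + e) + u (x - e) - 2 * u x.

Definition sol (F : mat -> R) (U : set vec) u : Prop := subsol F U u /\ supersol F U u.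

(** Let [g] be a mollification of [u]. At an interior maximum of [g (w + e) + g (w - e) - 2 * u w +
    c * psi w], half of the sum of the smooth terms touches [u] from below, up to a constant. The
    mean of the two Hessians of [g] lies in the convex set [F >= 0], and on the annulus [psi] raises
    [F] strictly, against the supersolution property. On the small ball the assumed drop [c] pays
    for [psi], and on the outer sphere [psi] vanishes. *)
Lemma barrier (rho Ra r : R) : 0 < rho -> rho < Ra -> 0 <= r -> r < Ra -> 0 < lam -> lam <= Lam ->
  exists2 beta : R, 0 < beta & forall (F : mat -> R) (K : R) u (U : set vec) y e m c s,
    ell F lam Lam -> Reg K u -> sol F U u -> 0 < s ->
    (exists2 d : R, 0 < d & forall x, enorm (x - y) <= Ra * s + enorm e + d -> U x) ->
    0 <= c ->
    (forall x, enorm (x - y) <= Ra * s -> dd u e x <= m) ->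
    (forall x, enorm (x - y) <= rho * s -> dd u e x <= m - c) ->
    forall x, enorm (x - y) <= r * s -> dd u e x <= m - beta * c.
Proof.
move=> rho0 rhoR r0 rR lam0 lamLam.
have Ra0 : 0 < Ra by exact: lt_trans rhoR.
have Lam0 : 0 < Lam by exact: lt_le_trans lamLam.
(* In the Hessian of [psi] the positive rank-one part gains a factor [k + 1] over the negative
   multiple of the identity; at distance at least [rho s] this exponent makes it win for all [F]
   with these constants. *)
have [k kE] : exists k : nat, Lam * Ra ^+ 2 / (2 * lam * rho ^+ 2) < k.+1%:R.
  by eexists; exact: truncnS_gt.
have kk : Lam * Ra ^+ 2 < 2 * k.+1%:R * lam * rho ^+ 2.
  by rewrite ltr_pdivrMr ?mulr_gt0 ?exprn_gt0 // in kE; apply: lt_le_trans kE _; rewrite le_eqVlt; apply/orP; left; apply/eqP; ring.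
(* The value of [psi] at distance [r s] from the centre. *)
pose beta := ((Ra ^+ 2 - r ^+ 2) / Ra ^+ 2) ^+ k.+2.
have rR2 : r ^+ 2 < Ra ^+ 2 by rewrite ltr_pXn2r ?nnegrE // ltW.
exists beta.
  by rewrite /beta exprn_gt0 // divr_gt0 ?exprn_gt0 // subr_gt0.
move=> F K u U y e m c s hF ru [hsub hsup] s0 [d d0 hU] c0 hm hmc x xr.
have [D DE] : exists D, D = (Ra * s) ^+ 2 by eexists.
have D0 : 0 < D by rewrite DE exprn_gt0 // mulr_gt0.
pose q (w : vec) := 1 - D^-1 * enorm (w - y) ^+ 2.
pose psi w := q w ^+ k.+2.
have q01 w : enorm (w - y) <= Ra * s -> 0 <= q w <= 1.
  move=> h; rewrite /q; apply/andP; split.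
    rewrite subr_ge0 mulrC ler_pdivrMr // mul1r DE ler_pXn2r ?nnegrE //.
    by rewrite mulr_ge0 // ltW.
  by rewrite gerBl mulr_ge0 ?invr_ge0 ?(ltW D0) // exprn_ge0.
have K0 := Reg_ge0 ru.
have main sig : 0 < sig -> 2 * n%:R * sig <= d / 2 ->
    dd u e x <= m - beta * c + 8 * n%:R * K * sig ^+ 2.
  move=> sig0 sigd.
  pose g := moll sig u; pose gam := 2 * n%:R * K * sig ^+ 2.
  have gnear w : `|g w - u w| <= gam by exact: moll_near.
  have [C sm] := moll_smooth sig0 ru.
  have hA := avop_moll n sig0.
  have rg : Reg K g by exact: (av_reg hA ru).
  pose W w := g (w + e) + g (w - e) - 2 * u w.
  have Wdd w : `|W w - dd u e w| <= 2 * gam.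
    have := gnear (w + e); have := gnear (w - e); rewrite /W /dd !ler_norml.
    by move=> /andP[? ?] /andP[? ?]; apply/andP; split; lra.
  pose Psi w := W w + c * psi w.
  have Wle w : W w <= dd u e w + 2 * gam by have := Wdd w; rewrite ler_norml => /andP[]; lra.
  have psi1 w : enorm (w - y) <= Ra * s -> 0 <= psi w <= 1.
    by move=> /q01 /andP[q0 q1]; rewrite exprn_ge0 //= exprn_ile1.
  have Ras0 : 0 <= Ra * s by rewrite mulr_ge0 // ltW.
  have [x0 x0R hx0] : exists2 x0, enorm (x0 - y) <= Ra * s & forall w, enorm (w - y) <= Ra * s -> Psi w <= Psi x0.
    have rW := RegB (RegD (RegT e rg) (RegT (- e) rg)) (RegZ 2 ru).
    have [L1 L10 hL1] := Reg_lip_ball y rW Ras0.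
    have sI : symmx (1%:M : mat) by exact: symmxM.
    have rq := RegB (Reg_cst n 1) (RegZ D^-1 (RegT (- y) (Reg_qf sI))).
    have [L2 L20 hL2] := Reg_lip_ball y rq Ras0.
    have qE w : q w = 1 - D^-1 * qf 1%:M (w - y) by rewrite qfM mul1r -enorm2.
    apply: (@cball_max _ _ Psi y (Ra * s) (L1 + c * (k.+2%:R * L2))) => // w w' hw hw'.
    have h1 := hL1 w w' hw hw'; have := hL2 w w' hw hw'; rewrite -!qE => h2.
    have h3 : `|psi w - psi w'| <= k.+2%:R * (L2 * enorm (w - w')).
      rewrite /psi subrXX normrM mulrC; apply: ler_pM => //.
      apply: le_trans (ler_norm_sum _ _ _) _.
      rewrite -[X in _ <= X%:R]card_ord -sumr_const; apply: ler_sum => i _.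
      have /andP[a0 a1] := q01 w hw; have /andP[b0 b1] := q01 w' hw'.
      by rewrite ger0_norm ?mulr_ge0 ?exprn_ge0 // mulr_ile1 ?exprn_ge0 // exprn_ile1.
    have h4 := ler_wpM2l c0 h3.
    rewrite /Psi; apply: (@le_trans _ _ (`|W w - W w'| + c * `|psi w - psi w'|)).
      rewrite (_ : c * `|psi w - psi w'| = `|c * (psi w - psi w')|); last by rewrite normrM (ger0_norm c0).
       apply: le_trans (ler_normD _ _).
      by rewrite le_eqVlt; apply/orP; left; apply/eqP; congr `|_|; ring.
    by move: h1; rewrite -/(W w) -/(W w'); move: h4; clear; lra.
  have bound : Psi x0 <= m + 2 * gam.
    have dx0 := hm _ x0R; have wx0 := Wle x0.
    have [xr0|xr0] := leP (enorm (x0 - y)) (rho * s).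
      have dc := hmc _ xr0; have /andP[p0 p1] := psi1 _ x0R.
      have : c * psi x0 <= c * 1 by rewrite ler_wpM2l.
      by rewrite /Psi; move: dc wx0; clear; lra.
    have [xR1|xR1] := ltP (enorm (x0 - y)) (Ra * s); last first.
      have E : enorm (x0 - y) = Ra * s by apply/eqP; rewrite eq_le x0R.
      have -> : Psi x0 = W x0.
        by rewrite /Psi /psi /q E -DE mulVf ?gt_eqF // subrr expr0n mulr0 addr0.
      by move: dx0 wx0; clear; lra.
    have [cz|cn0] := eqVneq c 0; first by rewrite /Psi cz mul0r addr0; move: dx0 wx0; clear; lra.
    exfalso.
    have cp : 0 < c by rewrite lt_def cn0.
    have q0 : 0 < q x0.
      rewrite /q subr_gt0 mulrC ltr_pdivrMr // mul1r DE ltr_pXn2r ?nnegrE //.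
    have jq : jet2 q x0 (q x0) (- D^-1 *: (2 *: (x0 - y))) (- D^-1 *: (2 *: 1%:M)).
      apply: (jet2_eq (jet2D (jet2_cst 1 x0) (jet2Z (- D^-1) (jet2_dist y x0)))).
      - by move=> w; rewrite /q mulNr.
      - by rewrite /q mulNr.
      - by rewrite add0r.
      - by rewrite add0r.
    have jpsi := jet2X k jq.
    pose z := x0 - y; pose t1 := (k.+2%:R * q x0 ^+ k.+1) * (2 / D).
    pose t2 := (k.+2%:R * k.+1%:R * q x0 ^+ k) * (2 / D) ^+ 2.
    have jg1 := jet2T (jet2_smooth (x0 + e) sm); have jg2 := jet2T (jet2_smooth (x0 - e) sm).
    have jphi := jet2Z (2^-1) (jet2D (jet2D (jet2D jg1 jg2) (jet2Z c jpsi)) (jet2_cst (- Psi x0) x0)).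
    pose Y := 2^-1 *: moll_hess sig u (x0 + e) + 2^-1 *: moll_hess sig u (x0 - e).
    have tb : touch_below u x0 (Y - (2^-1 * c * t1)%:M + (2^-1 * c * t2) *: outer z z).
      apply: (@jet2_touch_below _ _ _ (fun w => 2^-1 * (g (w + e) + g (w - e) + c * psi w + - Psi x0))).
        apply: (jet2_eq jphi) => //.
          by rewrite -/g /Psi /psi /W; field.
        rewrite addr0 !outerZ -[(_ * t1)%:M]scalemx1 -/z /Y /t1 /t2.
        move: (outer z z) (moll_hess sig u (x0 + e)) (moll_hess sig u (x0 - e)) (1%:M : mat) => O M1 M2 I1.
        by apply/matrixP => i j; rewrite !mxE; ring.
      exists (Ra * s - enorm (x0 - y)); first by rewrite subr_gt0.
      move=> h hd; have := hx0 (x0 + h); rewrite addrAC => /(_ _) hh.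
      have {}hh : Psi (x0 + h) <= Psi x0.
        by apply: hh; apply: le_trans (enormD _ _) _; move: hd; clear; lra.
      by move: hh; rewrite {1}/Psi /W -/(psi _); clear; lra.
    have D0' : 0 <= 2 / D by rewrite divr_ge0 // ltW.
    have t10 : 0 <= 2^-1 * c * t1.
      by rewrite !mulr_ge0 ?invr_ge0 // ?exprn_ge0 // ltW.
    have t20 : 0 <= 2^-1 * c * t2.
      by rewrite !mulr_ge0 ?invr_ge0 // ?exprn_ge0 // ltW.
    have near_U x1 : enorm (x1 - x0) <= enorm e -> 0 <= F (moll_hess sig u x1).
      move=> h1; apply: (mollified_subsol hF ru hsub hA sm (d := d / 2)); first by rewrite divr_gt0.
      move=> w hw; apply: hU; apply: le_trans (enorm_tri _ x1 _) _.
      by have := enorm_tri x1 x0 y; move: hw h1 x0R sigd; clear; lra.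
    have F1 : 0 <= F (moll_hess sig u (x0 + e)).
      by apply: near_U; rewrite addrAC subrr add0r.
    have F2 : 0 <= F (moll_hess sig u (x0 - e)).
      by apply: near_U; rewrite addrAC subrr add0r enormN.
    have s1 := sm_sym sm (x0 + e); have s2 := sm_sym sm (x0 - e).
    have h2 : 0 <= 2^-1 :> R by rewrite invr_ge0.
    have FY : 0 <= F Y by apply: (el_conv hF s1 s2 F1 F2 h2 h2); field.
    have sY : symmx Y by apply: symmxD; exact: symmxZ.
    have Ux0 : U x0 by apply: hU; have := enorm_ge0 e; move: x0R d0; clear; lra.
    have zp : 0 < enorm z by apply: le_lt_trans xr0; rewrite mulr_ge0 // ltW.
    have sYt : symmx (Y - (2^-1 * c * t1)%:M) by apply: symmxD => //; apply: symmxN; exact: symmxM.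
    have sN : symmx ((2^-1 * c * t2) *: outer z z) by apply: symmxZ; exact: symmx_outer.
    have := hsup _ _ Ux0 (symmxD sYt sN) tb.
    have v1 : enorm ((enorm z)^-1 *: z) = 1.
      by rewrite enormZ ger0_norm ?invr_ge0 // mulVf // gt_eqF.
    have pN w : 0 <= qf ((2^-1 * c * t2) *: outer z z) w.
      by rewrite qfZ qf_outer mulr_ge0 // -expr2 sqr_ge0.
    have := el_low hF sYt sN pN v1.
    rewrite qfZ qf_outer -expr2 dotZr -enorm2.
    have -> : ((enorm z)^-1 * enorm z ^+ 2) ^+ 2 = enorm z ^+ 2.
      by field; rewrite gt_eqF.
    have := el_down hF sY t10 => e1 e2 e3.
    have key : Lam * (2^-1 * c * t1) < lam * (2^-1 * c * t2 * enorm z ^+ 2).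
      have qz : q x0 * D = D - enorm z ^+ 2 by rewrite /q -/z; field; rewrite gt_eqF.
      have cc : 0 < 2^-1 * c * (k.+2%:R * q x0 ^+ k * (2 / D ^+ 2)).
        by rewrite !mulr_gt0 ?invr_gt0 ?ltr0n ?exprn_gt0.
      have -> : Lam * (2^-1 * c * t1) = 2^-1 * c * (k.+2%:R * q x0 ^+ k * (2 / D ^+ 2)) * (Lam * (q x0 * D)).
        by rewrite /t1 exprS; field; rewrite gt_eqF.
      have -> : lam * (2^-1 * c * t2 * enorm z ^+ 2) = 2^-1 * c * (k.+2%:R * q x0 ^+ k * (2 / D ^+ 2)) * (2 * k.+1%:R * lam * enorm z ^+ 2).
        by rewrite /t2; field; rewrite gt_eqF.
      rewrite ltr_pM2l // qz.
      have h1 : Lam * (D - enorm z ^+ 2) <= Lam * D.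
        by rewrite ler_pM2l // gerBl exprn_ge0.
      apply: le_lt_trans h1 _.
      have h3 : (rho * s) ^+ 2 <= enorm z ^+ 2.
        by rewrite ler_pXn2r ?nnegrE // ?(ltW xr0) // mulr_ge0 // ltW.
      have h4 : 2 * k.+1%:R * lam * (rho * s) ^+ 2 <= 2 * k.+1%:R * lam * enorm z ^+ 2.
        by rewrite ler_wpM2l // !mulr_ge0 // ltW.
      apply: lt_le_trans h4; rewrite DE !exprMn [Lam * _]mulrA [ltRHS]mulrA.
      by rewrite ltr_pM2r ?exprn_gt0.
    by move: key e3 e2 e1 FY; clear; lra.
  have rs : enorm (x - y) <= Ra * s by apply: le_trans xr _; rewrite ler_pM2r // ltW.
  have := hx0 _ rs; rewrite /Psi => hP.
  have : beta <= psi x.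
    rewrite /beta /psi ler_pXn2r ?nnegrE //.
    - rewrite /q DE exprMn; rewrite (_ : (Ra ^+ 2 - r ^+ 2) / Ra ^+ 2 = 1 - (Ra ^+ 2 * s ^+ 2)^-1 * (r * s) ^+ 2); last first.
        by rewrite exprMn; field; rewrite !gt_eqF.
      rewrite lerD2l lerN2 ler_wpM2l ?invr_ge0 ?mulr_ge0 ?exprn_ge0 ?(ltW s0) ?(ltW Ra0) //.
      by rewrite ler_pXn2r ?nnegrE // mulr_ge0 // ltW.
    - by rewrite divr_ge0 ?subr_ge0 ?exprn_ge0 // ltW.
    - by have /andP[] := q01 _ rs.
  move=> /(ler_wpM2l c0) hb.
  have := Wdd x; rewrite ler_norml => /andP[w1 w2].
  have := bound; rewrite /Psi => bd.
  have e8 : 8 * n%:R * K * sig ^+ 2 = 4 * gam by rewrite /gam; ring.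
  by rewrite e8; move: bd w1 hb hP; clear; lra.
have n0 : 0 <= n%:R :> R by [].
apply: (@le_add_inv_nat _ _ _ (8 * n%:R * K * (d / (4 * (n%:R + 1))) ^+ 2)) => j.
pose sig := d / (4 * (n%:R + 1)) / j.+1%:R.
have j1 : 1 <= j.+1%:R :> R by rewrite ler1n.
have p4 : 0 < 4 * (n%:R + 1) :> R by rewrite mulr_gt0 // ltr_wpDl.
have sig0 : 0 < sig by rewrite /sig !divr_gt0 ?ltr0n.
have sigd : sig <= d / (4 * (n%:R + 1)).
  by rewrite /sig ler_pdivrMr ?ltr0n // ler_peMr // divr_ge0 // ltW.
apply: le_trans (main sig sig0 _) _.
  apply: (@le_trans _ _ (2 * n%:R * (d / (4 * (n%:R + 1))))); first by rewrite ler_wpM2l // mulr_ge0.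
  by rewrite mulrA ler_pdivrMr //; have := mulr_ge0 n0 (ltW d0); move: d0; clear; lra.
rewrite lerD2l /sig exprMn mulrA ler_wpM2l ?mulr_ge0 ?exprn_ge0 ?divr_ge0 ?(ltW d0) ?(ltW p4) //.
by rewrite expr2 ler_piMr ?invr_ge0 // invf_le1 ?ltr0n.
Qed.

End Barrier.

(** * Local bounds on mixed second differences *)

Section Local.
Variables (R : realType) (n : nat).
Local Notation vec := 'rV[R]_n.
Local Notation mat := 'M[R]_n.
Local Notation e_ i := (delta_mx 0 i : vec).
Implicit Types (x y z a b e w : vec) (u : vec -> R) (U : set vec) (c K s t : R).

Definition MB u (th : R) U : Prop := forall x a b, U x -> U (x + a) -> U (x + b) ->
  U (x + a + b) -> `|mixd u x a b| <= th * (enorm a * enorm b).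

Definition hess_le u (H : mat) U : Prop := forall x z, U (x + z) -> U (x - z) -> dd u z x <= qf H z.
Definition hess_ge u (H : mat) U : Prop := forall x z, U (x + z) -> U (x - z) -> qf H z <= dd u z x.

Definition has_grad u (G : vec -> vec) K : Prop :=
  forall x z, `|u (x + z) - u x - dot (G x) z| <= K * enorm z ^+ 2.

Lemma eball_conv y r x a t : @eball R n y r x -> @eball R n y r (x + a) -> 0 <= t <= 1 ->
  @eball R n y r (x + t *: a).
Proof.
rewrite /eball /= => h1 h2 /andP[t0 t1].
have -> : x + t *: a - y = (1 - t) *: (x - y) + t *: (x + a - y).
  rewrite scalerBl scale1r !scalerBr scalerDr.
  by apply/rowP => i; rewrite !mxE; ring.
apply: le_lt_trans (enormD _ _) _; rewrite !enormZ !ger0_norm //; last by lra.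
have [->|tn] := eqVneq t 0; first by rewrite subr0 mul1r mul0r addr0.
have tp : 0 < t by rewrite lt_def tn.
have : t * enorm (x + a - y) < t * r by rewrite ltr_pM2l.
have : (1 - t) * enorm (x - y) <= (1 - t) * r by rewrite ler_wpM2l ?subr_ge0 // ltW.
lra.
Qed.

Lemma mixdC u x a b : mixd u x a b = mixd u x b a.
Proof. by rewrite /mixd (addrAC x a b); ring. Qed.

Lemma mixd_split u x a b (m : nat) :
  mixd u x (m%:R *: a) b = \sum_(k < m) mixd u (x + k%:R *: a) a b.
Proof.
elim: m => [|m IH]; first by rewrite big_ord0 scale0r /mixd !addr0; ring.
rewrite big_ord_recr /= -IH /mixd -natr1 scalerDl scale1r !addrA.
by rewrite (addrAC _ (m%:R *: a) b); ring.
Qed.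

Lemma dd_mixd u x z : dd u z x = mixd u (x - z) z z.
Proof. by rewrite /dd /mixd subrK; ring. Qed.

(** Polarisation bounds the mixed difference by [th / 2 * (|a|^2 + |b|^2)]. Cutting the longer side
    into pieces of about the length of the shorter one turns this sum into a product. *)
Lemma MB_of_hess u th y r : 0 <= th ->
  hess_le u (th%:M) (eball y r) -> hess_ge u (- th%:M) (eball y r) ->
  MB u (2 * th) (eball y r).
Proof.
move=> th0 hU hL.
have bal x a b : eball y r x -> eball y r (x + a) -> eball y r (x + b) -> eball y r (x + a + b) ->
    `|mixd u x a b| <= th / 2 * (enorm a ^+ 2 + enorm b ^+ 2).
  move=> h1 h2 h3 h4.
  pose c := x + 2^-1 *: (a + b); pose p := 2^-1 *: (a + b); pose q := 2^-1 *: (a - b).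
  have [cp cm] : c + p = x + a + b /\ c - p = x.
    by split; rewrite /c /p; apply/rowP => i; rewrite !mxE; field.
  have [cq cqm] : c + q = x + a /\ c - q = x + b.
    by split; rewrite /c /q; apply/rowP => i; rewrite !mxE; field.
  have E : mixd u x a b = dd u p c - dd u q c.
    by rewrite /dd cp cm cq cqm /mixd; ring.
  have p1 : dd u p c <= qf th%:M p by apply: hU; rewrite ?cp ?cm.
  have p2 : qf (- th%:M) p <= dd u p c by apply: hL; rewrite ?cp ?cm.
  have q1 : dd u q c <= qf th%:M q by apply: hU; rewrite ?cq ?cqm.
  have q2 : qf (- th%:M) q <= dd u q c by apply: hL; rewrite ?cq ?cqm.
  rewrite E; rewrite !qfN !qfM in p1 p2 q1 q2.
  have pq : dot p p + dot q q = 2^-1 * (enorm a ^+ 2 + enorm b ^+ 2).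
    by rewrite !enorm2 /p /q !(dotZl, dotZr, dotDl, dotDr, dotNl, dotNr) (dotC b a); field.
  rewrite -mulrA -pq mulrDr ler_norml; apply/andP; split; lra.
have main x a b : eball y r x -> eball y r (x + a) -> eball y r (x + b) -> eball y r (x + a + b) ->
    enorm b <= enorm a -> `|mixd u x a b| <= 2 * th * (enorm a * enorm b).
  move=> h1 h2 h3 h4 ba.
  have [b0|bn] := eqVneq b 0.
    have -> : mixd u x a b = 0 by rewrite b0 /mixd !addr0; ring.
    by rewrite normr0 b0 enorm0 !mulr0.
  have bp : 0 < enorm b by rewrite enorm_gt0.
  have [m mE] : exists m : nat, (m.+1%:R - 1 <= enorm a / enorm b < m.+1%:R).
    exists (Num.truncn (enorm a / enorm b)); rewrite truncnS_gt andbT -natr1 addrK.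
    by rewrite truncn_le divr_ge0.
  case/andP: mE => ml mu.
  have [M ME] : exists M : R, M = m.+1%:R by eexists.
  have M0 : 0 < M by rewrite ME ltr0n.
  rewrite -ME in ml mu.
  rewrite ltr_pdivrMr // in mu; rewrite ler_pdivlMr // in ml.
  have aE : a = m.+1%:R *: (M^-1 *: a) by rewrite scalerA -ME divff ?scale1r // gt_eqF.
  rewrite {1}aE mixd_split.
  apply: le_trans (ler_norm_sum _ _ _) _.
  apply: (@le_trans _ _ (\sum_(k < m.+1) th / 2 * ((enorm a / M) ^+ 2 + enorm b ^+ 2))).
    apply: ler_sum => k _.
    have -> : enorm a / M = enorm (M^-1 *: a) by rewrite enormZ ger0_norm ?invr_ge0 ?(ltW M0) // mulrC.
    have kM : 0 <= k%:R / M <= 1.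
      by rewrite divr_ge0 ?(ltW M0) //= ler_pdivrMr // mul1r ME ler_nat ltnW.
    have kM1 : 0 <= (k%:R + 1) / M <= 1.
      by rewrite divr_ge0 ?addr_ge0 ?(ltW M0) //= ler_pdivrMr // mul1r ME natr1 ler_nat.
    have s1 w : w + k%:R *: (M^-1 *: a) = w + (k%:R / M) *: a by rewrite scalerA.
    have s2 w : w + k%:R *: (M^-1 *: a) + M^-1 *: a = w + ((k%:R + 1) / M) *: a.
      by rewrite scalerA -addrA -scalerDl; congr (_ + _ *: _); ring.
    apply: bal.
    - by rewrite s1; exact: eball_conv.
    - by rewrite s2; exact: eball_conv.
    - by rewrite addrAC s1; apply: eball_conv => //; rewrite addrAC.
    - by rewrite addrAC [x + _ + b]addrAC s2; apply: eball_conv => //; rewrite addrAC.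
  rewrite sumr_const card_ord -[_ *+ m.+1]mulr_natr -ME.
  have -> : th / 2 * ((enorm a / M) ^+ 2 + enorm b ^+ 2) * M = th / 2 * (enorm a * (enorm a / M) + M * enorm b * enorm b).
    by field; rewrite gt_eqF.
  have a1 : enorm a / M <= enorm b by rewrite ler_pdivrMr // mulrC ltW.
  have a2 : enorm a * (enorm a / M) <= enorm a * enorm b by rewrite ler_wpM2l.
  have a3 : M * enorm b * enorm b <= 2 * (enorm a * enorm b).
    by rewrite mulrA ler_wpM2r //; lra.
  have : th / 2 * (enorm a * (enorm a / M) + M * enorm b * enorm b) <= th / 2 * (3 * (enorm a * enorm b)).
    by rewrite ler_wpM2l ?divr_ge0 //; lra.
  have : 0 <= th * (enorm a * enorm b) by rewrite !mulr_ge0.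
  lra.
move=> x a b h1 h2 h3 h4; have [ba|ab] := leP (enorm b) (enorm a); first exact: main.
by rewrite mixdC [enorm a * _]mulrC; apply: main => //; rewrite ?(ltW ab) // addrAC.
Qed.

(** The uncontrolled [K] serves only for a first step of size [|z| / (m + 1)], where it becomes
    negligible; mixed differences carry the expansion along the rest of the segment. *)
Lemma MB_grad u G K th y r x z : MB u th (eball y r) -> has_grad u G K -> 0 <= th ->
  eball y r x -> eball y r (x + z) ->
  `|u (x + z) - u x - dot (G x) z| <= th * enorm z ^+ 2.
Proof.
move=> mb hG th0 hx hxz.
apply: (@le_add_inv_nat _ _ _ (K * enorm z ^+ 2)) => m.
have [M ME] : exists M : R, M = m.+1%:R by eexists.
have M0 : 0 < M by rewrite ME ltr0n.
have MN : M != 0 by rewrite gt_eqF.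
rewrite -ME; pose w := M^-1 *: z.
have ew : enorm w = enorm z / M by rewrite enormZ ger0_norm ?invr_ge0 ?(ltW M0) // mulrC.
have zE : z = M *: w by rewrite scalerA divff // scale1r.
have h1 := hG x w.
have step (k : nat) : (k <= m.+1)%N ->
   `|u (x + k%:R *: w) - u x - k%:R * (u (x + w) - u x)| <= k%:R ^+ 2 * (th * enorm w ^+ 2).
  elim: k => [|k IH] km; first by rewrite scale0r addr0 subrr mul0r subr0 normr0 expr0n mul0r.
  have kM : 0 <= k%:R / M <= 1.
    by rewrite divr_ge0 ?(ltW M0) //= ler_pdivrMr // mul1r ME ler_nat ltnW.
  have kM1 : 0 <= (k%:R + 1) / M <= 1.
    by rewrite divr_ge0 ?addr_ge0 ?(ltW M0) //= ler_pdivrMr // mul1r ME natr1 ler_nat.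
  have w1 : 0 <= M^-1 <= 1 by rewrite invr_ge0 (ltW M0) /= invf_le1 // ME ler1n.
  have s1 : x + k%:R *: w = x + (k%:R / M) *: z by rewrite scalerA.
  have s2 : x + k%:R *: w + w = x + ((k%:R + 1) / M) *: z.
    by rewrite scalerA -addrA -scalerDl; congr (_ + _ *: _); ring.
  have := mb x (k%:R *: w) w hx; rewrite s2 {1}s1.
  move=> /(_ (eball_conv hx hxz kM) (eball_conv hx hxz w1) (eball_conv hx hxz kM1)).
  rewrite /mixd enormZ (ger0_norm (ler0n R k)).
  have := IH (ltnW km); rewrite -(natr1 k) scalerDl scale1r addrA.
  have k0 : 0 <= k%:R :> R by [].
  have t0 : 0 <= th * enorm w ^+ 2 by rewrite mulr_ge0 // exprn_ge0.
  have -> : th * (k%:R * enorm w * enorm w) = k%:R * (th * enorm w ^+ 2) by ring.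
  have -> : (k%:R + 1) ^+ 2 * (th * enorm w ^+ 2) =
     k%:R ^+ 2 * (th * enorm w ^+ 2) + 2 * (k%:R * (th * enorm w ^+ 2)) + th * enorm w ^+ 2 by ring.
  have := mulr_ge0 k0 t0.
  rewrite !ler_norml => q /andP[? ?] /andP[? ?]; apply/andP; split; lra.
have := step m.+1 (leqnn _); rewrite -ME -zE ew.
have -> : M ^+ 2 * (th * (enorm z / M) ^+ 2) = th * enorm z ^+ 2 by field.
have h2 : `|M * (u (x + w) - u x) - dot (G x) z| <= K * enorm z ^+ 2 / M.
  have := ler_wpM2l (ltW M0) h1; rewrite ew -{1}(ger0_norm (ltW M0)) -normrM.
  have -> : M * (K * (enorm z / M) ^+ 2) = K * enorm z ^+ 2 / M by field.
  by apply: le_of_eq_norm; rewrite [in LHS]zE dotZr; ring.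
move: h2; rewrite !ler_norml => /andP[? ?] /andP[? ?]; apply/andP; split; lra.
Qed.

End Local.

(** * Balls on which second differences with a fixed step are nearly constant *)

Section FlatBall.
Variables (R : realType) (n : nat) (lam Lam : R).
Local Notation vec := 'rV[R]_n.
Local Notation mat := 'M[R]_n.
Local Notation e_ i := (delta_mx 0 i : vec).
Implicit Types (x y z a b e w : vec) (u : vec -> R) (U : set vec) (c K s t : R).
Hypothesis lam0 : 0 < lam.
Hypothesis lamLam : lam <= Lam.

(** Where the chain stops, at [y], the second difference is within [eta s^2] of its maximum over a
    large ball. A value lower by [eps s^2] at some [x] would persist, up to a factor 2, near [x],
    and the barrier centred at [x] would lower the value at [y] by more than [eta s^2]. *)
Lemma flat_direction e (Ra eps : R) : 0 < Ra -> 0 < eps ->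
  exists2 R1 : R, Ra <= R1 & forall (F : mat -> R) K u U s y0,
    ell F lam Lam -> Reg K u -> sol F U u -> MB u 2 U -> 0 < s ->
    (forall x, enorm (x - y0) <= R1 * s -> U x) ->
    exists y m, enorm (y - y0) + Ra * s <= R1 * s /\
      forall x, enorm (x - y) <= Ra * s -> `|dd u (s *: e) x - m| <= eps * s ^+ 2.
Proof.
move=> Ra0 eps0.
have [E EE] : exists E : R, E = enorm e + 1 by eexists.
have E1 : 1 <= E by rewrite EE lerDr.
have eE : enorm e <= E by rewrite EE lerDl.
(* The second difference with step [s e] has Lipschitz constant [4 E s], so it varies by at most
   [eps / 2 * s^2] within distance [rho s]. *)
pose rho := Num.min (eps / (8 * E)) 2^-1.
have rho0 : 0 < rho by rewrite lt_min divr_gt0 ?mulr_gt0 ?invr_gt0 //; lra.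
have rho2 : rho <= 2^-1 by rewrite ge_min lexx orbT.
have rhoE : 4 * E * rho <= eps / 2.
  have h : rho <= eps / (8 * E) by rewrite ge_min lexx.
  by rewrite ler_pdivlMr ?mulr_gt0 // in h; lra.
(* Radius of the barrier ball around [x], which has to contain [y] well inside; [T = Ra + Rb] below
   covers that ball from [y]. *)
pose Rb := 2 * Ra + 1.
have rb1 : rho < Rb by rewrite /Rb; lra.
have rb2 : Ra < Rb by rewrite /Rb; lra.
have [beta b0 hb] := barrier n rho0 rb1 (ltW Ra0) rb2 lam0 lamLam.
pose eta := beta * eps / 4; have eta0 : 0 < eta by rewrite /eta !mulr_gt0 ?invr_gt0.
pose T := 3 * Ra + 1; have T0 : 0 < T by rewrite /T; lra.
(* The second difference ranges over an interval of length [4 E^2 s^2], which bounds the number of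
   jumps by [eta s^2]. *)
have [J hJ] : exists J : nat, 4 * E ^+ 2 / eta < J.+1%:R by eexists; exact: truncnS_gt.
rewrite ltr_pdivrMr // in hJ.
pose R1 := J.+1%:R * T + T + E + 1.
have JT : 0 <= J.+1%:R * T by rewrite mulr_ge0 // ltW.
exists R1; first by rewrite /R1 /T in JT *; lra.
move=> F K u U s y0 hF ru hs mb s0 hU.
have s2 : 0 < s ^+ 2 by rewrite exprn_gt0.
pose D := dd u (s *: e).
have ese : enorm (s *: e) <= E * s by rewrite enormZ gtr0_norm // mulrC ler_pM2r.
have inU x z : enorm (x - y0) <= (R1 - E) * s -> enorm z <= E * s -> U (x + z).
  move=> hx hz; apply: hU; rewrite addrAC; apply: le_trans (enormD _ _) _.
  by move: hx hz; clear -n lam0 lamLam; lra.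
have inU0 x : enorm (x - y0) <= (R1 - E) * s -> U x.
  by move=> hx; rewrite -[x]addr0; apply: inU => //; rewrite enorm0 mulr_ge0 ?(ltW s0) //; move: E1; clear -n lam0 lamLam; lra.
have inUm x : enorm (x - y0) <= (R1 - E) * s -> U (x - s *: e).
  by move=> hx; apply: inU => //; rewrite enormN.
have Db x : enorm (x - y0) <= (R1 - E) * s -> `|D x| <= 2 * E ^+ 2 * s ^+ 2.
  move=> hx; rewrite /D dd_mixd; apply: le_trans (mb _ _ _ _ _ _ _) _; rewrite ?subrK //.
  - exact: inUm.
  - exact: inU0.
  - exact: inU0.
  - exact: inU.
  rewrite -mulrA ler_wpM2l // -exprMn expr2 ler_pM //.
have Dlip x x' : enorm (x - y0) <= (R1 - E) * s -> enorm (x' - y0) <= (R1 - E) * s ->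
    `|D x - D x'| <= 4 * E * s * enorm (x - x').
  move=> hx hx'.
  have xE : x' + (x - x') = x by rewrite subrKC.
  have h1 := mb x' (s *: e) (x - x') (inU0 _ hx') (inU _ _ hx' ese).
  have h2 := mb (x' - s *: e) (s *: e) (x - x') (inUm _ hx').
  rewrite subrK in h2; rewrite (addrAC x') xE in h1; rewrite (addrAC x') xE in h2.
  have {}h1 := h1 (inU0 _ hx) (inU _ _ hx ese).
  have {}h2 := h2 (inU0 _ hx') (inUm _ hx) (inU0 _ hx).
  have -> : D x - D x' = mixd u x' (s *: e) (x - x') - mixd u (x' - s *: e) (s *: e) (x - x').
    have sh1 : x' + s *: e + (x - x') = x + s *: e by rewrite (addrAC x') xE.
    have sh2 : x' - s *: e + (x - x') = x - s *: e by rewrite (addrAC x') xE.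
    by rewrite /D /dd /mixd subrK sh1 sh2 xE; ring.
  have h3 : 2 * (enorm (s *: e) * enorm (x - x')) <= 2 * (E * s * enorm (x - x')).
    by rewrite ler_wpM2l // ler_wpM2r.
  move: h1 h2; rewrite !ler_norml; move: h3; clear -n lam0 lamLam.
  by move=> ? /andP[? ?] /andP[? ?]; apply/andP; split; lra.
pose good y := forall x, enorm (x - y) <= T * s -> D x <= D y + eta * s ^+ 2.
(* [j] counts the jumps still available: they fit in the region, and after all of them the second
   difference would exceed its bound [2 E^2 s^2]. *)
have chain (j : nat) : forall y, enorm (y - y0) + j%:R * T * s <= J.+1%:R * T * s ->
    (2 * E ^+ 2 - j%:R * eta) * s ^+ 2 < D y ->
    exists2 y', good y' & enorm (y' - y0) <= J.+1%:R * T * s.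
  elim: j => [|j IH] y hy hD.
    have : D y <= 2 * E ^+ 2 * s ^+ 2.
      apply: le_trans (ler_norm _) (Db _ _); rewrite !mul0r addr0 in hy.
      by apply: le_trans hy _; rewrite ler_pM2r // /R1; move: T0; clear -n lam0 lamLam; lra.
    by move: hD; rewrite mul0r subr0 => /lt_le_trans h /h; rewrite ltxx.
  have jT : 0 <= j%:R * T * s by rewrite !mulr_ge0 // ltW.
  have Ts : 0 <= T * s by rewrite mulr_ge0 // ltW.
  have hy' : enorm (y - y0) + j%:R * T * s + T * s <= J.+1%:R * T * s.
    by rewrite -[j.+1%:R]natr1 in hy; move: hy; clear -n lam0 lamLam; lra.
  have [gd|ng] := pselect (good y).
    by exists y => //; move: hy' jT Ts; clear -n lam0 lamLam; lra.
  have [x hx hDx] : exists2 x, enorm (x - y) <= T * s & D y + eta * s ^+ 2 < D x.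
    apply: contrapT => nx; apply: ng => x hx; rewrite leNgt; apply/negP => lt.
    by apply: nx; exists x.
  apply: (IH x).
    by have := enorm_tri x y y0; move: hx hy'; clear -n lam0 lamLam; lra.
  by rewrite -[j.+1%:R]natr1 in hD; move: hD hDx; clear -n lam0 lamLam; lra.
have [y gd hy] : exists2 y', good y' & enorm (y' - y0) <= J.+1%:R * T * s.
  apply: (chain J.+1 y0); first by rewrite subrr enorm0 add0r.
  have : - (2 * E ^+ 2 * s ^+ 2) <= D y0.
    have := Db y0; rewrite subrr enorm0 ler_norml => /(_ _)/andP[] //.
    by rewrite mulr_ge0 ?(ltW s0) // /R1; move: JT T0; clear -n lam0 lamLam; lra.
  have : 4 * E ^+ 2 * s ^+ 2 < J.+1%:R * eta * s ^+ 2 by rewrite ltr_pM2r.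
  by clear -n lam0 lamLam; lra.
have yin x : enorm (x - y) <= T * s -> enorm (x - y0) <= (R1 - E - 1) * s.
  by move=> hx; have := enorm_tri x y y0; rewrite /R1; move: hx hy; clear -n lam0 lamLam; lra.
have yin' x : enorm (x - y) <= T * s -> enorm (x - y0) <= (R1 - E) * s.
  by move=> /yin; move: s0; clear -n lam0 lamLam; lra.
have Ras : 0 <= Ra * s by rewrite mulr_ge0 // ltW.
have Es : 0 <= E * s by rewrite mulr_ge0 ?(ltW s0) //; move: E1; clear -n lam0 lamLam; lra.
have RT : Ra * s <= T * s by rewrite ler_pM2r // /T; move: Ra0; clear -n lam0 lamLam; lra.
exists y, (D y + eta * s ^+ 2); split; first by rewrite /R1 /T in hy *; move: hy Ras Es s0; clear -n lam0 lamLam; lra.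
move=> x hx; rewrite ler_norml; apply/andP; split; last first.
  have := gd x (le_trans hx RT); have : 0 < eps * s ^+ 2 by rewrite mulr_gt0.
  by rewrite -/D; clear -n lam0 lamLam; lra.
rewrite leNgt; apply/negP => lt.
have tri w : enorm (w - x) <= Rb * s -> enorm (w - y) <= T * s.
  by move=> hw; have := enorm_tri w x y; rewrite /Rb /T in hw *; move: hw hx; clear -n lam0 lamLam; lra.
have hd : exists2 d : R, 0 < d & forall w, enorm (w - x) <= Rb * s + enorm (s *: e) + d -> U w.
  exists s => // w hw; apply: hU.
  have := enorm_tri w x y0; have := enorm_tri x y y0.
  by rewrite /Rb /R1 /T in hw hy *; move: hw hx hy ese Ras s0; clear -n lam0 lamLam; lra.
have q1 : 0 <= eps / 2 * s ^+ 2 by rewrite !mulr_ge0 ?invr_ge0 ?ltW.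
have h : dd u (s *: e) y <= D y + eta * s ^+ 2 - beta * (eps / 2 * s ^+ 2).
  apply: (hb F K u U x (s *: e) _ _ s hF ru hs s0 hd q1); last by rewrite enormB.
    by move=> w hw; apply: gd; apply: tri.
  move=> w hw.
  have rs : rho * s <= Rb * s by rewrite ler_pM2r // /Rb; move: rho2 Ra0; clear -n lam0 lamLam; lra.
  have wT := tri _ (le_trans hw rs).
  have := Dlip w x (yin' _ wT) (yin' _ (le_trans hx RT)).
  have h1 : 4 * E * s * enorm (w - x) <= 4 * E * s * (rho * s) by rewrite ler_wpM2l // !mulr_ge0 ?(ltW s0) //; move: E1; clear -n lam0 lamLam; lra.
  have h2 : 4 * E * rho * s ^+ 2 <= eps / 2 * s ^+ 2 by rewrite ler_pM2r.
  rewrite ler_norml => /andP[_ h3]; rewrite -/D in lt *.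
  by move: h1 h2 h3 lt; clear -n lam0 lamLam; lra.
have h0 : eta * s ^+ 2 < beta * (eps / 2 * s ^+ 2).
  rewrite /eta (_ : beta * (eps / 2 * s ^+ 2) = 2 * (beta * eps / 4 * s ^+ 2)); last by field.
  have : 0 < beta * eps / 4 * s ^+ 2 by rewrite !mulr_gt0 ?invr_gt0.
  by clear -n lam0 lamLam; lra.
by rewrite -/D in h; move: h h0; clear -n lam0 lamLam; lra.
Qed.

(** Directions are treated one after another, each inside the flat ball of the previous one; the
    radius [R2] needed for the remaining directions is therefore fixed first and prescribed as the
    size of the ball for [e]. *)
Lemma flat_directions (es : seq vec) (Ra eps : R) : 0 < Ra -> 0 < eps ->
  exists2 R1 : R, Ra <= R1 & forall (F : mat -> R) K u U s y0,
    ell F lam Lam -> Reg K u -> sol F U u -> MB u 2 U -> 0 < s ->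
    (forall x, enorm (x - y0) <= R1 * s -> U x) ->
    exists y, enorm (y - y0) + Ra * s <= R1 * s /\
      forall e, e \in es -> exists m, forall x, enorm (x - y) <= Ra * s ->
        `|dd u (s *: e) x - m| <= eps * s ^+ 2.
Proof.
move=> Ra0 eps0; elim: es => [|e es [R2 hR2 IH]].
  exists Ra => // F K u U s y0 *; exists y0; split => //.
  by rewrite subrr enorm0 add0r.
have R20 : 0 < R2 by exact: lt_le_trans hR2.
have [R1 hR1 h1] := flat_direction e R20 eps0.
exists R1; first exact: le_trans hR1.
move=> F K u U s y0 hF ru hs mb s0 hU.
have [y1 [m [hy1 hm]]] := h1 F K u U s y0 hF ru hs mb s0 hU.
have [|y [hy he]] := IH F K u U s y1 hF ru hs mb s0.
  by move=> x hx; apply: hU; have := enorm_tri x y1 y0; lra.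
exists y; split; first by have := enorm_tri y y1 y0; lra.
move=> e'; rewrite inE => /predU1P[->|/he//].
by exists m => x hx; apply: hm; have := enorm_tri x y y1; lra.
Qed.

(** [P] holds at the corners of the path, so that a bound on a coordinate step is asked only where
    it is available. *)
Lemma coordinate_path (f : vec -> R) (A B : R) (P : vec -> Prop) x x' :
  (forall (l : seq 'I_n) j, P (x + \sum_(i <- l) (x' - x) 0 i *: e_ i) ->
     `|f (x + \sum_(i <- l) (x' - x) 0 i *: e_ i + (x' - x) 0 j *: e_ j)
       - f (x + \sum_(i <- l) (x' - x) 0 i *: e_ i)| <= A * `|(x' - x) 0 j| + B) ->
  (forall l : seq 'I_n, uniq l -> P (x + \sum_(i <- l) (x' - x) 0 i *: e_ i)) ->
  `|f x' - f x| <= A * (\sum_i `|(x' - x) 0 i|) + n%:R * B.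
Proof.
move=> hs hP; pose d := x' - x.
have main (l : seq 'I_n) : uniq l -> `|f (x + \sum_(i <- l) d 0 i *: e_ i) - f x|
     <= A * (\sum_(i <- l) `|d 0 i|) + (size l)%:R * B.
  elim: l => [|j l IH] /=; first by rewrite !big_nil addr0 subrr normr0 mulr0 mul0r addr0.
  move=> /andP[_ ul]; have := IH ul; have := hs l j (hP l ul); rewrite -/d !big_cons.
  rewrite [_ *: e_ j + _]addrC [x + (_ + _)]addrA -(natr1 (size l)).
  by rewrite !ler_norml => /andP[? ?] /andP[? ?]; apply/andP; split; lra.
have := main (index_enum 'I_n) (index_enum_uniq _).
rewrite -vec_sum_delta /d subrKC -/d.
by have -> : size (index_enum 'I_n) = n by rewrite /index_enum -enumT size_enum_ord.
Qed.

(** Fine control exists only for increments of length exactly [s]: whole steps are counted with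
    slope [A], and the last fraction of a step costs [B] once. *)
Lemma step_bound (f : R -> R) (A B s : R) (T : R) : 0 < s -> 0 <= A ->
  (forall t, 0 <= t -> t + s <= T -> `|f (t + s) - f t| <= A * s) ->
  (forall t h, 0 <= t -> 0 <= h <= s -> t + h <= T -> `|f (t + h) - f t| <= B) ->
  forall t, 0 <= t <= T -> `|f t - f 0| <= A * t + B.
Proof.
move=> s0 A0 h1 h2 t /andP[t0 tT].
pose k := Num.truncn (t / s).
have /andP[kl ku] := truncn_itv (divr_ge0 t0 (ltW s0)); rewrite -/k in kl ku.
rewrite ler_pdivlMr // in kl; rewrite ltr_pdivrMr // in ku.
have main (j : nat) : j%:R * s <= T -> `|f (j%:R * s) - f 0| <= A * (j%:R * s).
  elim: j => [|j IH] jT; first by rewrite mul0r subrr normr0 mulr0.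
  have e : j.+1%:R * s = j%:R * s + s by rewrite -natr1; ring.
  rewrite e in jT *; have := IH _; have := h1 (j%:R * s); rewrite mulr_ge0 ?(ltW s0) // => /(_ isT jT).
  have jT' : j%:R * s <= T by lra.
  move=> a1 /(_ jT') a2; move: a1 a2.
  by rewrite mulrDr !ler_norml => /andP[? ?] /andP[? ?]; apply/andP; split; lra.
have kT : k%:R * s <= T by lra.
have := main k kT; have := h2 (k%:R * s) (t - k%:R * s); rewrite subrKC.
have -> : 0 <= k%:R * s by rewrite mulr_ge0 // ltW.
have -> : 0 <= t - k%:R * s <= s by rewrite subr_ge0 kl /= -natr1 in ku *; lra.
move=> /(_ isT isT tT) a1 a2; have a3 : A * (k%:R * s) <= A * t by rewrite ler_wpM2l.
by move: a1 a2; rewrite !ler_norml => /andP[? ?] /andP[? ?]; apply/andP; split; lra.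
Qed.

(** Second differences along [a], [b] and [a + b] determine only the sum of the mixed differences at
    [x] and at [x - (a + b)]. These two agree up to [4 * eps], since moving the base point by [b]
    and then by [a] changes the mixed difference by increments of nearly constant functions. *)
Lemma mixed_near_cst u a b y (s Rb eps ma mb mab : R) :
  enorm a <= s -> enorm b <= s -> 0 <= s ->
  (forall x, enorm (x - y) <= Rb + 3 * s -> `|dd u a x - ma| <= eps) ->
  (forall x, enorm (x - y) <= Rb + 3 * s -> `|dd u b x - mb| <= eps) ->
  (forall x, enorm (x - y) <= Rb + 3 * s -> `|dd u (a + b) x - mab| <= eps) ->
  forall x, enorm (x - y) <= Rb -> `|mixd u x a b - (mab - ma - mb) / 2| <= 4 * eps.
Proof.
move=> as_ bs s0 ha hb hab x hx.
have nr w : enorm w <= 3 * s -> enorm (x + w - y) <= Rb + 3 * s.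
  by move=> hw; rewrite addrAC; apply: le_trans (enormD _ _) _; rewrite lerD.
have aa : enorm (a + b) <= 2 * s by apply: le_trans (enormD _ _) _; lra.
pose D w := mixd u w a b.
have e0 : dd u (a + b) x - dd u a x - dd u b x = D x + D (x - (a + b)).
  rewrite /dd /D /mixd.
  have -> : x - (a + b) + a = x - b by apply/rowP => i; rewrite !mxE; ring.
  have -> : x - (a + b) + b = x - a by apply/rowP => i; rewrite !mxE; ring.
  have -> : x - b + b = x by rewrite subrK.
  by rewrite addrA; ring.
have e1 : D (x - b) - D (x - (a + b)) = dd u a x - dd u a (x - b).
  rewrite /D /dd /mixd.
  have -> : x - (a + b) + a = x - b by apply/rowP => i; rewrite !mxE; ring.
  have -> : x - (a + b) + b = x - a by apply/rowP => i; rewrite !mxE; ring.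
  have -> : x - b + b = x by rewrite subrK.
  have -> : x - b + a + b = x + a by apply/rowP => i; rewrite !mxE; ring.
  have -> : x - b - a = x - (a + b) by apply/rowP => i; rewrite !mxE; ring.
  by ring.
have e2 : D x - D (x - b) = dd u b (x + a) - dd u b x.
  rewrite /D /dd /mixd.
  have -> : x - b + b = x by rewrite subrK.
  have -> : x - b + a + b = x + a by apply/rowP => i; rewrite !mxE; ring.
  have -> : x - b + a = x + a - b by apply/rowP => i; rewrite !mxE; ring.
  by ring.
have x3 : enorm (x - y) <= Rb + 3 * s by lra.
have a1 := ha x x3; have b1 := hb x x3; have c1 := hab x x3.
have a2 : `|dd u a (x - b) - ma| <= eps by apply/ha/nr; rewrite enormN; lra.
have b2 : `|dd u b (x + a) - mb| <= eps by apply/hb/nr; lra.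
rewrite -/(D x); move: a1 b1 c1 a2 b2; rewrite !ler_norml.
move=> /andP[? ?] /andP[? ?] /andP[? ?] /andP[? ?] /andP[? ?]; apply/andP; split; lra.
Qed.

End FlatBall.

(** * A ball on which the gradient is nearly affine *)

Section FlatBall2.
Variables (R : realType) (n : nat) (lam Lam : R).
Local Notation vec := 'rV[R]_n.
Local Notation mat := 'M[R]_n.
Local Notation e_ i := (delta_mx 0 i : vec).
Implicit Types (x y z a b e w : vec) (u : vec -> R) (U : set vec) (c K s t : R).
Hypothesis lam0 : 0 < lam.
Hypothesis lamLam : lam <= Lam.

(** The increment of [u] over a step [s e_i] is nearly affine, by summing mixed differences along a
    coordinate path, and it is [s] times the gradient up to [2 s^2]. After division by [s], the
    errors without a factor [eps] are multiples of [s], small against the radius [Ra * s] once [Ra]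
    is large. *)
Lemma flat_ball (del : R) : 0 < del -> exists2 kap : R, 0 < kap &
  forall (F : mat -> R) K u G, ell F lam Lam -> Reg K u -> has_grad u G K ->
    sol F (eball 0 1) u -> MB u 2 (eball 0 1) ->
  exists y (H : mat), [/\ symmx H, enorm y + kap <= 8^-1, (forall i j, `|H i j| <= 6) &
    forall x x', enorm (x - y) <= kap -> enorm (x' - y) <= kap ->
      forall i, `|G x 0 i - G x' 0 i - ((x - x') *m H) 0 i| <= del * kap].
Proof.
move=> del0; pose N : R := n%:R; have N0 : 0 <= N by [].
(* [4] comes from replacing the gradient by an increment at two points, [8 * N] from the incomplete
   last step in each coordinate. Together they use half of [del]; the errors with [eps] use the
   other half. *)
have [Ra RaE] : exists Ra, Ra = 2 * (4 + 8 * N) / del by eexists.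
have Ra0 : 0 < Ra by rewrite RaE divr_gt0 //; lra.
have Ra1 : Ra * del = 2 * (4 + 8 * N) by rewrite RaE divfK // gt_eqF.
have [eps [eps0 eps1 epsN]] : exists eps : R, [/\ 0 < eps, eps <= 1 & 16 * N * eps <= del].
  exists (Num.min 1 (del / (16 * N + 1))).
  have p0 : 0 < 16 * N + 1 by lra.
  split; first by rewrite lt_min ltr01 divr_gt0.
    by rewrite ge_min lexx.
  have h : Num.min 1 (del / (16 * N + 1)) <= del / (16 * N + 1) by rewrite ge_min lexx orbT.
  have h0 : 0 <= Num.min 1 (del / (16 * N + 1)) by rewrite le_min ler01 divr_ge0 // ltW.
  by rewrite ler_pdivlMr // in h; lra.
pose es := [seq e_ i | i <- enum 'I_n] ++ [seq e_ i + e_ j | i <- enum 'I_n, j <- enum 'I_n].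
(* Coordinate paths between points of the ball of radius [Ra s] may leave it by up to [2 N Ra s]. *)
have [Rc RcE] : exists Rc, Rc = (2 * N + 3) * Ra by eexists.
have Rc0 : 0 < Rc by rewrite RcE mulr_gt0 //; lra.
have Rc3 : 0 < Rc + 3 by lra.
have [R1 hR1 hflat] := flat_directions lam0 lamLam es Rc3 eps0.
have R10 : 0 < R1 by lra.
have [s sE] : exists s, s = (16 * R1)^-1 by eexists.
have s0 : 0 < s by rewrite sE invr_gt0 mulr_gt0.
have Rs : R1 * s = 16^-1 by rewrite sE; field; rewrite gt_eqF.
have s2 : 0 < s ^+ 2 by rewrite exprn_gt0.
exists (Ra * s); first exact: mulr_gt0.
move=> F K u G hF ru hG hs mb.
have [|y [hy hes]] := hflat F K u (eball 0 1) s 0 hF ru hs mb s0.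
  by move=> x; rewrite Rs /eball /= => h; lra.
rewrite subr0 Rs in hy.
have inB w : enorm (w - y) <= (Rc + 3) * s -> eball 0 1 w.
  by rewrite /eball /= subr0 => h; have := enorm_tri w y 0; rewrite !subr0; move: h hy; clear -n lam0 lamLam; lra.
have /choice[m hm] : forall e, exists m, e \in es -> forall x, enorm (x - y) <= (Rc + 3) * s ->
        `|dd u (s *: e) x - m| <= eps * s ^+ 2.
  by move=> e; have [/hes[m h]|//] := boolP (e \in es); [exists m|exists 0].
have ees i : e_ i \in es by rewrite mem_cat map_f ?mem_enum.
have eees i j : e_ i + e_ j \in es.
  rewrite mem_cat; apply/orP; right; apply/allpairsP; exists (i, j) => /=.
  by rewrite !mem_enum.
pose H : mat := \matrix_(i, j) ((m (e_ i + e_ j) - m (e_ i) - m (e_ j)) / (2 * s ^+ 2)).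
have ese i : enorm (s *: e_ i) = s by rewrite enormZ enorm_delta mulr1 gtr0_norm.
have sn : s ^+ 2 != 0 by rewrite gt_eqF.
have mixH x i j : enorm (x - y) <= Rc * s ->
    `|mixd u x (s *: e_ i) (s *: e_ j) - s ^+ 2 * H i j| <= 4 * (eps * s ^+ 2).
  move=> hx.
  have -> : s ^+ 2 * H i j = (m (e_ i + e_ j) - m (e_ i) - m (e_ j)) / 2.
    by rewrite mxE; field; rewrite gt_eqF.
  have r3 : Rc * s + 3 * s = (Rc + 3) * s by ring.
  apply: (@mixed_near_cst R n u (s *: e_ i) (s *: e_ j) y s (Rc * s)); rewrite ?ese ?(ltW s0) ?r3 //.
  - exact: hm.
  - exact: hm.
  - by rewrite -scalerDr; exact: hm.
have inBw x z w : enorm (x - y) <= Rc * s -> enorm z <= s -> enorm w <= s -> eball 0 1 (x + z + w).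
  move=> hx hz hw; apply: inB.
  have -> : x + z + w - y = (x - y) + (z + w) by apply/rowP => i; rewrite !mxE; ring.
  by apply: le_trans (enormD _ _) _; have := enormD z w; move: hx hz hw s0; clear -n lam0 lamLam; lra.
have z0 : enorm (0 : vec) <= s by rewrite enorm0 ltW.
have inB0 x : enorm (x - y) <= Rc * s -> eball 0 1 x.
  by move=> hx; rewrite -[x]addr0 -[x + 0]addr0; exact: inBw.
have inB1 x z : enorm (x - y) <= Rc * s -> enorm z <= s -> eball 0 1 (x + z).
  by move=> hx hz; rewrite -[x + z]addr0; exact: inBw.
have mixb x i j t : 0 <= t <= s -> enorm (x - y) <= Rc * s ->
   `|mixd u x (s *: e_ i) (t *: e_ j)| <= 2 * (s * t).
  move=> /andP[t0 ts] hx.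
  have et : enorm (t *: e_ j) = t by rewrite enormZ enorm_delta mulr1 ger0_norm.
  have := mb x (s *: e_ i) (t *: e_ j); rewrite ese et; apply.
  - exact: inB0.
  - by apply: inB1; rewrite // ese.
  - by apply: inB1; rewrite // et.
  - by apply: inBw; rewrite // ?ese ?et.
have Rcs : 0 <= Rc * s by rewrite mulr_ge0 // ltW.
have yy : enorm (y - y) <= Rc * s by rewrite subrr enorm0.
have H6 i j : `|H i j| <= 6.
  have := mixH y i j yy; have := mixb y i j s _ yy; rewrite lexx ltW // => /(_ isT) h1 h2.
  have h3 : eps * s ^+ 2 <= s ^+ 2 by rewrite ler_piMl // ltW.
  rewrite -(ler_pM2l s2) -{1}(gtr0_norm s2) -normrM.
  move: h1 h2; rewrite !ler_norml; move: h3; clear -n lam0 lamLam.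
  by move=> ? /andP[? ?] /andP[? ?]; apply/andP; split; lra.
have sH : symmx H.
  by apply/matrixP => i j; rewrite !mxE [e_ j + _]addrC; ring.
exists y, H; split => //.
  have : Ra * s <= (Rc + 3) * s.
    rewrite ler_pM2r // RcE; have : 0 <= N * Ra by rewrite mulr_ge0 // ltW.
    by move: Ra0; clear -n lam0 lamLam; lra.
  by move: hy; clear -n lam0 lamLam; lra.
move=> x x' hx hx' i.
pose f w := u (w + s *: e_ i) - u w - s * (w *m H) 0 i.
have fd w j t : f (w + t *: e_ j) - f w = mixd u w (s *: e_ i) (t *: e_ j) - s * t * H i j.
  have HT : H j i = H i j by rewrite -{1}sH [H^T _ _]mxE.
  have eH : ((w + t *: e_ j) *m H) 0 i = (w *m H) 0 i + t * H i j.
    rewrite -[LHS]dot_deltar mulmxDl dotDl -scalemxAl dotZl !dot_deltar -rowE.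
    by rewrite [row j H 0 i]mxE HT.
  by rewrite /f /mixd eH (addrAC w (t *: e_ j)); ring.
have loc b j t : 0 <= t <= s -> enorm (b - y) <= Rc * s -> `|f (b + t *: e_ j) - f b| <= 8 * s ^+ 2.
  move=> /[dup] ts /andP[t0 t1] hb; rewrite fd.
  have := mixb b i j t ts hb; have st : s * t <= s ^+ 2 by rewrite expr2 ler_pM2l.
  have st0 : 0 <= s * t by rewrite mulr_ge0 // ltW.
  have : `|s * t * H i j| <= s * t * 6 by rewrite normrM ger0_norm // ler_wpM2l.
  rewrite !ler_norml; move: st; clear -n lam0 lamLam.
  by move=> ? /andP[? ?] /andP[? ?]; apply/andP; split; lra.
have loc1 b j : enorm (b - y) <= Rc * s -> `|f (b + s *: e_ j) - f b| <= 4 * eps * s * s.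
  by move=> hb; rewrite fd; have := mixH b i j hb; rewrite -expr2 -!mulrA expr2.
have A0 : 0 <= 4 * eps * s by rewrite !mulr_ge0 // ltW.
have shift w v t : enorm (w - y) + `|t| <= Rc * s -> enorm v = 1 -> enorm (w + t *: v - y) <= Rc * s.
  move=> h v1; rewrite addrAC; apply: le_trans (enormD _ _) _.
  by rewrite enormZ v1 mulr1.
have seg w j t : enorm (w - y) + `|t| <= Rc * s ->
    `|f (w + t *: e_ j) - f w| <= (4 * eps * s) * `|t| + 8 * s ^+ 2.
  move=> hw; have [t0|t0] := leP 0 t.
    rewrite (ger0_norm t0) in hw *.
    have := @step_bound R (fun q => f (w + q *: e_ j)) (4 * eps * s) (8 * s ^+ 2) s t s0 A0.
    rewrite scale0r addr0; apply; last by rewrite t0 lexx.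
    - move=> q q0 qt; rewrite scalerDl addrA; apply: loc1; apply: shift; rewrite ?enorm_delta // ger0_norm //.
      by move: hw qt s0; clear -n lam0 lamLam; lra.
    - move=> q h q0 hh qt; rewrite scalerDl addrA; apply: loc => //; apply: shift; rewrite ?enorm_delta // ger0_norm //.
      by move: hw qt hh; clear -n lam0 lamLam => ? ? /andP[? ?]; lra.
  rewrite (ltr0_norm t0) in hw *.
  have := @step_bound R (fun q => f (w + (- q) *: e_ j)) (4 * eps * s) (8 * s ^+ 2) s (- t) s0 A0.
  rewrite oppr0 scale0r addr0 => sb; rewrite -{1}[t]opprK; apply: sb; last by rewrite lexx andbT; move: t0; clear -n lam0 lamLam; lra.
  - move=> q q0 qt; rewrite distrC.
    have -> : w + - q *: e_ j = w + - (q + s) *: e_ j + s *: e_ j.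
      by rewrite -addrA -scalerDl; congr (_ + _ *: _); ring.
    by apply: loc1; apply: shift; rewrite ?enorm_delta // normrN ger0_norm; move: hw q0 qt s0; clear -n lam0 lamLam; lra.
  - move=> q h q0 /[dup] hh /andP[h0 h1] qt; rewrite distrC.
    have -> : w + - q *: e_ j = w + - (q + h) *: e_ j + h *: e_ j.
      by rewrite -addrA -scalerDl; congr (_ + _ *: _); ring.
    by apply: loc => //; apply: shift; rewrite ?enorm_delta // normrN ger0_norm; move: hw q0 qt h0; clear -n lam0 lamLam; lra.
have dxx : enorm (x' - x) <= 2 * Ra * s.
  by have := enorm_tri x' y x; rewrite (enormB y x); move: hx hx'; clear -n lam0 lamLam; lra.
have sumd : \sum_j `|(x' - x) 0 j| <= N * (2 * Ra * s).
  by apply: le_trans (sum_abs_le_enorm _) _; rewrite ler_wpM2l.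
have NRs : 0 <= N * Ra * s by rewrite !mulr_ge0 // ltW.
have fxx : `|f x' - f x| <= (4 * eps * s) * (\sum_j `|(x' - x) 0 j|) + N * (8 * s ^+ 2).
  apply: (@coordinate_path R n f _ _ (fun w => enorm (w - y) <= (2 * N + 1) * Ra * s)).
    move=> l j hl; apply: seg; apply: le_trans (lerD hl (le_trans (coord_le_enorm _ _) dxx)) _.
    by rewrite RcE; clear -n lam0 lamLam; lra.
  move=> l ul; rewrite addrAC; apply: le_trans (enormD _ _) _.
  apply: (@le_trans _ _ (Ra * s + \sum_j `|(x' - x) 0 j|)); last by move: sumd; clear -n lam0 lamLam; lra.
  rewrite lerD // (big_uniq _ ul) /= big_mkcond /=.
  apply: (@le_trans _ _ (\sum_j enorm (if j \in l then (x' - x) 0 j *: e_ j else 0))).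
    by elim/big_rec2: _ => [|j p q _ h]; rewrite ?enorm0 //; apply: le_trans (enormD _ _) _; rewrite lerD2l.
  apply: ler_sum => j _; case: ifP => _; last by rewrite enorm0.
  by rewrite enormZ enorm_delta mulr1.
have RaRc : Ra * s <= Rc * s.
  rewrite ler_pM2r // RcE; have : 0 <= N * Ra by rewrite mulr_ge0 // ltW.
  by move: Ra0; clear -n lam0 lamLam; lra.
have gx w : enorm (w - y) <= Rc * s -> `|u (w + s *: e_ i) - u w - s * G w 0 i| <= 2 * s ^+ 2.
  move=> hw; have := MB_grad mb hG (ler0n R 2) (inB0 _ hw) (inB1 _ (s *: e_ i) hw _).
  by rewrite ese lexx => /(_ isT); rewrite dotZr dot_deltar.
have g1 := gx x (le_trans hx RaRc); have g2 := gx x' (le_trans hx' RaRc).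
rewrite -(ler_pM2l s0) -{1}(gtr0_norm s0) -normrM.
have sum2 : 4 * eps * s * (\sum_j `|(x' - x) 0 j|) <= 4 * eps * s * (N * (2 * Ra * s)) by rewrite ler_wpM2l.
have b1 : 4 * eps * s * (N * (2 * Ra * s)) <= 2^-1 * del * Ra * s ^+ 2.
  rewrite (_ : 4 * eps * s * (N * (2 * Ra * s)) = (16 * N * eps) * (2^-1 * Ra * s ^+ 2)); last by field.
  rewrite (_ : 2^-1 * del * Ra * s ^+ 2 = del * (2^-1 * Ra * s ^+ 2)); last by ring.
  by rewrite ler_wpM2r // !mulr_ge0 ?invr_ge0 // ltW.
have b2 : (4 + 8 * N) * s ^+ 2 = 2^-1 * del * Ra * s ^+ 2.
  by rewrite (_ : 2^-1 * del * Ra = 2^-1 * (Ra * del)); [rewrite Ra1; field|ring].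
have E : (x - x') *m H = x *m H - x' *m H by rewrite mulmxBl.
have {}E : ((x - x') *m H) 0 i = (x *m H) 0 i - (x' *m H) 0 i.
  by rewrite E -[LHS]dot_deltar dotBl !dot_deltar.
rewrite E; move: fxx g1 g2; rewrite /f !ler_norml; move: sum2 b1 b2; clear -n lam0 lamLam.
by move=> ? ? ? /andP[? ?] /andP[? ?] /andP[? ?]; apply/andP; split; lra.
Qed.

End FlatBall2.

(** * Bernstein's method at a maximum point *)

Section BernsteinPoint.
Variables (R : realType) (n : nat).
Local Notation vec := 'rV[R]_n.
Local Notation mat := 'M[R]_n.
Implicit Types (x y z p : vec) (u f g : vec -> R) (X : mat) (K t c d : R).

Lemma jet2_lip f x a p X : jet2 f x a p X -> exists C d, [/\ 0 <= C, 0 < d, d <= 1 &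
  forall z, enorm z < d -> `|f (x + z) - a| <= C * enorm z].
Proof.
move=> [C [d [C0 d0 hf]]]; exists (C + enorm p + mabs X), (Num.min d 1); split.
- by rewrite !addr_ge0 ?mabs_ge0.
- by rewrite lt_min d0 ltr01.
- by rewrite ge_min lexx orbT.
move=> z; rewrite lt_min => /andP[/hf hz z1].
have t0 := enorm_ge0 z; have t1 := ltW z1.
have t2 : enorm z ^+ 2 <= enorm z by rewrite expr2 ler_piMl.
have t3 : enorm z ^+ 3 <= enorm z.
  by rewrite exprS; apply: le_trans (ler_wpM2l t0 (le_trans t2 t1)) _; rewrite mulr1.
have h1 := cauchy_schwarz p z; have h2 := qf_le X z; rewrite -enorm2 in h2.
have h3 : mabs X * enorm z ^+ 2 <= mabs X * enorm z by rewrite ler_wpM2l ?mabs_ge0.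
have h4 : C * enorm z ^+ 3 <= C * enorm z by rewrite ler_wpM2l.
have h5 : 0 <= mabs X * enorm z by rewrite mulr_ge0 ?mabs_ge0.
move: hz h1 h2; rewrite !mulrDl !ler_norml => /andP[? ?] /andP[? ?] /andP[? ?].
by apply/andP; split; lra.
Qed.

Lemma jet2_crit f x p X C d : jet2 f x 0 p X -> 0 < d ->
  (forall z, enorm z < d -> f (x + z) <= C * enorm z ^+ 2) -> p = 0.
Proof.
move=> [C1 [d1 [C10 d10 hf]]] d0 hC; apply/eqP; rewrite -enorm_eq0; apply/negPn/negP => pn.
have pp : 0 < enorm p by rewrite lt_def pn enorm_ge0.
pose m := Num.min (Num.min d d1) 1; have m0 : 0 < m by rewrite !lt_min d0 d10 ltr01.
pose B := `|C| + C1 + mabs X.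
have B0 : 0 <= B by rewrite !addr_ge0 ?mabs_ge0.
have B1 : 0 < B + 1 by rewrite ltr_wpDl.
pose t := Num.min (m / 2) (enorm p / (2 * (B + 1))).
have t0 : 0 < t by rewrite lt_min !divr_gt0 // mulr_gt0.
have tm : t < m by apply: (@le_lt_trans _ _ (m / 2)); [rewrite ge_min lexx|lra].
have tp : t * (B + 1) <= enorm p / 2.
  have h : t <= enorm p / (2 * (B + 1)) by rewrite ge_min lexx orbT.
  by rewrite ler_pdivlMr ?mulr_gt0 // in h; lra.
pose z := (t / enorm p) *: p.
have ez : enorm z = t by rewrite enormZ ger0_norm ?divr_ge0 ?(ltW t0) // divfK // gt_eqF.
have [td td1 t1] : [/\ t < d, t < d1 & t < 1].
  by move: tm; rewrite !lt_min => /andP[/andP[-> ->] ->].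
have h1 := hC z; have h2 := hf z; rewrite ez in h1 h2.
have {}h1 := h1 td; have {}h2 := h2 td1.
have dp : dot p z = t * enorm p.
  by rewrite dotZr -enorm2; field; rewrite gt_eqF.
have h3 := qf_le X z; rewrite -enorm2 ez in h3.
rewrite dp in h2.
have t3 : C1 * t ^+ 3 <= C1 * t ^+ 2.
  by rewrite ler_wpM2l // exprS ler_piMl ?exprn_ge0 // ltW.
have C3 : C * t ^+ 2 <= `|C| * t ^+ 2 by rewrite ler_wpM2r ?exprn_ge0 ?(ltW t0) // ler_norm.
have X3 : 0 <= mabs X * t ^+ 2 by rewrite mulr_ge0 ?mabs_ge0 // exprn_ge0 // ltW.
have key : t * enorm p <= B * t ^+ 2.
  by rewrite /B; move: h2 h3; rewrite !ler_norml => /andP[? ?] /andP[? ?]; lra.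
have : t * enorm p <= t * (B * t) by rewrite (_ : t * (B * t) = B * t ^+ 2) //; ring.
rewrite ler_pM2l // => k2; lra.
Qed.

(** Let [v] be the deviation of [u] from its tangent plane at [x]. Then [Psi] minus its maximum is
    [Gam - kp * v] plus a nonnegative multiple of [v^2]; dropping the latter gives [v >= Gam / kp],
    a lower bound for [u] by a known jet. The division costs a cubic error only, because [kp]
    differs from [kap] by [O(|z|)] and [Gam] is [O(|z|^2)] once its gradient vanishes. *)
Lemma bernstein_touch u x (p : vec) K (eta P q1 q2 : vec -> R) (A c0 c1 : R)
    (eta0 P0 b1 b2 : R) (deta pP p1 p2 : vec) (Xe XP X1 X2 : mat) d :
  0 <= A -> 0 <= c0 -> 0 <= c1 ->
  (forall z, `|u (x + z) - u x - dot p z| <= K * enorm z ^+ 2) ->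
  jet2 eta x eta0 deta Xe -> jet2 P x P0 pP XP -> jet2 q1 x b1 p1 X1 -> jet2 q2 x b2 p2 X2 ->
  let Psi y := eta y * (P y - c0 * u y) + A * ((q1 y - c1 * u y) ^+ 2 + (q2 y - c1 * u y) ^+ 2) in
  0 < d -> (forall z, enorm z < d -> Psi (x + z) <= Psi x) ->
  let W := P0 - c0 * u x in let w := pP - c0 *: p in
  let Q1 := b1 - c1 * u x in let Q2 := b2 - c1 * u x in
  let xi1 := p1 - c1 *: p in let xi2 := p2 - c1 *: p in
  let kap := c0 * eta0 + 2 * A * c1 * (Q1 + Q2) in
  eta x = eta0 -> P x = P0 -> q1 x = b1 -> q2 x = b2 -> 0 < kap ->
  W *: deta + eta0 *: w + (2 * A * Q1) *: xi1 + (2 * A * Q2) *: xi2 = 0 /\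
  touch_below u x (kap^-1 *: (W *: Xe + eta0 *: XP + (outer deta w + outer w deta)
    + (2 * A * Q1) *: X1 + (2 * A) *: outer xi1 xi1 + (2 * A * Q2) *: X2 + (2 * A) *: outer xi2 xi2)).
Proof.
move=> A0 c00 c10 hu je jP j1 j2 Psi d0 hmax W w Q1 Q2 xi1 xi2 kap ee eP e1 e2 kap0.
pose s0 y := u x + dot p (y - x).
have xz z : x + z - x = z by rewrite addrAC subrr add0r.
have js : jet2 s0 x (u x) p 0.
  exists 0, 1; split => // z _; rewrite mul0r /s0 xz qf0 mulr0 addr0.
  by rewrite subrr normr0.
have jf0 := jet2D jP (jet2Z (- c0) js); have jf1 := jet2D j1 (jet2Z (- c1) js).
have jf2 := jet2D j2 (jet2Z (- c1) js).
pose f0 y := P y + - c0 * s0 y; pose f1 y := q1 y + - c1 * s0 y; pose f2 y := q2 y + - c1 * s0 y.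
pose Gam y := eta y * f0 y + A * (f1 y * f1 y + f2 y * f2 y) + - Psi x.
pose kp y := c0 * eta y + 2 * A * c1 * (f1 y + f2 y).
have jG0 := jet2D (jet2D (jet2M je jf0) (jet2Z A (jet2D (jet2M jf1 jf1) (jet2M jf2 jf2)))) (jet2_cst (- Psi x) x).
pose pG := W *: deta + eta0 *: w + (2 * A * Q1) *: xi1 + (2 * A * Q2) *: xi2.
pose XG := W *: Xe + eta0 *: XP + (outer deta w + outer w deta)
    + (2 * A * Q1) *: X1 + (2 * A) *: outer xi1 xi1 + (2 * A * Q2) *: X2 + (2 * A) *: outer xi2 xi2.
have jG : jet2 Gam x 0 pG XG.
  apply: (jet2_eq jG0) => //.
  - by rewrite /Psi ee eP e1 e2; ring.
  - rewrite addr0 /pG -/w /W /Q1 /Q2 -/xi1 -/xi2 !scaleNr -/w -/xi1 -/xi2.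
    by apply/rowP => i; rewrite !mxE; ring.
  - rewrite addr0 /XG !scaleNr scaler0 oppr0 !addr0 -/w -/xi1 -/xi2 /W /Q1 /Q2.
    move: (outer _ _) (outer _ _) (outer _ _) (outer _ _) => O1 O2 O3 O4.
    by apply/matrixP => i j; rewrite !mxE; ring.
have jk0 := jet2D (jet2Z c0 je) (jet2Z (2 * A * c1) (jet2D jf1 jf2)).
have [Ck [dk [Ck0 dk0 dk1 hk]]] := jet2_lip jk0.
have kE : c0 * eta0 + 2 * A * c1 * (b1 + - c1 * u x + (b2 + - c1 * u x)) = kap.
  by rewrite /kap /Q1 /Q2; ring.
rewrite kE in hk.
have main z : enorm z < d -> Gam (x + z) <= kp (x + z) * (u (x + z) - s0 (x + z)).
  move=> /hmax h; rewrite /Gam.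
  have E : Psi (x + z) = eta (x + z) * f0 (x + z) - c0 * eta (x + z) * (u (x + z) - s0 (x + z))
     + A * ((f1 (x + z) - c1 * (u (x + z) - s0 (x + z))) ^+ 2 + (f2 (x + z) - c1 * (u (x + z) - s0 (x + z))) ^+ 2).
    by rewrite /Psi /f0 /f1 /f2; ring.
  rewrite E in h; move: h; set v := u (x + z) - s0 (x + z) => h.
  have sq : 0 <= A * (2 * (c1 * v) ^+ 2) by apply: mulr_ge0 => //; apply: mulr_ge0 => //; exact: sqr_ge0.
  by rewrite /kp; move: sq h; clear; lra.
have us z : `|u (x + z) - s0 (x + z)| <= K * enorm z ^+ 2.
  have := hu z; rewrite /s0 xz; apply: le_of_eq_norm; ring.
have [d2 [d20 d2d d2k hk2]] : exists d2 : R, [/\ 0 < d2, d2 <= d, d2 <= dk &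
    forall z, enorm z < d2 -> kap / 2 <= kp (x + z) <= 2 * kap].
  exists (Num.min (Num.min d dk) (kap / (2 * (Ck + 1)))).
  have Ck1 : 0 < Ck + 1 by rewrite ltr_wpDl.
  split.
  - by rewrite !lt_min d0 dk0 divr_gt0 // mulr_gt0.
  - by rewrite !ge_min lexx.
  - by rewrite !ge_min lexx orbT.
  move=> z; rewrite !lt_min => /andP[/andP[zd zk] zC].
  have := hk z zk; rewrite ltr_pdivlMr ?mulr_gt0 // in zC.
  have := enorm_ge0 z; rewrite -/(kp (x + z)) ler_norml => t0 /andP[].
  by move: t0 zC kap0; clear; move=> ? ? ? ? ?; apply/andP; split; lra.
have crit : pG = 0.
  apply: (jet2_crit (C := 2 * kap * `|K|) jG d20) => z zd.
  apply: le_trans (main z (lt_le_trans zd d2d)) _.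
  have /andP[k1 k2] := hk2 z zd.
  have k0 : 0 <= kp (x + z) by apply: le_trans k1; rewrite divr_ge0 // ltW.
  apply: (@le_trans _ _ (kp (x + z) * (`|K| * enorm z ^+ 2))).
    rewrite ler_wpM2l //; apply: le_trans (ler_norm _) _; apply: le_trans (us z) _.
    by rewrite ler_wpM2r ?exprn_ge0 // ler_norm.
  by rewrite -[leRHS]mulrA ler_wpM2r // mulr_ge0 // exprn_ge0.
split; first exact: crit.
have [CG [dG [CG0 dG0 hG]]] := jG; rewrite crit in hG.
pose CX := CG + mabs XG; have CX0 : 0 <= CX by rewrite addr_ge0 ?mabs_ge0.
exists p, (kap^-1 * CG + 2 * kap^-1 ^+ 2 * CX * Ck), (Num.min (Num.min d2 dG) 1).
split; first by rewrite !lt_min d20 dG0 ltr01.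
move=> z; rewrite !lt_min => /andP[/andP[z2 zG] z1].
have zd := lt_le_trans z2 d2d; have zk := lt_le_trans z2 d2k.
have m1 := main z zd; have hz := hG z zG; have hkz := hk z zk.
have /andP[k1 k2] := hk2 z z2.
have kz0 : 0 < kp (x + z) by apply: lt_le_trans k1; rewrite divr_gt0.
rewrite dot0l !add0r in hz.
have t0 := enorm_ge0 z.
have t32 : enorm z ^+ 3 <= enorm z ^+ 2 by rewrite exprS ler_piMl ?exprn_ge0 // ltW.
have GX : `|Gam (x + z)| <= CX * enorm z ^+ 2.
  have h2 := qf_le XG z; rewrite -enorm2 in h2.
  have h3 : CG * enorm z ^+ 3 <= CG * enorm z ^+ 2 by rewrite ler_wpM2l.
  have h4 : 0 <= mabs XG * enorm z ^+ 2 by rewrite mulr_ge0 ?mabs_ge0 // exprn_ge0.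
  move: hz h2; rewrite /CX mulrDl !ler_norml; move: h3 h4; clear.
  by move=> h3 h4 /andP[? ?] /andP[? ?]; apply/andP; split; lra.
have m2 : kap^-1 * Gam (x + z) - 2 * kap^-1 ^+ 2 * CX * Ck * enorm z ^+ 3 <= u (x + z) - s0 (x + z).
  have : Gam (x + z) / kp (x + z) <= u (x + z) - s0 (x + z) by rewrite ler_pdivrMr // mulrC.
  apply: le_trans; rewrite lerBlDr -lerBlDl.
  have -> : kap^-1 * Gam (x + z) - Gam (x + z) / kp (x + z)
     = Gam (x + z) * (kp (x + z) - kap) * (kap^-1 * (kp (x + z))^-1).
    by field; rewrite !gt_eqF.
  apply: le_trans (ler_norm _) _; rewrite !normrM.
  have i1 : `|(kp (x + z))^-1| <= 2 * kap^-1.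
    rewrite ger0_norm ?invr_ge0 ?(ltW kz0) // -[2]invrK -invfM lef_pV2 ?posrE //.
      by rewrite mulrC.
    by rewrite mulr_gt0 // invr_gt0.
  have i2 : `|kap^-1| = kap^-1 by rewrite ger0_norm // invr_ge0 ltW.
  rewrite i2.
  apply: (@le_trans _ _ (CX * enorm z ^+ 2 * (Ck * enorm z) * (kap^-1 * (2 * kap^-1)))).
    apply: ler_pM; rewrite ?mulr_ge0 ?invr_ge0 ?(ltW kap0) //.
      by apply: ler_pM.
    by rewrite ler_wpM2l ?invr_ge0 ?(ltW kap0).
  by rewrite le_eqVlt; apply/orP; left; apply/eqP; ring.
have m3 : kap^-1 * (2^-1 * qf XG z - CG * enorm z ^+ 3) <= kap^-1 * Gam (x + z).
  rewrite ler_wpM2l ?invr_ge0 ?(ltW kap0) //.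
  by move: hz; rewrite ler_norml => /andP[]; clear; lra.
by rewrite qfZ -/XG; rewrite /s0 xz in m2; move: m2 m3; clear; lra.
Qed.

End BernsteinPoint.

(** As [a1 - a2] is nearly [W], the last inequality becomes [Y^2 / 4 <= q * (2048 * eps^2 + 36 * eps
    * Y)] for [Y = r2 * W], which fails when [Y] exceeds [500 * q * eps]. *)
Lemma bernstein_arith (R : realType) (lam Lam eps q W r2 Q1 Q2 a1 a2 nu gm : R) :
  0 < lam -> Lam = q * lam -> 1 <= q -> 0 < eps -> 0 < r2 -> r2 <= 1 -> 0 < W ->
  Q1 ^+ 2 + Q2 ^+ 2 <= 32 * eps ^+ 2 -> `|nu| <= gm -> a1 - a2 = W + nu ->
  5 * 10 * 10 * (q * eps) + 4 * gm < r2 * W ->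
  lam * (eps^-1 * (a1 ^+ 2 + a2 ^+ 2)) <= Lam * (64 * eps^-1 * (Q1 ^+ 2 + Q2 ^+ 2) / r2 + 36 * W) ->
  False.
Proof.
move=> lam0 LE q1 e0 r0 r1 W0 QQ hn ha hY hm.
set S := a1 ^+ 2 + a2 ^+ 2 in hm; set T := Q1 ^+ 2 + Q2 ^+ 2 in QQ hm.
have [Y YE] : exists Y, Y = r2 * W by eexists.
have [E EE] : exists E, E = q * eps by eexists.
rewrite -YE -EE in hY.
have E0 : 0 < E by rewrite EE mulr_gt0 //; lra.
have gm0 : 0 <= gm by apply: le_trans hn.
have Y0 : 0 < Y by rewrite YE mulr_gt0.
have T0 : 0 <= T by rewrite addr_ge0 ?sqr_ge0.
have h1 : r2 ^+ 2 * S <= q * (64 * T * r2 + 36 * eps * r2 * Y).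
  have p0 : 0 < lam * eps^-1 * r2 ^- 2 by rewrite !mulr_gt0 ?invr_gt0 // exprn_gt0.
  rewrite -(ler_pM2l p0).
  have -> : lam / eps * r2 ^- 2 * (r2 ^+ 2 * S) = lam * (eps^-1 * S) by field; rewrite !gt_eqF.
  have -> : lam / eps * r2 ^- 2 * (q * (64 * T * r2 + 36 * eps * r2 * Y)) = Lam * (64 * eps^-1 * T / r2 + 36 * W).
    by rewrite LE YE; field; rewrite !gt_eqF.
  exact: hm.
have h2 : 64 * T * r2 + 36 * eps * r2 * Y <= 64 * 32 * eps ^+ 2 + 36 * eps * Y.
  have k1 : T * r2 <= T by rewrite ler_piMr.
  have k2 : r2 * (eps * Y) <= eps * Y by rewrite ler_piMl // mulr_ge0 // ltW.
  lra.
have q0 : 0 <= q by lra.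
have h3 := le_trans h1 (ler_wpM2l q0 h2).
have V2 : Y ^+ 2 / 4 <= r2 ^+ 2 * S.
  have k1 : (a1 - a2) ^+ 2 <= 2 * S by have := sqr_ge0 (a1 + a2); rewrite /S !expr2; lra.
  have k2 : r2 * (a1 - a2) = Y + r2 * nu by rewrite ha YE; ring.
  have k3 : 3 / 4 * Y <= Y + r2 * nu.
    have : `|r2 * nu| <= gm by rewrite normrM gtr0_norm // (le_trans _ hn) // ler_piMl.
    by rewrite ler_norml => /andP[? ?]; lra.
  have k4 : (3 / 4 * Y) ^+ 2 <= (Y + r2 * nu) ^+ 2.
    by rewrite ler_pXn2r ?nnegrE //; lra.
  have k5 : r2 ^+ 2 * (a1 - a2) ^+ 2 <= r2 ^+ 2 * (2 * S) by rewrite ler_wpM2l // sqr_ge0.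
  rewrite -exprMn k2 in k5.
  have -> : Y ^+ 2 / 4 = 4^-1 * Y ^+ 2 by ring.
  have k6 : 0 <= Y ^+ 2 by exact: sqr_ge0.
  by rewrite exprMn (_ : (3 / 4) ^+ 2 = 9 / 16) in k4; [lra|field].
have m1 : q * (64 * 32 * eps ^+ 2 + 36 * eps * Y) = 64 * 32 * (eps * E) + 36 * (E * Y) by rewrite EE; ring.
have m2 : eps * E <= E * E by rewrite ler_pM2r // EE ler_peMl // ltW.
have m3 : E * (5 * 10 * 10 * E) <= E * Y by rewrite ler_pM2l //; move: gm0 hY; clear; lra.
have m4 : E * Y <= (5 * 10 * 10)^-1 * Y * Y by rewrite ler_pM2r //; move: gm0 hY; clear; lra.
have m5 : 0 < Y * Y by rewrite mulr_gt0.
by rewrite m1 expr2 in h3 V2; move: V2 h3 m5 m4 m3 m2; clear; lra.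
Qed.

(** [om], [x1], [x2] are the derivatives of [W], [Q1], [Q2] in one direction. The first-order
    condition at the maximum expresses [om] through [x1] and [x2], and half of the squares of these
    absorbs the resulting cross terms. *)
Lemma bernstein_quad (R : realType) (W r A Q1 Q2 om x1 x2 xv n2 : R) :
  0 <= W -> 0 < r -> r <= 1 -> 0 <= A -> xv ^+ 2 <= n2 ->
  r ^+ 2 * om = - (W * (- (4 * r) * xv) + 2 * A * Q1 * x1 + 2 * A * Q2 * x2) ->
  A * (x1 ^+ 2 + x2 ^+ 2) - (64 * A * (Q1 ^+ 2 + Q2 ^+ 2) / r ^+ 2 + 36 * W) * n2
  <= W * (- (4 * r) * n2 + 8 * xv ^+ 2) + 2 * ((- (4 * r) * xv) * om)
     + 2 * A * x1 ^+ 2 + 2 * A * x2 ^+ 2.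
Proof.
move=> W0 r0 r1 A0 hx hom.
have rn : r != 0 by rewrite gt_eqF.
have [k kE] : exists k, k = xv / r by eexists.
have xE : xv = k * r by rewrite kE divfK.
have n0 : 0 <= n2 by apply: le_trans (sqr_ge0 _) hx.
have om1 : 2 * ((- (4 * r) * xv) * om) = - (32 * (W * xv ^+ 2)) + 16 * A * k * (Q1 * x1 + Q2 * x2).
  have -> : om = - (W * (- (4 * r) * xv) + 2 * A * Q1 * x1 + 2 * A * Q2 * x2) / r ^+ 2.
    by rewrite -hom; field.
  by rewrite kE; field.
rewrite om1.
have k2 : k ^+ 2 <= n2 / r ^+ 2 by rewrite ler_pdivlMr ?exprn_gt0 // -exprMn -xE.
have sq Q y : 0 <= A * (y ^+ 2 + 16 * k * Q * y + 64 * Q ^+ 2 * (n2 / r ^+ 2)).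
  apply: mulr_ge0 => //.
  have : Q ^+ 2 * k ^+ 2 <= Q ^+ 2 * (n2 / r ^+ 2) by rewrite ler_wpM2l // sqr_ge0.
  by have := sqr_ge0 (y + 8 * k * Q); rewrite !expr2; lra.
have s1 := sq Q1 x1; have s2 := sq Q2 x2.
have w1 : W * xv ^+ 2 <= W * n2 by rewrite ler_wpM2l.
have w2 : W * (r * n2) <= W * n2 by rewrite ler_wpM2l // ler_piMl.
have w3 : 0 <= W * n2 by exact: mulr_ge0.
move: s1 s2 w1 w2 w3; clear; move: (r ^+ 2)^-1 => i; lra.
Qed.

Section EllAlg.
Variables (R : realType) (n : nat) (F : 'M[R]_n -> R) (lam Lam : R).
Hypothesis hF : ell F lam Lam.

Lemma el_conv3 (X1 X2 X3 : 'M[R]_n) (s1 s2 s3 : R) :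
  symmx X1 -> symmx X2 -> symmx X3 -> 0 <= F X1 -> 0 <= F X2 -> 0 <= F X3 ->
  0 < s1 -> 0 <= s2 -> 0 <= s3 -> s1 + s2 + s3 = 1 ->
  0 <= F (s1 *: X1 + s2 *: X2 + s3 *: X3).
Proof.
move=> y1 y2 y3 f1 f2 f3 p1 p2 p3 s123.
have p12 : 0 < s1 + s2 by rewrite ltr_wpDr.
have -> : s1 *: X1 + s2 *: X2 = (s1 + s2) *: ((s1 / (s1 + s2)) *: X1 + (s2 / (s1 + s2)) *: X2).
  by rewrite scalerDr !scalerA ![(s1 + s2) * _]mulrC !divfK // gt_eqF.
apply: (el_conv hF) => //; last exact: ltW.
  by apply: symmxD; exact: symmxZ.
apply: (el_conv hF) => //; rewrite ?divr_ge0 ?(ltW p1) ?(ltW p12) //.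
by rewrite -mulrDl divff // gt_eqF.
Qed.

(** [N] raises [F] by at least [lam] times its form at [e], and the rest of [E] lowers it by at most
    [Lam * T], both scaled by [kap^-1]; since [F] does not end above 0, the gain cannot beat the
    loss. *)
Lemma el_absorb (Y E N : 'M[R]_n) (T kap : R) (e : 'rV[R]_n) :
  symmx Y -> symmx E -> symmx N -> 0 <= F Y -> (forall v, 0 <= qf N v) -> 0 <= T -> 0 < kap ->
  (forall v, qf N v - T * dot v v <= qf E v) -> F (Y + kap^-1 *: E) <= 0 -> enorm e = 1 ->
  lam * qf N e <= Lam * T.
Proof.
move=> sY sE sN FY pN T0 k0 hE hFE e1.
have ki : 0 <= kap^-1 by rewrite invr_ge0 ltW.
have sT : symmx ((kap^-1 * T)%:M : 'M[R]_n) by exact: symmxM.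
have sYT : symmx (Y - (kap^-1 * T)%:M) by apply: symmxD => //; exact: symmxN.
have skN : symmx (kap^-1 *: N) by exact: symmxZ.
have sZ : symmx (kap^-1 *: (E - N) + (kap^-1 * T)%:M).
  by apply: symmxD => //; apply: symmxZ; apply: symmxD => //; exact: symmxN.
have h1 := el_mono hF (symmxD sYT skN) sZ.
have {}h1 : F (Y - (kap^-1 * T)%:M + kap^-1 *: N) <= F (Y + kap^-1 *: E).
  have -> : Y + kap^-1 *: E = Y - (kap^-1 * T)%:M + kap^-1 *: N + (kap^-1 *: (E - N) + (kap^-1 * T)%:M).
    by move: ((kap^-1 * T)%:M) => M; apply/matrixP => i j; rewrite !mxE; ring.
  apply: h1 => v; rewrite qfD qfZ qfB qfM -mulrA -mulrDr mulr_ge0 //.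
  by have := hE v; lra.
have pkN v : 0 <= qf (kap^-1 *: N) v by rewrite qfZ mulr_ge0.
have h2 := el_low hF sYT skN pkN e1.
have h3 := el_down hF sY (mulr_ge0 ki T0).
rewrite qfZ in h2.
rewrite -(ler_pM2l (x := kap^-1)) ?invr_gt0 //; lra.
Qed.

End EllAlg.

(** * Lipschitz functions on balls and gradients of segment averages *)

Section Bernstein.
Variables (R : realType) (n : nat).
Local Notation vec := 'rV[R]_n.
Local Notation mat := 'M[R]_n.
Implicit Types (x y z p e c : vec) (u f g : vec -> R) (X : mat) (K t d h r : R).

Definition lipB (f : vec -> R) (c : vec) r : Prop := exists2 L : R, 0 <= L &
  forall x y, enorm (x - c) <= r -> enorm (y - c) <= r -> `|f x - f y| <= L * enorm (x - y).

Lemma lipBD f g c r : lipB f c r -> lipB g c r -> lipB (fun x => f x + g x) c r.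
Proof.
move=> [L L0 h] [L' L0' h']; exists (L + L'); first exact: addr_ge0.
move=> x y hx hy; rewrite mulrDl; apply: le_trans (lerD (h x y hx hy) (h' x y hx hy)).
by apply: le_trans (ler_normD _ _); rewrite le_eqVlt; apply/orP; left; apply/eqP; congr `|_|; ring.
Qed.

Lemma lipBM f g c r : 0 <= r -> lipB f c r -> lipB g c r -> lipB (fun x => f x * g x) c r.
Proof.
move=> r0 [L L0 h] [L' L0' h'].
have bd f1 L1 : 0 <= L1 -> (forall x y, enorm (x - c) <= r -> enorm (y - c) <= r -> `|f1 x - f1 y| <= L1 * enorm (x - y)) ->
   forall x, enorm (x - c) <= r -> `|f1 x| <= `|f1 c| + L1 * r.
  move=> L10 h1 x hx; have := h1 x c hx; rewrite subrr enorm0 => /(_ r0) h2.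
  have -> : f1 x = f1 c + (f1 x - f1 c) by ring.
  apply: le_trans (ler_normD _ _) _; rewrite lerD2l; apply: le_trans h2 _.
  by rewrite ler_wpM2l.
have bf := bd _ _ L0 h; have bg := bd _ _ L0' h'.
exists ((`|f c| + L * r) * L' + L * (`|g c| + L' * r)).
  by rewrite !(addr_ge0, mulr_ge0).
move=> x y hx hy.
have -> : f x * g x - f y * g y = f x * (g x - g y) + (f x - f y) * g y by ring.
apply: le_trans (ler_normD _ _) _; rewrite !normrM mulrDl; apply: lerD.
  by rewrite -mulrA; apply: ler_pM => //; [exact: bf|exact: h'].
by rewrite mulrAC; apply: ler_pM => //; [exact: h|exact: bg].
Qed.

Lemma lipB_Reg K f c r : 0 <= r -> Reg K f -> lipB f c r.
Proof. by move=> r0 rf; exact: (Reg_lip_ball c rf r0). Qed.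

Lemma lipB_eq f g c r : f =1 g -> lipB f c r -> lipB g c r.
Proof. by move=> /funext ->. Qed.

Lemma lipB_max f c r : 0 <= r -> lipB f c r ->
  exists2 x, enorm (x - c) <= r & forall y, enorm (y - c) <= r -> f y <= f x.
Proof. by move=> r0 [L _ hL]; exact: cball_max hL. Qed.

(** As in [MB_grad], the uncontrolled [K] acts only on steps whose length tends to 0. *)
Lemma grad_small_lip u G K eps y r x z : has_grad u G K ->
  (forall w, eball y r w -> enorm (G w) <= eps) -> eball y r x -> eball y r (x + z) ->
  `|u (x + z) - u x| <= eps * enorm z.
Proof.
move=> hG hg hx hxz.
apply: (@le_add_inv_nat _ _ _ (K * enorm z ^+ 2)) => m.
have [M ME] : exists M : R, M = m.+1%:R by eexists.
have M0 : 0 < M by rewrite ME ltr0n.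
rewrite -ME; pose w := M^-1 *: z.
have ew : enorm w = enorm z / M by rewrite enormZ ger0_norm ?invr_ge0 ?(ltW M0) // mulrC.
have zE : z = M *: w by rewrite scalerA divff ?scale1r // gt_eqF.
have step (k : nat) : (k <= m.+1)%N ->
   `|u (x + k%:R *: w) - u x| <= k%:R * (eps * enorm w + K * enorm w ^+ 2).
  elim: k => [|k IH] km; first by rewrite scale0r addr0 subrr mul0r normr0.
  have kM : 0 <= k%:R / M <= 1.
    by rewrite divr_ge0 ?(ltW M0) //= ler_pdivrMr // mul1r ME ler_nat ltnW.
  have s1 : x + k%:R *: w = x + (k%:R / M) *: z by rewrite scalerA.
  have inb : eball y r (x + k%:R *: w) by rewrite s1; exact: eball_conv.
  have h1 := hG (x + k%:R *: w) w.
  have h2 : `|dot (G (x + k%:R *: w)) w| <= eps * enorm w.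
    by apply: le_trans (cauchy_schwarz _ _) _; rewrite ler_wpM2r // hg.
  have := IH (ltnW km); rewrite -(natr1 k) scalerDl scale1r addrA.
  move: h1 h2; rewrite !ler_norml => /andP[? ?] /andP[? ?] /andP[? ?]; apply/andP; split; lra.
have := step m.+1 (leqnn _); rewrite -ME -zE ew.
by rewrite (_ : M * _ = eps * enorm z + K * enorm z ^+ 2 / M) //; field; rewrite gt_eqF.
Qed.

(** The derivative along [z] of a segment average is an increment, and mollification preserves this.
    It turns the gradient terms of Bernstein's function into second differences. *)
Lemma moll_line_grad sig K u z x : 0 < sig -> Reg K u ->
  dot (moll_grad sig (lineavg z u) x) z = moll sig u (x + z) - moll sig u x.
Proof.
move=> sig0 ru.
have hA := avop_moll n sig0; have hL := avop_lineavg z.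
have rL : Reg K (lineavg z u) by exact: (av_reg hL ru).
have [C sm] := moll_smooth sig0 rL.
set L := dot _ _; set D := _ - _.
have K0 := Reg_ge0 ru; have C0 := sm_C0 sm.
pose B := K * enorm z ^+ 2 + 2^-1 * mabs (moll_hess sig (lineavg z u) x) * enorm z ^+ 2 + C * enorm z ^+ 3.
have key (t : R) : 0 <= t <= 1 -> `|t * (L - D)| <= B * t ^+ 2.
  move=> /andP[t0 t1].
  have h1 := sm_jet sm x (t *: z).
  rewrite dotZr -/L qf_scale enormZ (ger0_norm t0) exprMn in h1.
  have h2 : `|moll sig (lineavg z u) (x + t *: z) - moll sig (lineavg z u) x - t * D| <= K * enorm z ^+ 2 * t ^+ 2.
    rewrite /D -(avT hA) -(avT hA) -(avB hA _ (RegT _ rL) rL) -(avB hA _ (RegT _ ru) ru).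
    rewrite -(avZ hA _ _ (RegB (RegT _ ru) ru)).
    rewrite -(avB hA _ (RegB (RegT _ rL) rL) (RegZ t (RegB (RegT _ ru) ru))).
    apply: (av_bound hA (RegB (RegB (RegT _ rL) rL) (RegZ t (RegB (RegT _ ru) ru)))) => y _.
    exact: lineavg_derive.
  have h3 := qf_le (moll_hess sig (lineavg z u) x) z; rewrite -enorm2 in h3.
  have t20 : 0 <= t ^+ 2 by rewrite exprn_ge0.
  have h4 : `|2^-1 * (t ^+ 2 * qf (moll_hess sig (lineavg z u) x) z)| <=
      2^-1 * mabs (moll_hess sig (lineavg z u) x) * enorm z ^+ 2 * t ^+ 2.
    rewrite normrM normrM (ger0_norm t20) (@ger0_norm _ 2^-1) ?invr_ge0 //.
    have : 2^-1 * t ^+ 2 * `|qf (moll_hess sig (lineavg z u) x) z| <=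
       2^-1 * t ^+ 2 * (mabs (moll_hess sig (lineavg z u) x) * enorm z ^+ 2).
      by rewrite ler_wpM2l // mulr_ge0 ?invr_ge0.
    lra.
  have h5 : C * (t ^+ 3 * enorm z ^+ 3) <= C * enorm z ^+ 3 * t ^+ 2.
    rewrite -mulrA ler_wpM2l // mulrC ler_wpM2l ?exprn_ge0 // exprS ler_piMl //.
  rewrite /B !mulrDl mulrBr; move: h1 h2 h4; rewrite !ler_norml.
  by move=> /andP[? ?] /andP[? ?] /andP[? ?]; apply/andP; split; lra.
apply/eqP; rewrite -subr_eq0 -normr_le0; apply: (@le_add_inv_nat _ _ _ B) => m.
have M0 : 0 < m.+1%:R :> R by rewrite ltr0n.
have := key (m.+1%:R^-1); rewrite invr_ge0 (ltW M0) invf_le1 // ler1n => /(_ isT).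
rewrite normrM ger0_norm ?invr_ge0 ?(ltW M0) // add0r => h.
rewrite -(ler_pM2l (x := m.+1%:R^-1)) ?invr_gt0 //; apply: le_trans h _.
by rewrite le_eqVlt; apply/orP; left; apply/eqP; ring.
Qed.

End Bernstein.

(** * Bernstein's estimate: a small gradient bounds second differences from above *)

Section BernsteinMain.
Variables (R : realType) (n : nat).
Local Notation vec := 'rV[R]_n.
Local Notation mat := 'M[R]_n.
Implicit Types (x y z p e c : vec) (u f g : vec -> R) (X : mat) (K t d h r : R).

Lemma qf_bernstein (W a b c : R) x w (x1 x2 v : vec) :
  qf (W *: (a%:M + 8 *: outer x x) + (outer (b *: x) w + outer w (b *: x))
      + c *: outer x1 x1 + c *: outer x2 x2) v
  = W * (a * dot v v + 8 * dot x v ^+ 2) + 2 * ((b * dot x v) * dot w v)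
    + c * dot x1 v ^+ 2 + c * dot x2 v ^+ 2.
Proof. by rewrite !(qfD, qfZ, qf_outer, qfM, dotZl); ring. Qed.

Lemma bernstein_mx (k W h A Q1 Q2 r : R) (Xe Xa Xb X1 X2 O O1 O2 : mat) :
  (k * (2 * h ^- 2) * r) *: (2^-1 *: Xa + 2^-1 *: Xb) + (k * (2 * A * h^-1 * Q1)) *: X1
   + (k * (2 * A * h^-1 * Q2)) *: X2 + k *: (W *: Xe + O + (2 * A) *: O1 + (2 * A) *: O2)
  = k *: (W *: Xe + r *: (h ^- 2 *: (Xa + Xb)) + O + (2 * A * Q1) *: (h^-1 *: X1)
     + (2 * A) *: O1 + (2 * A * Q2) *: (h^-1 *: X2) + (2 * A) *: O2).
Proof.
move: (h ^- 2) (h^-1) => a b; apply/matrixP => i j; rewrite !mxE.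
move: (Xe i j) (Xa i j) (Xb i j) (X1 i j) (X2 i j) (O i j) (O1 i j) (O2 i j) => *; by field.
Qed.

(* Maximum principle for [eta * W + A * (q1^2 + q2^2)], where [W] is a mollified second
   difference quotient along [e], [q1] and [q2] are mollified first difference quotients
   along [e] and [-e], [A = 1 / eps] and [eta = (1 - |x|^2)^2]: at a large maximum the
   gradient terms contribute a positive multiple of [(D^2 u e . e)^2], which ellipticity
   does not allow. *)
Lemma bernstein lam Lam : 0 < lam -> lam <= Lam -> exists2 CA : R, 0 < CA &
  forall (F : mat -> R) K u G eps, ell F lam Lam -> Reg K u -> has_grad u G K ->
    sol F (eball 0 2) u -> 0 < eps -> (forall x, eball 0 2 x -> enorm (G x) <= eps) ->
    forall x e h, enorm x <= 2^-1 -> enorm e = 1 -> 0 < h -> h <= 4^-1 ->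
      dd u (h *: e) x <= CA * eps * h ^+ 2.
Proof.
move=> lam0 lamLam; have [q qE] : exists q, q = Lam / lam by eexists.
have q1 : 1 <= q by rewrite qE ler_pdivlMr // mul1r.
have qp : 0 < q by exact: lt_le_trans q1.
have LE : Lam = q * lam by rewrite qE divfK // gt_eqF.
have [CA CAE] : exists CA, CA = 12 * 10 * 10 * q by eexists.
exists CA; first by rewrite CAE; lra.
move=> F K u G eps hF ru hG [hsub hsup] eps0 hGe x e h hx he h0 h4.
have K0 := Reg_ge0 ru.
have h2 : 0 < h ^+ 2 by rewrite exprn_gt0.
pose z := h *: e; have ez : enorm z = h by rewrite enormZ he mulr1 gtr0_norm.
have main sig : 0 < sig -> 2 * n%:R * sig <= 4^-1 -> 2 * n%:R * K * sig ^+ 2 <= eps * h ->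
   dd u z x <= CA * eps * h ^+ 2 + 20 * (2 * n%:R * K * sig ^+ 2).
  move=> sig0 sig4 sige.
  have [gam gamE] : exists gam, gam = 2 * n%:R * K * sig ^+ 2 by eexists.
  rewrite -gamE in sige *.
  have gam0 : 0 <= gam by rewrite gamE !mulr_ge0 // ?exprn_ge0 // ltW.
  have hA := avop_moll n sig0.
  have rL1 : Reg K (lineavg z u) by exact: (av_reg (avop_lineavg z) ru).
  have rL2 : Reg K (lineavg (- z) u) by exact: (av_reg (avop_lineavg (- z)) ru).
  have [C sm] := moll_smooth sig0 ru.
  have [C1 sm1] := moll_smooth sig0 rL1; have [C2 sm2] := moll_smooth sig0 rL2.
  pose g := moll sig u; pose B1 := moll sig (lineavg z u); pose B2 := moll sig (lineavg (- z) u).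
  have rg : Reg K g by exact: (av_reg hA ru).
  have rB1 : Reg K B1 by exact: (av_reg hA rL1).
  have rB2 : Reg K B2 by exact: (av_reg hA rL2).
  have gu w : `|g w - u w| <= gam by rewrite gamE; exact: moll_near.
  have lin (v w : vec) : enorm v = h -> enorm w <= 1 -> `|lineavg v u w - u w| <= eps * h.
    move=> ev w1; have hL := avop_lineavg v.
    have -> : lineavg v u w - u w = lineavg v (fun y => u y - u w) w.
      by rewrite (avB hL _ ru (Reg_cst n (u w))) (avC hL).
    apply: (av_bound hL (RegB ru (Reg_cst n (u w)))) => y; rewrite ev => yw.
    have E : y = w + (y - w) by rewrite subrKC.
    have wb : eball 0 2 w by rewrite /eball /= subr0; lra.
    have yb : eball 0 2 (w + (y - w)).
      by rewrite /eball /= subr0; apply: le_lt_trans (enormD _ _) _; lra.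
    rewrite {1}E; apply: le_trans (grad_small_lip hG hGe wb yb) _.
    by rewrite ler_wpM2l // ltW.
  pose c0 := 2 * h ^- 2; pose c1 := h^-1; pose A := eps^-1.
  have A0 : 0 < A by rewrite invr_gt0.
  have c00 : 0 < c0 by rewrite mulr_gt0 // invr_gt0.
  have c10 : 0 < c1 by rewrite invr_gt0.
  pose P y := h ^- 2 * (g (y + z) + g (y - z)).
  (* Segment averages take the place of translates: the derivatives along [e] of [q1' - c1 * u] and
     [q2' - c1 * u] then differ exactly by a second difference quotient of [g], the gradient of [u]
     cancelling. The shift [2 * eps] makes both functions nonnegative, as befits weights of a convex
     combination. *)
  pose q1' y := h^-1 * B1 y + 2 * eps; pose q2' y := h^-1 * B2 y + 2 * eps.
  pose eta0 y := 1 + -1 * enorm (y - 0) ^+ 2.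
  pose eta y := eta0 y ^+ 2.
  pose Psi y := eta y * (P y - c0 * u y) + A * ((q1' y - c1 * u y) ^+ 2 + (q2' y - c1 * u y) ^+ 2).
  have Qb B w v : enorm v = h -> enorm w <= 1 -> `|B w - lineavg v u w| <= gam ->
      0 <= h^-1 * B w + 2 * eps - c1 * u w <= 4 * eps.
    move=> ev w1 hB; have hl := lin v w ev w1.
    have E : h^-1 * B w + 2 * eps - c1 * u w = (B w - u w) / h + 2 * eps by rewrite /c1; ring.
    have : `|(B w - u w) / h| <= 2 * eps.
      rewrite normrM [`|h^-1|]gtr0_norm ?invr_gt0 // ler_pdivrMr //.
      by move: hB hl sige; clear; rewrite !ler_norml => /andP[? ?] /andP[? ?] ?; apply/andP; split; lra.
    by rewrite E; clear; rewrite ler_norml => /andP[? ?]; apply/andP; split; lra.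
  have ezN : enorm (- z) = h by rewrite enormN.
  have Q1b w : enorm w <= 1 -> 0 <= q1' w - c1 * u w <= 4 * eps.
    by move=> w1; apply: (Qb _ _ z) => //; rewrite gamE; exact: moll_near.
  have Q2b w : enorm w <= 1 -> 0 <= q2' w - c1 * u w <= 4 * eps.
    by move=> w1; apply: (Qb _ _ (- z)) => //; rewrite gamE; exact: moll_near.
  have rW := RegB (RegZ (h ^- 2) (RegD (RegT z rg) (RegT (- z) rg))) (RegZ c0 ru).
  have rQ1 := RegB (RegD (RegZ h^-1 rB1) (Reg_cst n (2 * eps))) (RegZ c1 ru).
  have rQ2 := RegB (RegD (RegZ h^-1 rB2) (Reg_cst n (2 * eps))) (RegZ c1 ru).
  have sI : symmx (1%:M : mat) by exact: symmxM.
  have re := RegD (Reg_cst n 1) (RegZ (-1) (RegT (- 0) (Reg_qf sI))).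
  have lP : lipB Psi 0 1.
    have le : lipB eta0 0 1.
      apply: lipB_eq (lipB_Reg 0 ler01 re) => y.
      by rewrite /eta0 qfM mul1r -enorm2.
    have l1 := lipB_Reg 0 ler01 rW; have l2 := lipB_Reg 0 ler01 rQ1.
    have l3 := lipB_Reg 0 ler01 rQ2.
    have lA : lipB (fun _ : vec => A) 0 1 by exists 0 => // y y' _ _; rewrite subrr normr0 mul0r.
    apply: lipB_eq (lipBD (lipBM ler01 (lipBM ler01 le le) l1)
      (lipBM ler01 lA (lipBD (lipBM ler01 l2 l2) (lipBM ler01 l3 l3)))) => y.
    by rewrite /Psi /eta /P /q1' /q2' !expr2.
  have [x0 x01 hx0] := lipB_max ler01 lP.
  rewrite subr0 in x01.
  have [gm gmE] : exists gm, gm = c0 * gam by eexists.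
  have gm0 : 0 <= gm by rewrite gmE mulr_ge0 // ltW.
  have qe : eps <= q * eps by rewrite ler_peMl // ltW.
  have bound : Psi x0 <= 54 * 10 * (q * eps) + 4 * gm.
    rewrite leNgt; apply/negP => big.
    have /andP[Q10 Q14] := Q1b x0 x01; have /andP[Q20 Q24] := Q2b x0 x01.
    set W := P x0 - c0 * u x0 in big *.
    have [Q1 Q1E] : exists Q1, Q1 = q1' x0 - c1 * u x0 by eexists.
    have [Q2 Q2E] : exists Q2, Q2 = q2' x0 - c1 * u x0 by eexists.
    rewrite -Q1E in Q10 Q14; rewrite -Q2E in Q20 Q24.
    have Psi0 : Psi x0 = eta x0 * W + A * (Q1 ^+ 2 + Q2 ^+ 2) by rewrite /Psi -/W -Q1E -Q2E.
    have QQ : Q1 ^+ 2 + Q2 ^+ 2 <= 32 * eps ^+ 2.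
      have k1 : Q1 ^+ 2 <= (4 * eps) ^+ 2 by rewrite ler_pXn2r ?nnegrE // mulr_ge0 // ltW.
      have k2 : Q2 ^+ 2 <= (4 * eps) ^+ 2 by rewrite ler_pXn2r ?nnegrE // mulr_ge0 // ltW.
      by rewrite exprMn in k1 k2; move: k1 k2; clear; lra.
    have AQ : A * (Q1 ^+ 2 + Q2 ^+ 2) <= 32 * eps.
      apply: le_trans (ler_wpM2l (ltW A0) QQ) _.
      by rewrite (_ : A * _ = 32 * eps) // /A; field; rewrite gt_eqF.
    have Y0 : 5 * 10 * 10 * (q * eps) + 4 * gm < eta x0 * W.
      by rewrite Psi0 in big; move: big AQ qe eps0; clear; lra.
    have [r1 r1E] : exists r1, r1 = eta0 x0 by eexists.
    have etaE : eta x0 = r1 ^+ 2 by rewrite /eta -r1E.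
    rewrite etaE in Y0 Psi0.
    have qe0 : 0 < q * eps by rewrite mulr_gt0 //; lra.
    have Yp : 0 < r1 ^+ 2 * W by move: Y0 qe0 gm0; clear; lra.
    have r1n : r1 != 0.
      by apply/eqP => r10; move: Yp; rewrite r10 expr0n mul0r ltxx.
    have r1E' : r1 = 1 - enorm x0 ^+ 2 by rewrite r1E /eta0 subr0; ring.
    have x02 : enorm x0 ^+ 2 <= 1 by rewrite exprn_ile1.
    have r1p : 0 < r1 by rewrite lt_def r1n r1E' subr_ge0.
    have r11 : r1 <= 1 by rewrite r1E' gerBl exprn_ge0.
    have e0p : 0 < r1 ^+ 2 by rewrite exprn_gt0.
    have e01 : r1 ^+ 2 <= 1 by rewrite exprn_ile1 // ltW.
    have Wp : 0 < W by rewrite pmulr_rgt0 in Yp.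
    have x0lt : enorm x0 < 1.
      rewrite ltNge; apply/negP => x0ge; move: r1n; rewrite r1E'.
      by have -> : enorm x0 = 1; [apply/eqP; rewrite eq_le x01|rewrite expr1n subrr eqxx].
    have d0' : 0 < 1 - enorm x0 by rewrite subr_gt0.
    have loc v : enorm v < 1 - enorm x0 -> Psi (x0 + v) <= Psi x0.
      move=> hv; apply: hx0; rewrite subr0; apply: le_trans (enormD _ _) _.
      by rewrite -lerBrDl ltW.
    have je : jet2 eta x0 (r1 ^+ 2) ((- (4 * r1)) *: x0) ((- (4 * r1))%:M + 8 *: outer x0 x0).
      apply: (jet2_eq (jet2X 0 (jet2D (jet2_cst 1 x0) (jet2Z (-1) (jet2_dist 0 x0))))).
      - by move=> y.
      - by rewrite r1E.
      - by rewrite -/(eta0 x0) -r1E add0r subr0 !scalerA; congr (_ *: _); ring.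
      - rewrite -/(eta0 x0) -r1E !add0r subr0 !outerZ -[(- (4 * r1))%:M]scalemx1 !scalerA.
        by congr (_ *: _ + _ *: _); ring.
    set Xa := moll_hess sig u (x0 + z); set Xb := moll_hess sig u (x0 - z).
    set X1 := moll_hess sig (lineavg z u) x0; set X2 := moll_hess sig (lineavg (- z) u) x0.
    set m1 := moll_grad sig (lineavg z u) x0; set m2 := moll_grad sig (lineavg (- z) u) x0.
    have jP := jet2Z (h ^- 2) (jet2D (jet2T (jet2_smooth (x0 + z) sm)) (jet2T (jet2_smooth (x0 - z) sm))).
    have jq1 : jet2 q1' x0 (q1' x0) (h^-1 *: m1) (h^-1 *: X1).
      apply: (jet2_eq (jet2D (jet2Z h^-1 (jet2_smooth x0 sm1)) (jet2_cst (2 * eps) x0))) => //; by rewrite addr0.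
    have jq2 : jet2 q2' x0 (q2' x0) (h^-1 *: m2) (h^-1 *: X2).
      apply: (jet2_eq (jet2D (jet2Z h^-1 (jet2_smooth x0 sm2)) (jet2_cst (2 * eps) x0))) => //; by rewrite addr0.
    have kap0 : 0 < c0 * r1 ^+ 2 + 2 * A * c1 * (Q1 + Q2).
      rewrite ltr_wpDr //; last by rewrite mulr_gt0.
      by rewrite mulr_ge0 ?addr_ge0 // mulr_ge0 ?(ltW c10) // mulr_ge0 ?(ltW A0).
    have := bernstein_touch (ltW A0) (ltW c00) (ltW c10) (hG x0) je jP jq1 jq2 d0' loc etaE erefl erefl erefl.
    rewrite -/(P x0) -/W -Q1E -Q2E => /(_ kap0).
    set deta := - (4 * r1) *: x0.
    set w := _ - c0 *: G x0; set xi1 := _ *: m1 - _; set xi2 := _ *: m2 - _.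
    set kap := c0 * r1 ^+ 2 + _ in kap0 *.
    move=> [crit touch].
    pose Xe : mat := (- (4 * r1))%:M + 8 *: outer x0 x0.
    pose E : mat := W *: Xe + (outer deta w + outer w deta) + (2 * A) *: outer xi1 xi1 + (2 * A) *: outer xi2 xi2.
    pose N : mat := A *: (outer xi1 xi1 + outer xi2 xi2).
    pose T := 64 * A * (Q1 ^+ 2 + Q2 ^+ 2) / r1 ^+ 2 + 36 * W.
    (* A convex combination of four Hessians of averages of [u], all in [F >= 0]; the coefficients
       sum to 1 by the definition of [kap]. *)
    pose Y : mat := (kap^-1 * c0 * r1 ^+ 2) *: (2^-1 *: Xa + 2^-1 *: Xb)
      + (kap^-1 * (2 * A * c1 * Q1)) *: X1 + (kap^-1 * (2 * A * c1 * Q2)) *: X2.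
    have sa := sm_sym sm (x0 + z); have sb := sm_sym sm (x0 - z).
    have s1 := sm_sym sm1 x0; have s2 := sm_sym sm2 x0.
    have inU4 (w' y : vec) (rr : R) : enorm (w' - x0) <= 4^-1 -> rr <= 2^-1 -> enorm (y - w') <= rr -> eball 0 2 y.
      move=> h1 h2' h3; rewrite /eball /= subr0.
      have := enorm_tri y w' x0; have := enorm_tri y x0 0; rewrite !subr0.
      move: h1 h2' h3 x0lt; clear; lra.
    have h4p : 0 < 4^-1 :> R by rewrite invr_gt0.
    have Fa : 0 <= F Xa.
      apply: (mollified_subsol hF ru hsub hA sm h4p) => y; apply: (inU4 (x0 + z)).
        by rewrite addrAC subrr add0r ez.
      by move: sig4; clear; lra.
    have Fb : 0 <= F Xb.
      apply: (mollified_subsol hF ru hsub hA sm h4p) => y; apply: (inU4 (x0 - z)).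
        by rewrite addrAC subrr add0r ezN.
      by move: sig4; clear; lra.
    have F1 : 0 <= F X1.
      apply: (mollified_subsol hF ru hsub (avop_comp hA (avop_lineavg z)) sm1 (d := 8^-1)); first by rewrite invr_gt0.
      move=> y hy; rewrite /eball /= subr0; rewrite ez in hy.
      by have := enorm_tri y x0 0; rewrite !subr0; move: hy sig4 h4 x0lt; clear; lra.
    have F2 : 0 <= F X2.
      apply: (mollified_subsol hF ru hsub (avop_comp hA (avop_lineavg (- z))) sm2 (d := 8^-1)); first by rewrite invr_gt0.
      move=> y hy; rewrite /eball /= subr0; rewrite ezN in hy.
      by have := enorm_tri y x0 0; rewrite !subr0; move: hy sig4 h4 x0lt; clear; lra.
    have ki : 0 < kap^-1 by rewrite invr_gt0.
    have half : 0 <= 2^-1 :> R by rewrite invr_ge0.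
    have sab : symmx (2^-1 *: Xa + 2^-1 *: Xb) by apply: symmxD; exact: symmxZ.
    have FY : 0 <= F Y.
      apply: (el_conv3 hF) => //.
      - by apply: (el_conv hF) => //; field.
      - by apply: mulr_gt0 => //; apply: mulr_gt0.
      - by apply: mulr_ge0; [exact: ltW|apply: mulr_ge0 => //; apply: mulr_ge0 (ltW c10); apply: mulr_ge0 => //; exact: ltW].
      - by apply: mulr_ge0; [exact: ltW|apply: mulr_ge0 => //; apply: mulr_ge0 (ltW c10); apply: mulr_ge0 => //; exact: ltW].
      - transitivity (kap^-1 * (c0 * r1 ^+ 2 + 2 * A * c1 * (Q1 + Q2))); first by clearbody kap; ring.
        by rewrite -/kap mulVf // gt_eqF.
    have sY : symmx Y by apply: symmxD; [apply: symmxD|]; exact: symmxZ.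
    have sXe : symmx Xe by apply: symmxD; [exact: symmxM|apply: symmxZ; exact: symmx_outer].
    have sE : symmx E.
      apply: symmxD; last by apply: symmxZ; exact: symmx_outer.
      apply: symmxD; last by apply: symmxZ; exact: symmx_outer.
      by apply: symmxD; [exact: symmxZ|exact: symmx_outer2].
    have sN : symmx N by apply: symmxZ; apply: symmxD; exact: symmx_outer.
    have qN v : qf N v = A * (dot xi1 v ^+ 2 + dot xi2 v ^+ 2) by rewrite /N qfZ qfD !qf_outer -!expr2.
    have pN v : 0 <= qf N v.
      by rewrite qN; apply: mulr_ge0 (ltW A0) (addr_ge0 (sqr_ge0 _) (sqr_ge0 _)).
    have T0 : 0 <= T.
      apply: addr_ge0; last by apply: mulr_ge0 => //; exact: ltW.
      apply: divr_ge0 (ltW e0p); apply: mulr_ge0 (addr_ge0 (sqr_ge0 _) (sqr_ge0 _)).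
      by apply: mulr_ge0 => //; exact: ltW.
    have EN v : qf N v - T * dot v v <= qf E v.
      have xv2 : dot x0 v ^+ 2 <= dot v v.
        rewrite -real_normK ?num_real // -enorm2 ler_pXn2r ?nnegrE //.
        by apply: le_trans (cauchy_schwarz _ _) _; rewrite ler_piMl.
      have hom : r1 ^+ 2 * dot w v = - (W * (- (4 * r1) * dot x0 v) + 2 * A * Q1 * dot xi1 v + 2 * A * Q2 * dot xi2 v).
        have c := congr1 (fun y => dot y v) crit; rewrite dot0l 3!dotDl in c.
        rewrite 4!dotZl (dotZl _ x0) in c.
        have aux (a b c' d : R) : a + b + c' + d = 0 -> b = - (a + c' + d) by clear; lra.
        exact: aux c.
      have := bernstein_quad (ltW Wp) r1p r11 (ltW A0) xv2 hom.
      by rewrite qN /E /Xe [qf (_ + _) v]qf_bernstein.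
    have TE : F (Y + kap^-1 *: E) <= 0.
      have -> : Y + kap^-1 *: E = kap^-1 *: (W *: Xe + r1 ^+ 2 *: (h ^- 2 *: (Xa + Xb))
          + (outer deta w + outer w deta) + (2 * A * Q1) *: (h^-1 *: X1) + (2 * A) *: outer xi1 xi1
          + (2 * A * Q2) *: (h^-1 *: X2) + (2 * A) *: outer xi2 xi2).
        exact: bernstein_mx.
      apply: (hsup x0) => //; first by rewrite /eball /= subr0; move: x0lt; clear; lra.
      have sO x' : symmx ((2 * A) *: outer x' x') by apply: symmxZ; exact: symmx_outer.
      apply: symmxZ; apply: symmxD => //; apply: symmxD; last by do 2! apply: symmxZ.
      apply: symmxD => //; apply: symmxD; last by do 2! apply: symmxZ.
      apply: symmxD; last exact: symmx_outer2.
      by apply: symmxD; [exact: symmxZ|do 2! apply: symmxZ; exact: symmxD].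
    have fin := el_absorb hF sY sE sN FY pN T0 kap0 EN TE he.
    have zE v : dot v e = h^-1 * dot v z by rewrite dotZr mulKf // gt_eqF.
    have l1 := moll_line_grad z x0 sig0 ru; have l2 := moll_line_grad (- z) x0 sig0 ru.
    rewrite -/m1 in l1; rewrite -/m2 dotNr in l2.
    have ha : dot xi1 e - dot xi2 e = W + c0 * (u x0 - g x0).
      rewrite /xi1 /xi2 !dotBl !dotZl !zE l1 (_ : dot m2 z = - (moll sig u (x0 - z) - moll sig u x0)); last by rewrite -l2 opprK.
      by rewrite -/g /W /P /c0 /c1; field; rewrite gt_eqF.
    have hnu : `|c0 * (u x0 - g x0)| <= gm.
      by rewrite gmE normrM gtr0_norm // ler_pM2l // distrC.
    rewrite qN /T in fin.
    exact: (bernstein_arith lam0 LE q1 eps0 e0p e01 Wp QQ hnu ha Y0 fin).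
  have x1 : enorm (x - 0) <= 1 by rewrite subr0; move: hx; clear; lra.
  have := hx0 x x1; rewrite /Psi.
  set W := P x - c0 * u x.
  have sq0 : 0 <= A * ((q1' x - c1 * u x) ^+ 2 + (q2' x - c1 * u x) ^+ 2).
    by apply: mulr_ge0 (ltW A0) (addr_ge0 (sqr_ge0 _) (sqr_ge0 _)).
  move=> hPx.
  have eW : eta x * W <= 54 * 10 * (q * eps) + 4 * gm by rewrite /Psi in bound; move: bound hPx sq0; clear; lra.
  have etax : 2^-1 <= eta x.
    rewrite /eta /eta0 subr0.
    have x2 : enorm x ^+ 2 <= 4^-1.
      have : enorm x ^+ 2 <= 2^-1 ^+ 2 by rewrite ler_pXn2r ?nnegrE // invr_ge0.
      by rewrite exprVn -natrX.
    have y2 : 3 / 4 <= 1 + -1 * enorm x ^+ 2 by move: x2; clear; lra.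
    have : (3 / 4) ^+ 2 <= (1 + -1 * enorm x ^+ 2) ^+ 2 by rewrite ler_pXn2r ?nnegrE //; move: y2; clear; lra.
    by apply: le_trans; rewrite exprMn exprVn -!natrX; clear; lra.
  have hW : W <= 108 * 10 * (q * eps) + 8 * gm.
    have [W0|W0] := leP W 0; first by have := mulr_gt0 (lt_le_trans ltr01 q1) eps0; move: W0 gm0; clear; lra.
    have : 2^-1 * W <= eta x * W by rewrite ler_pM2r.
    by move: eW; clear; lra.
  have hh : h ^+ 2 * gm = 2 * gam by rewrite gmE /c0; field; rewrite gt_eqF.
  have hWd : h ^+ 2 * W = g (x + z) + g (x - z) - 2 * u x.
    by rewrite /W /P /c0; field; rewrite gt_eqF.
  have := ler_wpM2l (ltW h2) hW; rewrite hWd /dd.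
  have qq : 0 <= q * eps * h ^+ 2 by rewrite mulr_ge0 ?(ltW h2) // mulr_ge0 // ltW.
  have -> : CA * eps * h ^+ 2 = 12 * 10 * 10 * (q * eps * h ^+ 2) by rewrite CAE; ring.
  have := gu (x + z); have := gu (x - z); rewrite !ler_norml; move: hh qq gam0; clear.
  by move=> ? ? ? /andP[? ?] /andP[? ?]; lra.
have n0 : 0 <= n%:R :> R by [].
have nK : 0 <= 2 * n%:R * K by rewrite !mulr_ge0.
have [s [s0 s4 se s1]] : exists s : R, [/\ 0 < s, 2 * n%:R * s <= 4^-1, 2 * n%:R * K * s <= eps * h & s <= 1].
  have p1 : 0 < 8 * (n%:R + 1) :> R by rewrite mulr_gt0 // ltr_wpDl.
  have p2 : 0 < 2 * n%:R * K + 1 by rewrite ltr_wpDl.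
  have eh : 0 < eps * h by rewrite mulr_gt0.
  exists (Num.min (Num.min (8 * (n%:R + 1))^-1 (eps * h / (2 * n%:R * K + 1))) 1); set s := Num.min _ _.
  have a1 : s <= (8 * (n%:R + 1))^-1 by rewrite /s !ge_min lexx.
  have a2 : s <= eps * h / (2 * n%:R * K + 1) by rewrite /s !ge_min lexx orbT.
  have a3 : 0 < s by rewrite /s !lt_min invr_gt0 p1 divr_gt0 // ltr01.
  split => //; last by rewrite /s ge_min lexx orbT.
    have := a1; rewrite -[X in _ <= X]mul1r ler_pdivlMr // => a4.
    by move: a4 a3 n0; clear; lra.
  rewrite ler_pdivlMr // in a2.
  by move: a2 a3; clear; lra.
apply: (@le_add_inv_nat _ _ _ (20 * (2 * n%:R * K * s))) => m.
have M1 : 1 <= m.+1%:R :> R by rewrite ler1n.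
have M0 : 0 < m.+1%:R :> R by rewrite ltr0n.
have sm0 : 0 < s / m.+1%:R by rewrite divr_gt0.
have sms : s / m.+1%:R <= s by rewrite ler_pdivrMr // ler_peMr // ltW.
have sm2 : (s / m.+1%:R) ^+ 2 <= s / m.+1%:R.
  by rewrite expr2 ler_piMl ?(ltW sm0) // (le_trans sms).
have sm3 : 2 * n%:R * K * (s / m.+1%:R) ^+ 2 <= 2 * n%:R * K * (s / m.+1%:R) by rewrite ler_wpM2l.
apply: le_trans (main (s / m.+1%:R) sm0 _ _) _.
- by apply: le_trans s4; rewrite ler_wpM2l // mulr_ge0.
- by apply: le_trans sm3 _; apply: le_trans se; rewrite ler_wpM2l.
- rewrite lerD2l; apply: (@le_trans _ _ (20 * (2 * n%:R * K * (s / m.+1%:R)))).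
    by rewrite ler_wpM2l.
  by rewrite le_eqVlt; apply/orP; left; apply/eqP; ring.
Qed.

End BernsteinMain.

(** * Subtraction of quadratic polynomials and rescaling *)

Section Rescale.
Variables (R : realType) (n : nat).
Local Notation vec := 'rV[R]_n.
Local Notation mat := 'M[R]_n.
Implicit Types (x y z p e c : vec) (u f g : vec -> R) (X : mat) (K t d h r : R).

Lemma Reg_dil K f s : 0 <= s -> Reg K f -> Reg (K * s ^+ 2) (fun x => f (s *: x)).
Proof.
move=> s0 [K0 hC [L L0 hL]]; split; first by rewrite mulr_ge0 ?exprn_ge0.
  move=> x a b; rewrite /mixd !scalerDr; apply: le_trans (hC (s *: x) (s *: a) (s *: b)) _.
  rewrite !enormZ (ger0_norm s0) le_eqVlt; apply/orP; left; apply/eqP; ring.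
exists (L * s); first exact: mulr_ge0.
move=> x z; rewrite scalerDr; apply: le_trans (hL _ _) _.
rewrite !enormZ (ger0_norm s0) le_eqVlt; apply/orP; left; apply/eqP; ring.
Qed.

Section Fix.
Variables (u : vec -> R) (G : vec -> vec) (K : R) (y p : vec) (s th : R) (H : mat).
Hypotheses (s0 : 0 < s) (th0 : 0 < th) (sH : symmx H).

Definition rescale x : R :=
  (th * s ^+ 2)^-1 * (u (y + s *: x) - (dot p (s *: x) + 2^-1 * qf H (s *: x))).

Definition rescale_grad x : vec := (th * s)^-1 *: (G (y + s *: x) - p - (s *: x) *m H).

Let c0 : 0 < th * s ^+ 2. Proof. by rewrite mulr_gt0 // exprn_gt0. Qed.

Lemma rescale_reg : Reg K u -> has_grad u G K ->
  exists K', Reg K' rescale /\ has_grad rescale rescale_grad K'.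
Proof.
move=> ru hG; have K0 := Reg_ge0 ru.
have r1 : Reg (K * s ^+ 2) (fun x => u (y + s *: x)).
  have := Reg_dil (ltW s0) (RegT y ru); rewrite (_ : (fun x => u (s *: x + y)) = fun x => u (y + s *: x)) //.
  by apply: funext => x; rewrite addrC.
have r2 := Reg_dil (ltW s0) (RegD (Reg_dot p) (RegZ 2^-1 (Reg_qf sH))).
have r3 := RegZ (th * s ^+ 2)^-1 (RegB r1 r2).
set K1 := _ * _ in r3.
have m0 := mabs_ge0 H.
exists (Num.max K1 ((K + mabs H) / th)); split; first by apply: RegW r3; rewrite le_max lexx.
move=> x z.
apply: (@le_trans _ _ ((K + mabs H) / th * enorm z ^+ 2)); last first.
  by rewrite ler_wpM2r ?exprn_ge0 ?enorm_ge0 // le_max lexx orbT.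
have -> : rescale (x + z) - rescale x - dot (rescale_grad x) z =
   (th * s ^+ 2)^-1 * (u (y + s *: x + s *: z) - u (y + s *: x) - dot (G (y + s *: x)) (s *: z))
   - 2^-1 / th * qf H z.
  rewrite /rescale /rescale_grad scalerDr addrA (dotDr (s *: x)) (qf_add _ _ sH) dotZl !dotBl.
  rewrite (dotZr s z p) (dotZr s z (G _)) (qf_scale H s z) (dotZr s z (_ *m H)).
  by field; rewrite !gt_eqF.
apply: le_trans (ler_normB _ _) _; rewrite mulrDl mulrDl; apply: lerD.
  rewrite normrM gtr0_norm ?invr_gt0 // mulrC ler_pdivrMr //.
  apply: le_trans (hG _ _) _; rewrite enormZ (gtr0_norm s0) le_eqVlt; apply/orP; left; apply/eqP.
  by field; rewrite gt_eqF.
rewrite normrM ger0_norm ?divr_ge0 ?(ltW th0) //.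
apply: (@le_trans _ _ (th^-1 * (mabs H * enorm z ^+ 2))); last by rewrite mulrA [th^-1 * _]mulrC.
have q := qf_le H z; rewrite -enorm2 in q.
have ti : 0 <= th^-1 by rewrite invr_ge0 ltW.
rewrite [2^-1 / th]mulrC -mulrA ler_wpM2l //.
have := normr_ge0 (qf H z); move: q; lra.
Qed.

Lemma dd_rescale z x :
  dd rescale z x = (th * s ^+ 2)^-1 * (dd u (s *: z) (y + s *: x) - qf H (s *: z)).
Proof.
rewrite /dd /rescale !scalerDr !scalerN !addrA !(dotDr (s *: x)) !(qf_add _ _ sH).
by rewrite qf_opp !dotNr; field; rewrite !gt_eqF.
Qed.

Lemma eball_rescale r x : eball y (s * r) (y + s *: x) <-> eball 0 r x.
Proof.
rewrite /eball /= subr0 [y + _]addrC addrK enormZ (gtr0_norm s0).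
by rewrite ltr_pM2l.
Qed.

Lemma hess_le_rescale X r : hess_le u (H + th *: X) (eball y (s * r)) <->
  hess_le rescale X (eball 0 r).
Proof.
have E z : qf (H + th *: X) (s *: z) = qf H (s *: z) + th * s ^+ 2 * qf X z.
  by rewrite qfD qfZ !(qf_scale X s); ring.
split=> h x z h1 h2.
  rewrite dd_rescale mulrC ler_pdivrMr // lerBlDr [qf X z * _]mulrC -(addrC (qf H _)) -E.
  by apply: h; rewrite -addrA -?scalerN -scalerDr; apply/eball_rescale.
have [x' xE] : exists x', x = y + s *: x'.
  by exists (s^-1 *: (x - y)); rewrite scalerA divff ?gt_eqF // scale1r subrKC.
have [z' zE] : exists z', z = s *: z'.
  by exists (s^-1 *: z); rewrite scalerA divff ?gt_eqF // scale1r.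
move: h1 h2; rewrite xE zE -!addrA -!scalerN -!scalerDr => /eball_rescale h1 /eball_rescale h2.
have := h _ _ h1 h2; rewrite dd_rescale mulrC ler_pdivrMr // E [qf X z' * _]mulrC.
by rewrite lerBlDr (addrC (qf H _)).
Qed.

Lemma hess_ge_rescale X r : hess_ge u (H + th *: X) (eball y (s * r)) <->
  hess_ge rescale X (eball 0 r).
Proof.
have E z : qf (H + th *: X) (s *: z) = qf H (s *: z) + th * s ^+ 2 * qf X z.
  by rewrite qfD qfZ !(qf_scale X s); ring.
split=> h x z h1 h2.
  rewrite dd_rescale mulrC ler_pdivlMr // lerBrDr [qf X z * _]mulrC -(addrC (qf H _)) -E.
  by apply: h; rewrite -addrA -?scalerN -scalerDr; apply/eball_rescale.
have [x' xE] : exists x', x = y + s *: x'.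
  by exists (s^-1 *: (x - y)); rewrite scalerA divff ?gt_eqF // scale1r subrKC.
have [z' zE] : exists z', z = s *: z'.
  by exists (s^-1 *: z); rewrite scalerA divff ?gt_eqF // scale1r.
move: h1 h2; rewrite xE zE -!addrA -!scalerN -!scalerDr => /eball_rescale h1 /eball_rescale h2.
have := h _ _ h1 h2; rewrite dd_rescale mulrC ler_pdivlMr // E [qf X z' * _]mulrC.
by rewrite lerBrDr (addrC (qf H _)).
Qed.

Lemma rescale_increment x z :
  u (y + s *: x + z) = u (y + s *: x) + th * s ^+ 2 * (rescale (x + s^-1 *: z) - rescale x)
    + dot (p + (s *: x) *m H) z + 2^-1 * qf H z.
Proof.
have E : s *: (x + s^-1 *: z) = s *: x + z by rewrite scalerDr scalerA divff ?gt_eqF // scale1r.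
rewrite /rescale E addrA (dotDr (s *: x)) (qf_add _ _ sH) dotDl.
by field; rewrite !gt_eqF.
Qed.

Lemma rescale_sol F r : sol F (eball y (s * r)) u ->
  sol (fun X => th^-1 * F (H + th *: X)) (eball 0 r) rescale.
Proof.
have ti : 0 < th^-1 by rewrite invr_gt0.
have si : 0 < s^-1 by rewrite invr_gt0.
have qE X z : qf (H + th *: X) z = qf H z + th * s ^+ 2 * qf X (s^-1 *: z).
  by rewrite qfD qfZ qf_scale; field; rewrite gt_eqF.
have dE (q x z : vec) : dot (p + (s *: x) *m H + (th * s) *: q) z
   = dot (p + (s *: x) *m H) z + th * s ^+ 2 * dot q (s^-1 *: z).
  by rewrite dotDl dotZl dotZr; field; rewrite gt_eqF.
have nE C z : th * s^-1 * C * enorm z ^+ 3 = th * s ^+ 2 * (C * enorm (s^-1 *: z) ^+ 3).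
  by rewrite enormZ (gtr0_norm si); field; rewrite gt_eqF.
have small d z : enorm z < s * d -> enorm (s^-1 *: z) < d.
  by move=> hz; rewrite enormZ (gtr0_norm si) mulrC ltr_pdivrMr // mulrC.
move=> [hsub hsup]; split=> x X bx sX [q [C [d [d0 h]]]].
  rewrite pmulr_rge0 //; apply: (hsub (y + s *: x)).
  - by apply/eball_rescale.
  - by apply: symmxD => //; exact: symmxZ.
  - exists (p + (s *: x) *m H + (th * s) *: q), (th * s^-1 * C), (s * d); split; first exact: mulr_gt0.
    move=> z hz; rewrite rescale_increment qE dE nE.
    have := ler_wpM2l (ltW c0) (h _ (small _ _ hz)); lra.
rewrite pmulr_rle0 //; apply: (hsup (y + s *: x)).
- by apply/eball_rescale.
- by apply: symmxD => //; exact: symmxZ.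
- exists (p + (s *: x) *m H + (th * s) *: q), (th * s^-1 * C), (s * d); split; first exact: mulr_gt0.
  move=> z hz; rewrite rescale_increment qE dE nE.
  have := ler_wpM2l (ltW c0) (h _ (small _ _ hz)); lra.
Qed.

(** Quasiconcavity is invariant under affine changes of the matrix and positive multiples, and the
    factor [th^-1] restores both ellipticity constants. This holds whatever the value of [F H], so
    the estimates can be iterated with unchanged constants. *)
Lemma rescale_ell F lam Lam : ell F lam Lam -> ell (fun X => th^-1 * F (H + th *: X)) lam Lam.
Proof.
move=> hF; have ti : 0 < th^-1 by rewrite invr_gt0.
have sy X : symmx X -> symmx (H + th *: X) by move=> sX; apply: symmxD => //; exact: symmxZ.
split; [exact: (el_n hF)|exact: (el_lam hF)|exact: (el_Lam hF)| | |].
- move=> M N v sM sN pN v1; rewrite scalerDr addrA.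
  have pN' z : 0 <= qf (th *: N) z by rewrite qfZ mulr_ge0 // ltW.
  have := ler_wpM2l (ltW ti) (el_low hF (sy _ sM) (symmxZ th sN) pN' v1).
  by rewrite mulrDr qfZ (_ : th^-1 * (lam * _) = lam * qf N v) //; field; rewrite gt_eqF.
- move=> M t sM t0; rewrite scalerDr addrA scale_scalar_mx.
  have tt : 0 <= th * t by rewrite mulr_ge0 // ltW.
  have := ler_wpM2l (ltW ti) (el_up hF (sy _ sM) tt).
  by rewrite mulrDr (_ : th^-1 * (Lam * _) = Lam * t) //; field; rewrite gt_eqF.
- move=> M N t sM sN t01.
  have -> : H + th *: (t *: M + (1 - t) *: N) = t *: (H + th *: M) + (1 - t) *: (H + th *: N).
    by apply/matrixP => i j; rewrite !mxE; ring.
  have := ler_wpM2l (ltW ti) (el_qc hF (sy _ sM) (sy _ sN) t01).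
  by rewrite minr_pMr // ltW.
Qed.

End Fix.
End Rescale.

(** * A ball with an almost sharp upper Hessian bound *)

Section OneSided.
Variables (R : realType) (n : nat) (lam Lam : R).
Local Notation vec := 'rV[R]_n.
Local Notation mat := 'M[R]_n.
Implicit Types (x y z p e c : vec) (u f g : vec -> R) (X : mat) (K t d h r : R).
Hypotheses (lam0 : 0 < lam) (lamLam : lam <= Lam).

Lemma sol_sub (F : mat -> R) (U V : set vec) u : V `<=` U -> sol F U u -> sol F V u.
Proof.
move=> VU [h1 h2]; split=> x X /VU Ux; [exact: h1|exact: h2].
Qed.

(** On the unit ball [u] differs from its central value by at most [eps], so the paraboloid
    [-2 eps |x|^2], slid up from below, touches [u] at an interior point; its Hessian is [-4 eps]
    times the identity. *)
Lemma small_grad_nonpos (F : mat -> R) K u G eps : ell F lam Lam -> Reg K u -> has_grad u G K ->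
  sol F (eball 0 2) u -> 0 < eps -> (forall x, eball 0 2 x -> enorm (G x) <= eps) ->
  F 0 <= Lam * (4 * eps).
Proof.
move=> hF ru hG [_ hsup] e0 hGe.
have sI : symmx (1%:M : mat) by exact: symmxM.
have rf := RegD (RegZ (-1) ru) (RegZ (- (2 * eps)) (Reg_qf sI)).
have [x1 x1b hx1] := Reg_max 0 rf ler01; rewrite subr0 in x1b.
have b0 : eball 0 2 (0 : vec) by rewrite /eball /= subr0 enorm0.
have q1 (z : vec) : qf (1%:M : mat) z = dot z z by rewrite qfM mul1r.
have x1lt : enorm x1 < 1.
  rewrite ltNge; apply/negP => x1g.
  have := hx1 0; rewrite subrr enorm0 ler01 => /(_ isT); rewrite !q1 dot0l mulr0 addr0 -enorm2.
  have -> : enorm x1 = 1 by apply/eqP; rewrite eq_le x1b.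
  have xb : eball 0 2 (0 + x1) by rewrite add0r /eball /= subr0 (le_lt_trans x1b) // ltr1n.
  have := grad_small_lip hG hGe b0 xb; rewrite add0r ler_norml => /andP[].
  rewrite expr1n; have := ler_wpM2l (ltW e0) x1b; move: e0; lra.
have sE : symmx ((- (4 * eps))%:M : mat) by exact: symmxM.
have F0 : F (- (4 * eps))%:M <= 0.
  apply: (hsup x1) => //.
    by rewrite /eball /= subr0 (lt_trans x1lt) // ltr1n.
  exists (- (4 * eps) *: x1), 0, (1 - enorm x1); split; first by rewrite subr_gt0.
  move=> z hz; have xz : enorm (x1 + z - 0) <= 1.
    by rewrite subr0; apply: le_trans (enormD _ _) _; move: hz; lra.
  have := hx1 _ xz; rewrite !q1 qfM dotZl mul0r subr0 dotDl !dotDr (dotC z x1); lra.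
have s0 : symmx (0 : mat) by rewrite /symmx trmx0.
have e4 : 0 <= 4 * eps by rewrite mulr_ge0 // ltW.
have := el_down hF s0 e4; rewrite add0r.
have -> : - (4 * eps)%:M = (- (4 * eps))%:M :> mat by rewrite raddfN.
by move: F0; lra.
Qed.

(** Subtracting the quadratic polynomial given by [flat_ball] and rescaling its ball to radius 2
    leaves a solution with small gradient, to which both [bernstein] and [small_grad_nonpos]
    apply. *)
Lemma upper_flat_ball (eta : R) : 0 < eta -> exists2 ro : R, 0 < ro &
  forall (F : mat -> R) K u G, ell F lam Lam -> Reg K u -> has_grad u G K ->
    sol F (eball 0 1) u -> MB u 2 (eball 0 1) ->
  exists y (H : mat), [/\ symmx H, enorm y + ro <= 8^-1, mabs H <= 6 * n%:R ^+ 2, F H <= eta &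
    forall x z, enorm (x - y) <= ro -> enorm z <= ro -> dd u z x <= qf H z + eta * enorm z ^+ 2].
Proof.
move=> eta0; have Lam0 : 0 < Lam by exact: lt_le_trans lamLam.
have [CA CA0 hB] := bernstein n lam0 lamLam.
have N0 : 0 < n.+1%:R :> R by [].
(* The rescaled gradient is at most [2 (n + 1) del]; this choice keeps both [CA] times that and
   [4 Lam] times that below [eta]. *)
have [del [del0 del1]] : exists del : R, 0 < del /\ 8 * n.+1%:R * del * (CA + Lam) = eta.
  exists (eta / (8 * n.+1%:R * (CA + Lam))); split.
    by rewrite divr_gt0 // mulr_gt0 ?mulr_gt0 // addr_gt0.
  move: N0; move: (n.+1%:R : R) => N N0.
  by field; rewrite gt_eqF ?addr_gt0 //= (gt_eqF N0).
have aC : 0 < n.+1%:R * del * CA by rewrite mulr_gt0 // mulr_gt0.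
have aL : 0 < n.+1%:R * del * Lam by rewrite mulr_gt0 // mulr_gt0.
have [kap kap0 hflat] := flat_ball n lam0 lamLam del0.
exists (kap / 8); first by rewrite divr_gt0.
move=> F K u G hF ru hG hs mb.
have [y [H [sH yk H6 hGf]]] := hflat F K u G hF ru hG hs mb.
exists y, H; have s0 : 0 < kap / 2 by rewrite divr_gt0.
set s := kap / 2 in s0.
have kE : kap = s * 2 by rewrite /s divfK.
have [K' [rw hw]] := rescale_reg y (G y) s0 ltr01 sH ru hG.
set w := rescale _ _ _ _ _ _ in rw hw.
have hsw : sol (fun X => 1^-1 * F (H + 1 *: X)) (eball 0 2) w.
  apply: rescale_sol => //; apply: sol_sub hs => x; rewrite /eball /= subr0 => hx.
  have := enorm_tri x y 0; rewrite !subr0; move: hx yk; rewrite kE; lra.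
have hFw := rescale_ell ltr01 sH hF.
pose eps := 2 * n.+1%:R * del.
have eps0 : 0 < eps by rewrite !mulr_gt0.
have hGw x : eball 0 2 x -> enorm (rescale_grad G y (G y) s 1 H x) <= eps.
  rewrite /eball /= subr0 => hx; rewrite /rescale_grad mul1r enormZ gtr0_norm ?invr_gt0 //.
  rewrite mulrC ler_pdivrMr //; apply: le_trans (enorm_le_sum _) _.
  have le i : `|(G (y + s *: x) - G y - s *: x *m H) 0 i| <= del * kap.
    have k1 : enorm (y + s *: x - y) <= kap.
      by rewrite addrAC subrr add0r enormZ gtr0_norm // kE ler_pM2l // ltW.
    have k2 : enorm (y - y) <= kap by rewrite subrr enorm0 ltW.
    have := hGf _ _ k1 k2 i; rewrite [y + _ - y]addrAC subrr add0r.
    by move: (_ *m H) (G _) (G _) => A B D; rewrite !mxE.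
  apply: le_trans (ler_sum _ (fun i _ => le i)) _.
  rewrite sumr_const card_ord -(mulr_natr (del * kap) n) kE /eps -(natr1 n).
  have := mulr_gt0 del0 s0; move: (n%:R : R) => N.
  have -> : del * (s * 2) * N = 2 * (del * s) * N by ring.
  have -> : 2 * (N + 1) * del * s = 2 * (del * s) * N + 2 * (del * s) by ring.
  by lra.
split=> //.
- have kk : kap / 8 <= kap by rewrite ler_pdivrMr // ler_peMr ?ler1n // ltW.
  by apply: le_trans yk; rewrite lerD2l.
- rewrite /mabs; have le i : \sum_j `|H i j| <= 6 * n%:R.
    apply: le_trans (ler_sum _ (fun j _ => H6 i j)) _.
    by rewrite sumr_const card_ord mulr_natr.
  apply: le_trans (ler_sum _ (fun i _ => le i)) _.
  by rewrite sumr_const card_ord -(mulr_natr (6 * n%:R) n) expr2 mulrA.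
- have := small_grad_nonpos hFw rw hw hsw eps0 hGw.
  rewrite invr1 mul1r scaler0 addr0 => /le_trans; apply.
  by rewrite -del1 /eps; move: aC aL; move: (n.+1%:R : R) => N; lra.
- move=> x z hx hz.
  have [->|zn] := eqVneq z 0.
    by rewrite /dd subr0 addr0 enorm0 /qf mul0mx dot0l expr0n mulr0; lra.
  have z0 : 0 < enorm z by rewrite enorm_gt0.
  pose x' := s^-1 *: (x - y); pose e := (enorm z)^-1 *: z; pose h := enorm z / s.
  have x2 : enorm x' <= 2^-1.
    rewrite enormZ gtr0_norm ?invr_gt0 // mulrC ler_pdivrMr //.
    by apply: le_trans hx _; rewrite kE; move: s0; lra.
  have e1 : enorm e = 1 by rewrite enormZ gtr0_norm ?invr_gt0 // mulVf // gt_eqF.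
  have h0 : 0 < h by rewrite divr_gt0.
  have h4 : h <= 4^-1.
    rewrite /h ler_pdivrMr //.
    by apply: le_trans hz _; rewrite kE; move: s0; lra.
  have := hB _ _ _ _ _ hFw rw hw hsw eps0 hGw x' e h x2 e1 h0 h4.
  have zE : s *: (h *: e) = z.
    rewrite !scalerA [X in X *: _](_ : _ = 1) ?scale1r // /h.
    by field; rewrite (gt_eqF s0) (gt_eqF z0).
  have xE : y + s *: x' = x by rewrite scalerA divff ?gt_eqF // scale1r subrKC.
  rewrite dd_rescale // zE xE mul1r mulrC ler_pdivrMr ?exprn_gt0 // => le.
  have E : CA * eps * h ^+ 2 * s ^+ 2 = CA * eps * enorm z ^+ 2 by rewrite /h; field; rewrite gt_eqF.
  rewrite E in le.
  have z2 : 0 <= enorm z ^+ 2 by rewrite exprn_ge0 // ltW.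
  have ce : CA * eps <= eta.
    by rewrite -del1 /eps; move: aC aL; move: (n.+1%:R : R) => N; lra.
  by have := ler_wpM2r z2 ce; move: le; lra.
Qed.

End OneSided.

(** * Passing between step sizes and between directions *)

Section Doubling.
Variables (R : realType) (n : nat).
Local Notation vec := 'rV[R]_n.
Local Notation mat := 'M[R]_n.
Implicit Types (x y z p e c : vec) (u f g : vec -> R) (X : mat) (K t d h r : R).

(** A second difference with step [2 z] combines those with step [z] with weights 1, 2, 1, so the
    bound doubles its range at each turn and reaches every step that fits in the ball. *)
Lemma dd_doubling u y r e (m t0 : R) : 0 < t0 ->
  (forall x t, 0 < t -> t <= t0 -> eball y r (x + t *: e) -> eball y r (x - t *: e) ->
     dd u (t *: e) x <= m * t ^+ 2) ->
  forall x t, 0 < t -> eball y r (x + t *: e) -> eball y r (x - t *: e) ->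
     dd u (t *: e) x <= m * t ^+ 2.
Proof.
move=> t00 small.
have main k x t : 0 < t -> t <= 2 ^+ k * t0 -> eball y r (x + t *: e) ->
    eball y r (x - t *: e) -> dd u (t *: e) x <= m * t ^+ 2.
  elim: k x t => [|k IH] x t tp; first by rewrite expr0 mul1r; exact: small.
  move=> tk h1 h2; pose t' := t / 2; pose z := t' *: e.
  have t'p : 0 < t' by rewrite divr_gt0.
  have t'k : t' <= 2 ^+ k * t0 by rewrite ler_pdivrMr // mulrAC -exprSr.
  have tE : t *: e = z + z by rewrite /z -scalerDl /t' -splitr.
  have h1' : eball y r (x - t *: e + (4 * t') *: e).
    rewrite (_ : _ + _ = x + t *: e) // -addrA; congr (_ + _).
    by rewrite -scaleNr -scalerDl /t'; congr (_ *: _); field.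
  have inb s : 0 <= s <= 1 -> eball y r (x - t *: e + s *: ((4 * t') *: e)) by exact: eball_conv.
  have q (c : R) w : 0 <= c <= 1 -> w = x - t *: e + c *: ((4 * t') *: e) -> eball y r w.
    by move=> c01 ->; exact: inb.
  have vE (c a : R) : a = - t + c * (4 * t') -> x + a *: e = x - t *: e + c *: ((4 * t') *: e).
    by move=> ->; rewrite scalerA -addrA -scaleNr -scalerDl.
  have bx : eball y r x.
    apply: (q 2^-1); first by apply/andP; split; lra.
    by rewrite -[LHS]addr0 -[0](scale0r e); apply: vE; rewrite /t'; field.
  have bz1 : eball y r (x + z).
    by apply: (q (3 / 4)); [apply/andP; split; lra|apply: vE; rewrite /t'; field].
  have bz2 : eball y r (x - z).
    apply: (q 4^-1); first by apply/andP; split; lra.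
    by rewrite /z -scaleNr; apply: vE; rewrite /t'; field.
  have d0 := IH x t' t'p t'k bz1 bz2.
  have d1 : dd u (t' *: e) (x + z) <= m * t' ^+ 2.
    by apply: IH => //; rewrite ?addrK // -addrA -tE.
  have d2 : dd u (t' *: e) (x - z) <= m * t' ^+ 2.
    by apply: IH => //; rewrite ?subrK // -addrA -opprD -tE.
  have -> : dd u (t *: e) x = dd u z (x + z) + 2 * dd u z x + dd u z (x - z).
    by rewrite /dd tE opprD !addrA addrK subrK; ring.
  have -> : m * t ^+ 2 = m * t' ^+ 2 + 2 * (m * t' ^+ 2) + m * t' ^+ 2 by rewrite /t'; field.
  by rewrite -/z in d0 d1 d2; lra.
move=> x t tp; have [k hk] : exists k : nat, t <= 2 ^+ k * t0.
  exists (Num.truncn (t / t0)).+1; rewrite -ler_pdivrMr //.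
  apply: (@le_trans _ _ (Num.truncn (t / t0)).+1%:R); first exact: ltW (truncnS_gt _).
  by rewrite -natrX ler_nat ltnW // ltn_expl.
exact: main hk.
Qed.

Lemma enorm_diff_quad X x y : symmx X ->
  qf X x - qf X y = dot ((x - y) *m X) (x + y).
Proof.
move=> sX; rewrite mulmxBl dotBl !dotDr /qf.
by rewrite [dot (y *m X) x]dot_mulmx sX (dotC y); ring.
Qed.

(** Together with [MB] this makes second differences Lipschitz in the direction. *)
Lemma dd_dir_diff u x (a b : vec) : dd u b x - dd u a x = mixd u (x - b) (a + b) (b - a).
Proof.
rewrite /mixd /dd.
have -> : x - b + (a + b) = x + a by rewrite addrACA addNr addr0.
rewrite -[x + a + (b - a)]addrA subrKC.
have -> : x - b + (b - a) = x - a by rewrite addrA subrK.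
ring.
Qed.

(** Coordinates are rounded down to a grid of mesh [1 / N]. Grid points near the sphere are not unit
    vectors, so later bounds carry [|e|^2 <= 4]. *)
Lemma sphere_net (nu : R) : 0 < nu -> exists l : seq vec, (forall e, e \in l -> enorm e <= 2) /\
  forall e', enorm e' = 1 -> exists2 e, e \in l & enorm (e - e') <= nu.
Proof.
move=> nu0; have [N [N0 Nnu N1]] : exists N : nat, [/\ 0 < N%:R :> R, n%:R / N%:R <= nu & n%:R / N%:R <= 1 :> R].
  exists (Num.truncn (n%:R / nu) + n).+1; set N := _.+1.
  have N0 : 0 < N%:R :> R by rewrite ltr0n.
  split=> //; last by rewrite ler_pdivrMr // mul1r ler_nat /N ltnW // ltnS leq_addl.
  rewrite ler_pdivrMr // mulrC -ler_pdivrMr //.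
  apply: ltW; apply: lt_le_trans (truncnS_gt _) _.
  by rewrite ler_nat /N ltnS leq_addr.
pose v (f : {ffun 'I_n -> 'I_(2 * N).+1}) : vec := \row_i ((f i : nat)%:R / N%:R - 1).
exists [seq e <- [seq v f | f : {ffun 'I_n -> 'I_(2 * N).+1}] | enorm e <= 2].
split=> [e|e' e1]; first by rewrite mem_filter => /andP[].
pose f := [ffun i => inord (Num.truncn ((e' 0 i + 1) * N%:R)) : 'I_(2 * N).+1].
have near : enorm (v f - e') <= n%:R / N%:R.
  apply: le_trans (enorm_le_sum _) _.
  have le i : `|(v f - e') 0 i| <= N%:R^-1.
    have := coord_le_enorm e' i; rewrite e1 ler_norml => /andP[a1 a2].
    set T := (e' 0 i + 1) * N%:R.
    have T0 : 0 <= T by rewrite mulr_ge0 ?(ltW N0) // -lerBlDr add0r.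
    have T2 : T <= 2 * N%:R by rewrite ler_pM2r //; move: a2; lra.
    have fE : (f i : nat) = Num.truncn T.
      rewrite ffunE inordK // ltnS -(ler_nat R) natrM; apply: le_trans T2.
      by rewrite truncn_le.
    rewrite !mxE fE.
    have t1 : (Num.truncn T)%:R <= T by rewrite truncn_le.
    have t2 := truncnS_gt T; rewrite -natr1 in t2.
    have -> : (Num.truncn T)%:R / N%:R - 1 - e' 0 i = ((Num.truncn T)%:R - T) / N%:R.
      by rewrite /T; field; rewrite gt_eqF.
    rewrite normrM [`|N%:R^-1|]gtr0_norm ?invr_gt0 // ler_piMl ?invr_ge0 ?(ltW N0) //.
    by rewrite ler_norml; apply/andP; split; move: t1 t2; lra.
  apply: le_trans (ler_sum _ (fun i _ => le i)) _.
  by rewrite sumr_const card_ord -(mulr_natr N%:R^-1 n) mulrC.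
exists (v f); last exact: le_trans near Nnu.
rewrite mem_filter; apply/andP; split; last by apply: map_f; rewrite mem_enum.
have := enormD (v f - e') e'; rewrite subrK e1.
by move: (le_trans near N1); lra.
Qed.

End Doubling.

(** * A lower Hessian bound from the upper one *)

Section LowerBound.
Variables (R : realType) (n : nat).
Local Notation vec := 'rV[R]_n.
Local Notation mat := 'M[R]_n.
Implicit Types (x y z p e c : vec) (u f g : vec -> R) (X : mat) (K t d h r : R).

Lemma av_dd A ro K f x z b : avop A ro -> Reg K f ->
  (forall y, enorm (y - x) <= ro -> dd f z y <= b) -> dd (A f) z x <= b.
Proof.
move=> hA rf h; rewrite dd_mixd (av_mixd hA _ _ _ rf) -[X in _ <= X](avC hA b (x - z)).
have rm : Reg (K + K + K + K) (fun y => mixd f y z z).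
  have := RegD (RegB (RegB (RegT (z + z) rf) (RegT z rf)) (RegT z rf)) rf.
  by rewrite /mixd; under [X in Reg _ X -> _]eq_fun do rewrite addrA.
apply: (avle hA rm (Reg_cst n b)) => y hy.
have := h (y + z); rewrite dd_mixd addrK; apply.
by rewrite (_ : y + z - x = y - (x - z)) // opprB addrA addrAC.
Qed.

Lemma smooth_dd C g (p : vec -> vec) (X : vec -> mat) x z : smooth C g p X ->
  `|dd g z x - qf (X x) z| <= 2 * C * enorm z ^+ 3.
Proof.
move=> sm; have h1 := sm_jet sm x z; have h2 := sm_jet sm x (- z).
rewrite qf_opp dotNr enormN in h2.
move: h1 h2; rewrite /dd !ler_norml => /andP[? ?] /andP[? ?]; apply/andP; split; lra.
Qed.

(** The Hessian [X] of a mollification satisfies [X <= H + b] and [F X >= 0], while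
    [F (H + b) <= lam / 4]; lower ellipticity then leaves a gap of at most 1/4 between them. The
    remaining 1/4 of the claimed 1/2 covers the passage from Hessians to finite steps, for which
    [dd_doubling] is applied to the negative of the mollification. *)
Lemma lower_of_upper (F : mat -> R) lam Lam K u (H : mat) (b : R) :
  ell F lam Lam -> Reg K u -> subsol F (eball 0 2^-1) u -> symmx H -> 0 <= b ->
  hess_le u (H + b%:M) (eball 0 2^-1) -> F H + Lam * b <= lam / 4 ->
  hess_ge u (H - 2^-1%:M) (eball 0 8^-1).
Proof.
move=> hF ru hsub sH b0 hle FH.
have lam0 := el_lam hF.
have sHb : symmx (H + b%:M) by apply: symmxD => //; exact: symmxM.
have FHb : F (H + b%:M) <= lam / 4 by apply: le_trans (el_up hF sH b0) FH.
have main sig : 0 < sig -> 2 * n%:R * sig <= 8^-1 -> forall x z,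
    eball 0 8^-1 (x + z) -> eball 0 8^-1 (x - z) -> qf (H - 2^-1%:M) z <= dd (moll sig u) z x.
  move=> sig0 sig8; have hA := avop_moll n sig0; have [C sm] := moll_smooth sig0 ru.
  set g := moll sig u in sm *; set X := moll_hess sig u in sm.
  have C0 := sm_C0 sm.
  have up x e : eball 0 8^-1 x -> qf (X x) e <= qf (H + b%:M) e.
    rewrite /eball /= subr0 => hx.
    pose t0 := (8 * (enorm e + 1))^-1.
    have e0 := enorm_ge0 e.
    have p0 : 0 < 8 * (enorm e + 1) by rewrite mulr_gt0 // ltr_wpDl.
    have t00 : 0 < t0 by rewrite invr_gt0.
    have te : t0 * enorm e <= 8^-1 by rewrite mulrC ler_pdivrMr //; move: e0; lra.
    apply: (@le_add_inv_nat _ _ _ (2 * C * t0 * enorm e ^+ 3)) => m.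
    have M1 : 1 <= m.+1%:R :> R by rewrite ler1n.
    have M0 : 0 < m.+1%:R :> R by rewrite ltr0n.
    have [t tE] : exists t, t = t0 / m.+1%:R by eexists.
    have tp : 0 < t by rewrite tE divr_gt0.
    have tt0 : t <= t0 by rewrite tE ler_pdivrMr // ler_peMr // ltW.
    have nt : enorm (t *: e) <= 8^-1.
      by rewrite enormZ gtr0_norm //; apply: le_trans te; rewrite ler_wpM2r.
    have h1 : dd g (t *: e) x <= qf (H + b%:M) (t *: e).
      apply: (av_dd hA ru) => y hy; apply: hle; rewrite /eball /= subr0.
        apply: le_lt_trans (enormD _ _) _; have := enorm_tri y x 0; rewrite !subr0.
        by move: hy sig8 hx nt; lra.
      apply: le_lt_trans (enormDB _ _) _; have := enorm_tri y x 0; rewrite !subr0.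
      by move: hy sig8 hx nt; lra.
    have := smooth_dd x (t *: e) sm; rewrite ler_norml => /andP[h2 _].
    rewrite !qf_scale enormZ (gtr0_norm tp) exprMn in h1 h2.
    have t2 : 0 < t ^+ 2 by rewrite exprn_gt0.
    rewrite -(ler_pM2l t2).
    have -> : t ^+ 2 * (qf (H + b%:M) e + 2 * C * t0 * enorm e ^+ 3 / m.+1%:R) =
       t ^+ 2 * qf (H + b%:M) e + 2 * C * (t ^+ 3 * enorm e ^+ 3) by rewrite tE; field; rewrite gt_eqF.
    by move: h1 h2; move: (t ^+ 2) (t ^+ 3 * _) => a1 a2; lra.
  have low x e : eball 0 8^-1 x -> enorm e = 1 -> qf H e - 4^-1 <= qf (X x) e.
    move=> hx e1; have sX := sm_sym sm x.
    have FX : 0 <= F (X x).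
      apply: (mollified_subsol hF ru hsub hA sm (d := 8^-1)); first by rewrite invr_gt0.
      move=> y hy; rewrite /eball /= subr0; move: hx; rewrite /eball /= subr0 => hx.
      by have := enorm_tri y x 0; rewrite !subr0; move: hy sig8 hx; lra.
    have sN : symmx (H + b%:M - X x) by apply: symmxD => //; exact: symmxN.
    have pN z : 0 <= qf (H + b%:M - X x) z by rewrite qfB subr_ge0; exact: up.
    have := el_low hF sX sN pN e1; rewrite subrKC => l1.
    have l2 : qf (H + b%:M - X x) e <= 4^-1.
      by rewrite -(ler_pM2l lam0); move: l1 FX FHb; lra.
    by move: l2; rewrite qfB qfD qfM -enorm2 e1 expr1n; move: b0; lra.
  move=> x z h1 h2.
  have [z0|zn] := eqVneq z 0.
    by rewrite z0 /dd subr0 addr0 /qf mul0mx dot0l; lra.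
  have z0 : 0 < enorm z by rewrite enorm_gt0.
  pose e := (enorm z)^-1 *: z.
  have zE : z = enorm z *: e by rewrite scalerA divff ?gt_eqF // scale1r.
  have e1 : enorm e = 1 by rewrite enormZ gtr0_norm ?invr_gt0 // mulVf // gt_eqF.
  have p8 : 0 < 8 * C + 1 by move: C0; lra.
  have t00 : 0 < (8 * C + 1)^-1 by rewrite invr_gt0.
  have dN (v y : vec) : dd (fun y => - g y) v y = - dd g v y by rewrite /dd; ring.
  have [E EE] : exists E, E = qf (H - 2^-1%:M) e by eexists.
  have := @dd_doubling _ _ (fun y => - g y) 0 8^-1 e (- E) _ t00.
  have small y t : 0 < t -> t <= (8 * C + 1)^-1 -> eball 0 8^-1 (y + t *: e) ->
      eball 0 8^-1 (y - t *: e) -> dd (fun y => - g y) (t *: e) y <= - E * t ^+ 2.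
    move=> tp tC b1 b2; rewrite dN.
    have by_ : eball 0 8^-1 y.
      have := @eball_conv _ _ 0 8^-1 (y - t *: e) (t *: e + t *: e) 2^-1 b2.
      have -> : 2^-1 *: (t *: e + t *: e) = t *: e by rewrite -scalerDl scalerA; congr (_ *: _); field.
      by rewrite addrA subrK => /(_ b1); apply; apply/andP; split; lra.
    have := low y e by_ e1; have := smooth_dd y (t *: e) sm; rewrite ler_norml => /andP[l1 _].
    rewrite qf_scale enormZ e1 mulr1 (gtr0_norm tp) in l1.
    move=> l2; have t2 : 0 <= t ^+ 2 by rewrite exprn_ge0 // ltW.
    have l3 := ler_wpM2l t2 l2.
    have l4 : 2 * C * t <= 4^-1.
      rewrite -[X in _ <= X]mul1r ler_pdivlMr // in tC.
      by move: tC tp; lra.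
    have l5 := ler_wpM2l t2 l4.
    have EE' : E = qf H e - 2^-1 by rewrite EE qfB qfM -enorm2 e1 expr1n mulr1.
    have t3 : t ^+ 3 = t ^+ 2 * t by rewrite exprSr.
    by rewrite EE'; move: l1 l3 l5; rewrite t3; lra.
  move=> /(_ small x (enorm z) z0); rewrite -zE dN => /(_ h1 h2).
  rewrite mulNr lerN2; apply: le_trans.
  by rewrite EE [X in _ <= X]mulrC -qf_scale -zE.
have K0 := Reg_ge0 ru.
move=> x z h1 h2.
have n0 : 0 <= n%:R :> R by [].
have p1 : 0 < 16 * (n%:R + 1) :> R by rewrite mulr_gt0 // ltr_wpDl.
pose s := (16 * (n%:R + 1) : R)^-1; have s0 : 0 < s by rewrite invr_gt0.
have s8 : 2 * n%:R * s <= 8^-1 by rewrite ler_pdivrMr //; move: n0; lra.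
have s1 : s <= 1 by rewrite invf_le1 //; move: n0; lra.
apply: (@le_add_inv_nat _ _ _ (8 * n%:R * K * s)) => m.
have M1 : 1 <= m.+1%:R :> R by rewrite ler1n.
have M0 : 0 < m.+1%:R :> R by rewrite ltr0n.
set sg := s / m.+1%:R; have sg0 : 0 < sg by rewrite divr_gt0.
have sgs : sg <= s by rewrite ler_pdivrMr // ler_peMr // ltW.
have sg8 : 2 * n%:R * sg <= 8^-1 by apply: le_trans s8; rewrite ler_wpM2l // mulr_ge0.
have sg2 : sg ^+ 2 <= sg by rewrite expr2 ler_piMl ?(ltW sg0) // (le_trans sgs).
have a := main sg sg0 sg8 x z h1 h2.
have nK : 0 <= 2 * n%:R * K by rewrite !mulr_ge0.
have e1 := moll_near sg0 (x + z) ru; have e2 := moll_near sg0 (x - z) ru.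
have e3 := moll_near sg0 x ru.
have := ler_wpM2l nK sg2.
have -> : 8 * n%:R * K * s / m.+1%:R = 4 * (2 * n%:R * K * sg) by rewrite /sg; field; rewrite gt_eqF.
move: a e1 e2 e3; rewrite /dd !ler_norml => a /andP[? ?] /andP[? ?] /andP[? ?]; lra.
Qed.

End LowerBound.

(** * One step of the improvement: a drop in some direction, or halved oscillation *)

Section Improvement.
Variables (R : realType) (n : nat) (lam Lam : R).
Local Notation vec := 'rV[R]_n.
Local Notation mat := 'M[R]_n.
Implicit Types (x y z p e c : vec) (u f g : vec -> R) (X : mat) (K t d h r : R).
Hypotheses (lam0 : 0 < lam) (lamLam : lam <= Lam).

Definition dir_le u U e (m : R) : Prop := forall x t, 0 < t -> U (x + t *: e) -> U (x - t *: e) ->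
  dd u (t *: e) x <= m * t ^+ 2.

Definition normalized (F : mat -> R) u : Prop :=
  [/\ ell F lam Lam, exists K G, Reg K u /\ has_grad u G K, sol F (eball 0 1) u,
   hess_le u 1%:M (eball 0 1) & hess_ge u (- 1%:M) (eball 0 1)].

Definition osc_half u r : Prop := exists H : mat, [/\ symmx H,
  hess_le u (H + 2^-1%:M) (eball 0 r) & hess_ge u (H - 2^-1%:M) (eball 0 r)].

Lemma eball_sub (a b : vec) (r s : R) : enorm (a - b) + r <= s -> eball a r `<=` eball b s.
Proof. by move=> h x; rewrite /eball /= => hx; have := enorm_tri x a b; lra. Qed.

Lemma hess_le_sub u (X : mat) (U V : set vec) : V `<=` U -> hess_le u X U -> hess_le u X V.
Proof. by move=> VU h x z /VU h1 /VU h2; exact: h. Qed.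

Lemma hess_ge_sub u (X : mat) (U V : set vec) : V `<=` U -> hess_ge u X U -> hess_ge u X V.
Proof. by move=> VU h x z /VU h1 /VU h2; exact: h. Qed.

(** An arbitrary direction is compared with a nearby one of the net: [6 * nu] is the change of the
    second difference, by [dd_dir_diff] and [MB], and [18 n^2 nu] that of the form of [H]. *)
Lemma net_upper u (H : mat) (l : seq vec) (nu b : R) : symmx H -> 0 <= nu -> nu <= 1 ->
  MB u 2 (eball 0 1) -> mabs H <= 6 * n%:R ^+ 2 ->
  (forall e', enorm e' = 1 -> exists2 e, e \in l & enorm (e - e') <= nu) ->
  (forall e, e \in l -> dir_le u (eball 0 1) e (qf H e + b)) ->
  hess_le u (H + (b + (18 * n%:R ^+ 2 + 6) * nu)%:M) (eball 0 2^-1).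
Proof.
move=> sH nu0 nu1 mb mH net hl x z h1 h2.
have [z0|zn] := eqVneq z 0.
  by rewrite z0 /dd subr0 addr0 /qf mul0mx dot0l; lra.
have z0 : 0 < enorm z by rewrite enorm_gt0.
have [t tE] : exists t, t = enorm z by eexists.
pose e' := t^-1 *: z.
have tp : 0 < t by rewrite tE.
have zE : z = t *: e' by rewrite scalerA divff ?gt_eqF // scale1r.
have e1 : enorm e' = 1 by rewrite enormZ gtr0_norm ?invr_gt0 // -tE mulVf // gt_eqF.
have [e el ee] := net e' e1.
move: h1 h2; rewrite /eball /= !subr0 => h1 h2.
have t2 : t <= 2^-1.
  have := enormDB (x + z) (x - z).
  have -> : x + z - (x - z) = 2 *: z by rewrite opprB [z - x]addrC addrACA subrr add0r scaler_nat mulr2n.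
  by rewrite enormZ gtr0_norm // -tE; move: h1 h2; lra.
have tn : enorm (t *: e - z) <= 2^-1.
  rewrite zE -scalerBr enormZ gtr0_norm //.
  by apply: le_trans (ler_pM _ _ t2 (le_trans ee nu1)) _; rewrite ?mulr1 // ?(ltW tp) // enorm_ge0.
have b1 : eball 0 1 (x + t *: e).
  rewrite /eball /= subr0 (_ : x + t *: e = (x + z) + (t *: e - z)); last by rewrite -addrA subrKC.
  by apply: le_lt_trans (enormD _ _) _; move: h1 tn; lra.
have b2 : eball 0 1 (x - t *: e).
  rewrite /eball /= subr0 (_ : x - t *: e = (x - z) - (t *: e - z)).
    by apply: le_lt_trans (enormDB _ _) _; move: h2 tn; lra.
  by rewrite opprB addrA subrK.
have d1 := hl e el x t tp b1 b2.
have b3 : eball 0 1 (x + z) by rewrite /eball /= subr0; move: h1; lra.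
have b4 : eball 0 1 (x - z) by rewrite /eball /= subr0; move: h2; lra.
have D := dd_dir_diff u x (t *: e) z.
have s3 : enorm (e + e') <= 3.
  by have := enormD (e - e') (e' + e'); rewrite addrA subrK; have := enormD e' e'; rewrite e1; move: (le_trans ee nu1); lra.
have E1 : x - z + (t *: e + z) = x + t *: e by rewrite addrACA addNr addr0.
have E2 : x - z + (z - t *: e) = x - t *: e by rewrite addrA subrK.
have E3 : x - z + (t *: e + z) + (z - t *: e) = x + z by rewrite E1 -addrA subrKC.
have := mb (x - z) (t *: e + z) (z - t *: e).
rewrite E3 E1 E2 -D => /(_ b4 b1 b2 b3) d2.
have d3 : enorm (t *: e + z) * enorm (z - t *: e) <= t ^+ 2 * (3 * nu).
  rewrite zE -scalerDr -scalerBr !enormZ (gtr0_norm tp) mulrACA -expr2 ler_wpM2l ?exprn_ge0 ?(ltW tp) //.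
  by apply: ler_pM; rewrite ?enorm_ge0 // enormB.
have d4 : qf H e - qf H e' <= 18 * n%:R ^+ 2 * nu.
  rewrite enorm_diff_quad //; apply: le_trans (ler_norm _) _; apply: le_trans (bf_le _ _ _) _.
  have -> : 18 * n%:R ^+ 2 * nu = (6 * n%:R ^+ 2) * (nu * 3) by ring.
  apply: ler_pM => //; rewrite ?mabs_ge0 ?mulr_ge0 ?enorm_ge0 //.
  by apply: ler_pM; rewrite ?enorm_ge0.
have d5 : dd u z x <= t ^+ 2 * (qf H e + b) + t ^+ 2 * (6 * nu).
  by move: d2; rewrite ler_norml => /andP[_]; move: d1 d3; lra.
rewrite qfD qfM [X in _ <= qf H X + _]zE qf_scale -enorm2 -tE.
by have := ler_wpM2l (exprn_ge0 2 (ltW tp)) d4; move: d5; lra.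
Qed.

Lemma normalized_MB F u : normalized F u -> MB u 2 (eball 0 1).
Proof. by case=> _ _ _ h1 h2; rewrite -[2]mulr1; apply: MB_of_hess. Qed.

Lemma drop_or_flat : exists (l : seq vec) (c : R), [/\ 0 < c, forall e, e \in l -> enorm e <= 2 &
  forall F u (m : vec -> R), normalized F u ->
    (forall e, e \in l -> dir_le u (eball 0 1) e (m e)) ->
    (exists2 e, e \in l & dir_le u (eball 0 8^-1) e (m e - c)) \/ osc_half u 8^-1].
Proof.
have Lam0 : 0 < Lam by exact: lt_le_trans lamLam.
(* Together with [eta <= lam / 8] this gives [F H + Lam * b <= lam / 4], as [lower_of_upper]
   requires. *)
pose b := lam / (8 * Lam).
have b0 : 0 < b by rewrite divr_gt0 // mulr_gt0.
have bL : Lam * b = lam / 8 by rewrite /b; field; rewrite gt_eqF.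
have b8 : b <= 8^-1 by rewrite /b ler_pdivrMr ?mulr_gt0 //; move: lamLam; clear -n lam0 lamLam; lra.
have [eta [eta0 eta1 eta2]] : exists eta : R, [/\ 0 < eta, eta <= b / 16 & eta <= lam / 8].
  exists (Num.min (b / 16) (lam / 8)); split; [|by rewrite ge_min lexx|by rewrite ge_min lexx orbT].
  by rewrite lt_min; apply/andP; split; apply: divr_gt0.
have q0 : 0 < 18 * n%:R ^+ 2 + 6 :> R by rewrite ltr_wpDl // mulr_ge0 // exprn_ge0.
have [nu [nu0 nu1 nu2]] : exists nu : R, [/\ 0 < nu, nu <= 1 & (18 * n%:R ^+ 2 + 6) * nu <= b / 4].
  exists (Num.min 1 (b / 4 / (18 * n%:R ^+ 2 + 6))); split.
  - by rewrite lt_min ltr01; apply: divr_gt0 q0; apply: divr_gt0.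
  - by rewrite ge_min lexx.
  - by rewrite mulrC -ler_pdivlMr // ge_min lexx orbT.
have [l [l2 net]] := sphere_net n nu0.
have [ro ro0 hro] := upper_flat_ball n lam0 lamLam eta0.
have [ro' [ro'0 ro'1 ro'2]] : exists ro' : R, [/\ 0 < ro', ro' <= ro & ro' <= 16^-1].
  exists (Num.min ro 16^-1); split; [|by rewrite ge_min lexx|by rewrite ge_min lexx orbT].
  by rewrite lt_min ro0 invr_gt0 ltr0n.
have rR : ro' < 2^-1 by move: ro'2; clear -n lam0 lamLam; lra.
have r4 : 0 <= 4^-1 :> R by rewrite invr_ge0.
have r42 : 4^-1 < 2^-1 :> R by lra.
(* The barrier will be centred at [y], of norm at most 1/8, so its ball of radius 1/4 contains the
   ball of radius 1/8 about the origin. *)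
have [beta beta0 hbar] := barrier n ro'0 rR r4 r42 lam0 lamLam.
exists l, (beta * (b / 4)); split=> //; first by rewrite mulr_gt0 // divr_gt0.
move=> F u m nF hm; have [hF [K [G [ru hG]]] hs h1 h2] := nF.
have mb := normalized_MB nF.
have [y [H [sH yro mH FH hup]]] := hro F K u G hF ru hG hs mb.
(* The factor 4 bounds [|e|^2] on the net. If no direction qualifies, every [m e] exceeds the form
   of [H] by at most [b / 2]. *)
have [[e el he]|none] := pselect (exists2 e, e \in l & qf H e + eta * 4 <= m e - b / 4).
  left; exists e => //.
  have e2 := l2 e el; have e0 := enorm_ge0 e.
  have t00 : 0 < ro' / 2 by rewrite divr_gt0.
  apply: dd_doubling t00 _ => x t t0 tro b1 b2.
  have nt : enorm (t *: e) <= ro'.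
    by rewrite enormZ gtr0_norm //; apply: le_trans (ler_pM (ltW t0) e0 tro e2) _; rewrite divfK.
  have -> : (m e - beta * (b / 4)) * t ^+ 2 = m e * t ^+ 2 - beta * (b / 4 * t ^+ 2) by ring.
  have t2 : 0 <= t ^+ 2 by rewrite exprn_ge0 // ltW.
  have yl : enorm y <= 8^-1 by move: yro ro0; clear -n lam0 lamLam; lra.
  apply: (hbar F K u (eball 0 1) y (t *: e) (m e * t ^+ 2) (b / 4 * t ^+ 2) 1) => //.
  - exists 16^-1; first by rewrite invr_gt0 ltr0n.
    move=> x'; rewrite mulr1 /eball /= subr0 => hx.
    by have := enorm_tri x' y 0; rewrite !subr0; move: hx nt ro'2 yl; clear -n lam0 lamLam; lra.
  - by rewrite mulr_ge0 // divr_ge0 // ltW.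
  - move=> x'; rewrite mulr1 => hx.
    have hx' : enorm x' <= 8^-1 + 2^-1 by have := enorm_tri x' y 0; rewrite !subr0; move: hx yl; clear -n lam0 lamLam; lra.
    apply: hm => //; rewrite /eball /= subr0.
      by apply: le_lt_trans (enormD _ _) _; move: hx' nt ro'2; clear -n lam0 lamLam; lra.
    by apply: le_lt_trans (enormDB _ _) _; move: hx' nt ro'2; clear -n lam0 lamLam; lra.
  - move=> x'; rewrite mulr1 => hx.
    apply: le_trans (hup x' (t *: e) (le_trans hx ro'1) (le_trans nt ro'1)) _.
    rewrite qf_scale -mulrBl enormZ (gtr0_norm t0) exprMn mulrCA -mulrDr mulrC ler_wpM2r //.
    apply: le_trans he; rewrite lerD2l ler_wpM2l ?(ltW eta0) //.
    have := ler_pM e0 e0 e2 e2; rewrite -expr2; lra.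
  - rewrite mulr1; move: b1 b2; rewrite /eball /= !subr0 => b1 b2.
    have xn : enorm x < 8^-1.
      have := enormD (x + t *: e) (x - t *: e).
      rewrite addrACA subrr addr0 (_ : x + x = 2 *: x) ?enormZ; last by rewrite scaler_nat.
      by rewrite gtr0_norm //; move: b1 b2; clear -n lam0 lamLam; lra.
    by have := enorm_tri x 0 y; rewrite subr0 sub0r enormN; move: xn yl; clear -n lam0 lamLam; lra.
right; exists H.
have hl e : e \in l -> dir_le u (eball 0 1) e (qf H e + b / 2).
  move=> el x t t0 b1 b2; apply: le_trans (hm e el x t t0 b1 b2) _.
  rewrite ler_wpM2r ?exprn_ge0 ?(ltW t0) //.
  rewrite leNgt; apply/negP => hlt; apply: none; exists e => //.
  by move: hlt eta1 b0; clear -n lam0 lamLam; lra.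
have hle := net_upper sH (ltW nu0) nu1 mb mH net hl.
set b' := _ + _ * nu in hle.
have b'0 : 0 <= b' by rewrite addr_ge0 ?divr_ge0 ?mulr_ge0 // ltW.
have b'b : b' <= b by rewrite /b'; move: nu2 b0; clear -n lam0 lamLam; lra.
have s82 : eball 0 8^-1 `<=` eball (0 : vec) 2^-1.
  by apply: eball_sub; rewrite subrr enorm0; clear -n lam0 lamLam; lra.
split=> //.
  apply: hess_le_sub s82 _ => x z bx1 bx2; apply: le_trans (hle x z bx1 bx2) _.
  rewrite !qfD lerD2l !qfM ler_wpM2r ?dot_ge0 //.
  by move: b'b b8; clear -n lam0 lamLam; lra.
have [hsub _] := hs.
have hsub' : subsol F (eball 0 2^-1) u.
  move=> x X bx; apply: hsub; apply: (eball_sub _ bx).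
  by rewrite subrr enorm0; clear -n lam0 lamLam; lra.
apply: (lower_of_upper hF ru hsub' sH b'0 hle).
by have := ler_wpM2l (ltW Lam0) b'b; rewrite bL; move: FH eta2; clear -n lam0 lamLam; lra.
Qed.

End Improvement.

(** * Iteration of the improvement and geometric decay of the Hessian oscillation *)

Section Iteration.
Variables (R : realType) (n : nat) (lam Lam : R).
Local Notation vec := 'rV[R]_n.
Local Notation mat := 'M[R]_n.
Implicit Types (x y z p e c : vec) (u f g : vec -> R) (X : mat) (K t d h r : R).
Hypotheses (lam0 : 0 < lam) (lamLam : lam <= Lam).

Lemma symmx0 : symmx (0 : mat). Proof. by rewrite /symmx trmx0. Qed.

Lemma normalized_dir_ge F u e m : normalized lam Lam F u -> enorm e <= 2 ->
  dir_le u (eball 0 1) e m -> - 4 <= m.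
Proof.
move=> [_ _ _ _ hge] e2 hm.
have t0 : 0 < 4^-1 :> R by rewrite invr_gt0.
have tt : enorm (4^-1 *: e) < 1 by rewrite enormZ gtr0_norm //; move: e2; lra.
have b1 : eball 0 1 (0 + 4^-1 *: e) by rewrite /eball /= subr0 add0r.
have b2 : eball 0 1 (0 - 4^-1 *: e) by rewrite /eball /= subr0 sub0r enormN.
have a1 := hm 0 4^-1 t0 b1 b2; have a2 := hge 0 _ b1 b2.
have e0 := enorm_ge0 e; have e4 := ler_pM e0 e0 e2 e2; rewrite -expr2 in e4.
move: (le_trans a2 a1); rewrite qfN qfM mul1r dotZl dotZr -enorm2; move: e4; lra.
Qed.

Lemma normalized_dilate F u : normalized lam Lam F u ->
  normalized lam Lam (fun X => 1^-1 * F (0 + 1 *: X)) (rescale u 0 0 8^-1 1 0).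
Proof.
move=> [hF [K [G [ru hG]]] hs hle hge].
have s0 : 0 < 8^-1 :> R by rewrite invr_gt0.
have sub : eball 0 (8^-1 * 1) `<=` eball (0 : vec) 1.
  by apply: eball_sub; rewrite subrr enorm0; lra.
split.
- exact: (rescale_ell ltr01 symmx0 hF).
- have [K' [rK hK]] := rescale_reg 0 0 s0 ltr01 symmx0 ru hG.
  by exists K', (rescale_grad G 0 0 8^-1 1 0).
- by apply: (rescale_sol _ s0 ltr01 symmx0); exact: sol_sub sub hs.
- by apply/(hess_le_rescale _ _ _ s0 ltr01 symmx0); rewrite add0r scale1r; exact: hess_le_sub sub hle.
- by apply/(hess_ge_rescale _ _ _ s0 ltr01 symmx0); rewrite add0r scale1r; exact: hess_ge_sub sub hge.
Qed.

Lemma dir_le_dilate u e m : dir_le u (eball 0 8^-1) e m ->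
  dir_le (rescale u 0 0 8^-1 1 0) (eball 0 1) e m.
Proof.
have s0 : 0 < 8^-1 :> R by rewrite invr_gt0.
move=> h x t t0 b1 b2; rewrite (dd_rescale _ _ _ s0 ltr01 symmx0) qf0 subr0 mul1r add0r.
rewrite mulrC ler_pdivrMr ?exprn_gt0 // scalerA -mulrA -exprMn [t * _]mulrC.
apply: h; first exact: mulr_gt0.
  rewrite -scalerA -scalerDr -[X in eball _ _ X]add0r -[X in eball _ X]mulr1.
  by apply/eball_rescale.
rewrite -scalerA -scalerBr -[X in eball _ _ X]add0r -[X in eball _ X]mulr1.
by apply/eball_rescale.
Qed.

(** The potential is the sum of [m e + 4] over the net. It starts at 8 per vector, stays nonnegative
    by [normalized_dir_ge], and loses [c] at every drop, after which the ball of radius 1/8 is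
    dilated to unit size. *)
Lemma improvement : exists2 kap : R, 0 < kap <= 8^-1 &
  forall F u, normalized lam Lam F u -> @osc_half R n u kap.
Proof.
have [l [c [c0 l2 step]]] := drop_or_flat n lam0 lamLam.
have s0 : 0 < 8^-1 :> R by rewrite invr_gt0.
have main J F u m : normalized lam Lam F u -> (forall e, e \in l -> dir_le u (eball 0 1) e (m e)) ->
    \sum_(e <- l) (m e + 4) < J%:R * c -> osc_half u (8^-1 ^+ J).
  elim: J F u m => [|J IH] F u m nF hm.
    rewrite mul0r ltNge => /negP[]; rewrite big_seq; apply: sumr_ge0 => e el.
    by have := normalized_dir_ge nF (l2 e el) (hm e el); lra.
  move=> hs; have [[e0 e0l drop]|flat] := step F u m nF hm.
    pose m' e := if e == e0 then m e0 - c else m e.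
    have hm' e : e \in l -> dir_le (rescale u 0 0 8^-1 1 0) (eball 0 1) e (m' e).
      move=> el; apply: dir_le_dilate; rewrite /m'; case: eqVneq => [->//|_].
      have sub : eball 0 8^-1 `<=` eball (0 : vec) 1.
        by apply: eball_sub; rewrite subrr enorm0; lra.
      by move=> x t t0 /sub b1 /sub b2; exact: hm.
    have hs' : \sum_(e <- l) (m' e + 4) < J%:R * c.
      (* A vector repeated in [l] lowers every one of its terms, so the sum falls by at least
         [c]. *)
      have le : \sum_(e <- l) (m' e + 4) <= \sum_(e <- l) (m e + 4) - c.
        rewrite !(big_rem _ e0l) /= /m' eqxx.
        have : \sum_(e <- rem e0 l) ((if e == e0 then m e0 - c else m e) + 4)
            <= \sum_(e <- rem e0 l) (m e + 4).
          by apply: ler_sum => e _; case: eqVneq => [->|//]; move: c0; lra.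
        lra.
      by apply: le_lt_trans le _; move: hs; rewrite -natr1; lra.
    have [H [sH hle hge]] := IH _ _ _ (normalized_dilate nF) hm' hs'.
    exists H; rewrite exprS; split=> //.
      by move/(hess_le_rescale _ _ _ s0 ltr01 symmx0): hle; rewrite add0r scale1r.
    by move/(hess_ge_rescale _ _ _ s0 ltr01 symmx0): hge; rewrite add0r scale1r.
  have [H [sH hle hge]] := flat.
  have sub : eball 0 (8^-1 ^+ J.+1) `<=` eball (0 : vec) 8^-1.
    apply: eball_sub; rewrite subrr enorm0 add0r exprS ler_piMr ?(ltW s0) //.
    by rewrite exprn_ile1 // ?(ltW s0) // invf_le1 // ler1n.
  by exists H; split=> //; [exact: hess_le_sub sub hle|exact: hess_ge_sub sub hge].
pose S := \sum_(e <- l) (4 + 4 : R).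
pose J := (Num.truncn (S / c)).+1.
exists (8^-1 ^+ J).
  rewrite exprn_gt0 //= exprS ler_piMr ?(ltW s0) //.
  by rewrite exprn_ile1 // ?(ltW s0) // invf_le1 // ler1n.
move=> F u nF; apply: (main J F u (fun=> 4)) => //.
  move=> e el x t t0 b1 b2; have [_ _ _ hle _] := nF.
  apply: le_trans (hle _ _ b1 b2) _; rewrite qf_scale qfM mul1r mulrC -enorm2.
  rewrite ler_wpM2r ?exprn_ge0 ?(ltW t0) //.
  have e0 := enorm_ge0 e; have := ler_pM e0 e0 (l2 e el) (l2 e el); rewrite -expr2; lra.
by rewrite -/S -ltr_pdivrMr //; exact: truncnS_gt.
Qed.

(** Each stage subtracts the current [H] and rescales both the radius and the bound to 1, so the
    same [kap] serves at all stages. *)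
Lemma hessian_decay : exists2 kap : R, 0 < kap <= 8^-1 &
  forall (F : mat -> R) K u G y r (th : R), ell F lam Lam -> Reg K u -> has_grad u G K ->
    sol F (eball y r) u -> 0 < r -> 0 < th ->
    hess_le u th%:M (eball y r) -> hess_ge u (- th%:M) (eball y r) ->
  forall k, exists H : mat, [/\ symmx H,
    hess_le u (H + (th / 2 ^+ k)%:M) (eball y (r * kap ^+ k)) &
    hess_ge u (H - (th / 2 ^+ k)%:M) (eball y (r * kap ^+ k))].
Proof.
have [kap /andP[kap0 kap8] himp] := improvement; exists kap; first by rewrite kap0.
move=> F K u G y r th hF ru hG hs r0 th0 hle hge; elim=> [|k [H [sH hle' hge']]].
  by exists 0; rewrite !expr0 mulr1 divr1 add0r sub0r; split=> //; exact: symmx0.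
have s0 : 0 < r * kap ^+ k by rewrite mulr_gt0 // exprn_gt0.
have t0 : 0 < th / 2 ^+ k by rewrite divr_gt0 // exprn_gt0.
set s := r * kap ^+ k in s0 hle' hge'; set t := th / 2 ^+ k in t0 hle' hge'.
have sub : eball y s `<=` eball y r.
  apply: eball_sub; rewrite subrr enorm0 add0r /s ler_piMr ?(ltW r0) // exprn_ile1 //.
    exact: ltW.
  by apply: le_trans kap8 _; rewrite invf_le1 // ler1n.
have nW : normalized lam Lam (fun X => t^-1 * F (H + t *: X)) (rescale u y 0 s t H).
  split.
  - exact: rescale_ell.
  - have [K' [rK hK]] := rescale_reg y 0 s0 t0 sH ru hG.
    by exists K', (rescale_grad G y 0 s t H).
  - by apply: rescale_sol => //; rewrite mulr1; exact: sol_sub sub hs.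
  - by apply/hess_le_rescale => //; rewrite mulr1 scalemx1.
  - by apply/hess_ge_rescale => //; rewrite mulr1 scalerN scalemx1.
have [H' [sH' hl hg]] := himp _ _ nW.
have E : (th / 2 ^+ k.+1)%:M = t *: (2^-1%:M) :> mat.
  by rewrite scale_scalar_mx /t exprSr invfM mulrA.
exists (H + t *: H'); split; first by apply: symmxD => //; exact: symmxZ.
  rewrite E -addrA -scalerDr exprSr mulrA -/s.
  by apply/(hess_le_rescale u y 0 s0 t0 sH).
rewrite E -addrA -scalerBr exprSr mulrA -/s.
by apply/(hess_ge_rescale u y 0 s0 t0 sH).
Qed.

(** After subtraction of the form of [H] the two bounds give [MB] with constant [2 * a]. The mixed
    difference with one side [t z], divided by [t], tends to the increment of the gradient, and the
    term with [K] disappears. *)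
Lemma grad_osc K u G y r (a : R) (H : mat) : has_grad u G K -> 0 <= a -> symmx H ->
  hess_le u (H + a%:M) (eball y r) -> hess_ge u (H - a%:M) (eball y r) ->
  forall x x' z, eball y r x -> eball y r x' ->
  `|dot (G x' - G x - (x' - x) *m H) z| <= 2 * a * enorm (x' - x) * enorm z.
Proof.
move=> hG a0 sH hle hge x x' z bx bx'.
pose v w := u w - 2^-1 * qf H w.
have ddv w e : dd v e w = dd u e w - qf H e.
  by rewrite /dd /v !(qf_add _ _ sH) qf_opp dotNr; field.
have mv : MB v (2 * a) (eball y r).
  apply: MB_of_hess => // w e b1 b2; rewrite ddv.
    by have := hle _ _ b1 b2; rewrite qfD; lra.
  by have := hge _ _ b1 b2; rewrite qfB qfN; lra.
pose D := Num.min (r - enorm (x - y)) (r - enorm (x' - y)).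
have D0 : 0 < D by rewrite lt_min !subr_gt0 bx bx'.
have z0 := enorm_ge0 z.
have z1 : 0 < enorm z + 1 by rewrite ltr_wpDl.
pose t0 := D / (enorm z + 1); have t00 : 0 < t0 by rewrite divr_gt0.
apply: (@le_add_inv_nat _ _ _ (2 * K * t0 * enorm z ^+ 2)) => m.
have M1 : 1 <= m.+1%:R :> R by rewrite ler1n.
have M0 : 0 < m.+1%:R :> R by rewrite ltr0n.
have [t tE] : exists t, t = t0 / m.+1%:R by eexists.
have tp : 0 < t by rewrite tE divr_gt0.
have tD : t * enorm z < D.
  have tt0 : t <= t0 by rewrite tE ler_pdivrMr // ler_peMr // ltW.
  apply: le_lt_trans (ler_wpM2r z0 tt0) _; rewrite /t0 mulrAC ltr_pdivrMr // ltr_pM2l //.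
  by rewrite ltrDl.
have inb w : D <= r - enorm (w - y) -> eball y r (w + t *: z).
  move=> hw; rewrite /eball /= addrAC; apply: le_lt_trans (enormD _ _) _.
  by rewrite enormZ gtr0_norm //; move: hw tD; lra.
have b1 : eball y r (x + t *: z) by apply: inb; rewrite ge_min lexx.
have b2 : eball y r (x' + t *: z) by apply: inb; rewrite ge_min lexx orbT.
have := mv x (x' - x) (t *: z); rewrite subrKC => /(_ bx bx' b1 b2).
rewrite /mixd subrKC enormZ (gtr0_norm tp) => hm.
have g1 := hG x (t *: z); have g2 := hG x' (t *: z).
rewrite enormZ (gtr0_norm tp) !dotZr exprMn in g1 g2.
have [A AE] : exists A, A = dot (G x' - G x - (x' - x) *m H) z by eexists.
have hA : `|t * A| <= 2 * a * (enorm (x' - x) * (t * enorm z)) + 2 * (K * (t ^+ 2 * enorm z ^+ 2)).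
  move: hm g1 g2; rewrite /v !(qf_add _ _ sH) !dotZr AE !dotBl mulmxBl dotBl.
  rewrite !ler_norml => /andP[? ?] /andP[? ?] /andP[? ?]; apply/andP; split; lra.
rewrite -AE -(ler_pM2l tp) -[X in X * `|_|](gtr0_norm tp) -normrM; apply: le_trans hA _.
by rewrite le_eqVlt; apply/orP; left; apply/eqP; rewrite tE; field; rewrite gt_eqF.
Qed.

End Iteration.

(** * Differentiability expressed by Euclidean estimates *)

Section Differentiation.
Variables (R : realType) (n : nat).
Local Notation vec := 'rV[R]_n.
Local Notation mat := 'M[R]_n.
Implicit Types (x y z p e c g v : vec) (u f : vec -> R) (X : mat) (K t d h r : R).

Lemma dot_is_linear g : linear_for *:%R (dot g : vec -> R^o).
Proof. by move=> a x y; rewrite dotDr dotZr. Qed.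

HB.instance Definition _ g := GRing.isLinear.Build R vec R^o *:%R (dot g : vec -> R^o) (dot_is_linear g).

Lemma continuous_at_enorm f x : (forall e : R, 0 < e -> exists2 d, 0 < d &
    forall z, enorm z < d -> `|f (x + z) - f x| < e) -> {for x, continuous f}.
Proof.
move=> h; apply/(@cvgrPdist_lt _ _ _ (nbhs x)) => e e0; have [d d0 hd] := h e e0.
by apply: filterS (near_enorm x d0) => y hy; rewrite distrC -[y](subrKC x); exact: hd.
Qed.

Lemma dot_continuous g : continuous (dot g : vec -> R^o).
Proof.
move=> x; apply: continuous_at_enorm => e e0; exists (e / (enorm g + 1)).
  by rewrite divr_gt0 // ltr_wpDl // enorm_ge0.
move=> z hz; rewrite dotDr addrAC subrr add0r; apply: le_lt_trans (cauchy_schwarz _ _) _.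
have g1 : 0 < enorm g + 1 by rewrite ltr_wpDl // enorm_ge0.
rewrite ltr_pdivlMr // mulrC in hz; apply: le_lt_trans hz.
by rewrite ler_wpM2r ?enorm_ge0 // lerDl.
Qed.

Lemma enorm_le_normr z : enorm z <= n%:R * `|z|.
Proof.
apply: le_trans (enorm_le_sum _) _.
apply: le_trans (ler_sum _ (fun i _ => coord_le_normr z i)) _.
by rewrite sumr_const card_ord -(mulr_natr `|z| n) mulrC.
Qed.

Definition has_diff f x g : Prop := forall e : R, 0 < e -> exists2 d, 0 < d &
  forall z, enorm z < d -> `|f (x + z) - f x - dot g z| <= e * enorm z.

Lemma has_diffP f x g : has_diff f x g -> differentiable f x /\ forall v, 'D_v f x = dot g v.
Proof.
move=> h.
have E : (f \o shift x : vec -> R^o) = cst (f x) + dot g +o_ (0 : vec) id.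
  apply/eqaddoP => _/posnumP[e].
  have e0 : 0 < e%:num / (n%:R + 1) :> R by rewrite divr_gt0 // ltr_wpDl.
  have [d d0 hd] := h _ e0.
  apply: filterS (near_enorm 0 d0) => z; rewrite subr0 => zd.
  rewrite /= -[X in `|X|]/(f (z + x) - (f x + dot g z)) opprD addrA [z + x]addrC.
  apply: le_trans (hd z zd) _.
  rewrite mulrAC ler_pdivrMr ?ltr_wpDl // -mulrA ler_wpM2l // mulrC.
  by apply: le_trans (enorm_le_normr z) _; rewrite ler_wpM2r // lerDl.
have D := diff_unique (dot_continuous (g := g)) E.
have df : differentiable f x.
  apply/diff_locallyP; rewrite D; split => //; exact: dot_continuous.
by split=> // v; rewrite deriveE // D.
Qed.

Definition gradient f x : vec := \row_i partial i f x.

Lemma differentiable_derive f x v : differentiable f x -> 'D_v f x = dot (gradient f x) v.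
Proof.
move=> df; rewrite deriveE // [v in LHS]vec_sum_delta linear_sum /dot; apply: eq_bigr => i _.
by rewrite linearZ /= mxE /partial deriveE // mulrC.
Qed.

Lemma has_diff_partial f x g i : has_diff f x g -> partial i f x = g 0 i.
Proof. by move=> /has_diffP[_ h]; rewrite /partial h dot_deltar. Qed.

Lemma has_diff_grad f x g (K d : R) : 0 < d ->
  (forall z, enorm z < d -> `|f (x + z) - f x - dot g z| <= K * enorm z ^+ 2) -> has_diff f x g.
Proof.
move=> d0 h e e0; pose M := `|K| + 1; have M0 : 0 < M by rewrite ltr_wpDl.
exists (Num.min d (e / M)); first by rewrite lt_min d0 divr_gt0.
move=> z; rewrite lt_min ltr_pdivlMr // => /andP[zd ze].
apply: le_trans (h z zd) _; rewrite expr2 mulrA ler_wpM2r ?enorm_ge0 //.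
apply: le_trans (ltW ze); rewrite mulrC ler_wpM2l ?enorm_ge0 // /M.
by apply: le_trans (ler_norm K) _; rewrite lerDl.
Qed.

Lemma is_derive_line f x v t : differentiable f (x + t *: v) ->
  is_derive t 1 (fun s : R => f (x + s *: v)) (dot (gradient f (x + t *: v)) v).
Proof.
move=> df.
have E (h : R) : x + (h * 1 + t) *: v = h *: v + (x + t *: v) by rewrite mulr1 scalerDl addrCA.
have E' : (fun h : R => h^-1 *: (((fun s : R => f (x + s *: v)) \o shift t) (h *: 1) - f (x + t *: v))) =
  (fun h : R => h^-1 *: ((f \o shift (x + t *: v)) (h *: v) - f (x + t *: v))).
  by apply/funext => h; congr (_ *: (_ - _)); exact: (congr1 f (E h)).
have := @diff_derivable _ _ _ _ _ v df; rewrite /derivable -E' => d1.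
split; first exact: d1.
by rewrite -differentiable_derive // /derive E'.
Qed.

End Differentiation.

(** * Translating the hypotheses: ellipticity, test functions and norms *)

Section Conversions.
Variables (R : realType) (n : nat).
Local Notation vec := 'rV[R]_n.
Local Notation mat := 'M[R]_n.
Implicit Types (x y z p e c v : vec) (u f : vec -> R) (X M N : mat) (K t d h r : R).

Lemma enorm_dot_le x (K : R) : 0 <= K -> (forall i, `|x 0 i| <= K) -> enorm x <= n%:R * K.
Proof.
move=> K0 h; apply: le_trans (enorm_le_sum _) _.
apply: le_trans (ler_sum _ (fun i _ => h i)) _.
by rewrite sumr_const card_ord -(mulr_natr K n) mulrC.
Qed.

Lemma taylor_lip u c r K : 0 <= K -> (forall x, eball c r x -> differentiable u x) ->
  (forall i x y, eball c r x -> eball c r y -> `|partial i u x - partial i u y| <= K * enorm (x - y)) ->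
  forall x z, eball c r x -> eball c r (x + z) ->
  `|u (x + z) - u x - dot (gradient u x) z| <= n%:R * K * enorm z ^+ 2.
Proof.
move=> K0 du hL x z bx bz.
have inb (t : R) : 0 <= t <= 1 -> eball c r (x + t *: z) by move=> t01; exact: eball_conv.
have D (t : R) : 0 <= t <= 1 -> `|dot (gradient u (x + t *: z)) z - dot (gradient u x) z| <= n%:R * K * enorm z ^+ 2.
  move=> t01; rewrite -dotBl; apply: le_trans (cauchy_schwarz _ _) _.
  rewrite expr2 mulrA ler_wpM2r ?enorm_ge0 // -mulrA.
  apply: enorm_dot_le => [|i]; first by rewrite mulr_ge0 // enorm_ge0.
  rewrite !mxE; apply: le_trans (hL i _ _ (inb t t01) bx) _.
  rewrite ler_wpM2l // addrAC subrr add0r enormZ ler_piMl ?enorm_ge0 //.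
  by case/andP: t01 => t0 t1; rewrite ger0_norm.
have dl (t : R) : 0 <= t <= 1 -> is_derive t 1 (fun s : R => u (x + s *: z)) (dot (gradient u (x + t *: z)) z).
  by move=> t01; apply: is_derive_line; apply: du; exact: inb.
have up := @derive_bound _ _ _ 0 1 (dot (gradient u x) z + n%:R * K * enorm z ^+ 2) ler01 dl.
have dlN (t : R) : 0 <= t <= 1 -> is_derive t 1 (fun s : R => - u (x + s *: z)) (- dot (gradient u (x + t *: z)) z).
  by move=> t01; have h := dl t t01; apply: is_deriveN.
have lo := @derive_bound _ _ _ 0 1 (- dot (gradient u x) z + n%:R * K * enorm z ^+ 2) ler01 dlN.
rewrite !scale1r !scale0r !addr0 subr0 !mulr1 in up lo.
have {}up : u (x + z) - u x <= dot (gradient u x) z + n%:R * K * enorm z ^+ 2.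
  by apply: up => t t01; have := D t t01; rewrite ler_norml => /andP[_]; lra.
have {}lo : - u (x + z) - - u x <= - dot (gradient u x) z + n%:R * K * enorm z ^+ 2.
  by apply: lo => t t01; have := D t t01; rewrite ler_norml => /andP[]; lra.
by rewrite ler_norml; apply/andP; split; move: up lo; lra.
Qed.

Lemma enorm_mulmx_le v M : enorm (v *m M) <= mabs M * enorm v.
Proof.
set w := v *m M; have := bf_le M v w; rewrite -/w -enorm2 ger0_norm ?exprn_ge0 ?enorm_ge0 // => h.
have [w0|] := leP (enorm w) 0.
  by apply: le_trans w0 _; rewrite mulr_ge0 ?mabs_ge0 ?enorm_ge0.
by move=> w0; rewrite -(ler_pM2r w0) -expr2 -mulrA.
Qed.

Lemma opnorm_ge N v : enorm v = 1 -> qf N v <= opnorm N.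
Proof.
move=> v1; apply: (@le_trans _ _ (enorm (v *m N^T))).
  by rewrite -qf_tr; apply: le_trans (dot_le _ _) _; rewrite v1 mulr1.
apply: ub_le_sup; last by exists v.
by exists (mabs N^T) => _ [w w1 <-]; apply: le_trans (enorm_mulmx_le _ _) _; rewrite w1 mulr1.
Qed.

Lemma opnorm_scalar (t : R) : (0 < n)%N -> 0 <= t -> @opnorm R n t%:M <= t.
Proof.
move=> n0 t0; apply: sup_le_ub.
  by eexists; exists (delta_mx 0 (Ordinal n0)); [exact: enorm_delta|].
by move=> _ [w w1 <-]; rewrite tr_scalar_mx mul_mx_scalar enormZ w1 mulr1 ger0_norm.
Qed.

Lemma ell_of_unif_elliptic (F : mat -> R) lam Lam : (0 < n)%N -> 0 < lam -> lam <= Lam ->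
  unif_elliptic F lam Lam -> quasiconcave F -> ell F lam Lam.
Proof.
move=> n0 lam0 lamLam hF qF; split=> //.
- move=> M N v sM sN pN v1; have [|h _] := hF M N sM sN.
    by move=> z; rewrite qf_psd.
  rewrite -lerBrDl; apply: le_trans h; rewrite ler_pM2l //; exact: opnorm_ge.
- move=> M t sM t0; have [|_ h] := hF M t%:M sM (symmxM n t).
    by move=> z; rewrite qf_psd qfM mulr_ge0 // dot_ge0.
  rewrite -lerBlDl; apply: le_trans h _; rewrite ler_wpM2l ?opnorm_scalar //.
  by rewrite (le_trans (ltW lam0)).
Qed.

Definition quadratic x0 (a : R) p X x : R := a + dot p (x - x0) + 2^-1 * qf X (x - x0).

Lemma quadratic_has_diff x0 a p X x : symmx X ->
  has_diff (quadratic x0 a p X) x (p + (x - x0) *m X).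
Proof.
move=> sX; apply: (@has_diff_grad _ _ _ _ _ (mabs X) 1) => // z _.
rewrite /quadratic [x + z - x0]addrAC (dotDr (x - x0) z) (qf_add (x - x0) z sX) dotDl.
rewrite [X in `|X|](_ : _ = 2^-1 * qf X z); last by field.
rewrite normrM ger0_norm ?invr_ge0 // enorm2.
by have := qf_le X z; have := normr_ge0 (qf X z); lra.
Qed.

Lemma quadratic_partial x0 a p X i : symmx X ->
  partial i (quadratic x0 a p X) = fun x => (p + (x - x0) *m X) 0 i.
Proof.
by move=> sX; apply/funext => x; apply: has_diff_partial; exact: quadratic_has_diff.
Qed.

Lemma affine_has_diff x0 p X i x : symmx X ->
  has_diff (fun x => (p + (x - x0) *m X) 0 i) x (row i X).
Proof.
move=> sX e e0; exists 1 => // z _.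
rewrite [x + z - x0]addrAC mulmxDl addrA [in X in `|X - _ - _|]mxE.
rewrite (addrAC ((p + (x - x0) *m X) 0 i)) subrr add0r.
have -> : (z *m X) 0 i = dot (row i X) z.
  by rewrite mxE; apply: eq_bigr => j _; rewrite mxE mulrC -[in RHS]sX mxE.
by rewrite subrr normr0 mulr_ge0 ?enorm_ge0 // ltW.
Qed.

Lemma quadratic_partial2 x0 a p X i j : symmx X ->
  partial j (partial i (quadratic x0 a p X)) = cst (X i j).
Proof.
move=> sX; rewrite quadratic_partial //; apply/funext => x.
by rewrite (has_diff_partial _ (affine_has_diff _ _ _ _ sX)) mxE.
Qed.

Lemma quadratic_C2 x0 a p X (U : set vec) : symmx X -> C2_on U (quadratic x0 a p X).
Proof.
move=> sX; split; [|split].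
- by move=> x _; case: (has_diffP (quadratic_has_diff x0 a p x sX)).
- move=> i x _; rewrite quadratic_partial //.
  by case: (has_diffP (affine_has_diff x0 p i x sX)).
- move=> i j; rewrite quadratic_partial2 //.
  by apply: continuous_subspaceT => x; exact: cst_continuous.
Qed.

Lemma quadratic_hessian x0 a p X x : symmx X -> hessian (quadratic x0 a p X) x = X.
Proof. by move=> sX; apply/matrixP => i j; rewrite mxE quadratic_partial2. Qed.

Lemma cubic_le_quadratic (C g : R) : 0 < g -> exists2 d : R, 0 < d &
  forall z, enorm z < d -> C * enorm z ^+ 3 <= 2^-1 * (g * dot z z).
Proof.
move=> g0; have M0 : 0 < 2 * (`|C| + 1) by rewrite mulr_gt0 // ltr_wpDl.
exists (g / (2 * (`|C| + 1))); first by rewrite divr_gt0.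
move=> z; rewrite ltr_pdivlMr // => hz; rewrite -enorm2 [2^-1 * _]mulrA.
rewrite (_ : C * enorm z ^+ 3 = C * enorm z * enorm z ^+ 2); last by ring.
rewrite ler_wpM2r ?exprn_ge0 ?enorm_ge0 //.
have z0 := enorm_ge0 z.
have := ler_wpM2r z0 (ler_norm C); move: hz; lra.
Qed.

(** The cubic remainder of a jet is absorbed by adding or subtracting a small multiple [g] of the
    identity, which leaves an exact quadratic polynomial as test function; ellipticity bounds the
    effect on [F] by [Lam * g]. *)
Lemma sol_of_visc_sol (F : mat -> R) lam Lam (U V : set vec) u f : ell F lam Lam ->
  (forall x, V x -> \forall y \near x, f y = u y) -> V `<=` U ->
  visc_sol F U u -> sol F V f.
Proof.
move=> hF hfu VU [hsub hsup].
have Lam0 := el_Lam0 hF.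
split=> x0 X Vx sX [p [C [d [d0 h]]]].
  have main g : 0 < g -> - (Lam * g) <= F X.
    move=> g0; have [d' d'0 hd'] := cubic_le_quadratic C g0.
    have sXg : symmx (X + g%:M) by apply: symmxD => //; exact: symmxM.
    have : 0 <= F (X + g%:M).
      rewrite -(quadratic_hessian x0 (u x0) p x0 sXg).
      apply: (hsub x0); first exact: VU.
      - by exists 1 => //; exact: quadratic_C2.
      - by rewrite /quadratic subrr dot0r /qf mul0mx dot0l mulr0 !addr0.
      - have n1 := near_enorm x0 d0; have n2 := near_enorm x0 d'0.
        have n3 := hfu x0 Vx; have n4 := nbhs_singleton n3.
        apply: filterS (filterI n3 (filterI n1 n2)) => y [<- [h1 h2]].
        rewrite /quadratic -n4 qfD qfM.
        have := h _ h1; rewrite subrKC; have := hd' _ h2; lra.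
    by have := el_up hF sX (ltW g0); lra.
  rewrite leNgt; apply/negP => FX.
  have := main (- F X / (2 * Lam)); rewrite divr_gt0 ?oppr_gt0 ?mulr_gt0 // => /(_ isT).
  have -> : Lam * (- F X / (2 * Lam)) = - F X / 2 by field; rewrite gt_eqF.
  by move: FX; lra.
have main g : 0 < g -> F X <= Lam * g.
  move=> g0; have [d' d'0 hd'] := cubic_le_quadratic C g0.
  have sXg : symmx (X - g%:M) by apply: symmxD => //; apply: symmxN; exact: symmxM.
  have : F (X - g%:M) <= 0.
    rewrite -(quadratic_hessian x0 (u x0) p x0 sXg).
    apply: (hsup x0); first exact: VU.
    - by exists 1 => //; exact: quadratic_C2.
    - by rewrite /quadratic subrr dot0r /qf mul0mx dot0l mulr0 !addr0.
    - have n1 := near_enorm x0 d0; have n2 := near_enorm x0 d'0.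
      have n3 := hfu x0 Vx; have n4 := nbhs_singleton n3.
      apply: filterS (filterI n3 (filterI n1 n2)) => y [<- [h1 h2]].
      rewrite /quadratic -n4 qfB qfM.
      have := h _ h1; rewrite subrKC; have := hd' _ h2; lra.
  by have := el_down hF sX (ltW g0); lra.
rewrite leNgt; apply/negP => FX.
have := main (F X / (2 * Lam)); rewrite divr_gt0 ?mulr_gt0 // => /(_ isT).
have -> : Lam * (F X / (2 * Lam)) = F X / 2 by field; rewrite gt_eqF.
by move: FX; lra.
Qed.

Lemma lee_sum_const (A : 'I_n -> \bar R) (c : R) : (forall i, A i <= c%:E)%E ->
  (\sum_(i < n) A i <= (n%:R * c)%:E)%E.
Proof.
move=> h; apply: (@le_trans _ _ (\sum_(i < n) c%:E)%E); first by apply: lee_sum => i _.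
by rewrite sumEFin sumr_const card_ord -(mulr_natr c n) mulrC.
Qed.

(** Two distinct points keep all the suprema nonnegative: over an empty set they would be [-oo], and
    a bound on the sum would not bound its terms. *)
Lemma C11norm_bounds (U : set vec) u K x0 y0 : U x0 -> U y0 -> x0 != y0 ->
  (C11norm U u <= K%:E)%E ->
  [/\ forall x, U x -> `|u x| <= K, forall i x, U x -> `|partial i u x| <= K &
    forall i x y, U x -> U y -> `|partial i u x - partial i u y| <= K * enorm (x - y)].
Proof.
move=> Ux0 Uy0 xy; rewrite /C11norm => hK.
have s0 g : (0 <= supnorm U g)%E.
  apply: (@le_trans _ _ `|g x0|%:E); first by rewrite lee_fin.
  by apply: ereal_sup_ubound; exists x0.
have l0 g : (0 <= lipsemi U g)%E.
  apply: (@le_trans _ _ (`|g x0 - g y0| / enorm (x0 - y0))%:E).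
    by rewrite lee_fin divr_ge0 // enorm_ge0.
  by apply: ereal_sup_ubound; exists x0, y0.
have S0 : (0 <= \sum_(i < n) supnorm U (partial i u))%E by apply: sume_ge0 => i _.
have L0 : (0 <= \sum_(i < n) lipsemi U (partial i u))%E by apply: sume_ge0 => i _.
have k1 : (supnorm U u <= K%:E)%E.
  by apply: le_trans hK; rewrite -addeA leeDl // adde_ge0.
have k2 : (\sum_(i < n) supnorm U (partial i u) <= K%:E)%E.
  by apply: le_trans hK; rewrite addeAC leeDr // adde_ge0.
have k3 : (\sum_(i < n) lipsemi U (partial i u) <= K%:E)%E.
  by apply: le_trans hK; rewrite leeDr // adde_ge0.
have one (A : 'I_n -> \bar R) i : (forall j, 0 <= A j)%E -> (A i <= \sum_(j < n) A j)%E.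
  by move=> A0; rewrite (bigD1 i) //= leeDl // sume_ge0.
split.
- move=> x Ux; rewrite -lee_fin; apply: le_trans k1.
  by apply: ereal_sup_ubound; exists x.
- move=> i x Ux; rewrite -lee_fin; apply: le_trans k2.
  apply: le_trans (one (fun i => supnorm U (partial i u)) i (fun j => s0 _)).
  by apply: ereal_sup_ubound; exists x.
- move=> i x y Ux Uy; have [->|nxy] := eqVneq x y.
    by rewrite !subrr normr0 enorm0 mulr0.
  have p0 : 0 < enorm (x - y) by rewrite enorm_gt0 subr_eq0.
  rewrite -ler_pdivrMr // -lee_fin; apply: le_trans k3.
  apply: le_trans (one (fun i => lipsemi U (partial i u)) i (fun j => l0 _)).
  by apply: ereal_sup_ubound; exists x, y.
Qed.

End Conversions.

(** * Extension to the whole space by a cutoff *)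

Section Extension.
Variables (R : realType) (n : nat).
Local Notation vec := 'rV[R]_n.
Local Notation mat := 'M[R]_n.
Implicit Types (x y z p e c v : vec) (u f : vec -> R) (g : vec -> vec) (K t d h r : R).
Local Notation B := (eball (0 : vec) 1).

Definition taylor_on f g : Prop := exists K M : R, [/\ 0 <= K, 0 <= M,
  forall x, B x -> `|f x| <= M, forall x, B x -> enorm (g x) <= M &
  forall x z, B x -> B (x + z) -> `|f (x + z) - f x - dot (g x) z| <= K * enorm z ^+ 2].

Let step_le2 x z : B x -> B (x + z) -> enorm z <= 2.
Proof.
rewrite /eball /= !subr0 => h1 h2.
have -> : z = (x + z) - x by rewrite addrAC subrr add0r.
by apply: le_trans (enormDB _ _) _; move: h1 h2; lra.
Qed.

Lemma taylor_onM f g f' g' : taylor_on f g -> taylor_on f' g' ->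
  taylor_on (fun x => f x * f' x) (fun x => f' x *: g x + f x *: g' x).
Proof.
move=> [K [M [K0 M0 hf hg ht]]] [K' [M' [K'0 M'0 hf' hg' ht']]].
exists (K * M' + M * M' + 3 * M * K'), (2 * (M * M')); split.
- by rewrite !addr_ge0 // ?mulr_ge0.
- by rewrite !mulr_ge0.
- move=> x bx; rewrite normrM; apply: le_trans (ler_pM _ _ (hf x bx) (hf' x bx)) _ => //.
  by have := mulr_ge0 M0 M'0; lra.
- move=> x bx; apply: le_trans (enormD _ _) _; rewrite !enormZ.
  have a1 := ler_pM (normr_ge0 _) (enorm_ge0 _) (hf' x bx) (hg x bx).
  have a2 := ler_pM (normr_ge0 _) (enorm_ge0 _) (hf x bx) (hg' x bx).
  by move: a1 a2; lra.
- move=> x z bx bz; set m := enorm z; have m0 : 0 <= m by exact: enorm_ge0.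
  have m2 : m <= 2 by exact: step_le2 bx bz.
  have a1 := ht x z bx bz; have a2 := ht' x z bx bz.
  have a3 := hf' _ bz; have a4 := hf x bx.
  have a5 : `|dot (g x) z| <= M * m.
    by apply: le_trans (cauchy_schwarz _ _) _; rewrite ler_wpM2r // hg.
  have a6 : `|dot (g' x) z| <= M' * m.
    by apply: le_trans (cauchy_schwarz _ _) _; rewrite ler_wpM2r // hg'.
  rewrite dotDl !dotZl.
  move: a1 a2 a3 a4 a5 a6; rewrite -/m.
  move: (f (x + z)) (f x) (f' (x + z)) (f' x) (dot (g x) z) (dot (g' x) z) => b1 b b1' b' d d' a1 a2 a3 a4 a5 a6.
  have -> : b1 * b1' - b * b' - (b' * d + b * d') =
     (b1 - b - d) * b1' + d * d' + (b + d) * (b1' - b' - d') by ring.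
  have c1 : `|(b1 - b - d) * b1'| <= K * m ^+ 2 * M' by rewrite normrM; exact: ler_pM.
  have c2 : `|d * d'| <= M * m * (M' * m) by rewrite normrM; exact: ler_pM.
  have c4 : `|b + d| <= 3 * M.
    apply: le_trans (ler_normD _ _) _; have := ler_wpM2l M0 m2; move: a4 a5; lra.
  have c3 : `|(b + d) * (b1' - b' - d')| <= 3 * M * (K' * m ^+ 2) by rewrite normrM; exact: ler_pM.
  apply: le_trans (ler_normD _ _) _; apply: le_trans (lerD (ler_normD _ _) (lexx _)) _.
  apply: le_trans (lerD (lerD c1 c2) c3) _.
  by rewrite le_eqVlt; apply/orP; left; apply/eqP; ring.
Qed.

Lemma sqr_pos_taylor (t h : R) :
  `|Num.max (t + h) 0 ^+ 2 - Num.max t 0 ^+ 2 - 2 * Num.max t 0 * h| <= h ^+ 2.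
Proof.
have h2 := sqr_ge0 h; have sq := sqr_ge0 (t + h).
case: (leP (t + h) 0) => h1; case: (leP t 0) => h3.
- by rewrite expr0n /= mulr0 mul0r !subr0 normr0.
- have h5 : 0 <= t * (- (t + h)) by rewrite mulr_ge0 // ?(ltW h3) // oppr_ge0.
  have h6 := sqr_ge0 t.
  by rewrite expr0n /= ler_norml; apply/andP; split; move: h2 h5 h6 sq; lra.
- have h4 : h ^+ 2 - (t + h) ^+ 2 = (- t) * (h + (t + h)) by ring.
  have h5 : 0 <= (- t) * (h + (t + h)) by rewrite mulr_ge0 //; lra.
  rewrite expr0n /= mulr0 mul0r !subr0 ger0_norm //.
  by move: h4 h5; lra.
- rewrite (_ : _ - _ - _ = h ^+ 2); last by ring.
  by rewrite ger0_norm.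
Qed.

Lemma taylor_on_sqr_pos f g : taylor_on f g ->
  taylor_on (fun x => Num.max (f x) 0 ^+ 2) (fun x => (2 * Num.max (f x) 0) *: g x).
Proof.
move=> [K [M [K0 M0 hf hg ht]]].
have mx x : B x -> 0 <= Num.max (f x) 0 <= M.
  move=> bx; rewrite le_max lexx orbT /= ge_max M0 andbT.
  by have := hf x bx; rewrite ler_norml => /andP[].
exists ((M + 2 * K) ^+ 2 + 2 * M * K), (2 * M ^+ 2); split.
- by rewrite addr_ge0 ?sqr_ge0 // !mulr_ge0.
- by rewrite mulr_ge0 // sqr_ge0.
- move=> x bx; have /andP[p0 pM] := mx x bx; rewrite ger0_norm ?sqr_ge0 //.
  have := ler_pM p0 p0 pM pM; rewrite -!expr2; have := sqr_ge0 M; lra.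
- move=> x bx; have /andP[p0 pM] := mx x bx; rewrite enormZ ger0_norm ?mulr_ge0 //.
  by have := ler_pM p0 (enorm_ge0 _) pM (hg x bx); rewrite -expr2; lra.
- move=> x z bx bz; set m := enorm z; have m0 : 0 <= m by exact: enorm_ge0.
  have m2 : m <= 2 by exact: step_le2 bx bz.
  have /andP[p0 pM] := mx x bx.
  have a1 := ht x z bx bz; rewrite -/m in a1.
  have a5 : `|dot (g x) z| <= M * m.
    by apply: le_trans (cauchy_schwarz _ _) _; rewrite ler_wpM2r // hg.
  have [h hE] : exists h, h = f (x + z) - f x by eexists.
  have fE : f (x + z) = f x + h by rewrite hE; ring.
  have c1 : `|h| <= (M + 2 * K) * m.
    have -> : h = (f (x + z) - f x - dot (g x) z) + dot (g x) z by rewrite hE; ring.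
    apply: le_trans (ler_normD _ _) _.
    have := ler_wpM2l K0 (ler_wpM2r m0 m2); rewrite -expr2; move: a1 a5; lra.
  have c2 : h ^+ 2 <= (M + 2 * K) ^+ 2 * m ^+ 2.
    by rewrite -[h ^+ 2]real_normK ?num_real // -exprMn ler_pXn2r ?nnegrE // mulr_ge0 // addr_ge0 // mulr_ge0.
  have c3 : `|2 * Num.max (f x) 0 * (h - dot (g x) z)| <= 2 * M * K * m ^+ 2.
    rewrite normrM ger0_norm ?mulr_ge0 // -mulrA; apply: ler_pM; rewrite ?mulr_ge0 //.
      by rewrite ler_wpM2l.
    by rewrite hE.
  have c4 := le_trans (sqr_pos_taylor (f x) h) c2.
  rewrite fE dotZl (_ : _ - _ - _ = (Num.max (f x + h) 0 ^+ 2 - Num.max (f x) 0 ^+ 2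
     - 2 * Num.max (f x) 0 * h) + 2 * Num.max (f x) 0 * (h - dot (g x) z)); last by ring.
  by apply: le_trans (ler_normD _ _) _; rewrite [X in _ <= X]mulrDl; exact: lerD c4 c3.
Qed.

Lemma taylor_on_affine (a b : R) f g : taylor_on f g ->
  taylor_on (fun x => a + b * f x) (fun x => b *: g x).
Proof.
move=> [K [M [K0 M0 hf hg ht]]]; exists (`|b| * K), (`|a| + `|b| * M); split.
- by rewrite mulr_ge0.
- by rewrite addr_ge0 // mulr_ge0.
- move=> x bx; apply: le_trans (ler_normD _ _) _; rewrite lerD2l normrM ler_wpM2l //; exact: hf.
- move=> x bx; rewrite enormZ; apply: (@le_trans _ _ (`|b| * M)); last by rewrite lerDr.
  by rewrite ler_wpM2l // hg.
- move=> x z bx bz; rewrite dotZl (_ : _ - _ - _ = b * (f (x + z) - f x - dot (g x) z)); last by ring.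
  by rewrite normrM -mulrA ler_wpM2l // ht.
Qed.

Lemma taylor_on_sqr_norm : taylor_on (fun x => enorm x ^+ 2) (fun x => 2 *: x).
Proof.
exists 1, 2; split=> //.
- move=> x; rewrite /eball /= subr0 => bx; rewrite ger0_norm ?exprn_ge0 ?enorm_ge0 //.
  by apply: (@le_trans _ _ 1); [rewrite exprn_ile1 ?enorm_ge0 // ltW|rewrite ler1n].
- move=> x; rewrite /eball /= subr0 => bx; rewrite enormZ ger0_norm //.
  by rewrite ler_piMr // ltW.
- move=> x z bx bz; rewrite !enorm2 dotZl dotDl !dotDr (dotC z x).
  rewrite (_ : _ - _ - _ = dot z z); last by ring.
  by rewrite ger0_norm ?dot_ge0 // mul1r.
Qed.

(** The cutoff is the squared positive part of this function; squares of positive parts keep Taylor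
    bounds of second order, hence the nesting. As [9/16 = (3/4)^2], it is 1 up to radius 3/4, and it
    is 0 from radius 7/8 on because [25 * (13/64)^2 > 1]. *)
Definition cutoff_arg x : R := 1 + - 25 * Num.max (- (9 / 16) + 1 * enorm x ^+ 2) 0 ^+ 2.

Lemma cutoff_arg_in x : enorm x <= 3 / 4 -> cutoff_arg x = 1.
Proof.
move=> hx; rewrite /cutoff_arg.
have : enorm x ^+ 2 <= (3 / 4) ^+ 2 by rewrite ler_pXn2r ?nnegrE ?enorm_ge0 //; lra.
rewrite exprMn exprVn -!natrX => h.
have -> : Num.max (- (9 / 16) + 1 * enorm x ^+ 2) 0 = 0 by apply/max_idPr; move: h; lra.
by rewrite expr0n /= mulr0 addr0.
Qed.

Lemma cutoff_arg_out x : 7 / 8 <= enorm x -> cutoff_arg x <= 0.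
Proof.
move=> hx; rewrite /cutoff_arg.
have : (7 / 8) ^+ 2 <= enorm x ^+ 2 by rewrite ler_pXn2r ?nnegrE ?enorm_ge0 //; lra.
rewrite exprMn exprVn -!natrX => h.
have h1 : 13 / 64 <= Num.max (- (9 / 16) + 1 * enorm x ^+ 2) 0.
  by rewrite le_max; apply/orP; left; move: h; lra.
move: (Num.max _ _) h1 => m h1.
have : (13 / 64) * (13 / 64) <= m * m by apply: ler_pM => //; lra.
by rewrite expr2; lra.
Qed.

(** Comparing the expansions of [u (x + c + d)] from [x] and from [x + c] shows the gradient to be
    Lipschitz when [c] and [d] have equal length; rescaling [d] gives the general case. *)
Lemma Reg_of_has_grad K u G : 0 <= K -> has_grad u G K -> Reg (8 * K) u.
Proof.
move=> K0 hG.
have lip x a b : `|dot (G (x + a)) b - dot (G x) b| <= 6 * K * (enorm a * enorm b).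
  have eq (c d : vec) : enorm d = enorm c -> `|dot (G (x + c)) d - dot (G x) d| <= 6 * K * enorm c ^+ 2.
    move=> dc; have h1 := hG x (c + d); have h2 := hG (x + c) d; have h3 := hG x c.
    have h4 : enorm (c + d) ^+ 2 <= (2 * enorm c) ^+ 2.
      rewrite ler_pXn2r ?nnegrE ?enorm_ge0 ?mulr_ge0 ?enorm_ge0 //.
      by apply: le_trans (enormD _ _) _; rewrite dc; lra.
    have h5 := ler_wpM2l K0 h4; rewrite exprMn in h5.
    rewrite addrA dotDr in h1; rewrite dc in h2.
    move: h1 h2 h3; rewrite !ler_norml => /andP[? ?] /andP[? ?] /andP[? ?].
    by apply/andP; split; move: h5; lra.
  have [->|bn] := eqVneq b 0; first by rewrite !dot0r subrr normr0 enorm0 !mulr0.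
  have b0 : 0 < enorm b by rewrite enorm_gt0.
  pose d := (enorm a / enorm b) *: b.
  have ed : enorm d = enorm a.
    by rewrite enormZ ger0_norm ?divr_ge0 ?enorm_ge0 // divfK // gt_eqF.
  have := eq a d ed; rewrite !dotZr -mulrBr normrM ger0_norm ?divr_ge0 ?enorm_ge0 //.
  have [->|an] := eqVneq a 0; first by move=> _; rewrite addr0 subrr normr0 enorm0 mul0r mulr0.
  have a0 : 0 < enorm a by rewrite enorm_gt0.
  rewrite mulrAC ler_pdivrMr // expr2 => h.
  by rewrite -(ler_pM2l a0); apply: le_trans h _; rewrite le_eqVlt; apply/orP; left; apply/eqP; ring.
have c11 x a b : enorm b <= enorm a -> `|mixd u x a b| <= 8 * K * (enorm a * enorm b).
  move=> ba; have h1 := hG (x + a) b; have h2 := hG x b; have h3 := lip x a b.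
  have h4 := ler_wpM2l K0 (ler_wpM2r (enorm_ge0 b) ba); rewrite -expr2 in h4.
  rewrite /mixd; move: h1 h2 h3; rewrite !ler_norml => /andP[? ?] /andP[? ?] /andP[? ?].
  by apply/andP; split; move: h4; lra.
split; first by rewrite mulr_ge0.
  move=> x a b; case: (leP (enorm b) (enorm a)) => [|/ltW]; first exact: c11.
  by move/c11; rewrite mixdC [enorm a * _]mulrC; apply.
exists (enorm (G 0)); first exact: enorm_ge0.
move=> x z; have h1 := hG x z; have h2 := lip 0 x z; rewrite add0r in h2.
have h3 := cauchy_schwarz (G 0) z.
have h4 : 0 <= K * (enorm x * enorm z) by rewrite !mulr_ge0 ?enorm_ge0.
have h5 : 0 <= K * enorm z ^+ 2 by rewrite mulr_ge0 ?exprn_ge0 ?enorm_ge0.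
move: h1 h2 h3; rewrite !ler_norml => /andP[? ?] /andP[? ?] /andP[? ?].
by apply/andP; split; move: h4 h5; lra.
Qed.

Lemma extension u G : taylor_on u G -> exists f Gf K, [/\ Reg K f, has_grad f Gf K &
  forall x, enorm x <= 3 / 4 -> f x = u x].
Proof.
move=> hu.
pose gc x : vec := - 25 *: ((2 * Num.max (- (9 / 16) + 1 * enorm x ^+ 2) 0) *: (1 *: (2 *: x))).
have hc : taylor_on (fun x => Num.max (cutoff_arg x) 0 ^+ 2) (fun x => (2 * Num.max (cutoff_arg x) 0) *: gc x).
  by do 2! [apply: taylor_on_sqr_pos; apply: taylor_on_affine]; exact: taylor_on_sqr_norm.
pose f x := Num.max (cutoff_arg x) 0 ^+ 2 * u x.
pose Gf x := u x *: ((2 * Num.max (cutoff_arg x) 0) *: gc x) + Num.max (cutoff_arg x) 0 ^+ 2 *: G x.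
have [K [M [K0 M0 hf hg ht]]] : taylor_on f Gf by exact: taylor_onM.
have out x : 7 / 8 <= enorm x -> f x = 0 /\ Gf x = 0.
  move=> /cutoff_arg_out hx; rewrite /f /Gf.
  have -> : Num.max (cutoff_arg x) 0 = 0 by exact/max_idPr.
  by rewrite expr0n /= mul0r mulr0 !scale0r scaler0 addr0.
(* A step between the region where the cutoff is positive and the outside of the unit ball has
   length at least 1/8, so bounded quantities are controlled by [|z|^2]; [64 + 8] gives the 72
   below. *)
have far (z : vec) : 8^-1 <= enorm z -> 1 <= 64 * enorm z ^+ 2 /\ enorm z <= 8 * enorm z ^+ 2.
  move=> hz; have z0 := enorm_ge0 z.
  have p8 : 0 <= 8^-1 :> R by rewrite invr_ge0.
  by have := ler_pM p8 p8 hz hz; have := ler_wpM2r z0 hz; rewrite -expr2; lra.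
have hG : has_grad f Gf (K + 72 * M).
  move=> x z; set m := enorm z ^+ 2.
  have m0 : 0 <= m by rewrite exprn_ge0 // enorm_ge0.
  have Mm : 0 <= M * m by rewrite mulr_ge0.
  have Km : 0 <= K * m by rewrite mulr_ge0.
  have zero : f (x + z) = 0 -> f x = 0 -> Gf x = 0 -> `|f (x + z) - f x - dot (Gf x) z| <= (K + 72 * M) * m.
    by move=> -> -> ->; rewrite dot0l !subr0 normr0; lra.
  have inB y : enorm y < 1 -> B y by rewrite /eball /= subr0.
  have [x1|x1] := ltP (enorm x) 1; have [y1|y1] := ltP (enorm (x + z)) 1.
  - by apply: le_trans (ht x z (inB _ x1) (inB _ y1)) _; rewrite -/m; move: Mm; lra.
  - have [fy _] : f (x + z) = 0 /\ Gf (x + z) = 0 by apply: out; move: y1; lra.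
    have [x7|x7] := leP (7 / 8) (enorm x); first by have [? ?] := out x x7; exact: zero.
    have zf : 8^-1 <= enorm z by have := enormD x z; move: y1 x7; lra.
    have [z1 z2] := far z zf.
    have a1 := hf x (inB _ x1).
    have a2 : `|dot (Gf x) z| <= M * enorm z.
      by apply: le_trans (cauchy_schwarz _ _) _; rewrite ler_wpM2r ?enorm_ge0 // hg //; exact: inB.
    have a3 := ler_wpM2l M0 z1; have a4 := ler_wpM2l M0 z2; rewrite -/m in a3 a4.
    rewrite fy; move: a1 a2; rewrite !ler_norml => /andP[? ?] /andP[? ?].
    by apply/andP; split; move: Km a3 a4; lra.
  - have [fx gx] : f x = 0 /\ Gf x = 0 by apply: out; move: x1; lra.
    have [y7|y7] := leP (7 / 8) (enorm (x + z)); first by have [? ?] := out _ y7; exact: zero.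
    have zf : 8^-1 <= enorm z by have := enormDB (x + z) z; rewrite addrK; move: x1 y7; lra.
    have [z1 z2] := far z zf.
    have a1 := hf _ (inB _ y1).
    have a3 := ler_wpM2l M0 z1; rewrite -/m in a3.
    by rewrite fx gx dot0l !subr0; apply: le_trans a1 _; move: Km Mm a3; lra.
  - have [fx gx] : f x = 0 /\ Gf x = 0 by apply: out; move: x1; lra.
    have [fy _] : f (x + z) = 0 /\ Gf (x + z) = 0 by apply: out; move: y1; lra.
    exact: zero.
have KM0 : 0 <= K + 72 * M by rewrite addr_ge0 // mulr_ge0.
exists f, Gf, (8 * (K + 72 * M)); split.
- exact: Reg_of_has_grad hG.
- move=> x z; apply: le_trans (hG x z) _; rewrite ler_wpM2r ?exprn_ge0 ?enorm_ge0 //.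
  by move: KM0; lra.
- move=> x /cutoff_arg_in hx; rewrite /f hx.
  have -> : Num.max 1 0 = 1 :> R by apply/max_idPl.
  by rewrite expr1n mul1r.
Qed.

End Extension.

(** * Campanato's argument: from oscillation decay to a derivative *)

Section Campanato.
Variables (R : realType) (n : nat).
Local Notation vec := 'rV[R]_n.
Local Notation mat := 'M[R]_n.
Implicit Types (x y z p e c v : vec) (u f : vec -> R) (G : vec -> vec) (K t d h r : R) (H D : mat).
Variables (A kap r : R).
Hypotheses (A0 : 0 <= A) (kap0 : 0 < kap) (r0 : 0 < r).

Definition osc_le G y (k : nat) H : Prop := forall x x' z,
  eball y (r * kap ^+ k) x -> eball y (r * kap ^+ k) x' ->
  `|dot (G x' - G x - (x' - x) *m H) z| <= A / 2 ^+ k * enorm (x' - x) * enorm z.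

(** [D] is the Jacobian of [G] at [y], with rows indexed by the direction of differentiation since
    vectors act on the left. Closeness to an approximating matrix at every scale makes the rate of
    convergence part of the notion. *)
Definition derivative_at G y D : Prop := forall k, exists2 H, osc_le G y k H &
  forall i j, `|D i j - H i j| <= A / 2 ^+ k.

Let rk0 k : 0 < r * kap ^+ k. Proof. by rewrite mulr_gt0 // exprn_gt0. Qed.

Lemma dot_delta_mx D i j : dot (delta_mx 0 i *m D) (delta_mx 0 j) = D i j.
Proof. by rewrite dot_deltar -rowE mxE. Qed.

Lemma entry_of_increment (g : vec) H t i j : dot (g - (t *: delta_mx 0 i) *m H) (delta_mx 0 j) =
  dot g (delta_mx 0 j) - t * H i j.
Proof. by rewrite dotBl -scalemxAl dotZl dot_delta_mx. Qed.

Lemma eball_shift y t (a : R) i : 0 < t -> t < a -> eball y a (y + t *: delta_mx 0 i).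
Proof. by move=> t0 ta; rewrite /eball /= addrAC subrr add0r enormZ enorm_delta mulr1 gtr0_norm. Qed.

Lemma entry_bound G y t (b : R) H i j : 0 < t ->
  `|dot (G (y + t *: delta_mx 0 i) - G y - (y + t *: delta_mx 0 i - y) *m H) (delta_mx 0 j)|
    <= b * enorm (y + t *: delta_mx 0 i - y) * enorm (delta_mx 0 j : vec) ->
  `|(G (y + t *: delta_mx 0 i) - G y) 0 j - t * H i j| <= b * t.
Proof.
move=> t0; have -> : y + t *: delta_mx 0 i - y = t *: delta_mx 0 i :> vec by rewrite addrAC subrr add0r.
by rewrite entry_of_increment dot_deltar enormZ !enorm_delta !mulr1 (gtr0_norm t0).
Qed.

Lemma entry_close (b b' q : R) t (a a' : R) : 0 < t -> `|q - t * a| <= b * t -> `|q - t * a'| <= b' * t ->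
  `|a - a'| <= b + b'.
Proof.
move=> t0 h1 h2; rewrite -(ler_pM2l t0) -[X in X * `|_|](gtr0_norm t0) -normrM.
have -> : t * (a - a') = (q - t * a') - (q - t * a) by ring.
apply: le_trans (ler_normB _ _) _; move: h1 h2; lra.
Qed.

Lemma eball_center y (a : R) : 0 < a -> eball y a y.
Proof. by rewrite /eball /= subrr enorm0. Qed.

Lemma lt_pair (a b : R) : 0 < a -> 0 < b -> exists t : R, [/\ 0 < t, t < a & t < b].
Proof.
move=> a0 b0; have m0 : 0 < Num.min a b by rewrite lt_min a0.
exists (Num.min a b / 2); have h : Num.min a b / 2 < Num.min a b by move: m0; lra.
split; first by rewrite divr_gt0.
  by apply: lt_le_trans h _; rewrite ge_min lexx.
by apply: lt_le_trans h _; rewrite ge_min lexx orbT.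
Qed.

Lemma osc_le_close G y k l H H' i j : osc_le G y k H -> osc_le G y l H' ->
  `|H i j - H' i j| <= A / 2 ^+ k + A / 2 ^+ l.
Proof.
move=> h h'; have [t [t0 tk tl]] := lt_pair (rk0 k) (rk0 l).
have a1 := h _ _ (delta_mx 0 j) (eball_center y (rk0 k)) (eball_shift y i t0 tk).
have a2 := h' _ _ (delta_mx 0 j) (eball_center y (rk0 l)) (eball_shift y i t0 tl).
exact: entry_close t0 (entry_bound t0 a1) (entry_bound t0 a2).
Qed.

(** The intervals of radius [A / 2^k] about the entries of [H k] meet pairwise by [osc_le_close], so
    the supremum of their left ends lies in all of them. *)
Lemma derivative_at_ex G y : (forall k, exists H, osc_le G y k H) -> exists D, derivative_at G y D.
Proof.
move=> /choice[H hH].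
pose S i j := [set H k i j - A / 2 ^+ k | k in [set: nat]].
exists (\matrix_(i, j) sup (S i j)) => k; exists (H k) => // i j; rewrite mxE.
have ub l : ubound (S i j) (H l i j + A / 2 ^+ l).
  by move=> _ [m _ <-]; have := osc_le_close i j (hH m) (hH l); rewrite ler_norml => /andP[_]; lra.
have Sk : S i j (H k i j - A / 2 ^+ k) by exists k.
have h1 : sup (S i j) <= H k i j + A / 2 ^+ k by apply: sup_le_ub; [eexists; exact: Sk|exact: ub].
have h2 : H k i j - A / 2 ^+ k <= sup (S i j).
  by apply: ub_le_sup => //; exists (H k i j + A / 2 ^+ k); exact: ub.
by rewrite ler_norml; apply/andP; split; move: h1 h2; lra.
Qed.

Let N : R := n%:R ^+ 2.

Lemma derivative_at_taylor G y D k x z : derivative_at G y D -> eball y (r * kap ^+ k) x ->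
  `|dot (G x - G y - (x - y) *m D) z| <= (N + 1) * (A / 2 ^+ k) * enorm (x - y) * enorm z.
Proof.
move=> hD bx; have [H hH hDH] := hD k.
have a1 := hH y x z (eball_center y (rk0 k)) bx.
have a2 : `|dot ((x - y) *m (D - H)) z| <= N * (A / 2 ^+ k) * (enorm (x - y) * enorm z).
  apply: le_trans (bf_le _ _ _) _; rewrite ler_wpM2r ?mulr_ge0 ?enorm_ge0 //.
  have le i : \sum_j `|(D - H) i j| <= n%:R * (A / 2 ^+ k).
    rewrite mulrC mulr_natr -[X in _ *+ X]card_ord -sumr_const; apply: ler_sum => j _.
    by rewrite !mxE.
  apply: le_trans (ler_sum _ (fun i _ => le i)) _.
  by rewrite sumr_const card_ord -(mulr_natr (n%:R * _) n) /N expr2 mulrAC.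
have -> : G x - G y - (x - y) *m D = (G x - G y - (x - y) *m H) - (x - y) *m (D - H).
  by rewrite mulmxBr opprB addrA subrK.
rewrite dotBl; apply: le_trans (ler_normB _ _) _; move: a1 a2; lra.
Qed.

Lemma decay_small (b e : R) : 0 < e -> exists k : nat, b * (A / 2 ^+ k) <= e.
Proof.
move=> e0; pose k := Num.truncn (`|b| * A / e); exists k.
have p : 0 < 2 ^+ k :> R by rewrite exprn_gt0.
rewrite mulrA ler_pdivrMr //; apply: (@le_trans _ _ (`|b| * A)).
  by rewrite ler_wpM2r // ler_norm.
rewrite [e * _]mulrC -ler_pdivrMr //; apply: le_trans (ltW (truncnS_gt _)) _.
by rewrite -natrX ler_nat ltn_expl.
Qed.

Lemma derivative_at_has_diff G y D i : derivative_at G y D ->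
  has_diff (fun x => G x 0 i) y (\row_j D j i).
Proof.
move=> hD e e0; have [k hk] := decay_small (N + 1) e0.
exists (r * kap ^+ k) => // z hz.
have bx : eball y (r * kap ^+ k) (y + z) by rewrite /eball /= addrAC subrr add0r.
have := derivative_at_taylor (delta_mx 0 i) hD bx.
rewrite [y + z - y]addrAC subrr add0r dot_deltar enorm_delta mulr1 => h.
have := le_trans h (ler_wpM2r (enorm_ge0 z) hk); congr (`|_| <= _).
rewrite mxE [in LHS]mxE [in LHS]mxE; congr (_ + _).
rewrite mxE; congr (- _); rewrite mxE; apply: eq_bigr => j _; by rewrite mxE mulrC.
Qed.

(** Increments of [G] that start at [y'] and stay in the balls of scale [k] about both points
    compare [D'] with the approximating matrix of [y], which is close to [D]. *)
Lemma derivative_at_close G y y' D D' k i j : derivative_at G y D -> derivative_at G y' D' ->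
  enorm (y' - y) < r * kap ^+ k -> `|D i j - D' i j| <= (N + 3) * (A / 2 ^+ k).
Proof.
move=> hD hD' hy; have [H hH hDH] := hD k.
have d0 : 0 < r * kap ^+ k - enorm (y' - y) by rewrite subr_gt0.
have [t [t0 t1 t2]] := lt_pair d0 (rk0 k).
have by' : eball y (r * kap ^+ k) y' by [].
have bx : eball y (r * kap ^+ k) (y' + t *: delta_mx 0 i).
  rewrite /eball /= addrAC; apply: le_lt_trans (enormD _ _) _.
  by rewrite enormZ enorm_delta mulr1 gtr0_norm //; move: t1; lra.
have a1 := hH _ _ (delta_mx 0 j) by' bx.
have a2 := derivative_at_taylor (delta_mx 0 j) hD' (eball_shift y' i t0 t2).
have a3 := entry_close t0 (entry_bound t0 a1) (entry_bound t0 a2).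
have -> : D i j - D' i j = (D i j - H i j) + (H i j - D' i j) by ring.
apply: le_trans (ler_normD _ _) _; have := hDH i j; move: a3; lra.
Qed.

Lemma derivative_at_bound G y D (L : R) i j : derivative_at G y D ->
  (forall x, eball y r x -> `|G x 0 j - G y 0 j| <= L * enorm (x - y)) ->
  `|D i j| <= L + (N + 1) * A.
Proof.
move=> hD hL; have [t [t0 t1 _]] := lt_pair r0 r0.
have t1' : t < r * kap ^+ 0 by rewrite expr0 mulr1.
have a1 := derivative_at_taylor (delta_mx 0 j) hD (eball_shift y i t0 t1').
have := entry_bound t0 a1; rewrite expr0 divr1 => a2.
have a3 : `|(G (y + t *: delta_mx 0 i) - G y) 0 j - t * 0| <= L * t.
  rewrite mulr0 subr0 !mxE; apply: le_trans (hL _ (eball_shift y i t0 t1)) _.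
  by rewrite [y + _ - y]addrAC subrr add0r enormZ enorm_delta mulr1 gtr0_norm.
by have := entry_close t0 a2 a3; rewrite subr0 addrC.
Qed.

End Campanato.

(** * The Holder exponent and dyadic scales *)

Section HolderExponent.
Variables (R : realType) (kap : R).
Hypotheses (kap0 : 0 < kap) (kap8 : kap <= 8^-1).

(** With [a = ln 2 / ln (1 / kap)] the radius factor [kap^k] corresponds to the oscillation [2^-k];
    the exponent is below 1 because [kap <= 1/8 < 1/2]. *)
Lemma holder_exponent : exists2 a : R, 0 < a < 1 & kap `^ a = 2^-1.
Proof.
have k1 : 1 < kap^-1 by rewrite invf_gt1 //; apply: le_lt_trans kap8 _; rewrite invf_lt1 // ltr1n.
have l0 : 0 < ln kap^-1 by rewrite ln_gt0.
have l2 : 0 < ln (2 : R) by rewrite ln_gt0 // ltr1n.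
exists (ln 2 / ln kap^-1).
  rewrite divr_gt0 //= ltr_pdivrMr // mul1r ltr_ln ?posrE ?invr_gt0 //.
  rewrite -[X in X < _]invrK ltf_pV2 ?posrE ?invr_gt0 //; apply: le_lt_trans kap8 _.
  by rewrite ltf_pV2 ?posrE // ltr_nat.
rewrite /powR gt_eqF // lnV ?posrE // invrN mulrN mulNr divfK; last by rewrite -oppr_eq0 -lnV ?posrE // gt_eqF.
by rewrite expRN lnK // posrE.
Qed.

Lemma dyadic_scale (d r : R) : 0 < r -> 0 < d -> d < r ->
  exists k, d < r * kap ^+ k /\ r * kap ^+ k.+1 <= d.
Proof.
move=> r0 d0 dr.
have ex : exists k : nat, r * kap ^+ k.+1 <= d.
  exists (Num.truncn (r / d)).
  have [k kE] : exists k, k = (Num.truncn (r / d)).+1 by eexists.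
  have hk : r / d <= 2 ^+ k.
    rewrite kE; apply: le_trans (ltW (truncnS_gt _)) _.
    by rewrite -natrX ler_nat ltnW // ltn_expl.
  rewrite -kE; apply: (@le_trans _ _ (r * 2^-1 ^+ k)).
    rewrite ler_pM2l // lerXn2r ?nnegrE ?invr_ge0 // ?(ltW kap0) //.
    by apply: le_trans kap8 _; rewrite lef_pV2 ?posrE // ler_nat.
  by rewrite exprVn ler_pdivrMr ?exprn_gt0 // mulrC -ler_pdivrMr.
case: (ex_minnP ex) => k hk hmin; exists k; split=> //.
case: k hk hmin => [|k] hk hmin; first by rewrite expr0 mulr1.
by rewrite ltNge; apply/negP => /hmin; rewrite ltnn.
Qed.

(** The scale with [kap^(k+1) <= d / r < kap^k] costs one factor 2, whence [2 * b]; for [d >= r] the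
    plain bound [M] suffices. Since [r <= 1] and [al < 1], the factor [1 / r] dominates its power
    [al]. *)
Lemma holder_of_dyadic (al d r q b M : R) : 0 < al -> al < 1 -> kap `^ al = 2^-1 ->
  0 < r -> r <= 1 -> 0 < d -> 0 <= b -> 0 <= M -> q <= M ->
  (forall k, d < r * kap ^+ k -> q <= b / 2 ^+ k) -> q <= (M + 2 * b) / r * d `^ al.
Proof.
move=> al0 al1 kal r0 r1 d0 b0 M0 qM hq.
have dr0 : 0 < d / r by rewrite divr_gt0.
have main : q <= (M + 2 * b) * (d / r) `^ al.
  have [dr|rd] := ltP d r.
    have [k [k1 k2]] := dyadic_scale r0 d0 dr.
    apply: le_trans (hq k k1) _.
    have p1 : 2^-1 ^+ k.+1 <= (d / r) `^ al.
      have <- : (kap ^+ k.+1) `^ al = 2^-1 ^+ k.+1.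
        by rewrite -kal -(powR_mulrn _ (ltW kap0)) -(powR_mulrn _ (powR_ge0 kap al)) powRAC.
      apply: ge0_ler_powR; rewrite ?nnegrE ?exprn_ge0 ?(ltW kap0) ?(ltW dr0) ?(ltW al0) //.
      by rewrite ler_pdivlMr // mulrC.
    apply: (@le_trans _ _ (2 * b * 2^-1 ^+ k.+1)).
      rewrite exprS exprVn le_eqVlt; apply/orP; left; apply/eqP.
      by field; rewrite expf_neq0.
    have b2 : 0 <= 2 * b by rewrite mulr_ge0.
    have := ler_wpM2l b2 p1; have := mulr_ge0 M0 (powR_ge0 (d / r) al); lra.
  have p1 : 1 <= (d / r) `^ al.
    rewrite -(powRr0 (d / r)); apply: ler_powR; last exact: ltW.
    by rewrite ler_pdivlMr // mul1r.
  apply: le_trans qM _; have Mb : 0 <= M + 2 * b by rewrite addr_ge0 // mulr_ge0.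
  by have := ler_wpM2l Mb p1; move: b0; lra.
apply: le_trans main _; rewrite powRM ?invr_ge0 ?(ltW d0) ?(ltW r0) // -mulrA.
rewrite ler_wpM2l ?addr_ge0 ?mulr_ge0 // mulrC ler_wpM2r ?powR_ge0 //.
rewrite -[X in _ <= X]powRr1 ?invr_ge0 ?(ltW r0) //.
apply: ler_powR; last exact: ltW.
by rewrite invf_ge1.
Qed.

End HolderExponent.

(** * Assembly of the estimate on the ball of radius 1/2 *)

Section Final.
Variables (R : realType) (n : nat).
Local Notation vec := 'rV[R]_n.
Local Notation mat := 'M[R]_n.
Implicit Types (x y z p e c v : vec) (u f : vec -> R) (K t d h r : R).

Lemma has_diff_near f u x (g : vec) : (\forall y \near x, f y = u y) -> has_diff f x g -> has_diff u x g.
Proof.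
move=> hfu h e e0; have [d d0 hd] := h e e0; have [d' d'0 hd'] := enorm_near hfu.
exists (Num.min d d'); first by rewrite lt_min d0.
move=> z; rewrite lt_min => /andP[z1 z2].
rewrite -(nbhs_singleton hfu) -hd'; first exact: hd.
by rewrite addrAC subrr add0r.
Qed.

Lemma eball_nbhs y r x : eball y r x -> \forall w \near x, eball y r w.
Proof.
rewrite /eball /= => h; have d0 : 0 < r - enorm (x - y) by rewrite subr_gt0.
apply: filterS (near_enorm x d0) => w hw.
by apply: le_lt_trans (enorm_tri w x y) _; move: hw; lra.
Qed.

Lemma two_points r : (0 < n)%N -> 0 < r -> exists x y : vec, [/\ eball 0 r x, eball 0 r y & x != y].
Proof.
move=> n0 r0; exists 0, ((r / 2) *: delta_mx 0 (Ordinal n0)); split.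
- by rewrite /eball /= subrr enorm0.
- by rewrite /eball /= subr0 enormZ enorm_delta mulr1 gtr0_norm ?divr_gt0 //; move: r0; lra.
- by rewrite eq_sym -enorm_gt0 enormZ enorm_delta mulr1 gtr0_norm divr_gt0.
Qed.

Lemma supnorm_le (U : set vec) (g : vec -> R) (M : R) : (forall x, U x -> `|g x| <= M) ->
  (supnorm U g <= M%:E)%E.
Proof. by move=> h; apply: ge_ereal_sup => _ [x Ux <-]; rewrite lee_fin; exact: h. Qed.

Lemma holdsemi_le (U : set vec) (a : R) (g : vec -> R) (M : R) :
  (forall x y, U x -> U y -> x != y -> `|g x - g y| <= M * enorm (x - y) `^ a) ->
  (holdsemi U a g <= M%:E)%E.
Proof.
move=> h; apply: ge_ereal_sup => _ [x [y [Ux Uy xy ->]]]; rewrite lee_fin ler_pdivrMr; first exact: h.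
by rewrite powR_gt0 // enorm_gt0 subr_eq0.
Qed.

End Final.

Theorem theorem4p8 (R : realType) (n : nat) (lam Lam : R) :
  (0 < n)%N -> 0 < lam -> lam <= Lam ->
  exists alpha : R, 0 < alpha < 1 /\
    forall K : R, exists C : R,
      forall (F : 'M[R]_n -> R) (u : 'rV[R]_n -> R),
        cont_on_Sn F -> unif_elliptic F lam Lam -> quasiconcave F ->
        C11_on (eball 0 1) u ->
        visc_sol F (eball 0 1) u ->
        (C11norm (eball 0 (3/4)) u <= K%:E)%E ->
        C2a_on (eball 0 (1/2)) alpha u /\
        (C2a_norm (eball 0 (1/2)) alpha u <= C%:E)%E.
Proof.
move=> n0 lam0 lamLam.
have [kap /andP[kap0 kap8] decay] := @hessian_decay R n lam Lam lam0 lamLam.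
have [al /andP[al0 al1] kal] := holder_exponent kap0 kap8.
exists al; split; first by rewrite al0.
(* [taylor_lip] for [z] and [-z] bounds second differences by [2 n |K| |z|^2]; the added 1 keeps
   [th] positive for the rescaling, and [A] below is the constant that [grad_osc] derives from
   it. *)
move=> K; pose th := 2 * n%:R * `|K| + 1.
have nK : 0 <= n%:R * `|K| by rewrite mulr_ge0.
have th0 : 0 < th by rewrite /th; move: nK; clear; lra.
pose A := 2 * th; have A0 : 0 <= A by rewrite mulr_ge0 // ltW.
pose M := `|K| + (n%:R ^+ 2 + 1) * A.
have N0 : 0 <= n%:R ^+ 2 :> R by rewrite exprn_ge0.
have M0 : 0 <= M by rewrite addr_ge0 // mulr_ge0 // addr_ge0.
pose CH := (2 * M + 2 * ((n%:R ^+ 2 + 3) * A)) / 4^-1.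
pose C := `|K| + n%:R * `|K| + n%:R * (n%:R * M) + n%:R * (n%:R * CH).
exists C => F u _ ueF qcF [du C11u] vs hK.
have hF := ell_of_unif_elliptic n0 lam0 lamLam ueF qcF.
have r4 : 0 < 4^-1 :> R by rewrite invr_gt0.
have r34 : 0 < 3 / 4 :> R by rewrite divr_gt0.
have [x0 [y0 [bx0 by0 xy0]]] := two_points n0 r34.
have sub1 : eball 0 (3 / 4) `<=` eball (0 : 'rV[R]_n) 1.
  by apply: eball_sub; rewrite subrr enorm0; clear; lra.
(* The norm on the unit ball is finite but enters no constant of the conclusion: it only yields a
   global extension of [u], whose own bounds drop out of every estimate. *)
have [K1 hK1] : exists K1, (C11norm (eball 0 1) u <= K1%:E)%E.
  move: C11u; case: (C11norm _ _) => [k _||_]; [by exists k|by rewrite ltxx|by exists 0; exact: leNye].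
have [b1 b2 b3] := C11norm_bounds (sub1 _ bx0) (sub1 _ by0) xy0 hK1.
have K10 : 0 <= K1 by apply: le_trans (normr_ge0 _) (b1 _ (sub1 _ bx0)).
have tu : taylor_on u (gradient u).
  exists (n%:R * K1), (K1 + n%:R * K1); split.
  - by rewrite mulr_ge0.
  - by rewrite addr_ge0 // mulr_ge0.
  - by move=> x bx; apply: le_trans (b1 x bx) _; rewrite lerDl mulr_ge0.
  - move=> x bx; apply: (@le_trans _ _ (n%:R * K1)); last by rewrite lerDr.
    by apply: enorm_dot_le => // i; rewrite mxE; exact: b2.
  - by move=> x z bx bz; exact: (taylor_lip K10 du b3 bx bz).
have [f [G [Kf [rf hG fu]]]] := extension tu.
have near_fu x : eball 0 (3 / 4) x -> \forall y \near x, f y = u y.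
  move=> bx; apply: filterS (eball_nbhs bx) => y; rewrite /eball /= subr0 => hy.
  by apply: fu; exact: ltW.
have sf : sol F (eball 0 (3 / 4)) f by exact: (sol_of_visc_sol hF near_fu sub1 vs).
have GE x i : eball 0 (3 / 4) x -> partial i u x = G x 0 i.
  move=> bx; apply: has_diff_partial; apply: has_diff_near (near_fu x bx) _.
  by apply: (has_diff_grad ltr01) => z _; exact: hG.
have [c1 c2 c3] := C11norm_bounds bx0 by0 xy0 hK.
have KK : K <= `|K| by exact: ler_norm.
have c3' i x y : eball 0 (3 / 4) x -> eball 0 (3 / 4) y ->
    `|partial i u x - partial i u y| <= `|K| * enorm (x - y).
  by move=> bx by_; apply: le_trans (c3 i x y bx by_) _; rewrite ler_wpM2r // enorm_ge0.
have ty := taylor_lip (normr_ge0 K) (fun x bx => du x (sub1 x bx)) c3'.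
(* On these balls the extension [f] coincides with [u] and the bound by [K] is available. *)
have sub34 (y : 'rV[R]_n) : eball 0 (1 / 2) y -> eball y 4^-1 `<=` eball 0 (3 / 4).
  by rewrite /eball /= subr0 => hy; apply: eball_sub; rewrite subr0; move: hy; clear; lra.
have ddb (y x z : 'rV[R]_n) : eball 0 (1 / 2) y -> eball y 4^-1 (x + z) -> eball y 4^-1 (x - z) ->
    `|dd f z x| <= th * dot z z.
  move=> hy h1 h2.
  have hx : eball y 4^-1 x.
    have := @eball_conv _ _ y 4^-1 (x - z) (z + z) 2^-1 h2.
    have -> : 2^-1 *: (z + z) = z by rewrite -[z in z + z]scale1r -scalerDl scalerA (_ : _ * _ = 1) ?scale1r //; field.
    by rewrite addrA subrK => /(_ h1); apply; clear; apply/andP; split; lra.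
  have [k1 k2 k3] := And3 (sub34 y hy _ h1) (sub34 y hy _ h2) (sub34 y hy _ hx).
  have e1 := ty x z k3 k1; have e2 := ty x (- z) k3 k2; rewrite dotNr enormN in e2.
  have fE w : eball 0 (3 / 4) w -> f w = u w by rewrite /eball /= subr0 => hw; exact: fu (ltW hw).
  rewrite /dd !fE // -enorm2 /th; have := exprn_ge0 2 (enorm_ge0 z).
  move: e1 e2; rewrite !ler_norml; move: nK; clear.
  by move=> ? /andP[? ?] /andP[? ?] ?; apply/andP; split; lra.
have osc (y : 'rV[R]_n) : eball 0 (1 / 2) y -> forall k, exists H : 'M[R]_n, osc_le A kap 4^-1 G y k H.
  move=> hy k.
  have h1 : hess_le f th%:M (eball y 4^-1).
    by move=> x z k1 k2; rewrite qfM; apply: le_trans (ler_norm _) (ddb y x z hy k1 k2).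
  have h2 : hess_ge f (- th%:M) (eball y 4^-1).
    by move=> x z k1 k2; rewrite qfN qfM; have := ddb y x z hy k1 k2; rewrite ler_norml => /andP[].
  have [H [sH hle hge]] := decay F Kf f G y 4^-1 th hF rf hG (sol_sub (sub34 y hy) sf) r4 th0 h1 h2 k.
  exists H => x x' z bx bx'.
  have t0 : 0 <= th / 2 ^+ k by rewrite divr_ge0 ?exprn_ge0 // ltW.
  by have := grad_osc hG t0 sH hle hge z bx bx'; rewrite /A mulrA.
have dex (y : 'rV[R]_n) : exists D : 'M[R]_n, eball 0 (1 / 2) y -> derivative_at A kap 4^-1 G y D.
  have [hy|hy] := pselect (eball 0 (1 / 2) y); last by exists 0.
  by have [D hD] := derivative_at_ex kap0 r4 (osc y hy); exists D.
have [D hD] := choice dex.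
have sub2 : eball 0 (1 / 2) `<=` eball (0 : 'rV[R]_n) (3 / 4).
  by apply: eball_sub; rewrite subrr enorm0; clear; lra.
have hd (i : 'I_n) (y : 'rV[R]_n) : eball 0 (1 / 2) y -> has_diff (partial i u) y (\row_j D y j i).
  move=> hy; apply: has_diff_near (derivative_at_has_diff A0 kap0 r4 i (hD y hy)).
  by apply: filterS (eball_nbhs (sub2 _ hy)) => x bx; rewrite GE.
have DE (i j : 'I_n) (y : 'rV[R]_n) : eball 0 (1 / 2) y -> partial j (partial i u) y = D y j i.
  by move=> hy; rewrite (has_diff_partial _ (hd i y hy)) mxE.
have DM (i j : 'I_n) (y : 'rV[R]_n) : eball 0 (1 / 2) y -> `|D y i j| <= M.
  move=> hy; apply: (derivative_at_bound kap0 r4 _ (hD y hy)) => x bx.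
  have [k1 k2] := conj (sub34 y hy _ bx) (sub2 _ hy).
  by rewrite -(GE x j k1) -(GE y j k2); exact: c3'.
have close (i j : 'I_n) (y y' : 'rV[R]_n) k : eball 0 (1 / 2) y -> eball 0 (1 / 2) y' ->
   enorm (y - y') < 4^-1 * kap ^+ k -> `|D y i j - D y' i j| <= (n%:R ^+ 2 + 3) * (A / 2 ^+ k).
  by move=> hy hy'; rewrite enormB => hk; exact: (derivative_at_close _ _ _ _ (hD y hy) (hD y' hy') hk).
have B0 : 0 <= (n%:R ^+ 2 + 3) * A by rewrite mulr_ge0 // addr_ge0.
have hol (i j : 'I_n) (y y' : 'rV[R]_n) : eball 0 (1 / 2) y -> eball 0 (1 / 2) y' -> y != y' ->
    `|D y i j - D y' i j| <= CH * enorm (y - y') `^ al.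
  move=> hy hy' yy; have d0 : 0 < enorm (y - y') by rewrite enorm_gt0 subr_eq0.
  have M2 : 0 <= 2 * M by rewrite mulr_ge0.
  have qM : `|D y i j - D y' i j| <= 2 * M.
    by apply: le_trans (ler_normB _ _) _; have := DM i j y hy; have := DM i j y' hy'; clear; lra.
  have r1 : 4^-1 <= 1 :> R by clear; lra.
  apply: (holder_of_dyadic kap0 kap8 al0 al1 kal r4 r1 d0 B0 M2 qM) => k hk.
  by rewrite -mulrA; exact: close.
have C2 : C2_on (eball 0 (1 / 2)) u.
  split; [|split].
  - by move=> x /sub2 /sub1; exact: du.
  - by move=> i x bx; case: (has_diffP (hd i x bx)).
  - move=> i j; apply: continuous_in_subspaceT => x /set_mem bx.
    apply: continuous_at_enorm => e e0.
    have e2 : 0 < e / 2 by rewrite divr_gt0.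
    have [k hk] := decay_small A0 (n%:R ^+ 2 + 3) e2.
    have [d d0 hdd] := enorm_near (eball_nbhs bx).
    exists (Num.min d (4^-1 * kap ^+ k)); first by rewrite lt_min d0 mulr_gt0 // exprn_gt0.
    move=> z; rewrite lt_min => /andP[z1 z2].
    have bz : eball 0 (1 / 2) (x + z) by apply: hdd; rewrite addrAC subrr add0r.
    rewrite !DE //; apply: le_lt_trans (close j i _ _ k bz bx _) _.
      by rewrite addrAC subrr add0r.
    by move: hk e0; clear; lra.
have norm_le : (C2a_norm (eball 0 (1 / 2)) al u <= C%:E)%E.
  rewrite /C2a_norm /C !EFinD; apply: leeD; [apply: leeD; [apply: leeD|]|].
  - by apply: supnorm_le => x /sub2 bx; apply: le_trans (c1 x bx) KK.
  - apply: lee_sum_const => i; apply: supnorm_le => x /sub2 bx; exact: le_trans (c2 i x bx) KK.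
  - apply: lee_sum_const => i; apply: lee_sum_const => j; apply: supnorm_le => x bx.
    by rewrite DE // DM.
  - apply: lee_sum_const => i; apply: lee_sum_const => j; apply: holdsemi_le => x y bx by_ xy.
    by rewrite !DE // hol.
by split=> //; split=> //; exact: le_lt_trans norm_le (ltry _).
Qed.
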